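(* Let $E$ be an elliptic curve over an algebraically closed field and let $X=E\times E$. Then $X$ admits a pair of line bundles $(L,M)$ which satisfies the pair index condition and a curve $C\subseteq X$ for which the cup-product map $$\cup(T_x^*L,M)\colon H^{\mathrm{i}(T_x^*L)}(X,T_x^*L)\otimes H^{\mathrm{i}(M)}(X,M)\to H^{\mathrm{i}(T_x^*(L)\otimes M)}(X,T_x^*(L)\otimes M)$$ is zero for all $x\in C$, and nonzero for all $x\notin C$.
   Context: For $x\in X$, $T_x\colon X\to X$ denotes translation by $x$. A vector bundle $E$ on $X$ satisfies the index condition if exactly one of its cohomology groups is nonzero; in that case its index $\mathrm{i}(E)$ is the unique integer $j$ with $H^j(X,E)\neq0$. A pair $(E,F)$ of vector bundles on $X$ satisfies the pair index condition if, for all $x\in X$, the vector bundles $T_x^*E$, $F$, and $T_x^*(E)\otimes F$ satisfy the index condition and $\mathrm{i}(T_x^*(E)\otimes F)=\mathrm{i}(T_x^*E)+\mathrm{i}(F)$. A curve in $X$ is a nonempty closed subset of pure dimension one (not required to be irreducible). *)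

(* Defs.v *)
(* MathComp, with the classical sets and topologies of MathComp-Analysis.

   Varieties are taken over an algebraically closed field k and are handled
   through their closed points, as in Serre's "Faisceaux algébriques
   cohérents"; cohomology is, as there, Čech cohomology in the limit over all
   open covers. *)
From HB Require Import structures.
From mathcomp Require Import all_boot all_algebra ring.
From mathcomp Require Import boolp classical_sets filter topology_structure.
From mathcomp Require Import mpoly.

Set Implicit Arguments.
Unset Strict Implicit.
Unset Printing Implicit Defensive.

Import GRing.Theory.
Local Open Scope classical_set_scope.
Local Open Scope ring_scope.

(* The affine curve y^2 + a1 x y + a3 y = x^3 + a2 x^2 + a4 x + a6. *)
Definition weierstrass (k : closedFieldType) (a1 a2 a3 a4 a6 x y : k) : k :=
  y ^+ 2 + a1 * x * y + a3 * y - (x ^+ 3 + a2 * x ^+ 2 + a4 * x + a6).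

(* The elliptic curves over k, as nonsingular plane cubics in (generalised)
   Weierstrass form: the equation and its two partial derivatives have no
   common zero.  The point at infinity is always nonsingular.  There is no
   restriction on the characteristic. *)
Record elliptic_curve (k : closedFieldType) := EllipticCurve {
  ec1 : k; ec2 : k; ec3 : k; ec4 : k; ec6 : k;
  ec_nonsingular : forall x y : k,
    weierstrass ec1 ec2 ec3 ec4 ec6 x y = 0 ->
    ~ (ec1 * y - (3%:R * x ^+ 2 + 2%:R * ec2 * x + ec4) = 0 /\
       2%:R * y + ec1 * x + ec3 = 0)
}.

Definition on_curve (k : closedFieldType) (E : elliptic_curve k)
    (P : option (k * k)) : bool :=
  if P is Some (x, y)
  then weierstrass (ec1 E) (ec2 E) (ec3 E) (ec4 E) (ec6 E) x y == 0
  else true.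

(* None is the point at infinity, the neutral element of the group law. *)
Record point (k : closedFieldType) (E : elliptic_curve k) :=
  Point { pointval :> option (k * k); pointP : on_curve E pointval }.

HB.instance Definition _ (k : closedFieldType) (E : elliptic_curve k) :=
  [isSub for @pointval k E].
HB.instance Definition _ (k : closedFieldType) (E : elliptic_curve k) :=
  [Choice of point E by <:].

Section Surface.
Context (k : closedFieldType) (E : elliptic_curve k).

(* The chord-tangent law; y = l x + n is the chord or the tangent, and x3 the
   abscissa of its third intersection with the curve. *)
Definition add_coord (P Q : option (k * k)) : option (k * k) :=
  match P, Q with
  | None, _ => Q
  | _, None => P
  | Some (x1, y1), Some (x2, y2) =>
    if (x1 == x2) && (y1 + y2 + ec1 E * x1 + ec3 E == 0) then None else
    let l := if x1 == x2
             then (3%:R * x1 ^+ 2 + 2%:R * ec2 E * x1 + ec4 E - ec1 E * y1)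
                  / (2%:R * y1 + ec1 E * x1 + ec3 E)
             else (y2 - y1) / (x2 - x1) in
    let n := y1 - l * x1 in
    let x3 := l ^+ 2 + ec1 E * l - ec2 E - x1 - x2 in
    Some (x3, - (l + ec1 E) * x3 - n - ec3 E)
  end.

Lemma add_coordP (P Q : point E) : on_curve E (add_coord P Q).
Proof.
case: P => [[[x1 y1]|] hP]; case: Q => [[[x2 y2]|] hQ] //=.
case: ifP => // hne.
move: hP hQ; rewrite /= => /eqP; set W := weierstrass _ _ _ _ _ => hP /eqP hQ.
set l := (if _ then _ else _); set n := y1 - l * x1; set x3 := _ - x2.
have negW x y : W x (- y - ec1 E * x - ec3 E) = W x y.
  by rewrite /W /weierstrass; ring.
have -> : - (l + ec1 E) * x3 - n - ec3 E =
          - (l * x3 + n) - ec1 E * x3 - ec3 E by ring.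
rewrite negW; have y1E : y1 = l * x1 + n by rewrite /n; ring.
case: (eqVneq x1 x2) => [x12|nx12]; last first.
  have dx : x2 - x1 != 0 by rewrite subr_eq0 eq_sym.
  have y2E : y2 = l * x2 + n.
    by rewrite /n /l (negbTE nx12); field.
  apply/eqP/(mulIf dx); rewrite mul0r.
  have -> : W x3 (l * x3 + n) * (x2 - x1) =
      W x1 (l * x1 + n) * (x2 - x3) + W x2 (l * x2 + n) * (x3 - x1).
    by rewrite /W /weierstrass /x3; ring.
  by rewrite -y1E -y2E hP hQ !mul0r addr0.
move: hne; rewrite -x12 eqxx /= => /negbT hne.
have y12 : y1 = y2.
  have : (y1 - y2) * (y1 + y2 + ec1 E * x1 + ec3 E) = 0.
    transitivity (W x1 y1 - W x1 y2); first by rewrite /W /weierstrass; ring.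
    by rewrite hP x12 hQ subr0.
  by move/eqP; rewrite mulf_eq0 (negbTE hne) orbF subr_eq0 => /eqP.
have dF : 2%:R * y1 + ec1 E * x1 + ec3 E != 0.
  by move: hne; rewrite -y12 -mulr2n mulr_natl.
have lE : l * (2%:R * y1 + ec1 E * x1 + ec3 E) =
    3%:R * x1 ^+ 2 + 2%:R * ec2 E * x1 + ec4 E - ec1 E * y1.
  by rewrite /l x12 eqxx -x12 mulfVK.
have -> : W x3 (l * x3 + n) = W x1 (l * x1 + n) + (x3 - x1) *
    (l * (2%:R * (l * x1 + n) + ec1 E * x1 + ec3 E) -
     (3%:R * x1 ^+ 2 + 2%:R * ec2 E * x1 + ec4 E - ec1 E * (l * x1 + n))).
  by rewrite /W /weierstrass /x3 -x12; ring.
by rewrite -y1E hP lE subrr mulr0 addr0.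
Qed.

Definition addp (P Q : point E) : point E := Point (add_coordP P Q).

(* Representatives of points of P^2; the point at infinity is (0 : 1 : 0). *)
Definition hcoord (P : point E) (i : 'I_3) : k :=
  (if pointval P is Some (x, y) then [:: x; y; 1] else [:: 0; 1; 0])`_i.

(* The set of closed points of X = E x E, inside P^2 x P^2. *)
Definition surface : Type := (point E * point E)%type.

HB.instance Definition _ := Choice.on surface.

Definition translate (x y : surface) : surface :=
  (addp y.1 x.1, addp y.2 x.2).

Definition coords (x : surface) (i : 'I_(3 + 3)) : k :=
  match split i with inl j => hcoord x.1 j | inr j => hcoord x.2 j end.

Definition bihomog (d e : nat) (p : {mpoly k[3 + 3]}) : Prop :=
  forall m, m \in msupp p ->
    (\sum_(i < 3) m (lshift 3 i))%N = d /\ (\sum_(i < 3) m (rshift 3 i))%N = e.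

Definition nonvanishing (p : {mpoly k[3 + 3]}) : set surface :=
  [set x | p.@[coords x] != 0].

(* The Zariski topology: the closed sets are the common zero loci of families
   of bihomogeneous polynomials. *)
Definition zariski_open (A : set surface) : Prop :=
  exists S : set {mpoly k[3 + 3]},
    (forall p, S p -> exists d e, bihomog d e p) /\
    A = \bigcup_(p in S) nonvanishing p.

Lemma bihomogM d e d' e' p q : bihomog d e p -> bihomog d' e' q ->
  bihomog (d + d') (e + e') (p * q).
Proof.
move=> hp hq m /msuppM_le /allpairsP [[m1 m2]] /= [/hp [<- <-] /hq [<- <-] ->].
by split; rewrite -big_split; apply: eq_bigr => i _; rewrite mnmDE.
Qed.

Lemma zariski_openT : zariski_open setT.
Proof.
exists [set 1]; split.
  move=> _ ->; exists 0%N, 0%N => m; rewrite msupp1 inE => /eqP ->.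
  by split; apply: big1 => i _; rewrite mnm0E.
apply/esym/seteqP; split=> x _ //; exists 1 => //.
by rewrite /nonvanishing /= meval1 oner_neq0.
Qed.

Lemma zariski_openI : setI_closed zariski_open.
Proof.
move=> _ _ [S [hS ->]] [T [hT ->]].
exists [set r | exists p q, [/\ S p, T q & r = p * q]]; split.
  move=> _ [p [q [/hS [d [e hp]] /hT [d' [e' hq]] ->]]].
  by exists (d + d')%N, (e + e')%N; apply: bihomogM.
apply/seteqP; split=> x.
  move=> [[p Sp px] [q Tq qx]]; exists (p * q); first by exists p, q.
  by rewrite /nonvanishing /= mevalM mulf_neq0.
move=> [_ [p [q [Sp Tq ->]]]].
rewrite /nonvanishing /= mevalM mulf_eq0 negb_or => /andP [px qx].
by split; [exists p | exists q].
Qed.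

Lemma zariski_open_bigU (I : Type) (f : I -> set surface) :
  (forall i, zariski_open (f i)) -> zariski_open (\bigcup_i f i).
Proof.
move=> hf.
exists [set p | (exists d e, bihomog d e p) /\
                nonvanishing p `<=` \bigcup_i f i]; split; first by move=> p [].
apply/seteqP; split=> x.
  move=> [i _ fx]; have [S [hS fE]] := hf i.
  move: (fx); rewrite fE => -[p Sp px]; exists p => //; split; first exact: hS.
  by move=> y py; exists i => //; rewrite fE; exists p.
by move=> [p [_ hp] px]; apply: hp.
Qed.

HB.instance Definition _ := isOpenTopological.Build surface
  zariski_openT zariski_openI zariski_open_bigU.

Definition irreducible_closed (Z : set surface) : Prop :=
  [/\ closed Z, Z !=set0 &
      forall A B, closed A -> closed B -> Z `<=` A `|` B ->
        Z `<=` A \/ Z `<=` B].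

Definition irreducible_component (C Z : set surface) : Prop :=
  [/\ irreducible_closed Z, Z `<=` C &
      forall Z', irreducible_closed Z' -> Z `<=` Z' -> Z' `<=` C -> Z' `<=` Z].

Definition has_chain (Z : set surface) (n : nat) : Prop :=
  exists F : nat -> set surface,
    (forall i, (i <= n)%N -> irreducible_closed (F i) /\ F i `<=` Z) /\
    (forall i, (i < n)%N -> F i `<` F i.+1).

(* Krull dimension *)
Definition has_dim (Z : set surface) (n : nat) : Prop :=
  has_chain Z n /\ ~ has_chain Z n.+1.

Definition is_curve (C : set surface) : Prop :=
  [/\ closed C, C !=set0 & forall Z, irreducible_component C Z -> has_dim Z 1].

(* For open W this says that the restriction of f to W is a section of the
   structure sheaf; the values of f outside W are irrelevant. *)
Definition regular_on (W : set surface) (f : surface -> k) : Prop :=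
  forall x, W x -> exists d e (p q : {mpoly k[3 + 3]}),
    [/\ bihomog d e p, bihomog d e q, q.@[coords x] != 0 &
        \forall y \near x, f y = p.@[coords y] / q.@[coords y]].

(* Line bundles are given by transition functions on a finite open cover
   (X is quasi-compact): lb_trans L i j is meaningful on U_i `&` U_j only. *)
Record line_data := LineData {
  lb_index : finType;
  lb_open : lb_index -> set surface;
  lb_trans : lb_index -> lb_index -> surface -> k
}.

Record is_line_bundle (L : line_data) : Prop := IsLineBundle {
  lb_openP : forall i : lb_index L, open (lb_open i);
  lb_coverP : \bigcup_(i : lb_index L) lb_open i = setT;
  lb_regular : forall i j : lb_index L,
    regular_on (lb_open i `&` lb_open j) (lb_trans i j);
  lb_trans1 : forall (i : lb_index L) x, lb_open i x -> lb_trans i i x = 1;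
  lb_transM : forall (h i j : lb_index L) x,
    lb_open h x -> lb_open i x -> lb_open j x ->
    lb_trans h i x * lb_trans i j x = lb_trans h j x
}.

Definition tensor (L M : line_data) : line_data := {|
  lb_index := (lb_index L * lb_index M)%type;
  lb_open := fun i => lb_open i.1 `&` lb_open i.2;
  lb_trans := fun i j x => lb_trans i.1 j.1 x * lb_trans i.2 j.2 x
|}.

(* T_x^* L *)
Definition pullback_translate (x : surface) (L : line_data) : line_data := {|
  lb_index := lb_index L;
  lb_open := fun i => translate x @^-1` lb_open i;
  lb_trans := fun i j => lb_trans i j \o translate x
|}.

(* A section of L over W is the family of its expressions in the given
   trivialisations, the i-th one being meaningful on W `&` U_i only; hence
   equality of sections is eq_section. *)
Definition family (L : line_data) := lb_index L -> surface -> k.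

Definition is_section (L : line_data) (W : set surface) (s : family L) : Prop :=
  (forall i, regular_on (W `&` lb_open i) (s i)) /\
  (forall i j x, W x -> lb_open i x -> lb_open j x ->
     s i x = lb_trans i j x * s j x).

Definition eq_section (L : line_data) (W : set surface) (s t : family L) :
    Prop :=
  forall i x, W x -> lb_open i x -> s i x = t i x.

Record open_cover := OpenCover {
  oc_index :> finType;
  oc_set : oc_index -> set surface;
  oc_open : forall a, open (oc_set a);
  oc_cover : \bigcup_a oc_set a = setT
}.

(* Čech cochains: all simplices (a_0, ..., a_p) are allowed, the cochains are
   not assumed to be alternating. *)
Definition inter (U : open_cover) (p : nat) (a : 'I_p.+1 -> U) : set surface :=
  \bigcap_i oc_set (a i).

Definition cochain (L : line_data) (U : open_cover) (p : nat) :=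
  ('I_p.+1 -> U) -> family L.

Definition is_cochain (L : line_data) (U : open_cover) (p : nat)
    (c : cochain L U p) : Prop :=
  forall a, is_section (inter a) (c a).

Definition differential (L : line_data) (U : open_cover) (p : nat)
    (c : cochain L U p) : cochain L U p.+1 :=
  fun a i x => \sum_(j < p.+2) (-1) ^+ j * c (a \o lift j) i x.

Definition is_cocycle (L : line_data) (U : open_cover) (p : nat)
    (c : cochain L U p) : Prop :=
  is_cochain c /\
  forall a, eq_section (inter a) (differential c a) (fun _ _ => 0).

Definition is_coboundary (L : line_data) (U : open_cover) (p : nat) :
    cochain L U p -> Prop :=
  match p with
  | 0 => fun c => forall a, eq_section (inter a) (c a) (fun _ _ => 0)
  | p'.+1 => fun c => exists b : cochain L U p',
      is_cochain b /\ forall a, eq_section (inter a) (c a) (differential b a)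
  end.

(* The class of the cocycle c in H^p(X, L), the direct limit of the H^p(U, L)
   over the open covers U, is zero: c becomes a coboundary on a refinement. *)
Definition zero_class (L : line_data) (U : open_cover) (p : nat)
    (c : cochain L U p) : Prop :=
  exists (V : open_cover) (r : V -> U),
    (forall b, oc_set b `<=` oc_set (r b)) /\
    is_coboundary (fun a : 'I_p.+1 -> V => c (r \o a)).

(* H^p(X, L) <> 0 *)
Definition cohomology_nonzero (L : line_data) (p : nat) : Prop :=
  exists (U : open_cover) (c : cochain L U p), is_cocycle c /\ ~ zero_class c.

Definition index_condition (L : line_data) : Prop :=
  exists! j : nat, cohomology_nonzero L j.

(* 0 is a junk value, for bundles that do not satisfy the index condition *)
Definition bundle_index (L : line_data) : nat := xget 0%N (cohomology_nonzero L).

Definition pair_index_condition (L M : line_data) : Prop :=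
  forall x : surface,
    [/\ index_condition (pullback_translate x L), index_condition M,
        index_condition (tensor (pullback_translate x L) M) &
        bundle_index (tensor (pullback_translate x L) M) =
          (bundle_index (pullback_translate x L) + bundle_index M)%N].

Definition cup (L M : line_data) (U : open_cover) (p q : nat)
    (s : cochain L U p) (t : cochain M U q) : cochain (tensor L M) U (p + q) :=
  fun a ij x => s (fun h => a (inord h)) ij.1 x *
                t (fun h => a (inord (p + h)%N)) ij.2 x.

(* The map H^p(X, L) (x) H^q(X, M) -> H^(p+q)(X, L (x) M) is zero for p and q
   the indices of L and M.  Two classes are always represented by cocycles on
   a common cover, and the decomposable tensors generate the source. *)
Definition cup_product_zero (L M : line_data) : Prop :=
  forall (U : open_cover) (s : cochain L U (bundle_index L))
    (t : cochain M U (bundle_index M)),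
    is_cocycle s -> is_cocycle t -> zero_class (cup s t).

End Surface.

(* Main.v *)
(* Let D be the diagonal, L = O({o} x E + E x {o}) and M = O(E x {o} - D), and
   put p = - x.1, q = - x.2.  All sheaves are embedded in the constant sheaf of
   rational functions F(a, Q).  The bundle T_x^* L, with simple poles along a = p
   and Q = q, has H^0 spanned by the function 1 and no other cohomology; M and
   N = T_x^* L (x) M have only H^1.  Hence the cup product is the map
   H^1(M) -> H^1(N) induced by the inclusion of sheaves.  The line H^1(M) is
   spanned by a class with principal part a simple pole along a = o, corrected so
   as to vanish on D.  It dies in H^1(N) if p = o, where this pole is allowed, and
   if p = q, because of tau_p(a) - tau_p(Q); otherwise a function killing it would
   have on D the form f = tau_p with f regular at p.  So C is the union of
   {o} x E and D.

   Higher cohomology vanishes because the Cech complex is exact on affine pieces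
   (Nullstellensatz), which are then glued by Mayer-Vietoris; the splittings of
   functions that this needs come from a Kunneth decomposition.  For H^1(N) <> 0,
   a function on E with a full pole at p does not lift from D to X. *)
Require Import Defs.
From HB Require Import structures.
From mathcomp Require Import all_boot all_algebra ring zify.
From mathcomp Require Import boolp classical_sets filter topology_structure.
From mathcomp Require Import mpoly.

Set Implicit Arguments.
Unset Strict Implicit.
Unset Printing Implicit Defensive.

Import GRing.Theory.
Local Open Scope classical_set_scope.
Local Open Scope ring_scope.

(** * The Nullstellensatz for arbitrary ideals of a polynomial ring *)

(** The self-intersection numbers of L, M and L (x) M are 2, -2 and -2, which predicts the indices
    0, 1 and 1; the vanishing is nevertheless proved by hand, on explicit functions. Thanks to the
    embedding in a constant sheaf, a cochain is a family of functions compared only generically: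
    restriction is invisible and data on any two nonempty open sets can be compared. The price is
    that a function may have junk values at special points, hence the relation [RV] between a point,
    a function and its true value there. Cohomology is a limit over all covers, so each cocycle is
    first moved to a refinement by nonvanishing loci inside affine charts. Mayer-Vietoris then uses
    on each factor the complements of o and of a line y = c. Such a line misses o, and c is normally
    the ordinate of a pole, which then lies outside the intersection. The diagonal is not pulled
    back from a factor, so vanishing along it is carried by a separate flag and not by the
    divisor. *)

Record is_ideal (R : comNzRingType) (I : set R) : Prop := IsIdeal {
  ideal0 : I 0;
  idealD : forall a b, I a -> I b -> I (a + b);
  idealM : forall a b, I b -> I (a * b)
}.

Lemma ideal_sub (R : comNzRingType) (I : set R) a b :
  is_ideal I -> I a -> I b -> I (a - b).
Proof. by move=> h ha hb; rewrite -mulN1r; apply: (idealD h) => //; apply: (idealM h). Qed.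

Lemma ideal_mulr (R : comNzRingType) (I : set R) a b : is_ideal I -> I a -> I (a * b).
Proof. by move=> h ha; rewrite mulrC; apply: (idealM h). Qed.

Lemma exists_prime_avoiding (R : comNzRingType) (I : set R) (f : R) :
  is_ideal I -> (forall n, ~ I (f ^+ n)) ->
  exists P : set R, [/\ is_ideal P, I `<=` P, forall n, ~ P (f ^+ n) &
    forall a b, P (a * b) -> P a \/ P b].
Proof.
move=> hI nI.
(* The union of the empty chain is empty; adjoining I makes it satisfy [Q] as well. *)
pose Q (A : set R) := is_ideal (A `|` I) /\ forall n, ~ (A `|` I) (f ^+ n).
have [F FQ Ftot|A [[hA nA] maxA]] := @Zorn_bigcup R Q.
  have two a b : (\bigcup_(X in F) X `|` I) a -> (\bigcup_(X in F) X `|` I) b ->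
      (I a /\ I b) \/ exists2 X, F X & (X `|` I) a /\ (X `|` I) b.
    move=> [[X FX Xa]|Ia] [[Y FY Yb]|Ib]; last by left.
    - right; have [XY|YX] := Ftot _ _ FX FY.
        by exists Y => //; split; left => //; apply: XY.
      by exists X => //; split; left => //; apply: YX.
    - by right; exists X => //; split; [left|right].
    - by right; exists Y => //; split; [right|left].
  split; first split.
  - by right; apply: ideal0.
  - move=> a b ha hb; have [[Ia Ib]|[X FX [Xa Xb]]] := two _ _ ha hb.
      by right; apply: (idealD hI).
    have [hX _] := FQ _ FX; have [Xab|Iab] := idealD hX Xa Xb; last by right.
    by left; exists X.
  - move=> a b [[X FX Xb]|Ib]; last by right; apply: (idealM hI).
    have [hX _] := FQ _ FX.
    have [Xab|Iab] := idealM hX a (or_introl Xb : (X `|` I) b); last by right.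
    by left; exists X.
  - move=> n [[X FX Xf]|/nI//]; have [_ /(_ n) h] := FQ _ FX.
    by apply: h; left.
pose P := A `|` I.
have maxP (B : set R) : is_ideal B -> P `<=` B -> (exists2 b, B b & ~ P b) ->
    exists n, B (f ^+ n).
  move=> hB PB [b Bb nPb]; apply: contrapT => nB.
  have BI : B `|` I = B by apply/setUidl => c Ic; apply: PB; right.
  apply: (maxA B).
    split; last by move=> BA; apply: nPb; left; apply: BA.
    by move=> a Aa; apply: PB; left.
  by rewrite /Q BI; split => // n Bn; apply: nB; exists n.
exists P; split=> // [a Ia|a b Pab]; first by right.
apply: contrapT => /not_orP [nPa nPb].
(* By maximality, P + (c) contains a power of f. If a b were in P with a and b outside, the product
   of two such powers would lie in P. *)
have gen c : ~ P c -> exists n r s, P r /\ f ^+ n = r + s * c.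
  move=> nPc; have [|||n [r [s [Pr e]]]] := maxP [set d | exists r s, P r /\ d = r + s * c].
  - split.
    + by exists 0, 0; split; [exact: (ideal0 hA)|rewrite mul0r addr0].
    + move=> _ _ [r [s [Pr ->]]] [r' [s' [Pr' ->]]]; exists (r + r'), (s + s').
      by split; [apply: (idealD hA)|ring].
    + move=> d _ [r [s [Pr ->]]]; exists (d * r), (d * s).
      by split; [apply: (idealM hA)|ring].
  - by move=> d Pd; exists d, 0; split => //; ring.
  - by exists c => //; exists 0, 1; split; [exact: (ideal0 hA)|ring].
  - by exists n, r, s.
have [n [r [s [Pr en]]]] := gen _ nPa; have [m [r' [s' [Pr' em]]]] := gen _ nPb.
apply: (nA (n + m)%N); rewrite exprD en em.
have -> : (r + s * a) * (r' + s' * b) =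
  (r' + s' * b) * r + (s * a) * r' + (s * s') * (a * b) by ring.
apply: (idealD hA); last exact: (idealM hA).
by apply: (idealD hA); apply: (idealM hA).
Qed.

(** The points are an abstract family of homomorphisms to k, so that a variable can be adjoined to
    any domain R: the induction goes from R to R[X]. *)
Definition nullstellensatz (k : fieldType) (R : comNzRingType) (Pt : Type)
    (ev : Pt -> {rmorphism R -> k}) : Prop :=
  forall (I : set R) (f : R), is_ideal I ->
    (forall v, (forall g, I g -> ev v g = 0) -> ev v f = 0) -> exists n, I (f ^+ n).

Lemma leq_of_pred_lt (a b : nat) : (a.-1 < b)%N -> (a <= b)%N.
Proof. lia. Qed.

Lemma pseudo_division (R : idomainType) (g p : {poly R}) : g != 0 ->
  exists n (q r : {poly R}), [/\ lead_coef g ^+ n *: p = q * g + r & (size r < size g)%N].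
Proof.
move=> g0; have [n] := ubnP (size p); elim: n p => // n IH p /ltnSE lep.
case: (ltnP (size p) (size g)) => [lt|le].
  by exists 0%N, 0, p; split => //; rewrite expr0 scale1r mul0r add0r.
pose p' := lead_coef g *: p - lead_coef p *: 'X^(size p - size g) * g.
have p0 : p != 0 by rewrite -size_poly_gt0 (leq_trans _ le) // size_poly_gt0.
have sg : (0 < size g)%N by rewrite size_poly_gt0.
have E1 (a b : nat) : (0 < a -> a <= b -> b.-1 - (b - a) = a.-1)%N by lia.
have E2 (a b j : nat) : (a <= b -> b.-1 < j -> a <= j - (b - a))%N by lia.
have E4 (a b j : nat) : (0 < a -> a <= b -> b.-1 <= j -> (j < b - a) = false)%N by lia.
have [|m [q [r [e lt]]]] := IH p'.
  apply: leq_trans lep; rewrite (polySpred p0) ltnS; apply/leq_sizeP => j lej.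
  rewrite coefB coefZ -scalerAl coefZ coefXnM E4 //.
  case: (ltngtP j (size p).-1) lej => // [lt|->] _.
    by rewrite !nth_default ?mulr0 ?subr0 //; [exact: E2 le lt|exact: leq_of_pred_lt].
  by rewrite E1 // -!lead_coefE mulrC subrr.
exists m.+1, (q + lead_coef g ^+ m *: (lead_coef p *: 'X^(size p - size g))), r.
split => //; rewrite mulrDl -addrA (addrC _ r) addrA -e /p' scalerBr.
by rewrite exprSr -scalerA -!scalerAl subrK.
Qed.

Section NullstellensatzStep.
Context (k : closedFieldType) (R : idomainType) (Pt : Type).
Context (ev : Pt -> {rmorphism R -> k}).

Definition ev_poly (v : Pt * k) : {rmorphism {poly R} -> k} :=
  (horner_eval v.2 \o map_poly (ev v.1) : {rmorphism {poly R} -> k}).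

Lemma exists_nonroot (p : {poly k}) : p != 0 -> exists c, p.[c] != 0.
Proof. by move=> p0; have [c] := closed_nonrootP p p0; exists c. Qed.

(* If the prime ideal P contains g with lead_coef g not in P and g of least
   size for that, then the roots of g are the points of P above those of P0. *)
Lemma nullstellensatz_poly : nullstellensatz ev -> nullstellensatz ev_poly.
Proof.
move=> NS I; rewrite -[set _]/(set {poly R}) in I *.
move=> f; rewrite -[GRing.ComNzRing.sort _]/{poly R} in f *.
move=> hI hf; apply: contrapT => /forallNP nI.
have [P [hP IP nP pP]] := exists_prime_avoiding hI nI.
suff [v [hv fv]] : exists v, (forall g, P g -> ev_poly v g = 0) /\ ev_poly v f != 0.
  by move/eqP: fv; apply; apply: hf => g /IP; apply: hv.
have P1 : ~ P 1 by have := nP 0%N; rewrite expr0.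
pose P0 := [set r : R | P r%:P].
have hP0 : is_ideal P0.
  split; rewrite /P0 /=; first exact: (ideal0 hP).
    by move=> a b ha hb; rewrite polyCD; apply: (idealD hP).
  by move=> a b hb; rewrite polyCM; apply: (idealM hP).
have pP0 a b : P0 (a * b) -> P0 a \/ P0 b by rewrite /P0 /= polyCM; apply: pP.
have pP0X a n : P0 (a ^+ n) -> P0 a.
  elim: n => [|n IHn]; first by rewrite expr0 => /P1.
  by rewrite exprS => /pP0[//|/IHn].
pose PX := [set g : {poly R} | forall i, P0 g`_i].
have PXP (g : {poly R}) : PX g -> P g.
  move=> hg; rewrite -[g]coefK poly_def; elim/big_ind: _ => //.
  - exact: (ideal0 hP).
  - by move=> *; apply: (idealD hP).
  - by move=> i _; rewrite -mul_polyC; apply: (ideal_mulr _ hP); apply: hg.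
have avoid a : ~ P0 a -> exists v, (forall r, P0 r -> ev v r = 0) /\ ev v a != 0.
  move=> nPa; apply: contrapT => /forallNP h.
  have [|n /pP0X//] := NS P0 a hP0.
  by move=> v hv; have /not_andP[//|/negP/negPn/eqP] := h v.
have lead (g : {poly R}) : P g -> ~ PX g -> (forall h : {poly R}, P h -> (size h < size g)%N -> PX h) ->
    ~ P0 (lead_coef g).
  move=> Pg nPg ming Plg; apply: nPg.
  have g'P : P (g - lead_coef g *: 'X^((size g).-1)).
    by apply: (ideal_sub hP) => //; rewrite -mul_polyC; apply: (ideal_mulr _ hP).
  have := ming _ g'P; move=> hg' i.
  have [g0|g0] := eqVneq g 0; first by rewrite g0 coef0; apply: (ideal0 hP0).
  have /hg' {}hg' : (size (g - lead_coef g *: 'X^((size g).-1))%R < size g)%N.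
    rewrite (polySpred g0) ltnS; apply/leq_sizeP => j.
    rewrite coefB coefZ coefXn leq_eqVlt => /orP[/eqP<-|lt].
      by rewrite eqxx mulr1 lead_coefE subrr.
    by rewrite gtn_eqF // mulr0 subr0 nth_default //; apply: leq_of_pred_lt.
  rewrite -[g](subrK (lead_coef g *: 'X^((size g).-1))) coefD coefZ.
  by apply: (idealD hP0); [apply: hg'|apply: (ideal_mulr _ hP0)].
(* If P is generated by P0, some coefficient of f avoids P0. A point of R where it survives leaves a
   nonzero polynomial, and any nonroot of it will do. *)
have [allPX|] := pselect (forall g, P g -> PX g).
  have [i nPi] : exists i, ~ P0 f`_i.
    apply/existsNP => h; apply: (nP 1%N); rewrite expr1; exact: PXP.
  have [v [hv fv]] := avoid _ nPi.
  have [|c hc] := exists_nonroot (p := map_poly (ev v) f).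
    by apply: contraNneq fv => /(congr1 (fun p : {poly k} => p`_i)); rewrite coef_map coef0 => ->.
  exists (v, c); split => // g /allPX hg /=.
  suff -> : map_poly (ev v) g = 0 by rewrite /horner_eval horner0.
  by apply/polyP => j; rewrite coef_map coef0; apply: hv.
move=> /existsNP[g0 /not_implyP[Pg0 nPg0]].
have [g [Pg nPg ming]] : exists g : {poly R}, [/\ P g, ~ PX g &
    forall h : {poly R}, P h -> (size h < size g)%N -> PX h].
  have [n] := ubnP (size g0); elim: n g0 Pg0 nPg0 => // n IH g0 Pg0 nPg0 /ltnSE le.
  have [h|] := pselect (forall h, P h -> (size h < size g0)%N -> PX h).
    by exists g0.
  move=> /existsNP[h /not_implyP[Ph /not_implyP[lt nPh]]].
  by apply: (IH h) => //; lia.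
have nPd := lead g Pg nPg ming; set d := lead_coef g in nPd.
have gn0 : g != 0 by apply/eqP => g0'; apply: nPg => i; rewrite g0' coef0; apply: (ideal0 hP0).
have dnP : ~ P d%:P by [].
have sg : (1 < size g)%N.
  rewrite ltnNge; apply/negP => /size1_polyC e; apply: nPd.
  by rewrite /d e lead_coefC; move: Pg; rewrite {1}e.
have redg (h : {poly R}) : exists n (q r : {poly R}), [/\ d ^+ n *: h = q * g + r, (size r < size g)%N &
    P h -> PX r].
  have [n [q [r [e lt]]]] := pseudo_division h gn0; exists n, q, r; split => // Ph.
  apply: ming => //; have -> : r = d ^+ n *: h - q * g by rewrite e addrC addKr.
  by apply: (ideal_sub hP); rewrite -?mul_polyC; apply: (idealM hP).
(* J consists of the multiples of f modulo P that are outside P. An element h of least size is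
   constant: otherwise pseudo-division of g by h writes a multiple of g as q h + r with q and r in P
   and smaller than g, so that all coefficients of this multiple lie in P0, and its leading one does
   not. *)
pose J := [set h : {poly R} | exists u, P (h - u * f) /\ ~ P h].
have [r0 [u [Pr0 nr0]]] : exists (r0 : R) (u : {poly R}), P (r0%:P - u * f) /\ ~ P0 r0.
  have [h [[u [Pu nPh]] minh]] : exists h : {poly R}, J h /\
      forall h' : {poly R}, J h' -> (size h <= size h')%N.
    have Jf : J f.
      exists 1; split; first by rewrite mul1r subrr; apply: (ideal0 hP).
      by have := nP 1%N; rewrite expr1.
    suff gen n (f0 : {poly R}) : J f0 -> (size f0 < n)%N -> exists h : {poly R},
        J h /\ forall h' : {poly R}, J h' -> (size h <= size h')%N.
      exact: (gen _ _ Jf (ltnSn _)).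
    elim: n f0 => // n IH h Jh /ltnSE le.
    have [|] := pselect (forall h' : {poly R}, J h' -> (size h <= size h')%N); first by exists h.
    move=> /existsNP[h' /not_implyP[Jh' /negP]]; rewrite -ltnNge => lt.
    by apply: (IH h') => //; lia.
  have smallP (h' u' : {poly R}) : P (h' - u' * f) -> (size h' < size h)%N -> P h'.
    move=> Ph' lt; apply: contrapT => nPh'; suff : (size h <= size h')%N by lia.
    by apply: minh; exists u'.
  have hn0 : h != 0 by apply/eqP => h0; apply: nPh; rewrite h0; apply: (ideal0 hP).
  have nPlh : ~ P0 (lead_coef h).
    move=> Plh; apply: nPh.
    have Pl : P (lead_coef h *: 'X^((size h).-1)).
      by rewrite -mul_polyC; apply: (ideal_mulr _ hP).
    rewrite -[h](subrK (lead_coef h *: 'X^((size h).-1))); apply: (idealD hP) => //.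
    apply: (smallP _ u); first by rewrite addrAC; apply: (ideal_sub hP).
    rewrite (polySpred hn0) ltnS; apply/leq_sizeP => j.
    rewrite coefB coefZ coefXn leq_eqVlt => /orP[/eqP<-|lt].
      by rewrite eqxx mulr1 lead_coefE subrr.
    by rewrite gtn_eqF // mulr0 subr0 nth_default //; apply: leq_of_pred_lt.
  have ltg : (size h < size g)%N.
    have [n [q [r [e lt _]]]] := redg h; apply: leq_ltn_trans lt; apply: minh.
    exists (d ^+ n *: u); split.
      have -> : r - d ^+ n *: u * f = (d ^+ n)%:P * (h - u * f) - q * g.
        by rewrite mulrBr !mul_polyC e -scalerAl; ring.
      by apply: (ideal_sub hP); apply: (idealM hP).
    move=> Pr; have : P ((d ^+ n)%:P * h).
      by rewrite mul_polyC e; apply: (idealD hP) => //; apply: (idealM hP).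
    by case/pP => [/pP0X|].
  have sh : size h = 1%N.
    apply/eqP; rewrite eqn_leq size_poly_gt0 hn0 andbT leqNgt; apply/negP => gt1.
    have [n [q [r [e lt]]]] := pseudo_division g hn0.
    have Pr : P r.
      apply: (smallP _ (- q * u)) lt.
      have -> : r - - q * u * f = (lead_coef h ^+ n)%:P * g - q * (h - u * f).
        by rewrite mul_polyC e; ring.
      by apply: (ideal_sub hP); apply: (idealM hP).
    have Pq : P q.
      have : P (q * h).
        have -> : q * h = (lead_coef h ^+ n)%:P * g - r by rewrite mul_polyC e; ring.
        by apply: (ideal_sub hP) => //; apply: (idealM hP).
      by case/pP.
    have lhn : lead_coef h ^+ n != 0 by rewrite expf_neq0 // lead_coef_eq0.
    have ltq : (size q < size g)%N.
      have [->|q0] := eqVneq q 0; first by rewrite size_poly0; lia.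
      have : (size (q * h)%R <= size g)%N.
        have -> : q * h = lead_coef h ^+ n *: g - r by rewrite e addrK.
        by rewrite (leq_trans (size_polyD _ _)) // size_polyN geq_max size_scale // leqnn /= ltnW // (ltn_trans lt).
      by rewrite size_mul //; lia.
    have PXg i : P0 ((lead_coef h ^+ n *: g)`_i).
      rewrite e coefD; apply: (idealD hP0); last by apply: ming; [|exact: ltn_trans ltg].
      rewrite coefM; elim/big_ind: _ => [|a b Pa Pb|j _].
      - exact: (ideal0 hP0).
      - exact: (idealD hP0).
      - by apply: (ideal_mulr _ hP0); apply: ming.
    have := PXg (size g).-1; rewrite coefZ -lead_coefE => /pP0[/pP0X|] //.
  exists (lead_coef h), u; split => //.
  by rewrite /lead_coef sh /= -size1_polyC // sh.
(* At v neither the leading coefficient of g nor r0 vanishes: g keeps its degree, hence has a root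
   c, and f cannot vanish at (v, c) since it divides r0 modulo P. *)
have [|v [hv dv]] := avoid (d * r0); first by case/pP0.
move: dv; rewrite rmorphM mulf_eq0 negb_or => /andP[dv rv].
have szg : size (map_poly (ev v) g) = size g.
  by rewrite size_poly_eq //.
have [|c /rootP hc] := closed_rootP (map_poly (ev v) g) _; first by rewrite szg; lia.
have kill (h : {poly R}) : P h -> ev_poly (v, c) h = 0.
  move=> Ph; have [n [q [r [e _ /(_ Ph) PXr]]]] := redg h.
  have /(congr1 (fun p : {poly R} => (map_poly (ev v) p).[c])) := e.
  rewrite map_polyZ rmorphD rmorphM /= hornerZ hornerD hornerM hc mulr0 add0r.
  have -> : map_poly (ev v) r = 0 by apply/polyP => j; rewrite coef_map coef0; apply: hv.
  by rewrite horner0 rmorphXn => /eqP; rewrite mulf_eq0 expf_eq0 (negbTE dv) andbF /= => /eqP.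
exists (v, c); split => //; apply/eqP => f0.
have := kill _ Pr0; rewrite rmorphB rmorphM f0 mulr0 subr0 /= map_polyC /horner_eval /= hornerC.
by move/eqP; apply/negP.
Qed.

End NullstellensatzStep.

Lemma mpoly_hom_eq (k : comNzRingType) (n : nat) (R : comNzRingType)
    (f g : {rmorphism {mpoly k[n]} -> R}) :
  (forall c, f c%:MP = g c%:MP) -> (forall i, f 'X_i = g 'X_i) -> f =1 g.
Proof.
move=> hC hX p; rewrite (mpolyE p) !rmorph_sum; apply: eq_bigr => m _.
rewrite -mul_mpolyC !rmorphM hC; congr (_ * _).
rewrite mpolyXE_id !rmorph_prod; apply: eq_bigr => i _.
by rewrite !rmorphXn hX.
Qed.

Theorem nullstellensatz_mpoly (k : closedFieldType) (n : nat) (I : set {mpoly k[n]})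
    (f : {mpoly k[n]}) : is_ideal I ->
  (forall v : 'I_n -> k, (forall g, I g -> g.@[v] = 0) -> f.@[v] = 0) ->
  exists m, I (f ^+ m).
Proof.
suff NS : nullstellensatz (fun v : 'I_n -> k => meval v : {rmorphism _ -> k}).
  exact: NS.
elim: n {I f} => [|n /nullstellensatz_poly NS] I f hI hf.
  have cst (g : {mpoly k[0]}) : g = (g.@[fun _ => 0])%:MP.
    rewrite {1}(mpolyE g) mevalE rmorph_sum; apply: eq_bigr => m _.
    rewrite -mul_mpolyC /= mpolyCM; congr (_ * _).
    by rewrite big_ord0 mpolyXE_id big_ord0.
  have [[c [Ic c0]]|h] := pselect (exists c : {mpoly k[0]}, I c /\ c != 0).
    exists 0%N; rewrite expr0.
    have -> : 1 = (c.@[fun _ => 0])^-1%:MP * c.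
      rewrite {2}(cst c) -mpolyCM mulVf //.
      by apply: contraNneq c0 => c0; rewrite (cst c) c0 mpolyC0.
    exact: (idealM hI).
  exists 1%N; rewrite expr1 (cst f) (hf (fun _ => 0)) ?mpolyC0; first exact: (ideal0 hI).
  move=> g Ig; have [->|g0] := eqVneq g 0; first by rewrite rmorph0.
  by case: h; exists g.
pose w (i : 'I_n) : 'I_n.+1 := widen_ord (leqnSn n) i.
pose emb := comp_mpoly [tuple 'X_(w i) : {mpoly k[n.+1]} | i < n].
pose back : {rmorphism {poly {mpoly k[n]}} -> {mpoly k[n.+1]}} :=
  (horner_eval 'X_ord_max \o map_poly emb : {rmorphism _ -> _}).
have embX i : emb 'X_i = 'X_(w i) by rewrite /emb comp_mpolyXU -tnth_nth tnth_mktuple.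
have uniX (i : 'I_n) : muni 'X_(w i) = ('X_i)%:P :> {poly {mpoly k[n]}}.
  rewrite /muni mmapX mmap1U; case: splitP => [j eq|j].
    by congr ('X__)%:P; apply/val_inj => /=; rewrite -eq.
  by rewrite ord1 /= addn0 => /eqP /=; rewrite ltn_eqF.
have unimax : muni 'X_ord_max = 'X :> {poly {mpoly k[n]}}.
  rewrite /muni mmapX mmap1U; case: splitP => //; case=> j ltj /eqP /=.
  by have := ltj; rewrite ltn_neqAle eq_sym => /andP[/negbTE->].
have ordP (i : 'I_n.+1) : i = ord_max \/ exists j, i = w j.
  case: (unliftP ord_max i) => [j ->|->]; [right|by left].
  by exists j; apply/val_inj; rewrite /= /bump leqNgt ltn_ord.
have backK p : back (muni p) = p.
  apply: (mpoly_hom_eq (f := back \o @muni n k : {rmorphism _ -> _}) (g := idfun)) => [c|i] /=.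
    by rewrite muniC map_polyC /horner_eval hornerC /emb /= comp_mpolyC.
  have [->|[j ->]] := ordP i; first by rewrite unimax map_polyX /horner_eval hornerX.
  by rewrite uniX map_polyC /horner_eval hornerC; apply: embX.
have [|v hv|m hm] := NS [set g | I (back g)] (muni f).
- split; first by change (I (back 0)); rewrite rmorph0; apply: (ideal0 hI).
    move=> a b ha hb; change (I (back (a + b))).
    by rewrite rmorphD; apply: (idealD hI).
  move=> a b hb; change (I (back (a * b))).
  by rewrite rmorphM; apply: (idealM hI).
- pose v' (i : 'I_n.+1) := if unlift ord_max i is Some j then v.1 j else v.2.
  have v'w j : v' (w j) = v.1 j.
    rewrite /v'; case: unliftP => [j' e|/(congr1 val)/=]; last first.
      by have := ltn_ord j; lia.
    congr (v.1 _); apply/val_inj; move/(congr1 val): e => /=.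
    by rewrite /bump leqNgt ltn_ord.
  have v'm : v' ord_max = v.2 by rewrite /v' unlift_none.
  have evE p : ev_poly (fun v : 'I_n -> k => meval v : {rmorphism _ -> k}) v (muni p) = p.@[v'].
    apply: (mpoly_hom_eq (f := ev_poly (fun v : 'I_n -> k => meval v : {rmorphism _ -> k}) v
        \o @muni n k : {rmorphism _ -> _}) (g := meval v')) => [c|i] /=.
      by rewrite muniC map_polyC /horner_eval hornerC /= !mevalC.
    have [->|[j ->]] := ordP i; rewrite mevalXU.
      by rewrite unimax map_polyX /horner_eval hornerX v'm.
    by rewrite uniX map_polyC /horner_eval hornerC /= mevalXU v'w.
  rewrite evE; apply: hf => g Ig; rewrite /= -evE; apply: hv.
  by have : back (muni g) = g := backK g; rewrite /= => ->.
- by exists m; rewrite -(backK (f ^+ m)) rmorphXn.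
Qed.

(** * Rational functions *)

(* A space with homogeneous coordinates in copies of P^2 (one for E, two for
   E x E); [ratfun x f] says that f is given by a fraction of the coordinates that
   is defined at x. *)
Inductive ratfun (k : fieldType) (T J : Type) (H : J -> T -> 'I_3 -> k) (x : T) :
    (T -> k) -> Prop :=
| rat_coord s i j : H s x j != 0 -> ratfun H x (fun y => H s y i / H s y j)
| rat_cst c : ratfun H x (fun=> c)
| ratD f g : ratfun H x f -> ratfun H x g -> ratfun H x (fun y => f y + g y)
| ratM f g : ratfun H x f -> ratfun H x g -> ratfun H x (fun y => f y * g y)
| ratV f : ratfun H x f -> f x != 0 -> ratfun H x (fun y => (f y)^-1).

(* [gen P]: P holds at the generic point. *)
Record rspace (k : fieldType) := RSpace {
  rs_T :> Type;
  rs_J : Type;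
  rs_H : rs_J -> rs_T -> 'I_3 -> k;
  gen : (rs_T -> Prop) -> Prop;
  gen_true : forall P : rs_T -> Prop, (forall x, P x) -> gen P;
  genI : forall P Q, gen P -> gen Q -> gen (fun x => P x /\ Q x);
  genS : forall P Q : rs_T -> Prop, (forall x, P x -> Q x) -> gen P -> gen Q;
  gen_ex : forall P, gen P -> exists x, P x;
  gen_rat : forall x f, ratfun rs_H x f -> f x != 0 -> gen (fun y => f y != 0)
}.

Section RationalValues.
Context (k : fieldType) (S : rspace k).
Implicit Types (x : S) (F G : S -> k) (v : k).
Local Notation rat := (ratfun (@rs_H _ S)).

Lemma rat_ext x f g : rat x f -> (forall y, f y = g y) -> rat x g.
Proof. by move=> h /funext <-. Qed.

Lemma ratN x f : rat x f -> rat x (fun y => - f y).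
Proof.
move=> h; apply: (rat_ext (ratM (rat_cst _ _ (-1)) h)) => y; exact: mulN1r.
Qed.

Lemma ratB x f g : rat x f -> rat x g -> rat x (fun y => f y - g y).
Proof. by move=> hf /ratN hg; apply: (ratD hf hg). Qed.

Lemma genI3 (P Q R : S -> Prop) : gen P -> gen Q -> gen R ->
  gen (fun x => [/\ P x, Q x & R x]).
Proof. by move=> hP hQ hR; apply: genS (genI hP (genI hQ hR)) => x [? []]. Qed.

Lemma gen_and2 (P Q R : S -> Prop) : (forall x, P x -> Q x -> R x) ->
  gen P -> gen Q -> gen R.
Proof. by move=> h hP hQ; apply: genS (genI hP hQ) => x [? ?]; apply: h. Qed.

Lemma rat_eq x f g : rat x f -> rat x g -> gen (fun y => f y = g y) -> f x = g x.
Proof.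
move=> hf hg e; apply/eqP; rewrite -subr_eq0; apply/negPn/negP => n0.
have [y [e1]] := gen_ex (genI e (gen_rat (ratB hf hg) n0)).
by rewrite e1 subrr eqxx.
Qed.

(* F is defined at x as an element of the function field, with value v there;
   the function F itself need not take the value v at x. *)
Definition RV x F v := exists f, [/\ rat x f, f x = v & gen (fun y => F y = f y)].

Definition req F G := gen (fun y => F y = G y).

Lemma req_sym F G : req F G -> req G F. Proof. exact: genS. Qed.

Lemma RV_uniq x F v w : RV x F v -> RV x F w -> v = w.
Proof.
move=> [f [hf <- ef]] [g [hg <- eg]]; apply: (rat_eq hf hg).
by apply: gen_and2 ef eg => y -> ->.
Qed.

Lemma RV_req x F G v : RV x F v -> req F G -> RV x G v.
Proof.
move=> [f [hf e ef]] eg; exists f; split => //.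
by apply: gen_and2 ef eg => y -> ->.
Qed.

Lemma RV_eq x F G v w : RV x F v -> (forall y, F y = G y) -> v = w -> RV x G w.
Proof. by move=> h e <-; apply: (RV_req h); apply: gen_true. Qed.

Lemma rat_RV x f : rat x f -> RV x f (f x).
Proof. by move=> h; exists f; split => //; apply: gen_true. Qed.

Lemma RV_cst x c : RV x (fun=> c) c.
Proof. exact: (rat_RV (rat_cst _ _ c)). Qed.

Lemma RVD x F G v w : RV x F v -> RV x G w -> RV x (fun y => F y + G y) (v + w).
Proof.
move=> [f [hf <- ef]] [g [hg <- eg]]; exists (fun y => f y + g y).
by split; [exact: ratD| |apply: gen_and2 ef eg => y -> ->].
Qed.

Lemma RVM x F G v w : RV x F v -> RV x G w -> RV x (fun y => F y * G y) (v * w).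
Proof.
move=> [f [hf <- ef]] [g [hg <- eg]]; exists (fun y => f y * g y).
by split; [exact: ratM| |apply: gen_and2 ef eg => y -> ->].
Qed.

Lemma RVN x F v : RV x F v -> RV x (fun y => - F y) (- v).
Proof. by move=> h; apply: RV_eq (RVM (RV_cst x (-1)) h) _ _ => *; apply: mulN1r. Qed.

Lemma RVB x F G v w : RV x F v -> RV x G w -> RV x (fun y => F y - G y) (v - w).
Proof. by move=> h /RVN h'; apply: (RVD h h'). Qed.

Lemma RVV x F v : RV x F v -> v != 0 -> RV x (fun y => (F y)^-1) v^-1.
Proof.
move=> [f [hf <- ef]] n0; exists (fun y => (f y)^-1).
by split; [exact: ratV| |apply: genS ef => y ->].
Qed.

Lemma RVf x F G v w : RV x F v -> RV x G w -> w != 0 ->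
  RV x (fun y => F y / G y) (v / w).
Proof. by move=> h h' n0; apply: (RVM h); apply: RVV. Qed.

Lemma RVX x F v n : RV x F v -> RV x (fun y => F y ^+ n) (v ^+ n).
Proof.
move=> h; elim: n => [|n IH]; first exact: RV_cst.
by apply: RV_eq (RVM h IH) _ _ => *; rewrite exprS.
Qed.

Lemma RV_sum x (I : Type) (r : seq I) (F : I -> S -> k) (v : I -> k) :
  (forall i, RV x (F i) (v i)) ->
  RV x (fun y => \sum_(i <- r) F i y) (\sum_(i <- r) v i).
Proof.
move=> h; elim: r => [|i r IH].
  by apply: RV_eq (RV_cst x 0) _ _ => *; rewrite big_nil.
by apply: RV_eq (RVD (h i) IH) _ _ => *; rewrite big_cons.
Qed.

Lemma RV_gen_neq0 x F v : RV x F v -> v != 0 -> gen (fun y => F y != 0).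
Proof.
by move=> [f [hf <- ef]] n0; apply: gen_and2 ef (gen_rat hf n0) => y ->.
Qed.

Definition Rg x F := exists v, RV x F v.

Lemma RgD x F G : Rg x F -> Rg x G -> Rg x (fun y => F y + G y).
Proof. by move=> [v hv] [w hw]; eexists; apply: RVD hv hw. Qed.
Lemma RgB x F G : Rg x F -> Rg x G -> Rg x (fun y => F y - G y).
Proof. by move=> [v hv] [w hw]; eexists; apply: RVB hv hw. Qed.
Lemma RgM x F G : Rg x F -> Rg x G -> Rg x (fun y => F y * G y).
Proof. by move=> [v hv] [w hw]; eexists; apply: RVM hv hw. Qed.
Lemma RgX x F n : Rg x F -> Rg x (fun y => F y ^+ n).
Proof. by move=> [v hv]; eexists; apply: RVX hv. Qed.
Lemma Rg_cst x c : Rg x (fun=> c).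
Proof. by eexists; apply: RV_cst. Qed.
Lemma Rg_req x F G : Rg x F -> req F G -> Rg x G.
Proof. by move=> [v hv] e; exists v; apply: RV_req e. Qed.
Lemma Rg_eq x F G : Rg x F -> (forall y, F y = G y) -> Rg x G.
Proof. by move=> h e; apply: (Rg_req h); apply: gen_true. Qed.
Lemma Rg_sum x (I : Type) (r : seq I) (F : I -> S -> k) :
  (forall i, Rg x (F i)) -> Rg x (fun y => \sum_(i <- r) F i y).
Proof.
by move=> /choice [v hv]; exists (\sum_(i <- r) v i); apply: RV_sum.
Qed.

Lemma ratfun_gen x f : rat x f -> gen (fun y => rat y f).
Proof.
elim=> {f} [s i j hj|c|f g _ hf _ hg|f g _ hf _ hg|f hf gf f0].
- have : rat x (fun y => rs_H s y j / rs_H s y j) by apply: rat_coord.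
  move=> /gen_rat; rewrite divff // => /(_ (oner_neq0 _)); apply: genS => y.
  by rewrite mulf_eq0 negb_or => /andP[yj _]; apply: rat_coord.
- by apply: gen_true => y; apply: rat_cst.
- by apply: gen_and2 hf hg => y; apply: ratD.
- by apply: gen_and2 hf hg => y; apply: ratM.
- by apply: gen_and2 gf (gen_rat hf f0) => y; apply: ratV.
Qed.

Definition val_at x F : k := xget 0 (RV x F).

Lemma val_atP x F : Rg x F -> RV x F (val_at x F).
Proof. by move=> h; apply: (@xgetPex _ 0 (RV x F)). Qed.

Lemma val_atE x F v : RV x F v -> val_at x F = v.
Proof. by move=> hv; apply: (RV_uniq _ hv); apply: val_atP; exists v. Qed.

(** Lets pointwise values, such as those of transition functions, be traded for the rational
    function that they come from. *)
Lemma req_val_at x F : Rg x F -> req (fun y => val_at y F) F.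
Proof.
move=> [v [f [hf _ ef]]]; apply: (gen_and2 _ (ratfun_gen hf) ef) => y yf ->.
by apply: val_atE; exists f.
Qed.

End RationalValues.

Arguments RV {k S} x F v.
Arguments Rg {k S} x F.
Arguments req {k S} F G.
Arguments val_at {k S} x F.

(** * The function field of the curve *)

Notation i0 := (@Ordinal 3 0 isT).
Notation i1 := (@Ordinal 3 1 isT).
Notation i2 := (@Ordinal 3 2 isT).

Lemma ord3P (i : 'I_3) : [\/ i = i0, i = i1 | i = i2].
Proof.
case: i => [[|[|[|//]]] h]; [apply: Or31|apply: Or32|apply: Or33]; exact: val_inj.
Qed.

Lemma poly_roots (k : closedFieldType) (p : {poly k}) : p != 0 ->
  exists rs : seq k, forall x, p.[x] = 0 -> x \in rs.
Proof.
move=> p0; have [rs e] := closed_field_poly_normal p; exists rs => x /eqP.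
rewrite e hornerZ mulf_eq0 lead_coef_eq0 (negbTE p0) /=.
by rewrite -rootE root_prod_XsubC.
Qed.

Lemma avoid_seq (k : closedFieldType) (rs : seq k) : exists x, x \notin rs.
Proof.
have [|x] := exists_nonroot (p := \prod_(z <- rs) ('X - z%:P)).
  by rewrite monic_neq0 // monic_prod_XsubC.
by rewrite -rootE root_prod_XsubC; exists x.
Qed.

Lemma eq_of_relation (R : comPzRingType) (a b c l r : R) :
  l = r -> a - b = c * (l - r) -> a = b.
Proof. by move=> -> h; apply/eqP; rewrite -subr_eq0 h subrr mulr0. Qed.

Section Curve.
Context (k : closedFieldType) (E : elliptic_curve k).
Implicit Types (P Q : Defs.point E).
Local Notation a1 := (ec1 E).
Local Notation a2 := (ec2 E).
Local Notation a3 := (ec3 E).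
Local Notation a4 := (ec4 E).
Local Notation a6 := (ec6 E).

Definition hX P := hcoord P i0.
Definition hY P := hcoord P i1.
Definition hZ P := hcoord P i2.

Lemma weierstrass_hom P :
  hY P ^+ 2 * hZ P + a1 * hX P * hY P * hZ P + a3 * hY P * hZ P ^+ 2 =
  hX P ^+ 3 + a2 * hX P ^+ 2 * hZ P + a4 * hX P * hZ P ^+ 2 + a6 * hZ P ^+ 3.
Proof.
rewrite /hX /hY /hZ /hcoord; case: P => [[[x y]|]] /=; last by move=> _; ring.
by move=> /eqP; rewrite /weierstrass => h; apply/eqP; rewrite -subr_eq0 -h; apply/eqP; ring.
Qed.

Definition origin : Defs.point E := @Point k E None isT.

Lemma hZ_origin : hZ origin = 0. Proof. by []. Qed.
Lemma hY_origin : hY origin = 1. Proof. by []. Qed.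
Lemma hX_origin : hX origin = 0. Proof. by []. Qed.

Lemma hZ_affine P : hZ P != 0 -> hZ P = 1.
Proof. by rewrite /hZ /hcoord; case: P => [[[x y]|]] //= _; rewrite eqxx. Qed.

Lemma hZ_eq0 P : hZ P = 0 -> P = origin.
Proof.
rewrite /hZ /hcoord; case: P => [[[x y]|]] h /=; first by move/eqP; rewrite oner_eq0.
by move=> _; apply: val_inj.
Qed.

Lemma hZ_neq0 P : (hZ P != 0) = (P != origin).
Proof.
have [->|n] := eqVneq P origin; first by rewrite hZ_origin eqxx.
by apply/eqP => /hZ_eq0 /eqP; rewrite (negbTE n).
Qed.

Lemma affineE P : P != origin -> val P = Some (hX P, hY P).
Proof. by rewrite -hZ_neq0 /hZ /hX /hY /hcoord; case: P => [[[x y]|]] //= _; rewrite eqxx. Qed.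

Lemma affine_eq P Q : P != origin -> Q != origin -> hX P = hX Q -> hY P = hY Q -> P = Q.
Proof. by move=> /affineE eP /affineE eQ ex ey; apply: val_inj; rewrite eP eQ ex ey. Qed.

Lemma weierstrass_affine P : P != origin ->
  hY P ^+ 2 + a1 * hX P * hY P + a3 * hY P =
  hX P ^+ 3 + a2 * hX P ^+ 2 + a4 * hX P + a6.
Proof.
rewrite -hZ_neq0 => /hZ_affine e; have := weierstrass_hom P.
by rewrite e !expr1n !mulr1.
Qed.

Lemma on_curve_point x y : weierstrass a1 a2 a3 a4 a6 x y = 0 ->
  exists P, [/\ P != origin, hX P = x & hY P = y].
Proof. by move=> /eqP h; exists (@Point k E (Some (x, y)) h); split. Qed.

Lemma quadratic_roots x : exists rs : seq k, forall y,
  weierstrass a1 a2 a3 a4 a6 x y = 0 -> y \in rs.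
Proof.
pose p := 'X^2 + (a1 * x + a3) *: 'X - (x ^+ 3 + a2 * x ^+ 2 + a4 * x + a6)%:P.
have [|rs h] := poly_roots (p := p).
  apply/eqP => /(congr1 (fun p : {poly k} => p`_2)) /eqP.
  by rewrite /p !(coefD, coefN, coefC, coefZ, coefX, coefXn) /= mulr0 addr0 subr0 oner_eq0.
by exists rs => y e; apply: h; rewrite /p !hornerE /= -[RHS]e /weierstrass; ring.
Qed.

Lemma cubic_roots y : exists rs : seq k, forall x,
  weierstrass a1 a2 a3 a4 a6 x y = 0 -> x \in rs.
Proof.
pose p := 'X^3 + a2 *: 'X^2 + (a4 - a1 * y) *: 'X + (a6 - y ^+ 2 - a3 * y)%:P.
have [|rs h] := poly_roots (p := p).
  apply/eqP => /(congr1 (fun p : {poly k} => p`_3)) /eqP.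
  by rewrite /p !(coefD, coefN, coefC, coefZ, coefX, coefXn) /= !mulr0 !addr0 oner_eq0.
by exists rs => x e; apply: h; rewrite /p !hornerE /= -[RHS]oppr0 -e /weierstrass; ring.
Qed.

Lemma exists_y x : exists y, weierstrass a1 a2 a3 a4 a6 x y = 0.
Proof.
pose p := 'X^2 + (a1 * x + a3) *: 'X - (x ^+ 3 + a2 * x ^+ 2 + a4 * x + a6)%:P.
have [|y /rootP e] := closed_rootP p _; last first.
  by exists y; rewrite -e /p !hornerE /= /weierstrass; ring.
apply/eqP => s1; have /(congr1 (fun p : {poly k} => p`_2)) /eqP := size1_polyC (eq_leq s1).
by rewrite /p !(coefD, coefN, coefC, coefZ, coefX, coefXn) /= mulr0 addr0 subr0 oner_eq0.
Qed.

Definition cofin (A : Defs.point E -> Prop) :=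
  exists s : seq (Defs.point E), forall P, P \notin s -> A P.

Lemma cofin_true (A : Defs.point E -> Prop) : (forall P, A P) -> cofin A.
Proof. by move=> h; exists [::]. Qed.

Lemma cofinS (A B : Defs.point E -> Prop) : (forall P, A P -> B P) -> cofin A -> cofin B.
Proof. by move=> h [s hs]; exists s => P /hs/h. Qed.

Lemma cofinI (A B : Defs.point E -> Prop) : cofin A -> cofin B -> cofin (fun P => A P /\ B P).
Proof.
move=> [s hs] [t ht]; exists (s ++ t) => P; rewrite mem_cat negb_or => /andP[Ps Pt].
by split; [apply: hs|apply: ht].
Qed.

Lemma cofin_neq Q : cofin (fun P => P != Q).
Proof. by exists [:: Q] => P; rewrite inE. Qed.

Lemma cofin_ex (A : Defs.point E -> Prop) : cofin A -> exists P, A P.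
Proof.
move=> [s hs]; have [x hx] := avoid_seq [seq hX P | P <- s].
have [y /on_curve_point[P [_ ex _]]] := exists_y x.
by exists P; apply: hs; apply: contra hx => Ps; rewrite -ex map_f.
Qed.

(** Applied with f and g the two affine coordinates, in either order: g takes finitely many values
    on a fibre of f, and together they determine the point. *)
Lemma finite_fibers (rs : k -> seq k) (f g : Defs.point E -> k) (l : seq k) :
  (forall P, P != origin -> g P \in rs (f P)) ->
  (forall P Q, P != origin -> Q != origin -> f P = f Q -> g P = g Q -> P = Q) ->
  cofin (fun P => f P \notin l).
Proof.
move=> hg inj.
have one x y : exists s : seq (Defs.point E), forall P, P != origin -> f P = x -> g P = y -> P \in s.
  have [[Q [Q0 e e']]|h] := pselect (exists Q, [/\ Q != origin, f Q = x & g Q = y]).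
    exists [:: Q] => P P0 eP eP'; rewrite inE; apply/eqP.
    by apply: inj; rewrite // ?eP ?eP' ?e ?e'.
  by exists [::] => P P0 eP eP'; case: h; exists P.
have line x (ys : seq k) : exists s : seq (Defs.point E),
    forall P, P != origin -> f P = x -> g P \in ys -> P \in s.
  elim: ys => [|y ys [s hs]]; first by exists [::].
  have [t ht] := one x y; exists (t ++ s) => P P0 eP; rewrite inE mem_cat.
  by move=> /orP[/eqP/(ht _ P0 eP) ->//|/(hs _ P0 eP) ->]; rewrite orbT.
suff [s hs] : exists s : seq (Defs.point E), forall P, P != origin -> f P \in l -> P \in s.
  exists (origin :: s) => P; rewrite inE negb_or => /andP[P0]; apply: contra.
  exact: hs.
elim: l => [|x l [s hs]]; first by exists [::].
have [t ht] := line x (rs x); exists (t ++ s) => P P0; rewrite inE mem_cat.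
move=> /orP[/eqP e|/(hs _ P0) ->]; last by rewrite orbT.
by rewrite ht //; rewrite -e; apply: hg.
Qed.

Lemma cofin_hX (l : seq k) : cofin (fun P => hX P \notin l).
Proof.
have [rs hrs] := choice quadratic_roots.
apply: (@finite_fibers rs hX hY) => [P P0|P Q P0 Q0]; last exact: affine_eq.
by apply: hrs; rewrite /weierstrass weierstrass_affine // subrr.
Qed.

Lemma cofin_hY (l : seq k) : cofin (fun P => hY P \notin l).
Proof.
have [rs hrs] := choice cubic_roots.
apply: (@finite_fibers rs hY hX) => [P P0|P Q P0 Q0 ? ?]; last exact: affine_eq.
by apply: hrs; rewrite /weierstrass weierstrass_affine // subrr.
Qed.

(* Polynomial functions on the affine part of E, in the basis 1, y over k[x]. *)
Definition apol (f : Defs.point E -> k) := exists A B : {poly k},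
  forall P, P != origin -> f P = A.[hX P] + B.[hX P] * hY P.

Lemma apol_cst c : apol (fun=> c).
Proof. by exists c%:P, 0 => P _; rewrite !hornerE. Qed.

Lemma apolD f g : apol f -> apol g -> apol (fun P => f P + g P).
Proof.
move=> [A [B h]] [A' [B' h']]; exists (A + A'), (B + B') => P P0.
by rewrite h // h' // !hornerE /=; ring.
Qed.

Lemma apolM f g : apol f -> apol g -> apol (fun P => f P * g P).
Proof.
move=> [A [B h]] [A' [B' h']].
exists (A * A' + B * B' * ('X^3 + a2 *: 'X^2 + a4 *: 'X + a6%:P)),
  (A * B' + A' * B - B * B' * (a1 *: 'X + a3%:P)) => P P0.
rewrite h // h' // !hornerE /=.
apply: (eq_of_relation (c := B.[hX P] * B'.[hX P]) (weierstrass_affine P0)); ring.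
Qed.

Lemma apol_coord i : apol (fun P => hcoord P i).
Proof.
case: (ord3P i) => ->.
- by exists 'X, 0 => P _; rewrite !hornerE /=.
- by exists 0, 1 => P _; rewrite !hornerE /=.
- by exists 1, 0 => P; rewrite -hZ_neq0 => /hZ_affine e; rewrite !hornerE /=.
Qed.

(* The norm of A + B y down to k[x] is nonzero, by parity of degrees. *)
Lemma apol_gen_neq0 f c : apol f -> c != origin -> f c != 0 -> cofin (fun P => f P != 0).
Proof.
move=> [A [B h]] c0 fc.
pose N := A ^+ 2 - A * (B * (a1 *: 'X + a3%:P)) -
  B ^+ 2 * ('X^3 + (a2 *: 'X^2 + a4 *: 'X + a6%:P)).
have sl : (size (a2 *: 'X^2 + a4 *: 'X + a6%:P)%R <= 3)%N.
  apply/leq_sizeP => j hj; rewrite !(coefD, coefC, coefZ, coefX, coefXn).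
  by case: j hj => [|[|[|j]]] //= _; rewrite !mulr0 !addr0.
have sl' : (size (a1 *: 'X + a3%:P)%R <= 2)%N.
  apply/leq_sizeP => j hj; rewrite !(coefD, coefC, coefZ, coefX, coefXn).
  by case: j hj => [|[|j]] //= _; rewrite !mulr0 !addr0.
have sc : size ('X^3 + (a2 *: 'X^2 + a4 *: 'X + a6%:P)) = 4.
  by rewrite size_polyDl size_polyXn.
have N0 : N != 0.
  have [B0|B0] := eqVneq B 0.
    rewrite /N B0 mul0r mulr0 expr0n mul0r !subr0 expf_neq0 //.
    by apply: contraNneq fc => A0; rewrite h // A0 B0 !hornerE /=.
  rewrite subr_eq0; apply/eqP => e.
  have {e} : A * (A - B * (a1 *: 'X + a3%:P)) =
      B * (B * ('X^3 + (a2 *: 'X^2 + a4 *: 'X + a6%:P))).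
    by rewrite mulrBr -expr2 e expr2 mulrA.
  move=> /(congr1 (fun p : {poly k} => size p)).
  have c3 : 'X^3 + (a2 *: 'X^2 + a4 *: 'X + a6%:P) != 0 by rewrite -size_poly_gt0 sc.
  rewrite [in RHS]size_mul ?mulf_neq0 // [in RHS]size_mul // sc.
  have parity (a b : nat) : (0 < a -> 0 < b -> (a + a).-1 <> (b + (b + 4).-1).-1)%N by lia.
  have bound (a b n : nat) :
    (0 < b -> n <= (a + b.+1).-1 -> a <= b.+1 -> n <> (b + (b + 4).-1).-1)%N by lia.
  have sB : (0 < size B)%N by rewrite size_poly_gt0.
  have sBl : (size (B * (a1 *: 'X + a3%:P))%R <= (size B).+1)%N.
    by rewrite (leq_trans (size_polyMleq _ _)) //; move: sl'; lia.
  have [A0|A0] := eqVneq A 0; first by rewrite A0 mul0r size_poly0; lia.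
  have sA : (0 < size A)%N by rewrite size_poly_gt0.
  have [lt|le] := ltnP (size B).+1 (size A).
    have e : size (A - B * (a1 *: 'X + a3%:P)) = size A.
      by rewrite size_polyDl // size_polyN (leq_ltn_trans sBl).
    rewrite size_mul // -?size_poly_gt0 e //; exact: parity.
  have : (size (A * (A - B * (a1 *: 'X + a3%:P)))%R <= (size A + (size B).+1).-1)%N.
    rewrite (leq_trans (size_polyMleq _ _)) //.
    have h' : (size (A - B * (a1 *: 'X + a3%:P))%R <= (size B).+1)%N.
      by rewrite (leq_trans (size_polyD _ _)) // size_polyN geq_max le.
    by move: h'; case: (size A) (size _) => [|a] [|b] //=; rewrite ?addnS ?leq_add2l //; lia.
  by move=> h'; apply: (bound (size A)).
have [rs hrs] := poly_roots N0.
apply: cofinS (cofinI (cofin_hX rs) (cofin_neq origin)) => P [hP P0].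
apply: contra hP => /eqP; rewrite h // => e; apply: hrs.
rewrite /N !hornerE /=; have eA : A.[hX P] = - (B.[hX P] * hY P) by apply/eqP; rewrite -addr_eq0 e.
rewrite eA; apply: (eq_of_relation (c := B.[hX P] ^+ 2) (weierstrass_affine P0)); ring.
Qed.

Lemma rat_affine c f : ratfun (fun _ : unit => @hcoord k E) c f -> c != origin ->
  exists p q, [/\ apol p, apol q, q c != 0 &
    forall P, P != origin -> q P != 0 -> f P = p P / q P].
Proof.
move=> h c0; elim: h => {f} [[] i j hj|a|f g _ [p [q [hp hq q0 e]]] _ [p' [q' [hp' hq' q0' e']]]
  |f g _ [p [q [hp hq q0 e]]] _ [p' [q' [hp' hq' q0' e']]]|f _ [p [q [hp hq q0 e]]] f0].
- by exists (fun P => hcoord P i), (fun P => hcoord P j); split=> //; apply: apol_coord.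
- exists (fun=> a), (fun=> 1); split; rewrite ?oner_neq0 //; try exact: apol_cst.
  by move=> *; rewrite divr1.
- exists (fun P => p P * q' P + p' P * q P), (fun P => q P * q' P).
  split; [by apply: apolD; apply: apolM|exact: apolM|exact: mulf_neq0|].
  move=> P P0; rewrite mulf_eq0 negb_or => /andP[n n'].
  by rewrite e // e' //; field; rewrite n n'.
- exists (fun P => p P * p' P), (fun P => q P * q' P).
  split; [exact: apolM|exact: apolM|exact: mulf_neq0|].
  move=> P P0; rewrite mulf_eq0 negb_or => /andP[n n'].
  by rewrite e // e' //; field; rewrite n n'.
- exists (fun P => q P * q P), (fun P => p P * q P).
  have pc : p c != 0 by move: f0; rewrite e // mulf_eq0 negb_or => /andP[].
  split; [exact: apolM|exact: apolM|exact: mulf_neq0|].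
  move=> P P0; rewrite mulf_eq0 negb_or => /andP[n n'].
  by rewrite e //; field; rewrite n n'.
Qed.

Definition zc P := hX P / hY P.
Definition wc P := hZ P / hY P.

Lemma weierstrass_zw P : hY P != 0 ->
  zc P ^+ 3 = - a2 * wc P * zc P ^+ 2 + (a1 * wc P - a4 * wc P ^+ 2) * zc P +
    (wc P + a3 * wc P ^+ 2 - a6 * wc P ^+ 3).
Proof.
move=> y0; rewrite /zc /wc; apply/eqP; rewrite -subr_eq0; apply/eqP.
have : (hY P)^-3 * (hX P ^+ 3 + a2 * hX P ^+ 2 * hZ P + a4 * hX P * hZ P ^+ 2 + a6 * hZ P ^+ 3
  - (hY P ^+ 2 * hZ P + a1 * hX P * hY P * hZ P + a3 * hY P * hZ P ^+ 2)) = 0.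
  by rewrite weierstrass_hom subrr mulr0.
by move=> <-; field.
Qed.

(* Polynomial functions around the origin, in the basis 1, z, z^2 over k[w]. *)
Definition vpol (f : Defs.point E -> k) := exists A B C : {poly k},
  forall P, hY P != 0 -> f P = A.[wc P] + B.[wc P] * zc P + C.[wc P] * zc P ^+ 2.

Let e2 : {poly k} := - (a2 *: 'X).
Let e1 : {poly k} := a1 *: 'X - a4 *: 'X^2.
Let e0 : {poly k} := 'X + a3 *: 'X^2 - a6 *: 'X^3.

Let zw3 P : hY P != 0 ->
  zc P ^+ 3 = e2.[wc P] * zc P ^+ 2 + e1.[wc P] * zc P + e0.[wc P].
Proof. by move=> /weierstrass_zw ->; rewrite /e2 /e1 /e0 !hornerE /=; ring. Qed.

Lemma vpol_cst c : vpol (fun=> c).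
Proof. by exists c%:P, 0, 0 => P _; rewrite !hornerE /=; ring. Qed.

Lemma vpolD f g : vpol f -> vpol g -> vpol (fun P => f P + g P).
Proof.
move=> [A [B [C h]]] [A' [B' [C' h']]]; exists (A + A'), (B + B'), (C + C') => P P0.
by rewrite h // h' // !hornerE /=; ring.
Qed.

Lemma vpolM f g : vpol f -> vpol g -> vpol (fun P => f P * g P).
Proof.
move=> [A [B [C h]]] [A' [B' [C' h']]].
pose D3 := B * C' + C * B'.
pose D4 := C * C'.
exists (A * A' + D3 * e0 + D4 * e2 * e0),
 (A * B' + B * A' + D3 * e1 + D4 * (e0 + e2 * e1)),
 (A * C' + B * B' + C * A' + D3 * e2 + D4 * (e1 + e2 * e2)) => P P0.
rewrite h // h' //; move: (zw3 P0); rewrite /D3 /D4.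
move: (e0) (e1) (e2) => f0 f1 f2 zw; rewrite !(hornerD, hornerM).
pose c3 := B.[wc P] * C'.[wc P] + C.[wc P] * B'.[wc P].
apply: (eq_of_relation (c := c3 + C.[wc P] * C'.[wc P] * (zc P + f2.[wc P])) zw).
rewrite /c3; ring.
Qed.

Lemma vpol_coord i : vpol (fun P => hcoord P i / hY P).
Proof.
case: (ord3P i) => ->.
- by exists 0, 1, 0 => P _; rewrite !hornerE /= ?mul1r.
- by exists 1, 0, 0 => P y0; rewrite -/(hY P) divff // !hornerE /= ?mul0r ?addr0.
- by exists 'X, 0, 0 => P y0; rewrite !hornerE /= ?mul0r ?addr0.
Qed.

(** N is the norm of f down to k[w], and g0 + g1 z + g2 z^2 the cofactor that produces it. At w = 0
    the cubic relation is z^3 = 0, so N(0) = A(0)^3, the cube of the value of f at the origin. *)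
Lemma vpol_gen_neq0 f : vpol f -> f origin != 0 -> cofin (fun P => f P != 0).
Proof.
move=> [A [B [C h]]] fc.
pose D := B + C * e2.
pose m11 := A + C * e1.
pose m21 := C * e0 + D * e1.
pose m22 := A + C * e1 + D * e2.
pose g0 := m11 * m22 - D * m21.
pose g1 := C * m21 - B * m22.
pose g2 := B * D - C * m11.
pose N := A * g0 + C * e0 * g1 + D * e0 * g2.
have w0 : wc origin = 0 by rewrite /wc hZ_origin mul0r.
have z0 : zc origin = 0 by rewrite /zc hX_origin mul0r.
have A0 : A.[0] != 0.
  move: fc; rewrite h ?hY_origin ?oner_eq0 // w0 z0.
  by rewrite expr0n !mulr0 !addr0.
have N0 : N != 0.
  apply: contraNneq A0 => /(congr1 (fun p : {poly k} => p.[0])).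
  have ez2 : e2.[0] = 0 by rewrite /e2 !(hornerN, hornerZ, hornerX); ring.
  have ez1 : e1.[0] = 0.
    by rewrite /e1 !(hornerD, hornerN, hornerZ, hornerX, hornerXn); ring.
  have ez0 : e0.[0] = 0.
    by rewrite /e0 !(hornerD, hornerN, hornerZ, hornerX, hornerXn); ring.
  rewrite /N /g0 /m11 /m22 /m21 /D; move: (e0) (e1) (e2) ez0 ez1 ez2 => f0 f1 f2 ez0 ez1 ez2.
  rewrite !(hornerD, hornerM, hornerN) ez2 ez1 ez0 horner0.
  rewrite !(mulr0, mul0r, addr0, add0r, subr0) => /eqP.
  by rewrite !mulf_eq0 !orbb.
have [rs hrs] := poly_roots N0.
(* At affine points w = 1 / y, so the roots of N are avoided by excluding their inverses as
   ordinates. *)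
apply: cofinS (cofinI (cofin_hY (0 :: [seq x^-1 | x <- rs])) (cofin_neq origin)) => P [].
rewrite inE negb_or => /andP[y0 hy] P0; apply: contra hy => /eqP fP.
have wE : wc P = (hY P)^-1 by rewrite /wc hZ_affine ?hZ_neq0 // div1r.
rewrite -[hY P]invrK -wE map_f //; apply: hrs.
have := fP; rewrite h // => {}fP.
have e : (A.[wc P] + B.[wc P] * zc P + C.[wc P] * zc P ^+ 2) *
    (g0.[wc P] + g1.[wc P] * zc P + g2.[wc P] * zc P ^+ 2) = N.[wc P].
  move: (zw3 y0); rewrite /N /g0 /g1 /g2 /m11 /m22 /m21 /D.
  move: (e0) (e1) (e2) => f0 f1 f2 zw.
  apply: (eq_of_relation (c := (B * (B + C * f2) - C * (A + C * f1)).[wc P] *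
    (zc P * C.[wc P] + (B + C * f2).[wc P]) + C.[wc P] * (C * (C * f0 + (B + C * f2) * f1) -
     B * (A + C * f1 + (B + C * f2) * f2)).[wc P]) zw).
  rewrite !(hornerD, hornerM, hornerN); ring.
by rewrite -e fP mul0r.
Qed.

Lemma rat_origin f : ratfun (fun _ : unit => @hcoord k E) origin f ->
  exists p q, [/\ vpol p, vpol q, q origin != 0 &
    forall P, hY P != 0 -> q P != 0 -> f P = p P / q P].
Proof.
have yO : hY origin != 0 by rewrite hY_origin oner_eq0.
elim=> {f} [[] i j hj|a|f g _ [p [q [hp hq q0 e]]] _ [p' [q' [hp' hq' q0' e']]]
  |f g _ [p [q [hp hq q0 e]]] _ [p' [q' [hp' hq' q0' e']]]|f _ [p [q [hp hq q0 e]]] f0].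
- exists (fun P => hcoord P i / hY P), (fun P => hcoord P j / hY P); split.
  + exact: vpol_coord.
  + exact: vpol_coord.
  + by rewrite hY_origin divr1.
  move=> P y0; rewrite mulf_eq0 negb_or => /andP[n _].
  by field; rewrite n y0.
- exists (fun=> a), (fun=> 1); split; rewrite ?oner_neq0 //; try exact: vpol_cst.
  by move=> *; rewrite divr1.
- exists (fun P => p P * q' P + p' P * q P), (fun P => q P * q' P).
  split; [by apply: vpolD; apply: vpolM|exact: vpolM|exact: mulf_neq0|].
  move=> P P0; rewrite mulf_eq0 negb_or => /andP[n n'].
  by rewrite e // e' //; field; rewrite n n'.
- exists (fun P => p P * p' P), (fun P => q P * q' P).
  split; [exact: vpolM|exact: vpolM|exact: mulf_neq0|].
  move=> P P0; rewrite mulf_eq0 negb_or => /andP[n n'].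
  by rewrite e // e' //; field; rewrite n n'.
- exists (fun P => q P * q P), (fun P => p P * q P).
  have pc : p origin != 0 by move: f0; rewrite e // mulf_eq0 negb_or => /andP[].
  split; [exact: vpolM|exact: vpolM|exact: mulf_neq0|].
  move=> P P0; rewrite mulf_eq0 negb_or => /andP[n n'].
  by rewrite e //; field; rewrite n n'.
Qed.

Lemma cofin_rat c f : ratfun (fun _ : unit => @hcoord k E) c f -> f c != 0 ->
  cofin (fun P => f P != 0).
Proof.
have [->|c0] := eqVneq c origin => hf fc.
  have yO : hY origin != 0 by rewrite hY_origin oner_eq0.
  have [p [q [hp hq q0 e]]] := rat_origin hf.
  have pc : p origin != 0 by move: fc; rewrite e // mulf_eq0 negb_or => /andP[].
  apply: cofinS (cofinI (cofin_hY [:: 0])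
    (cofinI (vpol_gen_neq0 hp pc) (vpol_gen_neq0 hq q0))) => P [].
  by rewrite inE => y0 [pP qP]; rewrite e // mulf_neq0 // invr_eq0.
have [p [q [hp hq q0 e]]] := rat_affine hf c0.
have pc : p c != 0 by move: fc; rewrite e // mulf_eq0 negb_or => /andP[].
apply: cofinS (cofinI (cofin_neq origin)
  (cofinI (apol_gen_neq0 hp c0 pc) (apol_gen_neq0 hq c0 q0))) => P [P0 [pP qP]].
by rewrite e // mulf_neq0 // invr_eq0.
Qed.

Definition curve : rspace k := @RSpace k (Defs.point E) unit (fun _ => @hcoord k E) cofin
  cofin_true cofinI cofinS cofin_ex cofin_rat.

End Curve.

(** * The function field of the surface *)

Section Surface.
Context (k : closedFieldType) (E : elliptic_curve k).
Local Notation pt := (Defs.point E).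
Local Notation X := (surface E).
Implicit Types (P Q : pt) (x y : X).

Definition hcoord2 (s : bool) (y : X) : 'I_3 -> k := hcoord (if s then y.2 else y.1).

Local Notation ratE := (ratfun (fun _ : unit => @hcoord k E)).
Local Notation ratX := (ratfun hcoord2).

(** Iterated cofiniteness reduces generic statements to E, one factor at a time. Every neighbourhood
    of every point satisfies it ([near_gen2]). *)
Definition gen2 (A : X -> Prop) := cofin (fun a => cofin (fun b => A (a, b))).

Lemma gen2_true (A : X -> Prop) : (forall y, A y) -> gen2 A.
Proof. by move=> h; do 2 (apply: cofin_true => ?). Qed.

Lemma gen2S (A B : X -> Prop) : (forall y, A y -> B y) -> gen2 A -> gen2 B.
Proof. by move=> h; apply: cofinS => a; apply: cofinS => b; apply: h. Qed.

Lemma gen2I (A B : X -> Prop) : gen2 A -> gen2 B -> gen2 (fun y => A y /\ B y).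
Proof.
move=> hA hB; apply: cofinS (cofinI hA hB) => a [ha hb].
by apply: cofinS (cofinI ha hb).
Qed.

Lemma gen2_ex (A : X -> Prop) : gen2 A -> exists y, A y.
Proof. by move=> /cofin_ex [a] /cofin_ex [b h]; exists (a, b). Qed.

Lemma cofin_hcoord j : cofin (fun P : pt => hcoord P j != 0).
Proof.
have H (f : pt -> k) : cofin (fun P => f P \notin [:: 0]) -> cofin (fun P => f P != 0).
  by apply: cofinS => P; rewrite inE.
case: (ord3P j) => ->; apply: H; [exact: cofin_hX|exact: cofin_hY|].
by apply: cofinS (cofin_neq (origin E)) => P; rewrite -hZ_neq0 inE.
Qed.

Lemma ratE_cst_coord P0 (Q : pt) i j : ratE P0 (fun=> hcoord Q i / hcoord Q j).
Proof. exact: (rat_cst _ _ (hcoord Q i / hcoord Q j)). Qed.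

Lemma ratX_line1 a b f : ratX (a, b) f -> ratE a (fun a' => f (a', b)).
Proof.
elim=> {f} [[] i j hj|c|f g _ hf _ hg|f g _ hf _ hg|f _ hf f0].
- exact: ratE_cst_coord.
- exact: (@rat_coord _ _ _ (fun _ : unit => @hcoord k E) a tt i j).
- exact: rat_cst.
- exact: ratD.
- exact: ratM.
- exact: ratV.
Qed.

Lemma ratX_line2 a b f : ratX (a, b) f -> ratE b (fun b' => f (a, b')).
Proof.
elim=> {f} [[] i j hj|c|f g _ hf _ hg|f g _ hf _ hg|f _ hf f0].
- exact: (@rat_coord _ _ _ (fun _ : unit => @hcoord k E) b tt i j).
- exact: ratE_cst_coord.
- exact: rat_cst.
- exact: ratD.
- exact: ratM.
- exact: ratV.
Qed.

Lemma ratX_diag a f : ratX (a, a) f -> ratE a (fun a' => f (a', a')).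
Proof.
elim=> {f} [[] i j hj|c|f g _ hf _ hg|f g _ hf _ hg|f _ hf f0].
- exact: (@rat_coord _ _ _ (fun _ : unit => @hcoord k E) a tt i j).
- exact: (@rat_coord _ _ _ (fun _ : unit => @hcoord k E) a tt i j).
- exact: rat_cst.
- exact: ratD.
- exact: ratM.
- exact: ratV.
Qed.

Lemma cofin_ratX_line1 a b f : ratX (a, b) f -> cofin (fun a' => ratX (a', b) f).
Proof.
elim=> {f} [[] i j hj|c|f g _ hf _ hg|f g _ hf _ hg|f rf hf f0].
- by apply: cofin_true => a'; apply: (@rat_coord _ _ _ hcoord2 (a', b) true).
- by apply: cofinS (cofin_hcoord j) => a' h; apply: (@rat_coord _ _ _ hcoord2 (a', b) false).
- by apply: cofin_true => a'; apply: rat_cst.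
- by apply: cofinS (cofinI hf hg) => a' []; apply: ratD.
- by apply: cofinS (cofinI hf hg) => a' []; apply: ratM.
- apply: cofinS (cofinI hf (cofin_rat (ratX_line1 rf) f0)) => a' []; exact: ratV.
Qed.

Lemma cofin_ratX_line2 a b f : ratX (a, b) f -> cofin (fun b' => ratX (a, b') f).
Proof.
elim=> {f} [[] i j hj|c|f g _ hf _ hg|f g _ hf _ hg|f rf hf f0].
- by apply: cofinS (cofin_hcoord j) => a' h; apply: (@rat_coord _ _ _ hcoord2 (a, a') true).
- by apply: cofin_true => a'; apply: (@rat_coord _ _ _ hcoord2 (a, a') false).
- by apply: cofin_true => a'; apply: rat_cst.
- by apply: cofinS (cofinI hf hg) => a' []; apply: ratD.
- by apply: cofinS (cofinI hf hg) => a' []; apply: ratM.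
- apply: cofinS (cofinI hf (cofin_rat (ratX_line2 rf) f0)) => a' []; exact: ratV.
Qed.

Lemma cofin_ratX_diag a f : ratX (a, a) f -> cofin (fun a' => ratX (a', a') f).
Proof.
elim=> {f} [[] i j hj|c|f g _ hf _ hg|f g _ hf _ hg|f rf hf f0].
- by apply: cofinS (cofin_hcoord j) => a' h; apply: (@rat_coord _ _ _ hcoord2 (a', a') true).
- by apply: cofinS (cofin_hcoord j) => a' h; apply: (@rat_coord _ _ _ hcoord2 (a', a') false).
- by apply: cofin_true => a'; apply: rat_cst.
- by apply: cofinS (cofinI hf hg) => a' []; apply: ratD.
- by apply: cofinS (cofinI hf hg) => a' []; apply: ratM.
- apply: cofinS (cofinI hf (cofin_rat (ratX_diag rf) f0)) => a' []; exact: ratV.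
Qed.

Lemma gen2_rat x f : ratX x f -> f x != 0 -> gen2 (fun y => f y != 0).
Proof.
case: x => a b hf f0.
apply: cofinS (cofinI (cofin_ratX_line1 hf) (cofin_rat (ratX_line1 hf) f0)) => a' [ha fa].
exact: (cofin_rat (ratX_line2 ha) fa).
Qed.

Definition surf : rspace k := @RSpace k X bool hcoord2 gen2
  gen2_true gen2I gen2S gen2_ex gen2_rat.

Lemma RV_fst x f v : RV (S := curve E) x.1 f v -> RV (S := surf) x (fun y => f y.1) v.
Proof.
move=> [g [hg <- e]]; exists (fun y => g y.1); split=> //.
  elim: hg {e} => {g} [[] i j hj|c|g h _ hg _ hh|g h _ hg _ hh|g _ hg g0].
  - exact: (@rat_coord _ _ _ hcoord2 x false).
  - exact: rat_cst.
  - exact: ratD.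
  - exact: ratM.
  - exact: ratV.
by apply: cofinS e => a ea; apply: cofin_true.
Qed.

Lemma RV_snd x f v : RV (S := curve E) x.2 f v -> RV (S := surf) x (fun y => f y.2) v.
Proof.
move=> [g [hg <- e]]; exists (fun y => g y.2); split=> //.
  elim: hg {e} => {g} [[] i j hj|c|g h _ hg _ hh|g h _ hg _ hh|g _ hg g0].
  - exact: (@rat_coord _ _ _ hcoord2 x true).
  - exact: rat_cst.
  - exact: ratD.
  - exact: ratM.
  - exact: ratV.
by apply: cofin_true.
Qed.

Lemma Rg_fst x f : Rg (S := curve E) x.1 f -> Rg (S := surf) x (fun y => f y.1).
Proof. by move=> [v hv]; exists v; apply: RV_fst. Qed.

Lemma Rg_snd x f : Rg (S := curve E) x.2 f -> Rg (S := surf) x (fun y => f y.2).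
Proof. by move=> [v hv]; exists v; apply: RV_snd. Qed.

(* Restriction to a line is only meaningful for functions F that take the
   right values at the points of the line, not merely up to [req]. *)
Lemma RV_line1 (F : X -> k) a b v : RV (S := surf) (a, b) F v ->
  cofin (fun a' => RV (S := surf) (a', b) F (F (a', b))) ->
  RV (S := curve E) a (fun a' => F (a', b)) v.
Proof.
move=> [f [hf <- e]] he; exists (fun a' => f (a', b)); split=> //; first exact: ratX_line1.
apply: cofinS (cofinI he (cofin_ratX_line1 hf)) => a' [h1 h2].
by apply: (RV_uniq h1); exists f; split.
Qed.

Lemma RV_line2 (F : X -> k) a b v : RV (S := surf) (a, b) F v ->
  cofin (fun b' => RV (S := surf) (a, b') F (F (a, b'))) ->
  RV (S := curve E) b (fun b' => F (a, b')) v.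
Proof.
move=> [f [hf <- e]] he; exists (fun b' => f (a, b')); split=> //; first exact: ratX_line2.
apply: cofinS (cofinI he (cofin_ratX_line2 hf)) => b' [h1 h2].
by apply: (RV_uniq h1); exists f; split.
Qed.

(** ** Comparison with regular functions in the Zariski topology *)

Lemma open_nonvanishing d e (p : {mpoly k[3 + 3]}) :
  bihomog d e p -> open (nonvanishing p : set X).
Proof.
move=> h; exists [set p]; split; first by move=> _ ->; exists d, e.
by rewrite bigcup_set1.
Qed.

Lemma near_nonvanishing d e (p : {mpoly k[3 + 3]}) x :
  bihomog d e p -> p.@[coords x] != 0 -> \forall y \near x, p.@[coords y] != 0.
Proof. by move=> h px; apply: open_nbhs_nbhs; split => //; apply: (open_nonvanishing h). Qed.

Lemma nbhs_nonvanishing x (A : set X) : nbhs x A ->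
  exists d e p, [/\ bihomog d e p, p.@[coords x] != 0 & nonvanishing p `<=` A].
Proof.
rewrite nbhsE => -[B [[S [hS ->]] [p Sp px]] BA].
have [d [e h]] := hS p Sp; exists d, e, p; split => // y py.
by apply: BA; exists p.
Qed.

Lemma bihomogD d e (p q : {mpoly k[3 + 3]}) :
  bihomog d e p -> bihomog d e q -> bihomog d e (p + q).
Proof.
move=> hp hq m /msuppD_le; rewrite mem_cat => /orP[/hp|/hq] //.
Qed.

Lemma bihomogC c : bihomog 0 0 (c%:MP : {mpoly k[3 + 3]}).
Proof.
move=> m; rewrite msuppC; case: ifP => // _; rewrite inE => /eqP ->.
by split; apply: big1 => i _; rewrite mnm0E.
Qed.

Definition var (s : bool) (i : 'I_3) : 'I_(3 + 3) := if s then rshift 3 i else lshift 3 i.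

Lemma coords_var (y : X) s i : coords y (var s i) = hcoord2 s y i.
Proof.
rewrite /coords /var /hcoord2; case: s; case: splitP => j /= e.
- by have := ltn_ord j; lia.
- by congr hcoord; apply: val_inj => /=; lia.
- by congr hcoord; apply: val_inj => /=; lia.
- by have := ltn_ord i; lia.
Qed.

Lemma bihomog_var s i : bihomog (~~ s) s ('X_(var s i) : {mpoly k[3 + 3]}).
Proof.
move=> m; rewrite msuppX inE => /eqP ->.
case: s => /=; split.
- by apply: big1 => j _; rewrite mnm1E eq_rlshift.
- by rewrite (bigD1 i) //= mnm1E eqxx big1 // => j /negbTE ij; rewrite mnm1E eq_rshift eq_sym ij.
- by rewrite (bigD1 i) //= mnm1E eqxx big1 // => j /negbTE ij; rewrite mnm1E eq_lshift eq_sym ij.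
- by apply: big1 => j _; rewrite mnm1E eq_lrshift.
Qed.

Definition regular_at x (f : X -> k) := exists d e (p q : {mpoly k[3 + 3]}),
    [/\ bihomog d e p, bihomog d e q, q.@[coords x] != 0 &
        \forall y \near x, f y = p.@[coords y] / q.@[coords y]].

Lemma ratX_regular_at x f : ratX x f -> regular_at x f.
Proof.
elim=> {f} [s i j hj|c|f g _ [d [e [p [q [hp hq qx h]]]]] _ [d' [e' [p' [q' [hp' hq' qx' h']]]]]
  |f g _ [d [e [p [q [hp hq qx h]]]]] _ [d' [e' [p' [q' [hp' hq' qx' h']]]]]
  |f _ [d [e [p [q [hp hq qx h]]]]] f0].
- exists (~~ s : nat), (s : nat), 'X_(var s i), 'X_(var s j); split; try exact: bihomog_var.
    by rewrite mevalXU coords_var.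
  by apply: filterE => y; rewrite !mevalXU !coords_var.
- exists 0%N, 0%N, c%:MP, 1%:MP; split; try exact: bihomogC.
    by rewrite mevalC oner_neq0.
  by apply: filterE => y; rewrite !mevalC divr1.
- exists (d + d')%N, (e + e')%N, (p * q' + q * p'), (q * q'); split.
  + by apply: bihomogD; apply: bihomogM.
  + exact: bihomogM.
  + by rewrite mevalM mulf_neq0.
  have nqq := near_nonvanishing hq qx; have nqq' := near_nonvanishing hq' qx'.
  apply: filterS (filterI (filterI nqq nqq') (filterI h h')) => y [[n n'] [-> ->]].
  by rewrite mevalD !mevalM; field; rewrite n n'.
- exists (d + d')%N, (e + e')%N, (p * p'), (q * q'); split.
  + exact: bihomogM.
  + exact: bihomogM.
  + by rewrite mevalM mulf_neq0.
  apply: filterS (filterI h h') => y [-> ->].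
  by rewrite !mevalM invfM; ring.
- have fE := nbhs_singleton h.
  have px : p.@[coords x] != 0 by move: f0; rewrite fE mulf_eq0 negb_or => /andP[].
  exists d, e, q, p; split=> //.
  by apply: filterS h => y ->; rewrite invf_div.
Qed.

Lemma ratX_near x f : ratX x f -> \forall y \near x, ratX y f.
Proof.
elim=> {f} [s i j hj|c|f g _ hf _ hg|f g _ hf _ hg|f rf hf f0].
- have := @near_nonvanishing _ _ _ x (@bihomog_var s j); rewrite mevalXU coords_var => /(_ hj).
  by apply: filterS => y; rewrite mevalXU coords_var; apply: rat_coord.
- by apply: filterE => y; apply: rat_cst.
- by apply: filterS2 hf hg => y; apply: ratD.
- by apply: filterS2 hf hg => y; apply: ratM.
- have [d [e [p [q [hp hq qx h]]]]] := ratX_regular_at rf.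
  have fE := nbhs_singleton h.
  have px : p.@[coords x] != 0 by move: f0; rewrite fE mulf_eq0 negb_or => /andP[].
  have near_f : \forall y \near x, f y != 0.
    apply: filterS (filterI (near_nonvanishing hp px) (filterI (near_nonvanishing hq qx) h)).
    move=> y [n [n' ->]].
    by rewrite mulf_neq0 // invr_eq0.
  by apply: filterS2 hf near_f => y; apply: ratV.
Qed.

Lemma bihomog_scale d e (p : {mpoly k[3 + 3]}) (v w : 'I_(3 + 3) -> k) s t :
  bihomog d e p -> (forall i, v (lshift 3 i) = s * w (lshift 3 i)) ->
  (forall i, v (rshift 3 i) = t * w (rshift 3 i)) ->
  p.@[v] = s ^+ d * t ^+ e * p.@[w].
Proof.
move=> h hl hr; rewrite !mevalE big_distrr /= big_seq [RHS]big_seq.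
apply: eq_bigr => m /h [hd he]; rewrite !big_split_ord /=.
have -> : \prod_(i < 3) v (lshift 3 i) ^+ m (lshift 3 i) =
    s ^+ d * \prod_(i < 3) w (lshift 3 i) ^+ m (lshift 3 i).
  by rewrite -hd -prodrXr -big_split /=; apply: eq_bigr => i _; rewrite hl exprMn.
have -> : \prod_(i < 3) v (rshift 3 i) ^+ m (rshift 3 i) =
    t ^+ e * \prod_(i < 3) w (rshift 3 i) ^+ m (rshift 3 i).
  by rewrite -he -prodrXr -big_split /=; apply: eq_bigr => i _; rewrite hr exprMn.
ring.
Qed.

Lemma ratX_mpoly x (p : {mpoly k[3 + 3]}) (f : 'I_(3 + 3) -> X -> k) :
  (forall i, ratX x (f i)) -> ratX x (fun y => p.@[fun i => f i y]).
Proof.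
move=> h; elim/mpolyind: p => [|c m p _ _ IH].
  by apply: (@rat_ext _ surf x _ _ (rat_cst _ _ 0)) => y; rewrite meval0.
suff hm : ratX x (fun y => \prod_i f i y ^+ m i).
  apply: (@rat_ext _ surf x _ _ (ratD (ratM (rat_cst _ _ c) hm) IH)) => y.
  by rewrite mevalD mevalZ mevalX.
elim: (index_enum _) => [|i r hr].
  by apply: (@rat_ext _ surf x _ _ (rat_cst _ _ 1)) => y; rewrite big_nil.
suff hi n : ratX x (fun y => f i y ^+ n).
  by apply: (@rat_ext _ surf x _ _ (ratM (hi (m i)) hr)) => y; rewrite big_cons.
elim: n => [|n IHn]; first exact: rat_cst.
by apply: (@rat_ext _ surf x _ _ (ratM (h i) IHn)) => y; rewrite exprS.
Qed.

Lemma hcoord_neq0 P : exists j, hcoord P j != 0.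
Proof.
have [->|] := eqVneq P (origin E); first by exists i1; rewrite oner_neq0.
by rewrite -hZ_neq0; exists i2.
Qed.

Definition aff (j1 j2 : 'I_3) (i : 'I_(3 + 3)) (y : X) : k :=
  match split i with
  | inl i => hcoord y.1 i / hcoord y.1 j1
  | inr i => hcoord y.2 i / hcoord y.2 j2 end.

Lemma ratX_aff j1 j2 x i : hcoord x.1 j1 != 0 -> hcoord x.2 j2 != 0 -> ratX x (aff j1 j2 i).
Proof.
move=> h1 h2; rewrite /aff; case: (split i) => j.
  exact: (@rat_coord _ _ _ hcoord2 x false j j1).
exact: (@rat_coord _ _ _ hcoord2 x true j j2).
Qed.

Lemma meval_aff d e (p : {mpoly k[3 + 3]}) j1 j2 y : bihomog d e p ->
  hcoord y.1 j1 != 0 -> hcoord y.2 j2 != 0 ->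
  p.@[coords y] = hcoord y.1 j1 ^+ d * hcoord y.2 j2 ^+ e * p.@[fun i => aff j1 j2 i y].
Proof.
move=> h h1 h2; apply: (bihomog_scale h) => i.
  rewrite -[lshift _ _]/(var false i) coords_var /aff.
  case: splitP => j /= e'; last by have := ltn_ord i; lia.
  by have -> : j = i; [apply: val_inj => /=; lia|rewrite mulrC divfK].
rewrite -[rshift _ _]/(var true i) coords_var /aff.
case: splitP => j /= e'; first by have := ltn_ord j; lia.
by have -> : j = i; [apply: val_inj => /=; lia|rewrite mulrC divfK].
Qed.

(** Dividing by coordinates that are nonzero at x dehomogenises p and q; the factors cancel because
    p and q have the same bidegree. *)
Lemma regular_at_ratX x f : regular_at x f ->
  exists2 g, ratX x g & \forall y \near x, f y = g y.
Proof.
move=> [d [e [p [q [hp hq qx h]]]]].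
have [j1 h1] := hcoord_neq0 x.1; have [j2 h2] := hcoord_neq0 x.2.
have n1 : \forall y \near x, hcoord y.1 j1 != 0.
  have := @near_nonvanishing _ _ _ x (@bihomog_var false j1); rewrite mevalXU coords_var => /(_ h1).
  by apply: filterS => y; rewrite mevalXU coords_var.
have n2 : \forall y \near x, hcoord y.2 j2 != 0.
  have := @near_nonvanishing _ _ _ x (@bihomog_var true j2); rewrite mevalXU coords_var => /(_ h2).
  by apply: filterS => y; rewrite mevalXU coords_var.
pose ev (p : {mpoly k[3 + 3]}) y := p.@[fun i => aff j1 j2 i y].
have evx (p' : {mpoly k[3 + 3]}) : ratX x (ev p') by apply: ratX_mpoly => i; apply: ratX_aff.
exists (fun y => ev p y / ev q y).
  apply: ratM => //; apply: ratV => //.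
  by apply: contraNneq qx => e0; rewrite (meval_aff hq h1 h2) -/(ev q x) e0 mulr0.
apply: filterS (filterI h (filterI n1 n2)) => y [-> [y1 y2]].
rewrite (meval_aff hp y1 y2) (meval_aff hq y1 y2) -/(ev p y) -/(ev q y).
(* Division by zero gives 0, so the two fractions agree even where the denominator vanishes. *)
have [->|n0] := eqVneq (ev q y) 0; first by rewrite mulr0 invr0 !mulr0.
by field; rewrite n0 /= !expf_neq0.
Qed.

Lemma near_gen2 x (A : X -> Prop) : (\forall y \near x, A y) -> gen2 A.
Proof.
move=> /nbhs_nonvanishing [d [e [p [hp px pA]]]].
have [j1 h1] := hcoord_neq0 x.1; have [j2 h2] := hcoord_neq0 x.2.
have hr : ratX x (fun y => p.@[fun i => aff j1 j2 i y]).
  by apply: ratX_mpoly => i; apply: ratX_aff.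
have n0 : p.@[fun i => aff j1 j2 i x] != 0.
  by apply: contraNneq px => e0; rewrite (meval_aff hp h1 h2) e0 mulr0.
have g1 : gen2 (fun y => hcoord y.1 j1 != 0).
  by apply: cofinS (cofin_hcoord j1) => a ha; apply: cofin_true.
have g2 : gen2 (fun y => hcoord y.2 j2 != 0) by apply: cofin_true => a; apply: cofin_hcoord.
apply: gen2S (gen2I (gen2_rat hr n0) (gen2I g1 g2)) => y [py [y1 y2]].
by apply: pA; rewrite /nonvanishing /= (meval_aff hp y1 y2) !mulf_neq0 // expf_neq0.
Qed.

Lemma open_gen2 (W : set X) x : open W -> W x -> gen2 W.
Proof. by move=> oW Wx; apply: (near_gen2 (x := x)); apply: open_nbhs_nbhs; split. Qed.

Lemma regular_at_RV x f : regular_at x f -> RV (S := surf) x f (f x).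
Proof.
move=> /regular_at_ratX [g hg e]; exists g; split=> //; last exact: near_gen2 e.
by rewrite (nbhs_singleton e).
Qed.

Lemma RV_regular_on (W : set X) F f : open W ->
  (forall y, W y -> RV (S := surf) y F (f y)) -> regular_on W f.
Proof.
move=> oW h x Wx; have [g [hg gx e]] := h x Wx.
have [d [e' [p [q [hp hq qx hpq]]]]] := ratX_regular_at hg.
exists d, e', p, q; split=> //.
have nW : \forall y \near x, W y by apply: open_nbhs_nbhs; split.
apply: filterS (filterI hpq (filterI (ratX_near hg) nW)) => y [<- [gy Wy]].
by apply: (RV_uniq (h y Wy)); exists g.
Qed.

Lemma RV_near x F v : RV (S := surf) x F v -> \forall y \near x, Rg (S := surf) y F.
Proof.
by move=> [f [hf _ e]]; apply: filterS (ratX_near hf) => y yf; exists (f y), f.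
Qed.

(** F and its inverse are both defined near x and have product 1 generically, so the value of F
    there cannot be 0. *)
Lemma RV_near_neq0 x F v : RV (S := surf) x F v -> v != 0 ->
  \forall y \near x, exists2 w, RV (S := surf) y F w & w != 0.
Proof.
move=> hF n0; have hV := RVV hF n0.
apply: filterS (filterI (RV_near hF) (RV_near hV)) => y [[w hw] [w' hw']].
exists w => //; apply/eqP => w0.
have h1 := RVM hw hw'; rewrite w0 mul0r in h1.
have h2 : RV (S := surf) y (fun y => F y * (F y)^-1) 1.
  apply: (RV_req (RV_cst y 1)); apply: (genS (r := surf) _ (RV_gen_neq0 hF n0)) => z z0.
  by rewrite divff.
by have /eqP := RV_uniq h1 h2; rewrite eq_sym oner_eq0.
Qed.

End Surface.

(** * Affine charts *)

Section Charts.
Context (k : closedFieldType) (E : elliptic_curve k).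
Local Notation pt := (Defs.point E).
Local Notation X := (surface E).
Local Notation RVE := (@RV k (curve E)).
Local Notation RV := (@RV k (surf E)).
Local Notation Rg := (@Rg k (surf E)).
Local Notation req := (@req k (surf E)).
Local Notation ratX := (ratfun (@hcoord2 k E)).
Implicit Types (l : 'I_3 -> k) (p q f g : {mpoly k[3 + 3]}) (x y : X).

Definition lin l (P : pt) : k := \sum_i l i * hcoord P i.

Definition proj (s : bool) y : pt := if s then y.2 else y.1.

(* The affine chart of X where the linear forms l false and l true do not vanish. *)
Definition chart (L : bool -> 'I_3 -> k) y := forall s, lin (L s) (proj s y) != 0.

Definition affc (L : bool -> 'I_3 -> k) (i : 'I_(3 + 3)) y : k :=
  match split i with
  | inl i => hcoord y.1 i / lin (L false) y.1
  | inr i => hcoord y.2 i / lin (L true) y.2 end.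

Definition pol (L : bool -> 'I_3 -> k) p y : k := p.@[fun i => affc L i y].

Lemma affc_var L s i y : affc L (var s i) y = hcoord (proj s y) i / lin (L s) (proj s y).
Proof.
rewrite /affc /var; case: s; case: splitP => j /= e.
- by have := ltn_ord j; lia.
- by have -> : j = i by apply: val_inj => /=; lia.
- by have -> : j = i by apply: val_inj => /=; lia.
- by have := ltn_ord i; lia.
Qed.

Lemma polD L p q y : pol L (p + q) y = pol L p y + pol L q y.
Proof. exact: mevalD. Qed.
Lemma polM L p q y : pol L (p * q) y = pol L p y * pol L q y.
Proof. exact: mevalM. Qed.
Lemma polX L p n y : pol L (p ^+ n) y = pol L p y ^+ n.
Proof. exact: rmorphXn. Qed.
Lemma polC L c y : pol L c%:MP y = c.
Proof. exact: mevalC. Qed.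
Lemma pol0 L y : pol L 0 y = 0.
Proof. exact: meval0. Qed.
Lemma pol1 L y : pol L 1 y = 1.
Proof. exact: meval1. Qed.
Lemma pol_var L s i y : pol L 'X_(var s i) y = hcoord (proj s y) i / lin (L s) (proj s y).
Proof. by rewrite /pol mevalXU affc_var. Qed.

Definition lform (s : bool) l : {mpoly k[3 + 3]} := \sum_i l i *: 'X_(var s i).

Lemma coords_lform s l y : (lform s l).@[coords y] = lin l (proj s y).
Proof.
rewrite /lform rmorph_sum; apply: eq_bigr => i _ /=.
by rewrite mevalZ mevalXU coords_var; case: s.
Qed.

Lemma bihomogZ d e c p : bihomog d e p -> bihomog d e (c *: p).
Proof. by move=> h m /msuppZ_le /h. Qed.

Lemma bihomog0 d e : bihomog d e (0 : {mpoly k[3 + 3]}).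
Proof. by move=> m; rewrite msupp0. Qed.

Lemma bihomog_lform s l : bihomog (~~ s) s (lform s l).
Proof.
rewrite /lform; elim/big_ind: _ => [|p q|i _]; first exact: bihomog0.
  exact: bihomogD.
by apply: bihomogZ; apply: bihomog_var.
Qed.

Lemma affc_scale L y : chart L y -> forall s i,
  hcoord (proj s y) i = lin (L s) (proj s y) * affc L (var s i) y.
Proof. by move=> h s i; rewrite affc_var mulrC divfK. Qed.

Lemma meval_pol d e p L y : bihomog d e p -> chart L y ->
  p.@[coords y] = lin (L false) y.1 ^+ d * lin (L true) y.2 ^+ e * pol L p y.
Proof.
move=> h ch; apply: (bihomog_scale h) => i.
  by rewrite -[lshift _ _]/(var false i) coords_var -(affc_scale ch).
by rewrite -[rshift _ _]/(var true i) coords_var -(affc_scale ch).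
Qed.

Lemma meval_pol_neq0 d e p L y : bihomog d e p -> chart L y ->
  (p.@[coords y] != 0) = (pol L p y != 0).
Proof.
move=> h ch; have h1 : lin (L false) y.1 != 0 := ch false.
have h2 : lin (L true) y.2 != 0 := ch true.
by rewrite (meval_pol h ch) !mulf_eq0 !negb_or !expf_neq0.
Qed.

Lemma lin_ratE l (P : pt) j : hcoord P j != 0 ->
  ratfun (fun _ : unit => @hcoord k E) P (fun Q => lin l Q / hcoord Q j).
Proof.
move=> h0; have hc i : ratfun (fun _ : unit => @hcoord k E) P (fun Q => hcoord Q i / hcoord Q j).
  exact: (@rat_coord _ _ _ (fun _ : unit => @hcoord k E) P tt i j).
rewrite (_ : (fun Q : pt => _) = (fun Q : pt => l i0 * (hcoord Q i0 / hcoord Q j)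
    + l i1 * (hcoord Q i1 / hcoord Q j) + l i2 * (hcoord Q i2 / hcoord Q j))).
  by repeat first [exact: hc|apply: rat_cst|apply: ratD|apply: ratM].
apply/funext => y; rewrite /lin !big_ord_recl big_ord0 addr0.
rewrite (_ : lift _ _ = i1); last exact: val_inj.
rewrite (_ : lift _ _ = i2); last exact: val_inj.
rewrite (_ : ord0 = i0); last exact: val_inj.
ring.
Qed.

Lemma cofin_lin l (P : pt) : lin l P != 0 -> cofin (fun Q : pt => lin l Q != 0).
Proof.
have [j h0] := hcoord_neq0 P => lP.
have := cofin_rat (lin_ratE l h0); rewrite mulf_neq0 ?invr_eq0 // => /(_ isT).
by apply: cofinS => Q; rewrite mulf_eq0 negb_or => /andP[].
Qed.

Lemma RV_lin_coord l i (P : pt) : lin l P != 0 ->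
  RVE P (fun Q => hcoord Q i / lin l Q) (hcoord P i / lin l P).
Proof.
have [j h0] := hcoord_neq0 P => lP.
have n0 : lin l P / hcoord P j != 0 by rewrite mulf_neq0 ?invr_eq0.
have e Q : hcoord Q j != 0 -> hcoord Q i / hcoord Q j * (lin l Q / hcoord Q j)^-1 =
    hcoord Q i / lin l Q.
  by move=> y0; rewrite invfM invrK mulrA mulrAC divfK // mulrAC.
exists (fun Q => hcoord Q i / hcoord Q j * (lin l Q / hcoord Q j)^-1); split.
- apply: ratM; last exact: (ratV (lin_ratE l h0) n0).
  exact: (@rat_coord _ _ _ (fun _ : unit => @hcoord k E) P tt i j).
- exact: e.
- by apply: cofinS (cofin_hcoord E j) => Q /e.
Qed.

Lemma var_ind (i : 'I_(3 + 3)) : exists s j, i = var s j.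
Proof.
by rewrite -(splitK i); case: (split i) => j; [exists false, j|exists true, j].
Qed.

Lemma RV_affc L x i : chart L x -> RV x (affc L i) (affc L i x).
Proof.
move=> ch; have [s [j ->]] := var_ind i.
rewrite affc_var (_ : affc L _ = fun y => hcoord (proj s y) j / lin (L s) (proj s y)).
  have := RV_lin_coord j (ch s); case: (s) => h; [exact: RV_snd h|exact: RV_fst h].
by apply/funext => y; rewrite affc_var.
Qed.

Lemma RV_mpoly x p (f : 'I_(3 + 3) -> X -> k) v : (forall i, RV x (f i) (v i)) ->
  RV x (fun y => p.@[fun i => f i y]) p.@[v].
Proof.
move=> h; elim/mpolyind: p => [|c m p _ _ IH].
  by apply: (RV_eq (RV_cst (S := surf E) x 0)) => [y|]; rewrite meval0.
suff hm : RV x (fun y => \prod_i f i y ^+ m i) (\prod_i v i ^+ m i).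
  apply: (RV_eq (RVD (RVM (RV_cst (S := surf E) x c) hm) IH)) => [y|];
  by rewrite mevalD mevalZ mevalX.
elim: (index_enum _) => [|i r hr].
  by apply: (RV_eq (RV_cst (S := surf E) x 1)) => [y|]; rewrite big_nil.
by apply: (RV_eq (RVM (RVX (m i) (h i)) hr)) => [y|]; rewrite big_cons.
Qed.

Lemma RV_pol L p x : chart L x -> RV x (pol L p) (pol L p x).
Proof. by move=> ch; apply: RV_mpoly => i; apply: RV_affc. Qed.

Lemma gen_chart L x : chart L x -> gen2 (fun y : X => chart L y).
Proof.
move=> ch; apply: cofinS (cofin_lin (ch false)) => a ha.
by apply: cofinS (cofin_lin (ch true)) => b hb; case.
Qed.

Lemma ratX_pol L x (f : X -> k) : ratX x f -> chart L x -> exists a b, pol L b x != 0 /\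
  forall y, chart L y -> pol L b y != 0 -> f y = pol L a y / pol L b y.
Proof.
move=> hf ch; elim: hf => {f} [s i j hj|c|f g _ [a [b [b0 h]]] _ [a' [b' [b0' h']]]
  |f g _ [a [b [b0 h]]] _ [a' [b' [b0' h']]]|f _ [a [b [b0 h]]] f0].
- exists 'X_(var s i), 'X_(var s j); split.
    by rewrite pol_var mulf_neq0 ?invr_eq0 //; apply: ch.
  move=> y chy; rewrite !pol_var mulf_eq0 negb_or => /andP[h0 _].
  by have := chy s; case: (s) h0 => /= h0 n; rewrite /hcoord2; field; rewrite n h0.
- by exists c%:MP, 1%:MP; split=> [|y _ _]; rewrite !polC ?oner_neq0 ?divr1.
- exists (a * b' + b * a'), (b * b'); split; first by rewrite polM mulf_neq0.
  move=> y chy; rewrite polM mulf_eq0 negb_or => /andP[n n'].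
  by rewrite h // h' // polD !polM; field; rewrite n n'.
- exists (a * a'), (b * b'); split; first by rewrite polM mulf_neq0.
  move=> y chy; rewrite polM mulf_eq0 negb_or => /andP[n n'].
  by rewrite h // h' // !polM; field; rewrite n n'.
- exists (b * b), (a * b).
  have a0 : pol L a x != 0 by move: f0; rewrite h // mulf_eq0 negb_or => /andP[].
  split; first by rewrite polM mulf_neq0.
  move=> y chy; rewrite polM mulf_eq0 negb_or => /andP[n n'].
  by rewrite h // !polM; field; rewrite n n'.
Qed.

Lemma Rg_pol_frac L x F : Rg x F -> chart L x ->
  exists a b, pol L b x != 0 /\ req F (fun y => pol L a y / pol L b y).
Proof.
move=> [v [f [hf _ e]]] ch; have [a [b [b0 h]]] := ratX_pol hf ch.
exists a, b; split=> //.
have gb := RV_gen_neq0 (RV_pol b ch) b0.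
apply: (genS (r := surf E) _ (genI3 e gb (gen_chart ch))) => y [-> ? ?].
exact: h.
Qed.

Lemma homogeneous_point (v : 'I_3 -> k) l :
  v i1 ^+ 2 * v i2 + ec1 E * v i0 * v i1 * v i2 + ec3 E * v i1 * v i2 ^+ 2 =
  v i0 ^+ 3 + ec2 E * v i0 ^+ 2 * v i2 + ec4 E * v i0 * v i2 ^+ 2 + ec6 E * v i2 ^+ 3 ->
  \sum_i l i * v i = 1 ->
  exists P : pt, lin l P != 0 /\ forall i, v i = hcoord P i / lin l P.
Proof.
move=> W n1.
suff [P [s hs]] : exists (P : pt) s, forall i, v i = s * hcoord P i.
  have e : s * lin l P = 1.
    by rewrite /lin big_distrr -[RHS]n1; apply: eq_bigr => i _ /=; rewrite hs; ring.
  have l0 : lin l P != 0 by apply: contra_eq_neq e => ->; rewrite mulr0 eq_sym oner_neq0.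
  by exists P; split=> // i; rewrite hs -[s](mulfK l0) e; ring.
have [v0|v0] := eqVneq (v i2) 0.
  have : v i0 ^+ 3 = 0 by move: W; rewrite v0 => W; apply: (eq_of_relation (c := -1) W); ring.
  move/eqP; rewrite expf_eq0 /= => /eqP vi0.
  exists (origin E), (v i1) => i.
  by case: (ord3P i) => ->; rewrite ?v0 ?vi0 ?mulr0 ?mulr1.
have [P [P0 eX eY]] : exists P : pt, [/\ P != origin E, hX P = v i0 / v i2 & hY P = v i1 / v i2].
  apply: on_curve_point; rewrite /weierstrass.
  apply/eqP; rewrite subr_eq0; apply/eqP.
  apply: (mulfI (expf_neq0 3 v0)); rewrite -[RHS]/(_ * _).
  transitivity (v i1 ^+ 2 * v i2 + ec1 E * v i0 * v i1 * v i2 + ec3 E * v i1 * v i2 ^+ 2).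
    by field.
  by rewrite W; field.
exists P, (v i2) => i; have eZ := P0; rewrite -hZ_neq0 in eZ; move/hZ_affine: eZ => eZ.
case: (ord3P i) => ->; rewrite -/(hX P) -/(hY P) -/(hZ P) ?eX ?eY ?eZ ?mulr1 //.
  by rewrite mulrC divfK.
by rewrite mulrC divfK.
Qed.

(** In affine 6-space a chart is cut out by the two cubics and by the equations that set the two
    linear forms to 1. All of these belong to I, so the zeros of I are points of the chart. *)
Lemma nullstellensatz_chart L (I : set {mpoly k[3 + 3]}) f : is_ideal I ->
  (forall p, (forall y : X, chart L y -> pol L p y = 0) -> I p) ->
  (forall y : X, chart L y -> (forall p, I p -> pol L p y = 0) -> pol L f y = 0) ->
  exists n, I (f ^+ n).
Proof.
move=> hI hv hf; apply: nullstellensatz_mpoly => // v kv.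
pose W s : {mpoly k[3 + 3]} := let x i := 'X_(var s i) in
  x i1 ^+ 2 * x i2 + (ec1 E)%:MP * x i0 * x i1 * x i2 + (ec3 E)%:MP * x i1 * x i2 ^+ 2 -
  (x i0 ^+ 3 + (ec2 E)%:MP * x i0 ^+ 2 * x i2 + (ec4 E)%:MP * x i0 * x i2 ^+ 2 +
   (ec6 E)%:MP * x i2 ^+ 3).
have Wv (u : 'I_(3 + 3) -> k) s : (W s).@[u] = let x i := u (var s i) in
  x i1 ^+ 2 * x i2 + ec1 E * x i0 * x i1 * x i2 + ec3 E * x i1 * x i2 ^+ 2 -
  (x i0 ^+ 3 + ec2 E * x i0 ^+ 2 * x i2 + ec4 E * x i0 * x i2 ^+ 2 + ec6 E * x i2 ^+ 3).
  by rewrite /W /= !(mevalB, mevalD, mevalM, mevalC, rmorphXn, mevalXU) /=.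
have lv s : \sum_i L s i * v (var s i) = 1.
  have : (lform s (L s) - 1).@[v] = 0.
    apply: kv; apply: hv => y ch; rewrite /pol mevalB meval1 /lform rmorph_sum.
    apply/eqP; rewrite subr_eq0; apply/eqP.
    transitivity (lin (L s) (proj s y) / lin (L s) (proj s y)); last by rewrite divff //; apply: ch.
    rewrite {1}/lin mulr_suml; apply: eq_bigr => i _ /=.
    by rewrite mevalZ mevalXU affc_var mulrA.
  rewrite mevalB meval1 /lform rmorph_sum => /eqP; rewrite subr_eq0 => /eqP <-.
  by apply: eq_bigr => i _ /=; rewrite mevalZ mevalXU.
have wv s : (W s).@[v] = 0.
  apply: kv; apply: hv => y ch; rewrite /pol Wv /= !affc_var.
  have l0 := ch s; have := weierstrass_hom (proj s y); rewrite /hX /hY /hZ.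
  move: (lin _ _) l0 => t t0 e.
  by apply: (eq_of_relation (c := (t ^+ 3)^-1) e); field.
have pv s : exists P : pt, lin (L s) P != 0 /\ forall i, v (var s i) = hcoord P i / lin (L s) P.
  apply: homogeneous_point => //; apply/eqP; rewrite -subr_eq0; apply/eqP.
  by have := wv s; rewrite Wv.
have [P1 [n1 e1]] := pv false; have [P2 [n2 e2]] := pv true.
have ch : chart L (P1, P2) by case.
have ev : v =1 (fun i => affc L i (P1, P2)).
  by move=> i; have [[] [j ->]] := var_ind i; rewrite affc_var ?e1 ?e2.
rewrite (meval_eq _ ev); apply: hf => // p Ip.
by rewrite /pol -(meval_eq _ ev); apply: kv.
Qed.

(** The denominators of F form an ideal whose zeros in the chart lie on g = 0, so it contains a
    power of g. *)
Lemma pol_of_Rg L g F : (exists x, chart L x /\ pol L g x != 0) ->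
  (forall x, chart L x -> pol L g x != 0 -> Rg x F) ->
  exists n a, req (fun y => pol L g y ^+ n * F y) (pol L a).
Proof.
move=> [x0 [ch0 g0]] h.
pose I := [set q | exists a, req (fun y => pol L q y * F y) (pol L a)].
have [||x ch kx|n [a ha]] := @nullstellensatz_chart L I g.
- split.
  + by exists 0; apply: gen_true => y; rewrite pol0 mul0r.
  + move=> q q' [a ha] [a' ha']; exists (a + a').
    by apply: (gen_and2 _ ha ha') => y ea ea'; rewrite !polD mulrDl ea ea'.
  + move=> q q' [a ha]; exists (q * a).
    by apply: (genS (r := surf E) _ ha) => y ea; rewrite !polM -ea mulrA.
- move=> p hp; exists 0; apply: (genS (r := surf E) _ (gen_chart ch0)) => y /hp ->.
  by rewrite mul0r pol0.
- apply/eqP/negPn/negP => gx; have [a [b [b0 e]]] := Rg_pol_frac (h x ch gx) ch.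
  apply: (negP b0); apply/eqP; apply: kx; exists a.
  have gb := RV_gen_neq0 (RV_pol b ch) b0.
  by apply: (gen_and2 _ e gb) => y -> n; rewrite mulrC divfK.
- by exists n, a; apply: (genS (r := surf E) _ ha) => y; rewrite polX.
Qed.

End Charts.
(** * Functions with one simple pole on the curve *)

Lemma subr_neq0 (V : zmodType) (x y : V) : x != y -> x - y != 0.
Proof. by rewrite subr_eq0. Qed.

Section Tau.
Context (k : closedFieldType) (E : elliptic_curve k).
Local Notation pt := (Defs.point E).
Local Notation C := (curve E).
Local Notation RV := (@RV k (curve E)).
Local Notation Rg := (@Rg k (curve E)).
Implicit Types (P Q p b : pt) (f g : pt -> k).
Local Notation a1 := (ec1 E).
Local Notation a2 := (ec2 E).
Local Notation a3 := (ec3 E).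
Local Notation a4 := (ec4 E).
Local Notation a6 := (ec6 E).
Local Notation o := (origin E).

Lemma req_affine (A : pt -> Prop) (lx ly : seq k) :
  (forall P, P != o -> hX P \notin lx -> hY P \notin ly -> A P) -> cofin A.
Proof.
move=> h; apply: cofinS (cofinI (cofin_neq o) (cofinI (cofin_hX E lx) (cofin_hY E ly))).
by move=> P [? []]; apply: h.
Qed.

Lemma hZ1 P : P != o -> hZ P = 1.
Proof. by rewrite -hZ_neq0; apply: hZ_affine. Qed.

Lemma hY_o_neq0 : hY o != 0. Proof. by rewrite hY_origin oner_neq0. Qed.

Lemma RV_coord P i j : hcoord P j != 0 ->
  RV P (fun Q => hcoord Q i / hcoord Q j) (hcoord P i / hcoord P j).
Proof.
move=> h; apply: (rat_RV (S := C)).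
exact: (@rat_coord _ _ _ (fun _ : unit => @hcoord k E) P tt i j).
Qed.

Lemma RV_hX P : P != o -> RV P (@hX k E) (hX P).
Proof.
rewrite -hZ_neq0 => h; have := RV_coord i0 h; rewrite -/(hZ P) hZ_affine // divr1 => h'.
apply: (RV_req h'); apply: (req_affine (lx := [::]) (ly := [::])) => Q Q0 _ _.
by rewrite -/(hZ Q) hZ_affine ?hZ_neq0 // divr1.
Qed.

Lemma RV_hY P : P != o -> RV P (@hY k E) (hY P).
Proof.
rewrite -hZ_neq0 => h; have := RV_coord i1 h; rewrite -/(hZ P) hZ_affine // divr1 => h'.
apply: (RV_req h'); apply: (req_affine (lx := [::]) (ly := [::])) => Q Q0 _ _.
by rewrite -/(hZ Q) hZ_affine ?hZ_neq0 // divr1.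
Qed.

Lemma RV_z P : hY P != 0 -> RV P (@zc k E) (zc P).
Proof. exact: RV_coord. Qed.

Lemma RV_w P : hY P != 0 -> RV P (@wc k E) (wc P).
Proof. exact: RV_coord. Qed.

Lemma zc_o : zc o = 0. Proof. by rewrite /zc hX_origin mul0r. Qed.
Lemma wc_o : wc o = 0. Proof. by rewrite /wc hZ_origin mul0r. Qed.

Lemma RV_z_o : RV o (@zc k E) 0.
Proof. by rewrite -zc_o; apply: RV_z; apply: hY_o_neq0. Qed.
Lemma RV_w_o : RV o (@wc k E) 0.
Proof. by rewrite -wc_o; apply: RV_w; apply: hY_o_neq0. Qed.

(** The equation of E in z = x / y and w = 1 / y reads z^3 = w u, where u is this unit at the
    origin. *)
Definition uc P := 1 + a1 * zc P + a3 * wc P - a2 * zc P ^+ 2 - a4 * zc P * wc P - a6 * wc P ^+ 2.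

Lemma RV_u_o : RV o uc 1.
Proof.
have hz := RV_z_o; have hw := RV_w_o.
have h := RVB (RVB (RVB (RVD (RVD (RV_cst (S := C) o 1) (RVM (RV_cst (S := C) o a1) hz))
  (RVM (RV_cst (S := C) o a3) hw)) (RVM (RV_cst (S := C) o a2) (RVX 2 hz)))
  (RVM (RVM (RV_cst (S := C) o a4) hz) hw)) (RVM (RV_cst (S := C) o a6) (RVX 2 hw)).
by apply: (RV_eq h) => //; rewrite !expr0n /= !mulr0 !addr0 !subr0.
Qed.

Lemma uE P : P != o -> hY P != 0 -> uc P = hX P ^+ 3 / hY P ^+ 2.
Proof.
move=> P0 y0; have w0 : wc P = (hY P)^-1 by rewrite /wc hZ_affine ?hZ_neq0 // div1r.
have := weierstrass_zw y0; rewrite /uc w0 /zc => e.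
apply: (mulfI (invr_neq0 y0)).
transitivity ((hX P / hY P) ^+ 3); last by field.
by rewrite e; ring.
Qed.

Lemma zE P : zc P = hX P / hY P. Proof. by []. Qed.
Lemma wE P : P != o -> wc P = (hY P)^-1.
Proof. by move=> P0; rewrite /wc hZ_affine ?hZ_neq0 // div1r. Qed.

(** The pole order at the origin is 4 - 3 = 1; any other pole lies on the line y = c. *)
Definition phi_ (c : k) P := hX P ^+ 2 / (hY P - c).
Definition phi := phi_ 0.

Lemma phiE P : phi P = hX P ^+ 2 / hY P. Proof. by rewrite /phi /phi_ subr0. Qed.

Lemma RV_phiV_o : RV o (fun P => (phi P)^-1) 0.
Proof.
have h := RVf RV_z_o RV_u_o (oner_neq0 k); rewrite divr1 in h.
apply: (RV_req h); apply: (req_affine (lx := [:: 0]) (ly := [:: 0])) => P P0.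
rewrite !inE => x0 y0; rewrite phiE uE // zE; field.
by rewrite x0 y0.
Qed.

Lemma RV_xV_o : RV o (fun P => (hX P)^-1) 0.
Proof.
have h := RVf (RVX 2 RV_z_o) RV_u_o (oner_neq0 k); rewrite divr1 expr0n in h.
apply: (RV_req h); apply: (req_affine (lx := [:: 0]) (ly := [:: 0])) => P P0.
by rewrite !inE => x0 y0; rewrite uE // zE; field; rewrite x0 y0.
Qed.

Lemma RV_yV_o : RV o (fun P => (hY P)^-1) 0.
Proof.
apply: (RV_req RV_w_o); apply: (req_affine (lx := [::]) (ly := [:: 0])) => P P0.
by rewrite !inE => _ y0; rewrite wE.
Qed.

Lemma RV_phi_ratio c : RV o (fun P => phi_ c P / phi P) 1.
Proof.
have h := RVV (RVB (RV_cst (S := C) o 1) (RVM (RV_cst (S := C) o c) RV_yV_o)).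
rewrite mulr0 subr0 invr1 in h; move: (h (oner_neq0 k)) => {}h.
apply: (RV_req h); apply: (req_affine (lx := [:: 0]) (ly := [:: 0; c])) => P P0.
rewrite !inE negb_or => x0 /andP[y0 yc].
have n1 : hY P - c != 0 by rewrite subr_eq0.
by rewrite phiE /phi_; field; rewrite x0 y0 n1.
Qed.

Lemma RV_x_phi : RV o (fun P => hX P / phi P ^+ 2) 1.
Proof.
have h := RVV RV_u_o (oner_neq0 k); rewrite invr1 in h.
apply: (RV_req h); apply: (req_affine (lx := [:: 0]) (ly := [:: 0])) => P P0.
by rewrite !inE => x0 y0; rewrite uE // phiE; field; rewrite x0 y0.
Qed.

Lemma RV_y_phi : RV o (fun P => hY P / phi P ^+ 3) 1.
Proof.
have h := RVV (RVX 2 RV_u_o); rewrite expr1n invr1 in h; move: (h (oner_neq0 k)) => {}h.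
apply: (RV_req h); apply: (req_affine (lx := [:: 0]) (ly := [:: 0])) => P P0.
by rewrite !inE => x0 y0; rewrite uE // phiE; field; rewrite x0 y0.
Qed.

Lemma Rg_phi_ c b : b != o -> hY b != c -> Rg b (phi_ c).
Proof.
move=> b0 yc; exists (hX b ^+ 2 / (hY b - c)); apply: (RVf (RVX 2 (RV_hX b0))).
  by apply: (RVB (RV_hY b0)); apply: RV_cst.
by rewrite subr_eq0.
Qed.

(* Minus the ordinate of -p. *)
Definition nY p := hY p + a1 * hX p + a3.
(** The slope of the line through Q and -p. Numerator and denominator both vanish at -p, which
    leaves simple poles at p and at the origin. *)
Definition sg p Q := (hY Q + nY p) / (hX Q - hX p).
Definition GG p Q := hX Q ^+ 2 + hX Q * hX p + hX p ^+ 2 + a2 * (hX Q + hX p) + a4 - a1 * hY Q.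

Lemma chord p Q : p != o -> Q != o ->
  (hY Q - hY p) * (hY Q + nY p) = (hX Q - hX p) * GG p Q.
Proof.
move=> /weierstrass_affine ep /weierstrass_affine eQ; rewrite /nY /GG.
have e : hY Q ^+ 2 + a1 * hX Q * hY Q + a3 * hY Q - (hY p ^+ 2 + a1 * hX p * hY p + a3 * hY p) =
  (hX Q ^+ 3 + a2 * hX Q ^+ 2 + a4 * hX Q + a6) - (hX p ^+ 3 + a2 * hX p ^+ 2 + a4 * hX p + a6).
  by rewrite ep eQ.
apply: (eq_of_relation (c := 1) e); ring.
Qed.

Lemma RV_GG p b : b != o -> RV b (GG p) (GG p b).
Proof.
move=> b0; have hx := RV_hX b0; have hy := RV_hY b0; have hc := RV_cst (S := C) b.
exact: (RVB (RVD (RVD (RVD (RVD (RVX 2 hx) (RVM hx (hc (hX p)))) (hc (hX p ^+ 2)))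
  (RVM (hc a2) (RVD hx (hc (hX p))))) (hc a4)) (RVM (hc a1) hy)).
Qed.

Lemma RV_nY p b : b != o -> RV b (fun Q => hY Q + nY p) (hY b + nY p).
Proof. by move=> b0; apply: (RVD (RV_hY b0)); apply: RV_cst. Qed.

Lemma same_x p b : p != o -> b != o -> hX b = hX p -> b = p \/ hY b + nY p = 0.
Proof.
move=> p0 b0 e; have := chord p0 b0; rewrite e subrr mul0r => /eqP.
by rewrite mulf_eq0 subr_eq0 => /orP[/eqP ey|/eqP]; [left; apply: affine_eq|right].
Qed.

(** Up to sign, the two quantities are the partial derivatives of the equation at p. *)
Lemma GG_nonsingular p : p != o -> hY p + nY p = 0 -> GG p p != 0.
Proof.
move=> p0 e; apply/eqP => G0; apply: (ec_nonsingular (e := E) (x := hX p) (y := hY p)).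
  by rewrite /weierstrass weierstrass_affine // subrr.
split; last by rewrite -e /nY; ring.
by apply/eqP; rewrite -oppr_eq0; apply/eqP; rewrite -G0 /GG; ring.
Qed.

(** If p has order 2, then x - x(p) vanishes doubly at p. In that case [chord] rewrites the inverse
    as (y - y(p)) / GG, and GG is nonzero at p by nonsingularity. *)
Lemma RV_sgV p : p != o -> RV p (fun Q => (sg p Q)^-1) 0.
Proof.
move=> p0; have [e|n] := eqVneq (hY p + nY p) 0.
  have G0 := GG_nonsingular p0 e.
  have h := RVf (RVB (RV_hY p0) (RV_cst (S := C) p (hY p))) (RV_GG p p0) G0.
  rewrite subrr mul0r in h; apply: (RV_req h).
  have gG := RV_gen_neq0 (RV_GG p p0) G0.
  have gx := cofin_hX E [:: hX p]; have gy := cofin_hY E [:: - nY p].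
  apply: cofinS (cofinI (cofin_neq o) (cofinI gG (cofinI gx gy))) => Q [Q0 [G1]].
  rewrite !inE -addr_eq0 => -[/subr_neq0 x1 y1].
  have := chord p0 Q0; rewrite /sg => eq.
  rewrite invf_div; apply: (mulIf G1); rewrite divfK //; apply: (mulfI y1).
  rewrite mulrC eq; field; exact: y1.
have h := RVf (RVB (RV_hX p0) (RV_cst (S := C) p (hX p))) (RV_nY p p0) n.
rewrite subrr mul0r in h; apply: (RV_eq h) => // Q.
by rewrite /sg invf_div.
Qed.

Lemma Rg_sg p b : p != o -> b != o -> b != p -> Rg b (sg p).
Proof.
move=> p0 b0 bp; have [e|n] := eqVneq (hX b) (hX p); last first.
  exists (sg p b); apply: (RVf (RV_nY p b0)); last by rewrite subr_eq0.
  by apply: (RVB (RV_hX b0)); apply: RV_cst.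
have y0 : hY b - hY p != 0.
  by rewrite subr_eq0; apply: contra_neq bp => ey; apply: affine_eq.
have h := RVf (RV_GG p b0) (RVB (RV_hY b0) (RV_cst (S := C) b (hY p))) y0.
exists (GG p b / (hY b - hY p)); apply: (RV_req h).
apply: (req_affine (lx := [:: hX p]) (ly := [:: hY p])) => Q Q0; rewrite !inE => /subr_neq0 x1 /subr_neq0 y1.
apply: (mulIf y1); rewrite divfK // /sg; apply: (mulIf x1).
by rewrite mulrAC divfK // mulrC -chord // mulrC.
Qed.

Lemma RV_sg_phi p : p != o -> RV o (fun Q => sg p Q / phi Q) 1.
Proof.
move=> p0; have hc := RV_cst (S := C) o.
have h1 := RVD (hc 1) (RVM (hc (nY p)) RV_yV_o).
have h2 := RVM (RVB (hc 1) (RVM (hc (hX p)) RV_xV_o)) RV_u_o.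
rewrite mulr0 addr0 in h1; rewrite mulr0 subr0 mulr1 in h2.
have := RVf h1 h2 (oner_neq0 k); rewrite divr1 => h; apply: (RV_req h).
apply: (req_affine (lx := [:: 0; hX p]) (ly := [:: 0])) => Q Q0.
rewrite !inE negb_or => /andP[x0 /subr_neq0 xp] y0.
by rewrite uE // phiE /sg; field; rewrite x0 y0 xp.
Qed.

(** The two functions have the same leading term at the origin, so the poles cancel. This lets
    [tau p] stand in for [phi] near the origin. *)
Lemma Rg_sg_phi_ p c : p != o -> Rg o (fun Q => sg p Q - phi_ c Q).
Proof.
move=> p0; have hc := RV_cst (S := C) o; have ix := RV_xV_o; have iy := RV_yV_o.
(* The numerator of the difference over the common denominator, reduced by the equation of E and
   divided by x y; [hd] is that denominator divided by x y. *)
have hn := RVD (RVD (RVD (RVB (RVM (hc (nY p - c - a3)) ix) (hc a1))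
  (RVM (hc (a2 + hX p)) RV_z_o)) (RVM (hc a4) iy)) (RVM (hc (a6 - nY p * c)) (RVM ix iy)).
have hd := RVM (RVB (hc 1) (RVM (hc (hX p)) ix)) (RVB (hc 1) (RVM (hc c) iy)).
rewrite !mulr0 subr0 mulr1 in hd; have h := RVf hn hd (oner_neq0 k).
eexists; apply: (RV_req h).
apply: (req_affine (lx := [:: 0; hX p]) (ly := [:: 0; c])) => Q Q0.
rewrite !inE !negb_or => /andP[x0 /subr_neq0 xp] /andP[y0 /subr_neq0 yc].
rewrite zE /sg /phi_; have eQ := weierstrass_affine Q0.
apply: (eq_of_relation (c := ((hX Q - hX p) * (hY Q - c))^-1) (esym eQ)).
by field; rewrite x0 xp y0 yc.
Qed.

(* A simple pole at p and, for p != o, another one at o. *)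
Definition tau p := if p == o then phi else sg p.

Lemma tau_o : tau o = phi. Proof. by rewrite /tau eqxx. Qed.
Lemma tau_sg p : p != o -> tau p = sg p. Proof. by rewrite /tau => /negbTE ->. Qed.

Lemma RV_tauV p : RV p (fun Q => (tau p Q)^-1) 0.
Proof.
have [->|p0] := eqVneq p o; first by rewrite tau_o; apply: RV_phiV_o.
by rewrite tau_sg //; apply: RV_sgV.
Qed.

Lemma RV_tau_phi p : RV o (fun Q => tau p Q / phi Q) 1.
Proof.
have [->|p0] := eqVneq p o; first by rewrite tau_o; apply: RV_phi_ratio.
by rewrite tau_sg //; apply: RV_sg_phi.
Qed.

Lemma gen_phi : cofin (fun P => phi P != 0).
Proof.
apply: (req_affine (lx := [:: 0]) (ly := [:: 0])) => P P0; rewrite !inE phiE => x0 y0.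
by rewrite mulf_neq0 ?expf_neq0 ?invr_eq0.
Qed.

Lemma gen_tau p : cofin (fun P => tau p P != 0).
Proof.
have := RV_gen_neq0 (RV_tau_phi p) (oner_neq0 k).
by apply: cofinS => P; rewrite mulf_eq0 negb_or => /andP[].
Qed.

(* A linear form that kills the other poles of tau p. *)
Definition kill p : 'I_3 -> k := fun i => if p == o then (i == i1)%:R else (i == i2)%:R.

Lemma lin_coord j P : lin (fun i => (i == j)%:R) P = hcoord P j.
Proof.
rewrite /lin (bigD1 j) //= eqxx mul1r big1 ?addr0 // => i /negbTE ->.
by rewrite mul0r.
Qed.

Lemma lin_kill_neq0 p : lin (kill p) p != 0.
Proof.
rewrite /kill; have [->|p0] := eqVneq p o; rewrite lin_coord ?oner_neq0 //.
by rewrite -/(hZ p) hZ_neq0.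
Qed.

Lemma Rg_kill p l b : lin l b != 0 -> b != p ->
  Rg b (fun Q => lin (kill p) Q / lin l Q * tau p Q).
Proof.
move=> lb bp; have [eo|p0] := eqVneq p o.
  have b0 : b != o by rewrite -eo.
  exists (hX b * (hX b / lin l b)).
  apply: (RV_req (RVM (RV_hX b0) (RV_lin_coord i0 lb))).
  apply: cofinS (cofinI (cofin_neq o) (cofinI (cofin_lin lb) (cofin_hY E [:: 0]))).
  move=> Q [Q0 [l0]]; rewrite inE => y0.
  rewrite /kill eo eqxx lin_coord tau_o phiE -/(hX Q) -/(hY Q); field.
  by rewrite l0 y0.
rewrite tau_sg //; have [bo|b0] := eqVneq b o; last first.
  apply: RgM; last exact: Rg_sg.
  rewrite /kill (negbTE p0); eexists.
  by apply: (RV_eq (RV_lin_coord i2 lb)) => // Q; rewrite lin_coord.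
have lo : lin l o != 0 by rewrite -bo.
rewrite bo; have h := RVM (RVM (RV_lin_coord i1 lo) (RVX 2 RV_z_o)) (RV_sg_phi p0).
eexists; apply: (RV_req h).
apply: cofinS (cofinI (cofin_neq o) (cofinI (cofin_lin lb) (cofinI (cofin_hY E [:: 0]) (cofin_hX E [:: 0])))).
move=> Q [Q0 [l0]]; rewrite !inE => -[y0 x0].
rewrite /kill (negbTE p0) lin_coord -/(hY Q) -/(hZ Q) hZ_affine ?hZ_neq0 // zE phiE.
by field; rewrite l0 y0 x0.
Qed.

(* The maximal ideal of the local ring at p is generated by 1 / tau p. *)
Lemma ratE_uniformizer p f : ratfun (fun _ : unit => @hcoord k E) p f ->
  Rg p (fun Q => (f Q - f p) * tau p Q).
Proof.
move=> h; elim: h => {f} [[] i j hj|c|f g hf IHf hg IHg|f g hf IHf hg IHg|f hf IHf f0].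
- have [eo|p0] := eqVneq p o.
    move: hj; rewrite eo tau_o => hj.
    have ej : j = i1 by case: (ord3P j) hj => -> //; rewrite eqxx.
    rewrite ej; case: (ord3P i) => ->.
    + exists 1; apply: (RV_req RV_u_o).
      apply: (req_affine (lx := [::]) (ly := [:: 0])) => Q Q0 _; rewrite inE => y0.
      rewrite -/(hX Q) -/(hX o) -/(hY Q) hX_origin mul0r subr0 uE // phiE.
      by field.
    + exists 0; apply: (RV_req (RV_cst (S := C) o 0)).
      apply: (req_affine (lx := [::]) (ly := [:: 0])) => Q Q0 _; rewrite inE => y0.
      by rewrite -/(hY Q) -/(hY o) divff // divff ?hY_o_neq0 // subrr mul0r.
    + exists (0 ^+ 2); apply: (RV_req (RVX 2 RV_z_o)).
      apply: (req_affine (lx := [::]) (ly := [:: 0])) => Q Q0 _; rewrite inE => y0.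
      rewrite -/(hZ Q) -/(hZ o) -/(hY Q) hZ_origin mul0r subr0 hZ_affine ?hZ_neq0 // zE phiE.
      by field.
  rewrite tau_sg //.
  have hi i' : Rg p (fun Q => (hcoord Q i' - hcoord p i') * sg p Q).
    case: (ord3P i') => ->.
    + exists (hY p + nY p); apply: (RV_req (RV_nY p p0)).
      apply: (req_affine (lx := [:: hX p]) (ly := [::])) => Q Q0; rewrite inE -subr_eq0 => x1 _.
      by rewrite /sg -/(hX Q) -/(hX p) mulrC divfK.
    + exists (GG p p); apply: (RV_req (RV_GG p p0)).
      apply: (req_affine (lx := [:: hX p]) (ly := [::])) => Q Q0; rewrite inE -subr_eq0 => x1 _.
      rewrite /sg -/(hY Q) -/(hY p) mulrA chord // mulrAC.
      by rewrite divff // mul1r.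
    + exists 0; apply: (RV_req (RV_cst (S := C) p 0)).
      apply: (req_affine (lx := [::]) (ly := [::])) => Q Q0 _ _.
      by rewrite -/(hZ Q) -/(hZ p) (hZ1 Q0) (hZ1 p0) subrr mul0r.
  have hcj i' : RV p (fun Q => hcoord Q i') (hcoord p i').
    case: (ord3P i') => ->; [exact: RV_hX|exact: RV_hY|].
    apply: (RV_req (RV_cst (S := C) p (hcoord p i2))).
    apply: (req_affine (lx := [::]) (ly := [::])) => Q Q0 _ _.
    by rewrite -/(hZ Q) -/(hZ p) (hZ1 Q0) (hZ1 p0).
  have hV : Rg p (fun Q => (hcoord Q j)^-1 * (hcoord p j)^-1).
    by eexists; apply: RVM (RVV (hcj j) hj) (RV_cst _ _).
  have := RgM hV (RgB (RgM (hi i) (Rg_cst (S := C) p (hcoord p j)))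
    (RgM (hi j) (Rg_cst (S := C) p (hcoord p i)))).
  move=> h; apply: (Rg_req h).
  apply: cofinS (cofin_hcoord E j) => Q j0.
  have hj' : hcoord p j != 0 := hj.
  by field; rewrite j0 hj'.
- by exists 0; apply: (RV_eq (RV_cst (S := C) p 0)) => // Q; rewrite subrr mul0r.
- by apply: (Rg_eq (RgD IHf IHg)) => Q; ring.
- have rf : Rg p f by exists (f p); apply: (rat_RV (S := C)).
  have := RgD (RgM rf IHg) (RgM (Rg_cst (S := C) p (g p)) IHf) => h.
  by apply: (Rg_eq h) => Q; ring.
- have rf := RVV (rat_RV (S := C) hf) f0.
  have rf' : Rg p (fun Q => (f Q)^-1 * (f p)^-1) by eexists; apply: RVM rf (RV_cst _ _).
  have h := RgM rf' (RgM (Rg_cst (S := C) p (-1)) IHf).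
  apply: (Rg_req h); apply: cofinS (cofin_rat hf f0) => Q fQ.
  by field; rewrite f0 fQ.
Qed.

Lemma Rg_uniformizer p f : RV p f 0 -> Rg p (fun Q => f Q * tau p Q).
Proof.
move=> [g [hg g0 e]]; apply: (Rg_req (ratE_uniformizer hg)).
by apply: cofinS e => Q ->; rewrite g0 subr0.
Qed.

End Tau.

(** * Functions with at most one simple pole, and the first cohomology of E *)

Section LinearSystems.
Context (k : closedFieldType) (E : elliptic_curve k).
Local Notation pt := (Defs.point E).
Local Notation X := (surface E).
Local Notation C := (curve E).
Local Notation RV := (@RV k (curve E)).
Local Notation Rg := (@Rg k (curve E)).
Implicit Types (P Q p b : pt) (f g : pt -> k).
Local Notation o := (origin E).

(* The chart where both points are affine. *)
Definition lz (s : bool) (i : 'I_3) : k := (i == i2)%:R.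

Lemma lin_lz s P : lin (lz s) P = hZ P.
Proof. exact: lin_coord. Qed.

Lemma chart_lz (y : X) : chart lz y <-> y.1 != o /\ y.2 != o.
Proof.
rewrite /chart; split=> [h|[h1 h2] []]; rewrite ?lin_lz ?hZ_neq0 //.
by have := h true; have := h false; rewrite !lin_lz !hZ_neq0.
Qed.

Lemma exists_affine : exists P, P != o.
Proof. exact: cofin_ex (cofin_neq o). Qed.

Lemma apol_mpoly (p : {mpoly k[3 + 3]}) (f : 'I_(3 + 3) -> pt -> k) :
  (forall i, apol (f i)) -> apol (fun Q => p.@[fun i => f i Q]).
Proof.
move=> h; elim/mpolyind: p => [|c m p _ _ IH].
  rewrite (_ : (fun _ => _) = fun=> 0); first exact: apol_cst.
  by apply/funext => Q; rewrite meval0.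
suff hm : apol (fun Q => \prod_i f i Q ^+ m i).
  rewrite (_ : (fun _ => _) = fun Q => c * (\prod_i f i Q ^+ m i) + p.@[fun i => f i Q]).
    by apply: apolD => //; apply: apolM => //; apply: apol_cst.
  by apply/funext => Q; rewrite mevalD mevalZ mevalX.
elim: (index_enum _) => [|i r hr].
  rewrite (_ : (fun _ => _) = fun=> 1); first exact: apol_cst.
  by apply/funext => Q; rewrite big_nil.
suff hi n : apol (fun Q => f i Q ^+ n).
  rewrite (_ : (fun _ => _) = fun Q => f i Q ^+ m i * \prod_(j <- r) f j Q ^+ m j).
    exact: apolM.
  by apply/funext => Q; rewrite big_cons.
elim: n => [|n IHn]; first exact: apol_cst.
rewrite (_ : (fun _ => _) = fun Q => f i Q * f i Q ^+ n); first exact: apolM.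
by apply/funext => Q; rewrite exprS.
Qed.

Lemma apol_ext f g : apol f -> (forall Q, Q != o -> g Q = f Q) -> apol g.
Proof. by move=> [A [B h]] e; exists A, B => Q Q0; rewrite e // h. Qed.

(** f is viewed as a function of the second point of X, where [pol_of_Rg] applies, and the first
    point is then fixed at a general value. *)
Lemma affine_regular f : (forall b, b != o -> Rg b f) ->
  exists A B : {poly k}, cofin (fun Q => f Q = A.[hX Q] + B.[hX Q] * hY Q).
Proof.
move=> hf; have [P0 hP0] := exists_affine.
have [||n [a ha]] := @pol_of_Rg k E lz 1 (fun y => f y.2).
- exists (P0, P0); split; first exact/chart_lz.
  by rewrite pol1 oner_neq0.
- by move=> x /chart_lz[_ /hf] h _; apply: Rg_snd.
have [a0 /= [h0 ha0]] := cofin_ex (cofinI (cofin_neq o) ha).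
have [A [B hAB]] : apol (fun Q => pol lz a (a0, Q)).
  apply: apol_mpoly => i; have [[] [j ->]] := var_ind i; last first.
    apply: (apol_ext (apol_cst E (hcoord a0 j / lin (lz false) a0))) => Q _.
    by rewrite affc_var.
  apply: (apol_ext (apol_coord E j)) => Q Q0.
  by rewrite affc_var lin_lz (hZ1 Q0) divr1.
exists A, B; apply: cofinS (cofinI (cofin_neq o) ha0) => Q [Q0].
by rewrite pol1 expr1n mul1r hAB.
Qed.

Lemma RV_phiV_X n : (0 < n)%N -> RV o (fun P => (phi P)^-1 ^+ n) 0.
Proof. by move=> n0; have := RVX n (RV_phiV_o E); rewrite expr0n; case: n n0. Qed.

(* The pole orders 2 i and 2 i + 3 of x^i and x^i y are distinct and never 1. *)
Lemma no_simple_pole_origin f : (forall b, b != o -> Rg b f) ->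
  Rg o (fun Q => f Q / phi Q) -> exists c, cofin (fun Q => f Q = c).
Proof.
move=> hf [r hr]; have [A [B hAB]] := affine_regular hf.
suff [s1 B0] : (size A <= 1)%N /\ B = 0.
  exists A`_0; apply: cofinS hAB => Q ->.
  by rewrite B0 (size1_polyC s1) horner0 mul0r addr0 hornerC coefC.
(* Divided by phi^n, a term of pole order n tends at the origin to its coefficient and the terms of
   lower order tend to 0. So does f, because n is at least 2. *)
have val n : (2 <= n)%N -> (size A <= n./2.+1)%N -> (B == 0) || (2 * size B + 1 <= n)%N ->
    \sum_(i < size A) (if (n == 2 * i)%N then A`_i else 0) +
    \sum_(i < size B) (if (n == 2 * i + 3)%N then B`_i else 0) = 0.
  move=> n2 sA sB.
  have H1 i : (i < size A -> 2 * i <= n)%N.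
    by move: sA; move: (size A) => s sA lti; have := odd_double_half n; lia.
  have H2 i : (i < size B -> 2 * i + 3 <= n)%N.
    move=> lti; case/orP: sB => [/eqP B0|]; first by move: lti; rewrite B0 size_poly0.
    by move: lti; move: (size B) => s; lia.
  have hx := RV_x_phi E; have hy := RV_y_phi E.
  have term m : RV o (fun Q => (phi Q)^-1 ^+ m) (if m == 0%N then 1 else 0).
    have [->|m0] := eqVneq m 0%N; first exact: (RV_cst (S := C)).
    by apply: RV_phiV_X; rewrite lt0n.
  have hA : RV o (fun Q => \sum_(i < size A) A`_i * (hX Q / phi Q ^+ 2) ^+ i *
      (phi Q)^-1 ^+ (n - 2 * i)) (\sum_(i < size A) (if (n == 2 * i)%N then A`_i else 0)).
    apply: (RV_sum (S := C)) => i.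
    apply: (RV_eq (RVM (RVM (RV_cst (S := C) o A`_i) (RVX i hx)) (term _))) => //.
    rewrite expr1n mulr1 subn_eq0.
    have -> : (n <= 2 * i)%N = (n == 2 * i)%N by rewrite eqn_leq H1 // andbT.
    by case: eqP; rewrite ?mulr1 ?mulr0.
  have hB : RV o (fun Q => \sum_(i < size B) B`_i * (hX Q / phi Q ^+ 2) ^+ i *
      (hY Q / phi Q ^+ 3) * (phi Q)^-1 ^+ (n - (2 * i + 3)))
      (\sum_(i < size B) (if (n == 2 * i + 3)%N then B`_i else 0)).
    apply: (RV_sum (S := C)) => i.
    apply: (RV_eq (RVM (RVM (RVM (RV_cst (S := C) o B`_i) (RVX i hx)) hy) (term _))) => //.
    rewrite expr1n !mulr1 subn_eq0.
    have -> : (n <= 2 * i + 3)%N = (n == 2 * i + 3)%N by rewrite eqn_leq H2 // andbT.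
    by case: eqP; rewrite ?mulr1 ?mulr0.
  have hn := RVM hr (RV_phiV_X (n := n.-1) _); rewrite mulr0 in hn.
  apply: (RV_uniq (RVD hA hB)); have {}hn : RV o _ 0 := hn ltac:(lia).
  apply: (RV_req hn); apply: cofinS (cofinI hAB (gen_phi E)) => Q [-> ph0].
  rewrite !horner_coef mulr_suml mulrDl mulrDl !mulr_suml; congr (_ + _).
    apply: eq_bigr => i _; have en : n = (2 * i + (n - 2 * i))%N by rewrite subnKC ?H1.
    have en' : n = (n.-1).+1 by case: (n) n2.
    rewrite -!mulrA; congr (_ * _); rewrite expr_div_n -exprM -mulrA; congr (_ * _).
    by rewrite -!exprVn -exprS -exprD -en -en'.
  apply: eq_bigr => i _.
  have en : n = (2 * i + 3 + (n - (2 * i + 3)))%N by rewrite subnKC ?H2.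
  have en' : n = (n.-1).+1 by case: (n) n2.
  rewrite expr_div_n -exprM -!exprVn.
  transitivity (B`_i * hX Q ^+ i * hY Q * ((phi Q)^-1 * (phi Q)^-1 ^+ n.-1)).
    by rewrite !mulrA.
  have -> : (phi Q)^-1 * (phi Q)^-1 ^+ n.-1 = (phi Q)^-1 ^+ (2 * i) * (phi Q)^-1 ^+ 3 * (phi Q)^-1 ^+ (n - (2 * i + 3)).
    by rewrite -exprS -!exprD -en -en'.
  ring.
have pick (T : {poly k}) n (F : nat -> nat) (j : nat) : injective F -> (j < size T)%N -> n = F j ->
    \sum_(i < size T) (if n == F i then T`_i else 0) = T`_j.
  move=> injF ltj ->; rewrite (bigD1 (Ordinal ltj)) //= eqxx big1 ?addr0 // => i ij.
  by case: eqP => // /injF e; case/negP: ij; apply/eqP/val_inj.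
have none (T : {poly k}) n (F : nat -> nat) : (forall i, (i < size T)%N -> n <> F i) ->
    \sum_(i < size T) (if n == F i then T`_i else 0) = 0.
  by move=> h; apply: big1 => i _; case: eqP => // /h; case.
have inj2 : injective (fun i => 2 * i)%N by move=> i j; lia.
have inj3 : injective (fun i => 2 * i + 3)%N by move=> i j; lia.
(* The leading terms have pole orders 2 size B + 1 and 2 (size A - 1). Taking n to be the larger one
   forces the corresponding leading coefficient to vanish. *)
have [Bn|B0] := boolP ((B != 0) && (2 * size A <= 2 * size B + 3)%N).
  case/andP: Bn => B0 le.
  have sB : (0 < size B)%N by rewrite size_poly_gt0.
  have := val (2 * size B + 1)%N; rewrite leqnn orbT.
  rewrite (none A _ (fun i => 2 * i)%N); last by move=> i; lia.
  rewrite (pick B _ (fun i => 2 * i + 3)%N (size B).-1) //; try lia.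
  rewrite add0r -lead_coefE => h.
  have /eqP : lead_coef B = 0 by apply: h => //; lia.
  by rewrite lead_coef_eq0 (negbTE B0).
have [A1|A2] := leqP (size A) 1.
  split=> //; apply/eqP; apply: contraNT B0 => -> /=; move: A1.
  by move: (size A) (size B) => s t; lia.
have sA0 : (0 < size A)%N by move: A2; case: (size A).
have nB : (B == 0) || (2 * size B + 1 <= 2 * (size A).-1)%N.
  move: B0; rewrite negb_and negbK; case: eqP => //= _; rewrite -ltnNge.
  by move: (size A) (size B) => s t; lia.
have := val (2 * (size A).-1)%N.
rewrite (pick A _ (fun i => 2 * i)%N (size A).-1) // ?prednK //.
rewrite (none B _ (fun i => 2 * i + 3)%N); last first.
  case/orP: nB => [/eqP -> i|nB i lti]; first by rewrite size_poly0.
  by move: nB lti; move: (size A) (size B) => s t; lia.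
rewrite addr0 -lead_coefE => h.
have /eqP : lead_coef A = 0.
  by apply: h => //; move: A2; move: (size A) => s; lia.
by rewrite lead_coef_eq0 => /eqP A0; move: sA0; rewrite A0 size_poly0.
Qed.

(** Subtracting r tau p, where r is the value of f / tau p at p, moves the pole from p to o. The
    difference is therefore constant, so r tau p is regular at o like f, and r = 0. *)
Lemma no_simple_pole p f : (forall b, b != p -> Rg b f) ->
  Rg p (fun Q => f Q / tau p Q) -> exists c, cofin (fun Q => f Q = c).
Proof.
have [->|p0] := eqVneq p o; first by rewrite tau_o; apply: no_simple_pole_origin.
move=> hf [r hr].
have [||c hc] := @no_simple_pole_origin (fun Q => f Q - r * tau p Q).
- move=> b b0; have [->|bp] := eqVneq b p.
    have h := RVB hr (RV_cst (S := C) p r); rewrite subrr in h.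
    apply: (Rg_req (Rg_uniformizer h)); apply: cofinS (gen_tau p) => Q t0.
    by rewrite mulrBl divfK.
  by apply: (RgB (hf b bp)); apply: RgM (Rg_cst _ _) _; rewrite tau_sg //; apply: Rg_sg.
- have ho : Rg o f by apply: hf; rewrite eq_sym.
  have hV : Rg o (fun Q => (phi Q)^-1) by exists 0; apply: RV_phiV_o.
  have ht : Rg o (fun Q => tau p Q / phi Q) by exists 1; apply: RV_tau_phi.
  apply: (Rg_eq (RgB (RgM ho hV) (RgM (Rg_cst (S := C) o r) ht))) => Q.
  by rewrite mulrBl mulrA.
suff r0 : r = 0.
  by exists c; apply: cofinS hc => Q <-; rewrite r0 mul0r subr0.
apply/eqP/negPn/negP => r0.
have [v hv] : Rg o (tau p).
  have ho : Rg o f by apply: hf; rewrite eq_sym.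
  apply: (Rg_req (RgM (Rg_cst (S := C) o r^-1) (RgB ho (Rg_cst (S := C) o c)))).
  by apply: cofinS hc => Q <-; rewrite subKr mulKf.
have := RV_uniq (RVM hv (RV_phiV_o E)) (RV_tau_phi p); rewrite mulr0 => /eqP.
by rewrite eq_sym oner_eq0.
Qed.

(* Splitting along the cover of E by the complements of o and of the line y = c,
   up to multiples of phi_ c. *)
Definition splits (c : k) f := exists al be e, [/\ forall b, b != o -> Rg b al,
  forall b, b = o \/ hY b != c -> Rg b be &
  cofin (fun Q => f Q = al Q - be Q + e * phi_ c Q)].

Lemma splits_req c f g : splits c f -> cofin (fun Q => g Q = f Q) -> splits c g.
Proof.
move=> [al [be [e [h1 h2 h3]]]] h; exists al, be, e; split=> //.
by apply: cofinS (cofinI h h3) => Q [-> ->].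
Qed.

Lemma splitsD c f g u v : splits c f -> splits c g -> splits c (fun Q => u * f Q + v * g Q).
Proof.
move=> [al [be [e [h1 h2 h3]]]] [al' [be' [e' [h1' h2' h3']]]].
exists (fun Q => u * al Q + v * al' Q), (fun Q => u * be Q + v * be' Q), (u * e + v * e').
have hc := Rg_cst (S := C).
split=> [b b0|b b0|].
- by apply: (RgD (RgM (hc b u) (h1 b b0)) (RgM (hc b v) (h1' b b0))).
- by apply: (RgD (RgM (hc b u) (h2 b b0)) (RgM (hc b v) (h2' b b0))).
- by apply: cofinS (cofinI h3 h3') => Q [-> ->]; ring.
Qed.

Lemma splits_left c f : (forall b, b != o -> Rg b f) -> splits c f.
Proof.
move=> h; exists f, (fun=> 0), 0; split=> //; first by move=> b _; apply: Rg_cst.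
by apply: cofin_true => Q; rewrite mul0r addr0 subr0.
Qed.

Lemma splits_right c f : (forall b, b = o \/ hY b != c -> Rg b f) -> splits c f.
Proof.
move=> h; exists (fun=> 0), (fun Q => - f Q), 0; split=> [b _|b hb|]; first exact: Rg_cst.
  by apply: (Rg_eq (RgM (Rg_cst (S := C) b (-1)) (h b hb))) => Q; rewrite mulN1r.
by apply: cofin_true => Q; rewrite mul0r addr0 opprK add0r.
Qed.

Lemma RV_yc_o c : RV o (fun Q => (hY Q - c)^-1) 0.
Proof.
have hc := RV_cst (S := C) o; have iy := RV_yV_o E.
have hd := RVB (hc 1) (RVM (hc c) iy); rewrite mulr0 subr0 in hd.
have h := RVf iy hd (oner_neq0 k); rewrite mul0r in h.
apply: (RV_req h); apply: (req_affine (lx := [::]) (ly := [:: 0; c])) => Q Q0 _.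
rewrite !inE !negb_or => /andP[y0 /subr_neq0 yc].
by field; rewrite y0 yc.
Qed.

Lemma Rg_x_yc_o c : Rg o (fun Q => hX Q / (hY Q - c)).
Proof.
have hc := RV_cst (S := C) o; have iy := RV_yV_o E.
have hd := RVB (hc 1) (RVM (hc c) iy); rewrite mulr0 subr0 in hd.
have h := RVf (RV_z_o E) hd (oner_neq0 k).
eexists; apply: (RV_req h).
apply: (req_affine (lx := [::]) (ly := [:: 0; c])) => Q Q0 _.
rewrite !inE !negb_or => /andP[y0 /subr_neq0 yc].
by rewrite zE; field; rewrite y0 yc.
Qed.

(** The equation of E lowers i below 3, and y = (y - c) + c lowers j to 0 unless n becomes 0. For n
    > 0 the pole order 2 i - 3 n of x^i / (y - c)^n at the origin is then positive only in the case
    of [phi_ c] itself. *)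
Lemma splits_monomial c i j n : splits c (fun Q => hX Q ^+ i * hY Q ^+ j / (hY Q - c) ^+ n).
Proof.
have [m] := ubnP i; elim: m i j n => // m IHi i j n /ltnSE lei.
have gx : cofin (fun Q : pt => hY Q - c != 0).
  by apply: cofinS (cofin_hY E [:: c]) => Q; rewrite inE subr_eq0.
have [lt3|ge3] := ltnP i 3; last first.
  have -> : i = (i - 3 + 3)%N by lia.
  have s1 := splitsD 1 (ec1 E) (IHi (i - 3)%N j.+2 n ltac:(lia)) (IHi (i - 3).+1 j.+1 n ltac:(lia)).
  have s2 := splitsD (ec3 E) (- ec2 E) (IHi (i - 3)%N j.+1 n ltac:(lia)) (IHi (i - 3).+2 j n ltac:(lia)).
  have s3 := splitsD (- ec4 E) (- ec6 E) (IHi (i - 3).+1 j n ltac:(lia)) (IHi (i - 3)%N j n ltac:(lia)).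
  apply: (splits_req (splitsD 1 1 (splitsD 1 1 s1 s2) s3)).
  apply: cofinS (cofinI (cofin_neq o) gx) => Q [Q0 yc].
  have e := weierstrass_affine Q0; rewrite exprD.
  apply: (eq_of_relation (c := - (hX Q ^+ (i - 3) * hY Q ^+ j / (hY Q - c) ^+ n)) e).
  by rewrite !exprS; ring.
elim: j n => [|j IHj] n; last first.
  case: n => [|n].
    apply: splits_left => b b0; eexists.
    have h := RVM (RVX i (RV_hX b0)) (RVX j.+1 (RV_hY b0)).
    by apply: (RV_eq h) => // Q; rewrite expr0 divr1.
  apply: (splits_req (splitsD 1 c (IHj n) (IHj n.+1))).
  apply: cofinS gx => Q yc; rewrite !exprS; field.
  by rewrite yc /= expf_neq0.
have affine_case : forall n b, hY b != c -> b != o -> Rg b (fun Q => hX Q ^+ i * hY Q ^+ 0 / (hY Q - c) ^+ n).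
  move=> n' b yb b0; eexists; apply: RVf (RVM (RVX i (RV_hX b0)) (RVX 0 (RV_hY b0)))
    (RVX n' (RVB (RV_hY b0) (RV_cst (S := C) b c))) _.
  by rewrite expf_neq0 // subr_eq0.
case: n => [|n].
  apply: splits_left => b b0; eexists; have h := RVX i (RV_hX b0).
  by apply: (RV_eq h) => // Q; rewrite !expr0 divr1 mulr1.
have [/andP[/eqP-> /eqP->]|nphi] := boolP ((i == 2) && (n == 0%N)).
  exists (fun=> 0), (fun=> 0), 1; split=> [b _|b _|]; try exact: Rg_cst.
  by apply: cofin_true => Q; rewrite expr0 expr1 mulr1 mul1r subr0 add0r.
have atO : Rg o (fun Q => hX Q ^+ i * hY Q ^+ 0 / (hY Q - c) ^+ n.+1).
  have h1 : Rg o (fun Q => (hY Q - c)^-1) by exists 0; apply: RV_yc_o.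
  have h2 := Rg_x_yc_o c.
  case: i lt3 nphi {lei affine_case} => [|[|[|//]]] _.
  - by move=> _; apply: (Rg_eq (RgX n.+1 h1)) => Q; rewrite !expr0 mul1r mul1r exprVn.
  - move=> _; apply: (Rg_eq (RgM h2 (RgX n h1))) => Q.
    by rewrite expr1 expr0 mulr1 exprVn exprS invfM mulrA.
  - case: n => [//|n _]; apply: (Rg_eq (RgM (RgX 2 h2) (RgX n h1))) => Q.
    by rewrite expr0 mulr1 exprVn expr_div_n -mulrA -invfM -exprD.
apply: splits_right => b [->//|yb].
by have [->//|b0] := eqVneq b o; apply: affine_case.
Qed.

End LinearSystems.
(** * Sections with bounded poles, and their Čech complex *)

Section Stalks.
Context (k : closedFieldType) (E : elliptic_curve k).
Local Notation pt := (Defs.point E).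
Local Notation X := (surface E).
Local Notation RgE := (@Rg k (curve E)).
Local Notation RV := (@RV k (surf E)).
Local Notation Rg := (@Rg k (surf E)).
Local Notation req := (@req k (surf E)).
Implicit Types (x y : X) (F G : X -> k) (D : seq (bool * pt)).

Definition mu1 (d : bool * pt) x y : k :=
  if proj d.1 x == d.2 then (tau d.2 (proj d.1 y))^-1 else 1.

(* 1 / mu D x generates at x the functions with poles bounded by the divisor D,
   where (false, c) stands for {c} x E and (true, c) for E x {c}. *)
Definition mu D x y : k := \prod_(d <- D) mu1 d x y.

Lemma mu_nil x y : mu [::] x y = 1. Proof. exact: big_nil. Qed.
Lemma mu_cons d D x y : mu (d :: D) x y = mu1 d x y * mu D x y.
Proof. exact: big_cons. Qed.
Lemma mu_cat D D' x y : mu (D ++ D') x y = mu D x y * mu D' x y.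
Proof. exact: big_cat. Qed.

Lemma gen_proj s (A : pt -> Prop) : cofin A -> gen2 (fun y : X => A (proj s y)).
Proof.
case: s => h; first by apply: cofin_true.
by apply: cofinS h => a ha; apply: cofin_true.
Qed.

Lemma Rg_proj s x (f : pt -> k) : RgE (proj s x) f -> Rg x (fun y => f (proj s y)).
Proof. by case: s; [apply: Rg_snd|apply: Rg_fst]. Qed.

Lemma gen_mu1 d x : gen2 (fun y => mu1 d x y != 0).
Proof.
rewrite /mu1; case: (proj d.1 x == d.2); last by apply: gen2_true => y; rewrite oner_neq0.
by apply: gen2S (gen_proj d.1 (gen_tau d.2)) => y; rewrite invr_eq0.
Qed.

Lemma gen_mu D x : gen2 (fun y => mu D x y != 0).
Proof.
elim: D => [|d D IH]; first by apply: gen2_true => y; rewrite mu_nil oner_neq0.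
apply: gen2S (gen2I (gen_mu1 d x) IH) => y [h1 h2].
by rewrite mu_cons mulf_neq0.
Qed.

Lemma Rg_mu1 d x : Rg x (mu1 d x).
Proof.
rewrite /mu1; have [e|_] := eqVneq (proj d.1 x) d.2; last exact: Rg_cst.
apply: (Rg_proj (f := fun b => (tau d.2 b)^-1)); rewrite e.
by exists 0; apply: RV_tauV.
Qed.

Lemma Rg_mu D x : Rg x (mu D x).
Proof.
elim: D => [|d D IH].
  by apply: (Rg_eq (Rg_cst (S := surf E) x 1)) => y; rewrite mu_nil.
by apply: (Rg_eq (RgM (Rg_mu1 d x) IH)) => y; rewrite mu_cons.
Qed.

Lemma pol_lform L s l y : pol L (lform s l) y = lin l (proj s y) / lin (L s) (proj s y).
Proof.
rewrite /pol /lform rmorph_sum /lin mulr_suml; apply: eq_bigr => i _ /=.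
by rewrite mevalZ mevalXU affc_var mulrA.
Qed.

(** The generator 1 / mu D x0 has unwanted poles elsewhere in the chart, because [tau] has other
    poles; r removes them without vanishing at x0. *)
Lemma kill_poles D L x0 : chart L x0 -> exists r, pol L r x0 != 0 /\
  forall x, chart L x -> Rg x (fun y => mu D x y * (pol L r y / mu D x0 y)).
Proof.
move=> ch; elim: D => [|[s c] D [r [r0 hr]]].
  exists 1; split; first by rewrite pol1 oner_neq0.
  move=> x _; apply: (Rg_eq (Rg_cst (S := surf E) x 1)) => y.
  by rewrite !mu_nil pol1 !mul1r invr1.
have [e|ne] := eqVneq (proj s x0) c; last first.
  exists r; split=> // x chx; apply: (Rg_eq (RgM (Rg_mu1 (s, c) x) (hr x chx))) => y.
  have e1 : mu1 (s, c) x0 y = 1 by rewrite /mu1 /= (negbTE ne).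
  by rewrite !mu_cons e1 mul1r !mulrA.
exists (lform s (kill c) * r); split.
  rewrite polM mulf_neq0 // pol_lform e mulf_neq0 ?lin_kill_neq0 // invr_eq0 -e.
  exact: ch.
move=> x chx.
suff h : Rg x (fun y => mu1 (s, c) x y * (pol L (lform s (kill c)) y * tau c (proj s y))).
  apply: (Rg_eq (RgM h (hr x chx))) => y.
  have e1 : mu1 (s, c) x0 y = (tau c (proj s y))^-1 by rewrite /mu1 /= e eqxx.
  by rewrite !mu_cons polM e1 invfM invrK; ring.
rewrite /mu1 /=; have [e'|ne] := eqVneq (proj s x) c.
  apply: (Rg_req (G := _) (ex_intro _ _ (RV_pol (lform s (kill c)) chx))).
  apply: gen2S (gen_proj s (gen_tau c)) => y t0.
  by field.
apply: (Rg_eq (Rg_proj (s := s) (Rg_kill (chx s) ne))) => y.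
by rewrite mul1r pol_lform.
Qed.

Section WithDivisor.
Context (m : bool) (D : seq (bool * pt)).

(* The stalk at x of the sheaf of functions with poles bounded by D and, if m
   holds, vanishing on the diagonal. *)
Definition St x F := Rg x (fun y => mu D x y * F y) /\
  (m -> x.1 = x.2 -> RV x (fun y => mu D x y * F y) 0).

Lemma St_req x F G : St x F -> req F G -> St x G.
Proof.
move=> [h1 h2] e.
have e' : req (fun y => mu D x y * F y) (fun y => mu D x y * G y).
  by apply: gen2S e => y ->.
split; first exact: Rg_req e'.
by move=> mt xd; apply: (RV_req (h2 mt xd)).
Qed.

Lemma St_eq x F G : St x F -> (forall y, F y = G y) -> St x G.
Proof. by move=> h e; apply: (St_req h); apply: gen2_true. Qed.

Lemma StD x F G : St x F -> St x G -> St x (fun y => F y + G y).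
Proof.
move=> [h1 h2] [g1 g2]; split.
  by apply: (Rg_eq (RgD h1 g1)) => y; rewrite mulrDr.
move=> mt xd; apply: (RV_eq (RVD (h2 mt xd) (g2 mt xd))); rewrite ?addr0 // => y.
by rewrite mulrDr.
Qed.

Lemma StM x F G : Rg x F -> St x G -> St x (fun y => F y * G y).
Proof.
move=> hF [h1 h2]; split.
  by apply: (Rg_eq (RgM hF h1)) => y; rewrite mulrCA.
move=> mt xd; have [v hv] := hF; apply: (RV_eq (RVM hv (h2 mt xd))); rewrite ?mulr0 // => y.
by rewrite mulrCA.
Qed.

Lemma St0 x : St x (fun=> 0).
Proof.
split; first by apply: (Rg_eq (Rg_cst (S := surf E) x 0)) => y; rewrite mulr0.
by move=> _ _; apply: (RV_eq (RV_cst (S := surf E) x 0)) => // y; rewrite mulr0.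
Qed.

Lemma StN x F : St x F -> St x (fun y => - F y).
Proof. by move=> h; apply: (St_eq (StM (Rg_cst (S := surf E) x (-1)) h)) => y; rewrite mulN1r. Qed.

Lemma StB x F G : St x F -> St x G -> St x (fun y => F y - G y).
Proof. by move=> h /StN h'; apply: (StD h h'). Qed.

Lemma St_sum x (I : Type) (r : seq I) (F : I -> X -> k) :
  (forall i, St x (F i)) -> St x (fun y => \sum_(i <- r) F i y).
Proof.
move=> h; elim: r => [|i r IH]; first by apply: (St_eq (St0 x)) => y; rewrite big_nil.
by apply: (St_eq (StD (h i) IH)) => y; rewrite big_cons.
Qed.

(** The q for which q F has poles bounded by D form an ideal. By [kill_poles] its zeros lie on f g =
    0, so it contains a power of f g, and g is invertible at the points considered. *)
Lemma Rg_ext L g f F :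
  (forall x, chart L x -> pol L g x != 0 -> pol L f x != 0 -> Rg x (fun y => mu D x y * F y)) ->
  exists n, forall n', (n <= n')%N -> forall x, chart L x -> pol L g x != 0 ->
    Rg x (fun y => mu D x y * (pol L f y ^+ n' * F y)).
Proof.
move=> hF; have [[x1 ch1]|nch] := pselect (exists x : X, chart L x); last first.
  by exists 0%N => n' _ x chx; case: nch; exists x.
pose I := [set q | forall x, chart L x -> Rg x (fun y => mu D x y * (pol L q y * F y))].
have [||x ch kx|n hn] := @nullstellensatz_chart k E L I (f * g).
- split=> [x _|a b ha hb x ch|a b hb x ch].
  + by apply: (Rg_eq (Rg_cst (S := surf E) x 0)) => y; rewrite pol0 mul0r mulr0.
  + by apply: (Rg_eq (RgD (ha x ch) (hb x ch))) => y; rewrite polD; ring.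
  + have hp : Rg x (pol L a) by eexists; apply: RV_pol.
    by apply: (Rg_eq (RgM hp (hb x ch))) => y; rewrite polM; ring.
- move=> q hq x ch; apply: (Rg_req (Rg_cst (S := surf E) x 0)).
  by apply: gen2S (gen_chart ch1) => y /hq ->; rewrite mul0r mulr0.
- apply/eqP/negPn/negP; rewrite polM mulf_eq0 negb_or => /andP[f0 g0].
  have [a [b [b0 e]]] := Rg_pol_frac (hF x ch g0 f0) ch.
  have [r [r0 hr]] := kill_poles D ch.
  have : pol L (r * b) x != 0 by rewrite polM mulf_neq0.
  move=> /negP; apply; apply/eqP; apply: kx => z chz.
  have ha : Rg z (pol L a) by eexists; apply: RV_pol.
  apply: (Rg_req (RgM (hr z chz) ha)).
  have gb := RV_gen_neq0 (RV_pol b ch) b0.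
  apply: gen2S (gen2I e (gen2I gb (gen_mu D x))) => y [ey [by0 my]].
  have -> : pol L a y = mu D x y * F y * pol L b y by rewrite ey divfK.
  by rewrite polM; field.
exists n => n' len x ch g0.
have hf : Rg x (fun y => pol L f y ^+ (n' - n)).
  by apply: RgX; eexists; apply: RV_pol.
have hg : Rg x (fun y => (pol L g y)^-1 ^+ n).
  apply: RgX; eexists; exact: (RVV (RV_pol g ch) g0).
apply: (Rg_req (RgM (RgM hf hg) (hn x ch))).
have gg := RV_gen_neq0 (RV_pol g ch) g0.
apply: gen2S gg => y gy; rewrite polX polM exprMn exprVn.
rewrite -{2}(subnK len) exprD; field.
by rewrite expf_neq0.
Qed.

(** At diagonal points where f vanishes, one more factor f provides the required zero; hence
    [n.+1]. *)
Lemma St_ext L g f F :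
  (forall x, chart L x -> pol L g x != 0 -> pol L f x != 0 -> St x F) ->
  exists n, forall n', (n <= n')%N -> forall x, chart L x -> pol L g x != 0 ->
    St x (fun y => pol L f y ^+ n' * F y).
Proof.
move=> hF; have [n hn] := Rg_ext (fun x h1 h2 h3 => proj1 (hF x h1 h2 h3)).
exists n.+1 => n' len x ch g0; split; first by apply: hn => //; apply: ltnW.
move=> mt xd; have [f0|f0] := eqVneq (pol L f x) 0; last first.
  have [_ /(_ mt xd) h] := hF x ch g0 f0.
  have := RVM (RVX n' (RV_pol f ch)) h; rewrite mulr0 => {}h.
  by apply: (RV_eq h) => // y; rewrite mulrCA.
have hf := RV_pol f ch; rewrite f0 in hf.
have [|v hv] := hn n'.-1 _ x ch g0; first by case: n' len.
have en : n' = n'.-1.+1 by case: (n') len.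
have := RVM hf hv; rewrite mul0r => h; apply: (RV_eq h) => // y.
by rewrite [n' in RHS]en exprS; ring.
Qed.

End WithDivisor.

Lemma partition_of_unity L (I : finType) (p : I -> {mpoly k[3 + 3]}) n :
  (forall y : X, chart L y -> exists j, pol L (p j) y != 0) ->
  exists g : I -> {mpoly k[3 + 3]}, forall y : X, chart L y ->
    \sum_j pol L (g j) y * pol L (p j) y ^+ n = 1.
Proof.
move=> hp.
pose J := [set q | exists g : I -> {mpoly k[3 + 3]}, forall y : X, chart L y ->
  pol L q y = \sum_j pol L (g j) y * pol L (p j) y ^+ n].
have [||y ch ky|m [g hg]] := @nullstellensatz_chart k E L J 1.
- split.
  + exists (fun=> 0) => y ch; rewrite pol0 big1 // => j _.
    by rewrite /= ?pol0 mul0r.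
  + move=> a b [g hg] [g' hg']; exists (fun j => g j + g' j) => y ch.
    rewrite polD hg // hg' // -big_split; apply: eq_bigr => j _.
    by rewrite /= polD mulrDl.
  + move=> a b [g hg]; exists (fun j => a * g j) => y ch.
    rewrite polM hg // big_distrr; apply: eq_bigr => j _.
    by rewrite /= polM mulrA.
- move=> q hq; exists (fun=> 0) => y ch; rewrite hq // big1 // => j _.
  by rewrite /= ?pol0 mul0r.
- have [j pj] := hp y ch; have : pol L (p j ^+ n) y = 0.
    apply: ky; exists (fun i => (i == j)%:R) => z _; rewrite polX (bigD1 j) //= eqxx.
    by rewrite pol1 mul1r big1 ?addr0 // => i /negbTE ->; rewrite /= ?pol0 mul0r.
  by move=> /eqP; rewrite polX expf_eq0 (negbTE pj) andbF.
by exists g => y ch; rewrite -hg // polX pol1 expr1n.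
Qed.

(** Quasi-compactness of a chart: the polynomials that vanish wherever some finite part of A does
    form an ideal without zeros in the chart. *)
Lemma finite_subcover L (A : set {mpoly k[3 + 3]}) :
  (forall y : X, chart L y -> exists2 p, A p & pol L p y != 0) ->
  exists ps : seq {mpoly k[3 + 3]}, (forall p, p \in ps -> A p) /\
    forall y : X, chart L y -> exists2 p, p \in ps & pol L p y != 0.
Proof.
move=> hA.
pose J := [set q | exists ps : seq {mpoly k[3 + 3]}, (forall p, p \in ps -> A p) /\
  forall y : X, chart L y -> (forall p, p \in ps -> pol L p y = 0) -> pol L q y = 0].
have [||y ch ky|n [ps [psA h]]] := @nullstellensatz_chart k E L J 1.
- split.
  + by exists [::]; split=> // y _ _; rewrite pol0.
  + move=> a b [ps [h1 h2]] [qs [g1 g2]]; exists (ps ++ qs); split=> [p|y ch hz].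
      by rewrite mem_cat => /orP[/h1|/g1].
    rewrite polD h2 // ?g2 ?addr0 // => p pin; apply: hz; rewrite mem_cat pin ?orbT //.
  + move=> a b [ps [h1 h2]]; exists ps; split=> // y ch hz.
    by rewrite polM h2 // mulr0.
- by move=> p hp; exists [::]; split=> // y ch _; apply: hp.
- have [p Ap p0] := hA y ch; have : pol L p y = 0.
    apply: ky; exists [:: p]; split=> [q|z _ h]; first by rewrite inE => /eqP ->.
    by apply: h; rewrite inE.
  by move=> e; move: p0; rewrite e eqxx.
exists ps; split=> // y ch; apply: contrapT => hn.
have : pol L (1 ^+ n) y = 0.
  apply: h => // p pin; apply/eqP/negPn/negP => p0; apply: hn; exists p => //.
by move/eqP; rewrite polX pol1 expr1n oner_eq0.
Qed.

End Stalks.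

(** The alternating sum over omitted indices ([deltaE]), in the recursive form that makes a homotopy
    which prepends an index immediate. *)
Fixpoint delta (A : zmodType) (I : Type) (c : seq I -> A) (l : seq I) : A :=
  if l is x :: l' then c l' - delta (fun t => c (x :: t)) l' else 0.

Lemma deltaD (A : zmodType) (I : Type) (c d : seq I -> A) l :
  delta (fun t => c t + d t) l = delta c l + delta d l.
Proof. by elim: l c d => [|x l IH] c d /=; [rewrite addr0|rewrite IH opprD addrACA]. Qed.

Lemma deltaN (A : zmodType) (I : Type) (c : seq I -> A) l :
  delta (fun t => - c t) l = - delta c l.
Proof. by elim: l c => [|x l IH] c /=; [rewrite oppr0|rewrite IH opprD]. Qed.

Lemma deltaB (A : zmodType) (I : Type) (c d : seq I -> A) l :
  delta (fun t => c t - d t) l = delta c l - delta d l.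
Proof. by rewrite deltaD deltaN. Qed.

Lemma delta_delta (A : zmodType) (I : Type) (c : seq I -> A) l : delta (delta c) l = 0.
Proof.
elim: l c => [//|x l IH] c /=.
by rewrite deltaB IH subr0 subrr.
Qed.

Lemma deltaZ (R : pzRingType) (I : Type) (a : R) (c : seq I -> R) l :
  delta (fun t => a * c t) l = a * delta c l.
Proof. by elim: l c => [|x l IH] c /=; [rewrite mulr0|rewrite IH mulrBr]. Qed.

Lemma delta0 (A : zmodType) (I : Type) l : delta (fun _ : seq I => 0 : A) l = 0.
Proof. by elim: l => //= x l ->; rewrite subr0. Qed.

Lemma delta_sum (A : zmodType) (I J : Type) (r : seq J) (c : J -> seq I -> A) l :
  delta (fun t => \sum_(j <- r) c j t) l = \sum_(j <- r) delta (c j) l.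
Proof.
elim: r => [|j r IH].
  rewrite big_nil -[RHS](delta0 A l); congr (delta _ l).
  by apply/funext => t; rewrite big_nil.
rewrite big_cons -IH -deltaD; congr (delta _ l).
by apply/funext => t; rewrite big_cons.
Qed.

(** * Exactness of Čech complexes: affine pieces and Mayer-Vietoris *)

Section Exactness.
Context (k : closedFieldType) (E : elliptic_curve k).
Local Notation pt := (Defs.point E).
Local Notation X := (surface E).
Local Notation req := (@req k (surf E)).
Implicit Types (x y : X) (F G : X -> k).
Context (m : bool) (D : seq (bool * pt)).
Context (I : finType) (V : I -> {mpoly k[3 + 3]}).
Implicit Types (l t : seq I).

Record is_affine_cover : Prop := IsAffineCover {
  cover_bihomog : forall v, exists d e, bihomog d e (V v);
  cover_nonempty : forall v, exists y : X, (V v).@[coords y] != 0;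
  cover_all : forall y : X, exists v, (V v).@[coords y] != 0;
  cover_chart : forall v, exists L, forall y : X, (V v).@[coords y] != 0 -> chart L y
}.

Context (hV : is_affine_cover).

Definition sections (T : X -> Prop) F := forall x, T x -> St m D x F.

Definition inV l y := forall v, v \in l -> (V v).@[coords y] != 0.

Definition nv (q : {mpoly k[3 + 3]}) y := q.@[coords y] != 0.

(* Exactness in degree p of the Čech complex of the cover V restricted to T. *)
Definition exact p (T : X -> Prop) := forall C : seq I -> X -> k,
  (forall l, size l = p.+1 -> sections (fun y => T y /\ inV l y) (C l)) ->
  (forall l, size l = p.+2 -> gen2 (fun y : X => delta (C^~ y) l = 0)) ->
  exists B : seq I -> X -> k,
    (forall l, size l = p -> sections (fun y => T y /\ inV l y) (B l)) /\
    forall l, size l = p.+1 -> gen2 (fun y : X => C l y = delta (B^~ y) l).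

Lemma exact_iff p (T T' : X -> Prop) : (forall y, T y <-> T' y) -> exact p T -> exact p T'.
Proof.
move=> e h C hC dC; have [|B [hB eB]] := h C _ dC.
  by move=> l sl x [/e Tx xl]; apply: hC.
by exists B; split=> // l sl x [/e Tx xl]; apply: hB.
Qed.

Lemma gen2_all (J : finType) (A : J -> X -> Prop) :
  (forall j, gen2 (A j)) -> gen2 (fun y => forall j, A j y).
Proof.
move=> h; suff : gen2 (fun y => forall j, j \in enum J -> A j y).
  by apply: gen2S => y hy j; apply: hy; rewrite mem_enum.
elim: (enum J) => [|j r IH]; first by apply: gen2_true => y j.
apply: gen2S (gen2I (h j) IH) => y [h1 h2] i; rewrite inE => /orP[/eqP ->//|].
exact: h2.
Qed.

Lemma prodV_neq0 L l y : chart L y -> inV l y <-> pol L (\prod_(v <- l) V v) y != 0.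
Proof.
move=> ch; elim: l => [|v l IH]; first by rewrite big_nil pol1 oner_neq0; split.
have [d [e hv]] := cover_bihomog hV v.
rewrite big_cons polM mulf_eq0 negb_or -(meval_pol_neq0 hv ch); split.
  move=> h; rewrite h ?inE ?eqxx //=; apply/IH => w wl; apply: h.
  by rewrite inE wl orbT.
move=> /andP[h1 /IH h2] w; rewrite inE => /orP[/eqP -> //|]; exact: h2.
Qed.

Lemma V_pol L y : chart L y -> exists v, pol L (V v) y != 0.
Proof.
move=> ch; have [v hv] := cover_all hV y; exists v.
by have [d [e h]] := cover_bihomog hV v; rewrite -(meval_pol_neq0 h ch).
Qed.

Lemma sections_ext L g F v :
  sections (fun y => [/\ chart L y, pol L g y != 0 & pol L v y != 0]) F ->
  exists n, forall n', (n <= n')%N ->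
  sections (fun y => chart L y /\ pol L g y != 0) (fun y => pol L v y ^+ n' * F y).
Proof.
move=> h; have [n hn] := @St_ext k E m D L g v F (fun x h1 h2 h3 => h x (And3 h1 h2 h3)).
by exists n => n' len x [ch g0]; apply: hn.
Qed.

(** The homotopy is B l = sum_j h_j V_j^N C (j :: l), with sum_j h_j V_j^N = 1. The exponent N is
    large enough for every V_j^N C (j :: l) to extend across V_j = 0. *)
Lemma exact_affine L g p : (exists x, chart L x) ->
  exact p (fun y => chart L y /\ pol L g y != 0).
Proof.
move=> [x0 ch0] C hC dC.
pose P l := \prod_(v <- l) V v.
have ext (t : p.-tuple I) j : exists n, forall n', (n <= n')%N ->
    sections (fun y => chart L y /\ pol L (g * P t) y != 0)
      (fun y => pol L (V j) y ^+ n' * C (j :: t) y).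
  apply: sections_ext => x [ch]; rewrite polM mulf_eq0 negb_or => /andP[g0 Pt] vx.
  apply: hC; first by rewrite /= size_tuple.
  split=> // v; rewrite inE => /orP[/eqP ->|]; last by move: v; apply/(prodV_neq0 _ ch).
  by have [d [e h]] := cover_bihomog hV j; rewrite (meval_pol_neq0 h ch).
have /choice [n hn] : forall t : p.-tuple I, exists f : I -> nat, forall j n',
    (f j <= n')%N -> sections (fun y => chart L y /\ pol L (g * P t) y != 0)
      (fun y => pol L (V j) y ^+ n' * C (j :: t) y).
  by move=> t; have [f hf] := choice (ext t); exists f.
pose N := \max_(t : p.-tuple I) \max_j n t j.
have [h hh] := partition_of_unity N (V_pol (L := L)).
exists (fun l y => \sum_j pol L (h j) y * (pol L (V j) y ^+ N * C (j :: l) y)); split.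
  move=> l /eqP sl x [[ch g0] xl]; apply: St_sum => j.
  apply: StM; first by eexists; apply: RV_pol.
  apply: (hn (Tuple sl) j N).
    by rewrite /N (bigD1 (Tuple sl)) //= leq_max (bigD1 j) //= leq_max leqnn.
  by split=> //; rewrite polM mulf_neq0 //; apply/(prodV_neq0 _ ch).
move=> l sl.
have dCj : gen2 (fun y : X => forall j, delta (C^~ y) (j :: l) = 0).
  by apply: gen2_all => j; apply: dC; rewrite /= sl.
apply: gen2S (gen2I (gen_chart ch0) dCj) => y [chy dy].
rewrite delta_sum /=.
transitivity (\sum_j (pol L (h j) y * pol L (V j) y ^+ N) * C l y).
  by rewrite -mulr_suml hh // mul1r.
apply: eq_bigr => j _; have /= /eqP := dy j; rewrite subr_eq0 => /eqP ->.
by rewrite -deltaZ; congr (delta _ l); apply/funext => t; rewrite mulrA.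
Qed.

Lemma inhabitedV : exists v : I, True.
Proof. by have [v _] := cover_all hV (origin E, origin E); exists v. Qed.

(** Compatible local sections agree generically, so any one of them is already the global
    section. *)
Lemma exact0 T : exact 0 T.
Proof.
move=> C hC dC; have [v0 _] := inhabitedV.
have e v w : req (C [:: v]) (C [:: w]).
  apply: gen2S (dC [:: w; v] erefl) => y /=; rewrite subr0 => /eqP.
  by rewrite subr_eq0 => /eqP.
exists (fun _ => C [:: v0]); split=> [[]// _ x [Tx _]|[|v []]// _].
  have [v hv] := cover_all hV x.
  apply: (St_req _ (e v v0)); apply: hC => //; split=> // w.
  by rewrite inE => /eqP ->.
by apply: gen2S (e v v0) => y /= ->; rewrite subr0.
Qed.

Definition splits_over p (A B : X -> Prop) := forall l, size l = p ->
  forall F, sections (fun y => [/\ A y, B y & inV l y]) F ->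
  exists al be, [/\ sections (fun y => A y /\ inV l y) al,
    sections (fun y => B y /\ inV l y) be & req F (fun y => al y - be y)].

(** Primitives bA and bB of C over A and B differ over the intersection by a cocycle, the coboundary
    of f. Writing f = al - be on each simplex, bA - delta al and bB - delta be agree generically. *)
Lemma exact_mv p A B : exact p.+1 A -> exact p.+1 B -> exact p (fun y => A y /\ B y) ->
  splits_over p A B -> exact p.+1 (fun y => A y \/ B y).
Proof.
move=> exA exB exAB sp C hC dC.
have [|bA [hA eA]] := exA C _ dC.
  by move=> l sl x [Ax xl]; apply: hC => //; split=> //; left.
have [|bB [hB eB]] := exB C _ dC.
  by move=> l sl x [Bx xl]; apply: hC => //; split=> //; right.
have [||f [hf ef]] := exAB (fun l y => bA l y - bB l y).
- move=> l sl x [[Ax Bx] xl]; apply: StB; [apply: hA|apply: hB] => //; by split.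
- move=> l sl; apply: gen2S (gen2I (eA l sl) (eB l sl)) => y [h1 h2].
  by rewrite deltaB -h1 -h2 subrr.
have /choice [al hal] : forall l, exists al, size l = p ->
    sections (fun y => A y /\ inV l y) al /\
    sections (fun y => B y /\ inV l y) (fun y => al y - f l y).
  move=> l; have [sl|nsl] := eqVneq (size l) p; last first.
    by exists (fun=> 0) => e; rewrite e eqxx in nsl.
  have [|al [be [h1 h2 e]]] := sp l sl (f l).
    by move=> x [Ax Bx xl]; apply: hf.
  exists al => _; split=> // x xB; apply: (St_req (h2 x xB)).
  by apply: gen2S e => y ->; rewrite subKr.
(* Proved for lists with a prefix s, the part that [delta] has already traversed. *)
have sub l (F : seq I -> X -> k) (T : X -> Prop) x :
    (forall t, size t = p -> sections (fun y => T y /\ inV t y) (F t)) ->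
    size l = p.+1 -> T x -> inV l x -> St m D x (fun y => delta (F^~ y) l).
  move=> hF sl Tx; have : forall s, size (s ++ l) = p.+1 -> inV (s ++ l) x ->
      St m D x (fun y => delta (fun t => F (s ++ t) y) l).
    move=> {sl} s; elim: l s => [|v l IH] s sl xl /=; first exact: St0.
    apply: StB.
      apply: hF; first by move: sl; rewrite !size_cat /= addnS => -[].
      split=> // w wl; apply: xl; move: wl; rewrite !mem_cat inE => /orP[->//|->].
      by rewrite !orbT.
    have := IH (rcons s v); rewrite cat_rcons => /(_ sl xl) h.
    by apply: (St_eq h) => y; congr (delta _ l); apply/funext => t; rewrite cat_rcons.
  by move=> /(_ [::] sl) h xl; apply: (St_eq (h xl)).
exists (fun l y => bA l y - delta (al^~ y) l); split=> [l sl x [[Ax|Bx] xl]|l sl].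
- apply: StB; first by apply: hA.
  by apply: (sub _ al A) => // t st; have [] := hal t st.
- have h1 : St m D x (bB l) by apply: hB.
  have h2 : St m D x (fun y => delta (fun t => al t y - f t y) l).
    by apply: (sub _ (fun t y => al t y - f t y) B) => // t st; have [] := hal t st.
  apply: (St_req (StB h1 h2)); apply: gen2S (ef l sl) => y.
  by rewrite deltaB => <-; ring.
- apply: gen2S (eA l sl) => y ->.
  by rewrite deltaB delta_delta subr0.
Qed.

(** From u a^n + v b^n = 1, F is the sum of u a^n F and v b^n F, which extend across a = 0 and b = 0
    respectively. *)
Lemma split_affine L g a b F : (exists x, chart L x) ->
  (forall y : X, chart L y -> pol L a y != 0 \/ pol L b y != 0) ->
  sections (fun y => [/\ chart L y, pol L g y != 0, pol L a y != 0 & pol L b y != 0]) F ->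
  exists al be, [/\
    sections (fun y => [/\ chart L y, pol L g y != 0 & pol L a y != 0]) al,
    sections (fun y => [/\ chart L y, pol L g y != 0 & pol L b y != 0]) be &
    req F (fun y => al y - be y)].
Proof.
move=> [x0 ch0] hab hF.
have [|na hna] := @sections_ext L (g * b) F a.
  by move=> x [ch]; rewrite polM mulf_eq0 negb_or => /andP[g0 b0] a0; apply: hF.
have [|nb hnb] := @sections_ext L (g * a) F b.
  by move=> x [ch]; rewrite polM mulf_eq0 negb_or => /andP[g0 b0] a0; apply: hF.
pose n := maxn na nb.
pose c (s : bool) := if s then a else b.
have [|h hh] := @partition_of_unity k E L bool c n.
  by move=> y /hab [h|h]; [exists true|exists false].
exists (fun y => pol L (h false) y * (pol L b y ^+ n * F y)),
       (fun y => - (pol L (h true) y * (pol L a y ^+ n * F y))); split.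
- move=> x [ch g0 a0]; apply: StM; first by eexists; apply: RV_pol.
  apply: hnb; first exact: leq_maxr.
  by split=> //; rewrite polM mulf_neq0.
- move=> x [ch g0 a0]; apply: StN; apply: StM; first by eexists; apply: RV_pol.
  apply: hna; first exact: leq_maxl.
  by split=> //; rewrite polM mulf_neq0.
- apply: gen2S (gen_chart ch0) => y /hh; rewrite big_bool /c /= => e.
  by rewrite opprK -[LHS]mul1r -e; ring.
Qed.

(** A nonempty simplex lies in an affine chart, where [split_affine] applies. Only the empty list,
    that is degree 0, needs the geometry of E. *)
Lemma splits_over_forms p s a b q : (exists d e, bihomog d e q) ->
  (forall P : pt, lin a P != 0 \/ lin b P != 0) ->
  splits_over p.+1 (nv (q * lform s a)) (nv (q * lform s b)).
Proof.
move=> [d [e hq]] hab [//|v l] sl F hF.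
have [L hL] := cover_chart hV v.
have hL' y : inV (v :: l) y -> chart L y by move=> h; apply: hL; apply: h; rewrite inE eqxx.
have e' c y : chart L y -> inV (v :: l) y -> nv (q * lform s c) y <->
    pol L q y != 0 /\ pol L (lform s c) y != 0.
  move=> ch _; rewrite /nv mevalM mulf_eq0 negb_or (meval_pol_neq0 hq ch).
  rewrite (meval_pol_neq0 (@bihomog_lform k s c) ch); split; first by move/andP.
  by move=> [-> ->].
pose g := q * \prod_(w <- v :: l) V w.
have [|y ch|x [ch gx ax bx]|al [be [h1 h2 h3]]] :=
  @split_affine L g (lform s a) (lform s b) F.
- by have [x hx] := cover_nonempty hV v; exists x; apply: hL.
- have hc c : lin c (proj s y) != 0 -> pol L (lform s c) y != 0.
    by move=> h; rewrite -(meval_pol_neq0 (@bihomog_lform k s c) ch) coords_lform.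
  by case: (hab (proj s y)) => /hc; [left|right].
- move: gx; rewrite /g polM mulf_eq0 negb_or => /andP[qx /(prodV_neq0 _ ch) xl].
  by apply: hF; split=> //; apply/e'.
exists al, be; split=> // x [hx xl]; have ch := hL' x xl; move/(e' _ _ ch xl): hx => [qx cx].
  by apply: h1; split=> //; rewrite /g polM mulf_neq0 //; apply/(prodV_neq0 _ ch).
by apply: h2; split=> //; rewrite /g polM mulf_neq0 //; apply/(prodV_neq0 _ ch).
Qed.

Lemma exact_nv p a b q : (exists d e, bihomog d e q) ->
  (exists P : pt, lin a P != 0) -> (exists P : pt, lin b P != 0) ->
  exact p (nv (lform false a * lform true b * q)).
Proof.
move=> [d [e hq]] [P aP] [Q bQ]; pose L (s : bool) := if s then b else a.
apply: (exact_iff (T := fun y => chart L y /\ pol L q y != 0)); last first.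
  by apply: exact_affine; exists (P, Q); case.
move=> y; rewrite /nv !mevalM !mulf_eq0 !negb_or !coords_lform.
split=> [[ch qy]|/andP[/andP[ay by_] qy]].
  by rewrite (meval_pol_neq0 hq ch) qy (ch true) (ch false).
have ch : chart L y by case.
by rewrite -(meval_pol_neq0 hq ch).
Qed.

(** The form y - c z is nonzero at the origin, so it has no common zero with z on E. *)
Definition ly (c : k) (i : 'I_3) : k := if i == i1 then 1 else if i == i2 then - c else 0.

Lemma lin_ly c (P : pt) : lin (ly c) P = hY P - c * hZ P.
Proof.
rewrite /lin !big_ord_recl big_ord0 /ly /= /hY /hZ addr0 mul0r add0r mul1r mulNr.
by congr (hcoord P _ - c * hcoord P _); apply: val_inj.
Qed.

End Exactness.
(** * Line bundles and function sheaves *)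

Section Refinement.
Context (k : closedFieldType) (E : elliptic_curve k).
Local Notation X := (surface E).
Local Notation pt := (Defs.point E).

Lemma exists_chart (y : X) : exists a b : bool,
  chart (fun s : bool => if (if s then b else a) then lz k false else ly 0) y.
Proof.
have h (P : pt) : exists b : bool, lin (if b then lz k false else ly 0) P != 0.
  have [e|n] := eqVneq (hZ P) 0; last by exists true; rewrite lin_lz.
  by exists false; rewrite (hZ_eq0 e) lin_ly hY_origin mul0r subr0 oner_neq0.
have [a ha] := h y.1; have [b hb] := h y.2; exists a, b; by case.
Qed.

(** X is the union of four charts, according to which of z and y is nonzero on each factor, and each
    chart is quasi-compact. *)
Lemma affine_refinement (U : open_cover E) : exists (J : finType) (V : J -> {mpoly k[3 + 3]}),
  is_affine_cover E V /\ forall v, exists u : U, nonvanishing (V v) `<=` oc_set u.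
Proof.
pose good (p : {mpoly k[3 + 3]}) := [/\ exists d e, bihomog d e p,
  exists y : X, p.@[coords y] != 0,
  exists L, forall y : X, p.@[coords y] != 0 -> chart L y &
  exists u : U, nonvanishing p `<=` oc_set u].
have one (L : bool -> 'I_3 -> k) : exists ps : seq {mpoly k[3 + 3]}, (forall p, p \in ps -> good p) /\
    forall y : X, chart L y -> exists2 p, p \in ps & p.@[coords y] != 0.
  have [y ch|ps [h1 h2]] := @finite_subcover k E L good.
    have [u _ yu] : (\bigcup_(u : U) oc_set u) y by rewrite oc_cover.
    have /nbhs_nonvanishing [d [e [p [hp py pu]]]] : nbhs y (oc_set u).
      by apply: open_nbhs_nbhs; split => //; apply: oc_open.
    pose q := lform false (L false) * lform true (L true) * p.
    have hq := bihomogM (bihomogM (@bihomog_lform k false (L false)) (@bihomog_lform k true (L true))) hp.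
    have qE z : (q.@[coords z] != 0) = [&& lin (L false) z.1 != 0, lin (L true) z.2 != 0 & p.@[coords z] != 0].
      by rewrite /q !mevalM !mulf_eq0 !negb_or !coords_lform andbA.
    have qy : q.@[coords y] != 0.
      by rewrite qE py (ch false : lin (L false) y.1 != 0) (ch true : lin (L true) y.2 != 0).
    exists q; last by rewrite -(meval_pol_neq0 hq ch).
    split; [by do 2 eexists; apply: hq|by exists y| |].
      by exists L => z; rewrite qE => /and3P[h1 h2 _]; case.
    by exists u => z; rewrite /nonvanishing /= qE => /and3P[_ _ /pu].
  exists ps; split=> // y ch; have [p pin p0] := h2 y ch; exists p => //.
  by have [[d [e hp]] _ _ _] := h1 p pin; rewrite (meval_pol_neq0 hp ch).
have /choice [ps hps] := one.
pose L (a b s : bool) := if (if s then b else a) then lz k false else ly 0.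
pose pall := flatten [seq ps (L ab.1 ab.2) | ab <- enum {: bool * bool}].
have inall p : p \in pall -> good p.
  by move=> /flattenP [_ /mapP [ab _ ->]] pin; have [h _] := hps (L ab.1 ab.2); apply: h.
have covall (y : X) : exists2 p, p \in pall & p.@[coords y] != 0.
  have [a [b ch]] := exists_chart y; have [_ h] := hps (L a b).
  have [p pin p0] := h y ch; exists p => //; apply/flattenP; exists (ps (L a b)) => //.
  by apply/mapP; exists (a, b); rewrite ?mem_enum.
exists 'I_(size pall), (fun i : 'I_(size pall) => pall`_i); split; last first.
  by move=> i; have [] := inall pall`_i (mem_nth _ (ltn_ord i)).
split=> [i|i|y|i].
- by have [] := inall pall`_i (mem_nth _ (ltn_ord i)).
- by have [] := inall pall`_i (mem_nth _ (ltn_ord i)).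
- have [p pin p0] := covall y.
  by move: (pin); rewrite -index_mem => lti; exists (Ordinal lti); rewrite /= nth_index.
- by have [] := inall pall`_i (mem_nth _ (ltn_ord i)).
Qed.

End Refinement.

Definition skip (T : Type) j (l : seq T) := take j l ++ drop j.+1 l.

Lemma size_skip (T : Type) j (l : seq T) n : size l = n.+1 -> (j < n.+1)%N -> size (skip j l) = n.
Proof. by move=> sl lj; rewrite /skip size_cat size_take size_drop sl lj; lia. Qed.

Lemma nth_skip (T : Type) (x0 : T) j (l : seq T) i :
  (j < size l)%N -> nth x0 (skip j l) i = nth x0 l (bump j i).
Proof.
move=> lj; rewrite /skip nth_cat size_take lj /bump; case: ltnP => h.
  by rewrite nth_take // leqNgt h.
by rewrite nth_drop add1n; congr nth; lia.
Qed.

Lemma deltaE (R : pzRingType) (I : Type) (c : seq I -> R) l :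
  delta c l = \sum_(j < size l) (-1) ^+ j * c (skip j l).
Proof.
elim: l c => [|x l IH] c /=; first by rewrite big_ord0.
rewrite big_ord_recl expr0 mul1r /skip /= drop0 IH -sumrN; congr (_ + _).
apply: eq_bigr => j _; rewrite /bump /= add1n exprS mulN1r mulNr; congr (- (_ * c _)).
Qed.

Lemma delta_size (R : pzRingType) (I : Type) (c : seq I -> R) l n : size l = n ->
  delta c l = \sum_(j < n) (-1) ^+ j * c (skip j l).
Proof. by move=> <-; apply: deltaE. Qed.

Section Presentations.
Context (k : closedFieldType) (E : elliptic_curve k).
Local Notation X := (surface E).
Local Notation pt := (Defs.point E).
Local Notation RV := (@RV k (surf E)).
Local Notation Rg := (@Rg k (surf E)).
Local Notation val_at := (@val_at k (surf E)).
Implicit Types (N : line_data E) (x y : X) (W : set X).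

(* The bundle N embedded in the constant sheaf of rational functions: the
   section with local expressions s_i corresponds to F = s_i / psi_i. *)
Record presented N (psi : lb_index N -> X -> k) : Prop := Presented {
  pr_open : forall i, open (lb_open (l := N) i);
  pr_cover : forall x, exists i, lb_open (l := N) i x;
  pr_gen : forall i, gen2 (fun y : X => psi i y != 0);
  pr_trans : forall i j x, lb_open (l := N) i x -> lb_open (l := N) j x ->
    RV x (fun y => psi i y / psi j y) (lb_trans i j x)
}.

(** The comparison is made over a whole open set because vanishing at one diagonal point says too
    little: divisibility by a local equation of the diagonal follows from vanishing at all nearby
    diagonal points. *)
Definition matches N (psi : lb_index N -> X -> k) m D := forall W F, open W ->
  (forall x, W x -> forall i, lb_open i x -> Rg x (fun y => psi i y * F y)) <->
  (forall x, W x -> St m D x F).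

Lemma open_near W x : open W -> W x -> \forall y \near x, W y.
Proof. by move=> oW Wx; apply: open_nbhs_nbhs; split. Qed.

Lemma open_gen W x : open W -> W x -> gen2 W.
Proof. exact: open_gen2. Qed.

Lemma near_forall (J : finType) (A : J -> set X) x :
  (forall j, nbhs x (A j)) -> nbhs x (fun y => forall j, A j y).
Proof.
move=> h; suff : nbhs x (fun y => forall j, j \in enum J -> A j y).
  by apply: filterS => y hy j; apply: hy; rewrite mem_enum.
elim: (enum J) => [|j r IH]; first by apply: filterE => y j.
apply: filterS (filterI (h j) IH) => y [h1 h2] i; rewrite inE => /orP[/eqP ->//|].
exact: h2.
Qed.

Section Fixed.
Context N (psi : lb_index N -> X -> k) (m : bool) (D : seq (bool * pt)).
Context (hP : presented psi) (hM : matches psi m D).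

(** A single quotient s_i0 / psi_i0 serves for all of W: nonempty open sets always meet, so the
    transition functions identify it generically with the other quotients. *)
Lemma function_of_section W (s : Defs.family N) : open W -> is_section W s ->
  exists F, forall x, W x -> forall i, lb_open i x -> RV x (fun y => psi i y * F y) (s i x).
Proof.
move=> oW [hreg htr].
have [i0 hi0] : exists i0, exists x, lb_open (l := N) i0 x.
  by have [i hi] := pr_cover hP (origin E, origin E); exists i, (origin E, origin E).
have [z hz] := hi0; exists (fun y => s i0 y / psi i0 y) => x Wx i xi.
have rx : RV x (s i) (s i x).
  by apply: regular_at_RV; apply: (hreg i x); split.
have gW := open_gen oW Wx; have gi := open_gen (pr_open hP i) xi.
have gi0 := open_gen (pr_open hP i0) hz.
apply: (RV_req rx).
have [y [[Wy yi] yi0]] := gen2_ex (gen2I (gen2I gW gi) gi0).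
have ht : RV y (s i) (s i y) by apply: regular_at_RV; apply: (hreg i y); split.
have hs0 : RV y (s i0) (s i0 y) by apply: regular_at_RV; apply: (hreg i0 y); split.
have e1 := req_val_at (ex_intro _ _ (pr_trans hP yi yi0)).
apply: gen2S (gen2I e1 (gen2I (gen2I gW gi) (gen2I gi0 (pr_gen hP i0)))) => u [e [[Wu ui] [ui0 p0]]].
rewrite (htr i i0 u Wu ui ui0) -(val_atE (pr_trans hP ui ui0)) e; field.
exact: p0.
Qed.

Lemma section_of_function W F : open W -> (forall x, W x -> St m D x F) ->
  is_section (L := N) W (fun i x => val_at x (fun y => psi i y * F y)) /\
  forall x, W x -> forall i, lb_open i x ->
    RV x (fun y => psi i y * F y) (val_at x (fun y => psi i y * F y)).
Proof.
move=> oW hF; have h := proj2 (hM F oW) hF.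
have hv x : W x -> forall i, lb_open i x ->
    RV x (fun y => psi i y * F y) (val_at x (fun y => psi i y * F y)).
  by move=> Wx i xi; apply: val_atP; apply: h.
split=> //; split=> [i|i j x Wx xi xj].
  apply: (RV_regular_on (F := fun y => psi i y * F y)).
    by apply: openI => //; apply: (pr_open hP).
  by move=> y [Wy yi]; apply: hv.
apply: (RV_uniq (hv x Wx i xi)).
apply: (RV_req (RVM (pr_trans hP xi xj) (hv x Wx j xj))).
by apply: gen2S (pr_gen hP j) => y p0; field.
Qed.

Lemma inter_open (U : open_cover E) p (a : 'I_p.+1 -> U) : open (inter a).
Proof.
rewrite openE => x xa; rewrite /interior.
apply: (filterS (P := fun y => forall i, oc_set (a i) y)); first by move=> y h i _; apply: h.
by apply: near_forall => i; apply: open_near; [apply: oc_open|apply: xa].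
Qed.

Definition represents (U : open_cover E) p (c : cochain N U p) (CC : ('I_p.+1 -> U) -> X -> k) :=
  forall a x, inter a x -> forall i, lb_open i x -> RV x (fun y => psi i y * CC a y) (c a i x).

Lemma cochain_represents (U : open_cover E) p (c : cochain N U p) :
  is_cochain c -> exists CC, represents c CC.
Proof.
move=> hc; have /choice [CC h] : forall a, exists F, forall x, inter a x ->
    forall i, lb_open i x -> RV x (fun y => psi i y * F y) (c a i x).
  by move=> a; apply: (function_of_section (inter_open a)); apply: hc.
by exists CC.
Qed.

Lemma represents_St (U : open_cover E) p (c : cochain N U p) CC a x :
  represents c CC -> inter a x -> St m D x (CC a).
Proof.
move=> h xa; apply: (proj1 (hM (CC a) (inter_open a))) => // y ya i yi.
by exists (c a i y); apply: h.
Qed.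

Lemma RV_differential (U : open_cover E) p (c : cochain N U p) CC a x i :
  represents c CC -> inter a x -> lb_open i x ->
  RV x (fun y => psi i y * \sum_(j < p.+2) (-1) ^+ j * CC (a \o lift j) y)
    (differential c a i x).
Proof.
move=> h xa xi; rewrite /differential.
have hs := RV_sum (S := surf E) (index_enum 'I_p.+2)
  (F := fun j y => (-1) ^+ (j : nat) * (psi i y * CC (a \o lift j) y))
  (v := fun j => (-1) ^+ (j : nat) * c (a \o lift j) i x) (x := x).
have {}hs : RV x _ _ := hs _.
apply: (RV_eq (hs _)) => // [j|y].
  apply: RVM; first exact: RV_cst.
  by apply: h => // j' _; apply: xa.
by rewrite mulr_sumr; apply: eq_bigr => j _; rewrite mulrCA.
Qed.

End Fixed.
End Presentations.
(** * Vanishing and nonvanishing of cohomology *)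

Definition list_of (T : Type) n (a : 'I_n -> T) : seq T := [seq a i | i <- enum 'I_n].

Lemma size_list_of (T : Type) n (a : 'I_n -> T) : size (list_of a) = n.
Proof. by rewrite size_map -cardE card_ord. Qed.

Lemma nth_list_of (T : Type) (v0 : T) n (a : 'I_n -> T) (i : 'I_n) : nth v0 (list_of a) i = a i.
Proof. by rewrite (nth_map i) ?nth_ord_enum // -cardE card_ord. Qed.

Lemma skip_list_of (T : Type) n (a : 'I_n.+1 -> T) (j : 'I_n.+1) :
  skip j (list_of a) = list_of (a \o lift j).
Proof.
have v0 := a ord0; apply: (@eq_from_nth _ v0) => [|i].
  by rewrite size_list_of (size_skip (size_list_of a)).
rewrite (size_skip (size_list_of a) (ltn_ord j)) => lti.
rewrite nth_skip ?size_list_of //.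
have -> : bump j i = lift j (Ordinal lti) by [].
by rewrite nth_list_of -[i]/(val (Ordinal lti)) nth_list_of.
Qed.

Section Cohomology.
Context (k : closedFieldType) (E : elliptic_curve k).
Local Notation X := (surface E).
Local Notation pt := (Defs.point E).
Local Notation RV := (@RV k (surf E)).
Local Notation req := (@req k (surf E)).
Local Notation val_at := (@val_at k (surf E)).
Implicit Types (x y : X).
Context (N : line_data E) (psi : lb_index N -> X -> k) (m : bool) (D : seq (bool * pt)).
Context (hP : presented psi) (hM : matches psi m D).

Lemma RV0_req W x F : open W -> W x -> (forall y, W y -> RV y F 0) -> req F (fun=> 0).
Proof.
move=> oW Wx h; have e := req_val_at (ex_intro _ _ (h x Wx)).
apply: gen2S (gen2I e (open_gen oW Wx)) => y [<- Wy].
exact: (val_atE (h y Wy)).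
Qed.

Lemma psi_cancel i F : req (fun y => psi i y * F y) (fun=> 0) -> req F (fun=> 0).
Proof.
move=> h; apply: gen2S (gen2I h (pr_gen hP i)) => y [/eqP].
by rewrite mulf_eq0 => /orP[/eqP ->|/eqP //]; rewrite eqxx.
Qed.

Section Refined.
Context (U : open_cover E) (J : finType) (V : J -> {mpoly k[3 + 3]}) (r : J -> U) (v0 : J).
Context (hV : is_affine_cover E V) (hr : forall v, nonvanishing (V v) `<=` oc_set (r v)).

Lemma refined_open v : open (nonvanishing (V v) : set X).
Proof. by have [d [e h]] := cover_bihomog hV v; apply: open_nonvanishing h. Qed.

Lemma refined_cover : \bigcup_v (nonvanishing (V v) : set X) = setT.
Proof. by apply/seteqP; split=> // x _; have [v hv] := cover_all hV x; exists v. Qed.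

Definition refined : open_cover E := OpenCover refined_open refined_cover.

Lemma inter_inV n (a : 'I_n.+1 -> refined) x : inter a x <-> inV V (list_of a) x.
Proof.
split=> [h v|h i _]; last by apply: h; apply: map_f; rewrite mem_enum.
by move=> /mapP [i _ ->]; apply: h.
Qed.

(** Translates simplices given as functions on an ordinal into lists, for which [exact] is
    stated. *)
Lemma zero_class_of_lists p (c : cochain N U p.+1) CC (B : seq J -> X -> k) :
  represents psi c CC ->
  (forall l, size l = p.+1 -> forall x, inV V l x -> St m D x (B l)) ->
  (forall l, size l = p.+2 ->
    gen2 (fun y : X => CC (fun i : 'I_p.+2 => r (nth v0 l i)) y = delta (B^~ y) l)) ->
  zero_class c.
Proof.
move=> hc hB eB; exists refined, r; split; first exact: hr.
pose b : cochain N refined p := fun a i x => val_at x (fun y => psi i y * B (list_of a) y).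
have hb (a : 'I_p.+1 -> refined) : is_section (inter a) (b a) /\
    forall x, inter a x -> forall i, lb_open i x -> RV x (fun y => psi i y * B (list_of a) y) (b a i x).
  apply: (section_of_function hP hM (inter_open a)) => x /inter_inV xa.
  by apply: hB; rewrite ?size_list_of.
have rb : represents psi b (fun a => B (list_of a)) by move=> a x xa i xi; apply: (proj2 (hb a)).
exists b; split=> [a|a i x xa xi]; first exact: (proj1 (hb a)).
have h1 : RV x (fun y => psi i y * CC (r \o a) y) (c (r \o a) i x).
  by apply: hc => // j _; apply: hr; apply: xa.
apply: (RV_uniq h1); apply: (RV_req (RV_differential rb xa xi)).
apply: gen2S (eB (list_of a) (size_list_of a)) => y.
have -> : (fun i : 'I_p.+2 => r (nth v0 (list_of a) i)) = r \o a.
  by apply/funext => j /=; rewrite nth_list_of.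
move=> ->; congr (_ * _); rewrite (delta_size _ (size_list_of a)).
by apply: eq_bigr => j _; rewrite skip_list_of.
Qed.

Definition list_cochain p (CC : ('I_p.+1 -> U) -> X -> k) (l : seq J) : X -> k :=
  CC (fun i : 'I_p.+1 => r (nth v0 l i)).

Lemma inter_of_list p (l : seq J) x : size l = p.+1 -> inV V l x ->
  inter (fun i : 'I_p.+1 => r (nth v0 l i)) x.
Proof.
by move=> sl xl i _; apply: hr; apply: xl; apply: mem_nth; rewrite sl.
Qed.

Lemma list_cochain_St p (c : cochain N U p) CC l x : represents psi c CC ->
  size l = p.+1 -> inV V l x -> St m D x (list_cochain CC l).
Proof. by move=> hc sl xl; apply: (represents_St hM hc); apply: inter_of_list. Qed.

Lemma inV_ex l : exists x : X, inV V l x.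
Proof.
suff h : gen2 (fun x : X => inV V l x) by exact: (gen2_ex h).
elim: l => [|v l IH]; first by apply: gen2_true => y w.
have [x hx] := cover_nonempty hV v.
have gv := open_gen (refined_open v) (hx : nonvanishing (V v) x).
apply: gen2S (gen2I gv IH) => y [h1 h2] w; rewrite inE => /orP[/eqP -> //|]; exact: h2.
Qed.

Lemma list_cochain_delta p (c : cochain N U p) CC l : is_cocycle c -> represents psi c CC ->
  size l = p.+2 -> gen2 (fun y : X => delta ((list_cochain CC)^~ y) l = 0).
Proof.
move=> [_ hc] rc sl; pose a := fun i : 'I_p.+2 => r (nth v0 l i).
have [x xl] := inV_ex l; have [i xi] := pr_cover hP x.
have h y : (inter a `&` lb_open i) y ->
    RV y (fun y => psi i y * \sum_(j < p.+2) (-1) ^+ j * CC (a \o lift j) y) 0.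
  by move=> [ya yi]; have := RV_differential rc ya yi; rewrite (hc a i y ya yi).
have oW : open (inter a `&` lb_open i) by apply: openI; [apply: inter_open|apply: (pr_open hP)].
have Wx : (inter a `&` lb_open i) x by split=> //; apply: inter_of_list.
apply: gen2S (psi_cancel (RV0_req oW Wx h)) => y <-.
rewrite (delta_size _ sl); apply: eq_bigr => j _; congr (_ * _).
rewrite /list_cochain; congr (CC _ y); apply/funext => i'.
by rewrite /a /= nth_skip ?sl.
Qed.

End Refined.

Lemma vanishing p :
  (forall (J : finType) (V : J -> {mpoly k[3 + 3]}), is_affine_cover E V ->
    exact m D V p.+1 (fun=> True)) -> ~ cohomology_nonzero N p.+1.
Proof.
move=> hex [U [c [hc nz]]]; apply: nz.
have [J [V [hV /choice [r hr]]]] := affine_refinement U.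
have [v0 _] := inhabitedV hV.
have [CC rc] := cochain_represents hP (proj1 hc).
have [||B [hB eB]] := hex J V hV (list_cochain r v0 CC).
- by move=> l sl x [_ xl]; apply: (list_cochain_St v0 hr rc).
- by move=> l sl; apply: (list_cochain_delta v0 hV hr hc rc).
apply: (zero_class_of_lists (v0 := v0) hV hr rc (B := B)) => // l sl x xl.
by apply: hB.
Qed.

(** The cocycle condition on the edge between two members of the cover makes the components of a
    0-cocycle agree generically. Each of them is thus a global section, hence zero. *)
Lemma vanishing0 : (forall F, (forall x, St m D x F) -> req F (fun=> 0)) ->
  ~ cohomology_nonzero N 0.
Proof.
move=> h0 [U [c [hc nz]]]; apply: nz; exists U, id; split=> [v y //|a i x xa xi].
have [CC rc] := cochain_represents hP (proj1 hc).
suff e : req (CC a) (fun=> 0).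
  apply: (RV_uniq (rc a x xa i xi)).
  apply: (RV_req (RV_cst (S := surf E) x 0)); apply: gen2S e => y ->; by rewrite mulr0.
apply: h0 => y.
have [u _ yu] : (\bigcup_(u : U) oc_set u) y by rewrite oc_cover.
pose a' : 'I_1 -> U := fun=> u.
have ya' : inter a' y by move=> j _.
apply: (St_req (represents_St hM rc ya')).
pose d : 'I_2 -> U := fun j => if j == ord0 then a ord0 else u.
have oI : open (inter a `&` inter a') by apply: openI; apply: inter_open.
have [z [za za']] := gen2_ex (gen2I (open_gen (inter_open a) xa) (open_gen (inter_open a') ya')).
have e0 : d \o lift ord0 = a'.
  by apply/funext => j; rewrite /d /=.
have e1 : d \o lift (lift ord0 ord0) = a.
  by apply/funext => j; rewrite (ord1 j) /d /=; congr a; apply: val_inj.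
have dI t : inter a t -> inter a' t -> inter d t.
  move=> ta ta' j _; rewrite /d; case: eqP => _; first exact: ta.
  exact: (ta' ord0).
have [j zj] := pr_cover hP z.
have oW : open ((inter a `&` inter a') `&` lb_open j).
  by apply: openI => //; apply: (pr_open hP).
have h t : ((inter a `&` inter a') `&` lb_open j) t ->
    RV t (fun y => psi j y * (CC a' y - CC a y)) 0.
  move=> [[ta ta'] tj]; have := RV_differential rc (dI t ta ta') tj.
  rewrite (proj2 hc d j t (dI t ta ta') tj) => h; apply: (RV_eq h) => // s.
  by rewrite !big_ord_recl big_ord0 e0 e1 expr0 mul1r addr0 expr1 mulN1r.
have := psi_cancel (RV0_req oW (conj (conj za za') zj) h).
by apply: gen2S => s /eqP; rewrite subr_eq0 => /eqP.
Qed.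

Lemma global_cochain F : (forall x, St m D x F) -> forall (U : open_cover E),
  exists c : cochain N U 0, is_cocycle c /\ represents psi c (fun _ => F).
Proof.
move=> hF U; have oT : open [set: X] by apply: openT.
have [hs hv] := section_of_function hP hM oT (fun x _ => hF x).
pose c : cochain N U 0 := fun _ i x => val_at x (fun y => psi i y * F y).
have rc : represents psi c (fun _ => F) by move=> a x _ i xi; apply: hv.
exists c; split=> //; split=> [a|a i x xa xi].
  have [_ hv'] := section_of_function hP hM (inter_open a) (fun x _ => hF x).
  exact: (proj1 (section_of_function hP hM (inter_open a) (fun x _ => hF x))).
rewrite /differential !big_ord_recl big_ord0 /c expr0 expr1 mul1r mulN1r addr0.
by rewrite subrr.
Qed.

Lemma nonvanishing0 F : (forall x, St m D x F) -> ~ req F (fun=> 0) -> cohomology_nonzero N 0.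
Proof.
move=> hF nF.
have hc : \bigcup_(a : unit) [set: X] = setT by apply/seteqP; split=> // x _; exists tt.
pose U := @OpenCover k E unit (fun _ => setT) (fun _ => openT) hc.
have [c [cc rc]] := global_cochain hF U; exists U, c; split=> // -[V [r [hr hz]]].
apply: nF; have [i xi] := pr_cover hP (origin E, origin E).
apply: (psi_cancel (i := i)); apply: (RV0_req (pr_open hP i) xi) => y yi.
have [v _ yv] : (\bigcup_(v : V) oc_set v) y by rewrite oc_cover.
have yI : inter (fun _ : 'I_1 => v) y by [].
have := hz (fun _ => v) i y yI yi; rewrite /= => e.
by rewrite -e; apply: rc => // j _; apply: hr.
Qed.

(* A 1-cochain of differences of local functions is a coboundary only if these
   functions come from a global one modulo sections. *)
Lemma zero_class_glue (U : open_cover E) (rho : U -> X -> k) (c : cochain N U 1) :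
  (forall u w x, oc_set u x -> oc_set w x -> St m D x (fun y => rho w y - rho u y)) ->
  represents psi c (fun a y => rho (a (lift ord0 ord0)) y - rho (a ord0) y) ->
  zero_class c -> exists F, forall u x, oc_set u x -> St m D x (fun y => rho u y - F y).
Proof.
move=> hrho rc [V [r [hr [b [hb eb]]]]].
have [BB rb] := cochain_represents hP hb.
pose bb v := BB (fun _ : 'I_1 => v).
have inter1 v x : oc_set v x -> inter (fun _ : 'I_1 => v : V) x by move=> h j _.
have hbb v x : oc_set v x -> St m D x (bb v).
  by move=> vx; apply: (represents_St hM rb (inter1 v x vx)).
have [v0 _ xv0] : (\bigcup_(v : V) oc_set v) (origin E, origin E) by rewrite oc_cover.
(* On the edge joining v0 and v the two coboundaries agree, so rho (r v) - bb v does not depend on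
   v; it is the global function sought. *)
have key v x : oc_set v x -> req (fun y => rho (r v) y - rho (r v0) y) (fun y => bb v y - bb v0 y).
  move=> vx; pose a : 'I_2 -> V := fun j => if j == ord0 then v0 else v.
  have oI : open (oc_set v `&` oc_set v0) by apply: openI; apply: oc_open.
  have [z [zv zv0]] := gen2_ex (gen2I (open_gen (oc_open v) vx) (open_gen (oc_open v0) xv0)).
  have [i zi] := pr_cover hP z.
  have oW : open ((oc_set v `&` oc_set v0) `&` lb_open i) by apply: openI => //; apply: (pr_open hP).
  have h t : ((oc_set v `&` oc_set v0) `&` lb_open i) t ->
      RV t (fun y => psi i y * ((rho (r v) y - rho (r v0) y) - (bb v y - bb v0 y))) 0.
    move=> [[tv tv0] ti].
    have ta : inter a t by move=> j _; rewrite /a; case: eqP.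
    have tra : inter (r \o a) t by move=> j _; apply: hr; apply: ta.
    have h1 := rc (r \o a) t tra i ti; have h2 := RV_differential rb ta ti.
    have := RVB h1 h2; rewrite (eb a i t ta ti) subrr => h3; apply: (RV_eq h3) => // s.
    have e0 : a \o lift ord0 = fun=> v by apply/funext => j; rewrite /a /=.
    have e1 : a \o lift (lift ord0 ord0) = fun=> v0.
      by apply/funext => j; rewrite (ord1 j) /a.
    by rewrite !big_ord_recl big_ord0 e0 e1 expr0 expr1 mul1r mulN1r addr0 -mulrBr.
  have := psi_cancel (RV0_req oW (conj (conj zv zv0) zi) h).
  by apply: gen2S => s /eqP; rewrite subr_eq0 => /eqP.
exists (fun y => rho (r v0) y - bb v0 y) => u x ux.
have [v _ xv] : (\bigcup_(v : V) oc_set v) x by rewrite oc_cover.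
have h := StD (hrho (r v) u x (hr v x xv) ux) (hbb v x xv).
apply: (St_req h); apply: gen2S (key v x xv) => y /eqP.
rewrite subr_eq => /eqP e; have -> : rho (r v) y = bb v y - bb v0 y + rho (r v0) y := e.
by ring.
Qed.

Lemma difference_cochain (U : open_cover E) (rho : U -> X -> k) :
  (forall u w x, oc_set u x -> oc_set w x -> St m D x (fun y => rho w y - rho u y)) ->
  exists c : cochain N U 1, is_cocycle c /\
    represents psi c (fun a y => rho (a (lift ord0 ord0)) y - rho (a ord0) y).
Proof.
move=> hrho; pose CC (a : 'I_2 -> U) y := rho (a (lift ord0 ord0)) y - rho (a ord0) y.
have hs a := section_of_function hP hM (inter_open (a : 'I_2 -> U))
  (fun x xa => hrho (a ord0) (a (lift ord0 ord0)) x (xa ord0 I) (xa (lift ord0 ord0) I)).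
pose c : cochain N U 1 := fun a i x => val_at x (fun y => psi i y * CC a y).
have rc : represents psi c CC by move=> a x xa i xi; apply: (proj2 (hs a)).
exists c; split=> //; split=> [a|a i x xa xi]; first exact: (proj1 (hs a)).
apply: (RV_uniq (RV_differential rc xa xi)).
apply: (RV_eq (RV_cst (S := surf E) x 0)) => // y.
rewrite !big_ord_recl big_ord0 /CC /= expr0 expr1 /bump /= addr0 !mul1r.
have -> : lift ord0 (lift ord0 ord0) = Ordinal (isT : 2 < 3)%N by apply: val_inj.
rewrite (_ : lift (lift ord0 ord0) (lift ord0 ord0) = Ordinal (isT : 2 < 3)%N :> 'I_3); last exact: val_inj.
rewrite (_ : lift (Ordinal (isT : 2 < 3)%N) (lift ord0 ord0) = Ordinal (isT : 1 < 3)%N :> 'I_3); last exact: val_inj.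
rewrite (_ : lift (lift ord0 ord0) ord0 = ord0 :> 'I_3); last exact: val_inj.
rewrite (_ : lift (Ordinal (isT : 2 < 3)%N) ord0 = ord0 :> 'I_3); last exact: val_inj.
rewrite (_ : lift ord0 ord0 = Ordinal (isT : 1 < 3)%N :> 'I_3); last exact: val_inj.
ring.
Qed.

Lemma nonvanishing1 (U : open_cover E) (rho : U -> X -> k) :
  (forall u w x, oc_set u x -> oc_set w x -> St m D x (fun y => rho w y - rho u y)) ->
  ~ (exists F, forall u x, oc_set u x -> St m D x (fun y => rho u y - F y)) ->
  cohomology_nonzero N 1.
Proof.
move=> hrho nF; have [c [hc rc]] := difference_cochain hrho.
by exists U, c; split=> // /(zero_class_glue hrho rc).
Qed.

End Cohomology.

(** * A Künneth decomposition *)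

(* Dual basis: a finite sum of products r_i(a) m_i(b) is determined by its
   restrictions to finitely many values of b. *)
Lemma dual_points (k : fieldType) (A B : Type) (S : B -> Prop) n (r : 'I_n -> A -> k) (m : 'I_n -> B -> k) :
  exists t (b : 'I_t -> B) (c : 'I_t -> 'I_n -> k), (forall s, S (b s)) /\
    forall a x, S x -> \sum_i r i a * m i x =
      \sum_s (\sum_i r i a * m i (b s)) * \sum_i c s i * m i x.
Proof.
elim: n r m => [|n IH] r m.
  by exists 0%N, (fun s : 'I_0 => match s with Ordinal _ i => False_rect _ (Bool.diff_false_true i) end),
    (fun _ _ => 0); split=> [[]//|a x _]; rewrite !big_ord0.
have [[b0 [Sb0 mb0]]|h0] := pselect (exists b0, S b0 /\ m ord_max b0 != 0); last first.
  have m0 x : S x -> m ord_max x = 0.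
    by move=> Sx; apply/eqP/negPn/negP => mx; apply: h0; exists x.
  have [t [b [c [Sb e]]]] := IH (fun i => r (widen_ord (leqnSn n) i)) (fun i => m (widen_ord (leqnSn n) i)).
  exists t, b, (fun s i => if unlift ord_max i is Some j then c s j else 0); split=> // a x Sx.
  rewrite big_ord_recr /= m0 // mulr0 addr0 e //; apply: eq_bigr => s _.
  rewrite [in RHS]big_ord_recr /= m0 // mulr0 addr0; congr (_ * _).
  rewrite [in RHS]big_ord_recr /= m0 // mulr0 addr0; apply: eq_bigr => i _; congr (_ * _).
  by rewrite (_ : widen_ord _ i = lift ord_max i) ?liftK //; apply: val_inj; rewrite /= /bump leqNgt ltn_ord.
(* Gaussian elimination with the value of the last m at b0 as pivot: each m_i - w_i m_max vanishes
   at b0. *)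
pose w i := m (widen_ord (leqnSn n) i) b0 / m ord_max b0.
have [t [b [c [Sb e]]]] := IH (fun i => r (widen_ord (leqnSn n) i))
  (fun i x => m (widen_ord (leqnSn n) i) x - w i * m ord_max x).
exists t.+1, (fun s => if unlift ord_max s is Some s' then b s' else b0).
pose cm s := \sum_i c s i * w i.
pose cs (s : 'I_t) (i : 'I_n.+1) := if unlift ord_max i is Some j then c s j else - cm s.
exists (fun s i => if unlift ord_max s is Some s' then cs s' i else
  (if i == ord_max then 1 else 0) / m ord_max b0 - \sum_s' m ord_max (b s') / m ord_max b0 * cs s' i).
split=> [s|a x Sx]; first by case: unliftP.
have wl N (j : 'I_N) : widen_ord (leqnSn N) j = lift ord_max j.
  by apply: val_inj; rewrite /= /bump leqNgt ltn_ord.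
have csx s y : \sum_i cs s i * m i y = \sum_i c s i * (m (widen_ord (leqnSn n) i) y - w i * m ord_max y).
  rewrite big_ord_recr /= /cs unlift_none /cm mulNr mulr_suml -sumrB.
  by apply: eq_bigr => i _; rewrite wl liftK; ring.
pose F y := \sum_i r i a * m i y.
pose G y := \sum_i r (widen_ord (leqnSn n) i) a * (m (widen_ord (leqnSn n) i) y - w i * m ord_max y).
have FG y : F y = G y + F b0 / m ord_max b0 * m ord_max y.
  rewrite /F /G [in LHS]big_ord_recr /= [X in X / _]big_ord_recr /= mulrDl mulfK // mulrDl addrA.
  congr (_ + _); rewrite !mulr_suml -big_split; apply: eq_bigr => i _ /=; rewrite /w.
  by ring.
rewrite -/(F x) [RHS]big_ord_recr /= unlift_none.
rewrite (eq_bigr (fun s => F (b s) * \sum_i cs s i * m i x)); last first.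
  by move=> s _; rewrite wl liftK.
have -> : \sum_i ((if i == ord_max then 1 else 0) / m ord_max b0 -
    \sum_s' m ord_max (b s') / m ord_max b0 * cs s' i) * m i x =
    m ord_max x / m ord_max b0 - \sum_s m ord_max (b s) / m ord_max b0 * \sum_i cs s i * m i x.
  under eq_bigr => i _ do rewrite mulrBl.
  rewrite sumrB; congr (_ - _).
    rewrite big_ord_recr /= eqxx big1 ?add0r => [|i _]; first by rewrite div1r mulrC.
    by rewrite wl eq_sym (negbTE (neq_lift _ _)) !mul0r.
  under eq_bigr => i _ do rewrite mulr_suml.
  rewrite exchange_big; apply: eq_bigr => s _; rewrite mulr_sumr.
  by apply: eq_bigr => i _; rewrite /= mulrA.
rewrite FG {1}/G e // -/(F b0) mulrBr addrCA addrC; congr (_ + _); first last.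
  by rewrite mulrA mulrAC.
rewrite mulr_sumr -sumrB; apply: eq_bigr => s _; rewrite csx (FG (b s)) -/(G (b s)); ring.
Qed.

Lemma RV_prod (k : fieldType) (S : rspace k) (x : S) (I : Type) (r : seq I)
    (F : I -> S -> k) (v : I -> k) : (forall i, RV x (F i) (v i)) ->
  RV x (fun y => \prod_(i <- r) F i y) (\prod_(i <- r) v i).
Proof.
move=> hF; elim: r => [|i r IH].
  by apply: RV_eq (RV_cst x 1) _ _ => [y|]; rewrite big_nil.
by apply: RV_eq (RVM (hF i) IH) _ _ => [y|]; rewrite big_cons.
Qed.

Section Kunneth.
Context (k : closedFieldType) (E : elliptic_curve k).
Local Notation pt := (Defs.point E).
Local Notation X := (surface E).
Local Notation RVE := (@RV k (curve E)).
Local Notation RgE := (@Rg k (curve E)).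
Local Notation Rg := (@Rg k (surf E)).
Local Notation req := (@req k (surf E)).
Local Notation o := (origin E).
Implicit Types (a l : 'I_3 -> k) (b p : pt) (f g : pt -> k) (F G : X -> k) (P : seq pt) (x y : X).

(** Provides the hypothesis of [RV_line1] and [RV_line2]: almost everywhere, the true value of f is
    the one that the function takes. *)
Lemma honest b f : RgE b f -> cofin (fun Q => RVE Q f (f Q)).
Proof.
move=> [v [g [hg _ fg]]]; have hg' := ratfun_gen (S := curve E) hg.
apply: cofinS (cofinI fg hg') => Q [e r]; exists g; split=> //.
Qed.

Lemma RV_lin l (l' : 'I_3 -> k) b : lin l b != 0 ->
  RVE b (fun Q => lin l' Q / lin l Q) (lin l' b / lin l b).
Proof.
move=> lb; apply: RV_eq (RV_sum (S := curve E) (x := b) (index_enum 'I_3)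
  (F := fun i Q => l' i * (hcoord Q i / lin l Q))
  (v := fun i => l' i * (hcoord b i / lin l b)) _) _ _ => [i|Q|].
- by apply: (RVM (S := curve E)); [exact: RV_cst | exact: RV_lin_coord].
- by rewrite /lin mulr_suml; apply: eq_bigr => i _; rewrite mulrA.
- by rewrite /lin mulr_suml; apply: eq_bigr => i _; rewrite mulrA.
Qed.

Definition kl (p : pt) : 'I_3 -> k := if p == o then lz k false else ly (hY p).

Lemma lin_kl p : lin (kl p) p = 0.
Proof.
rewrite /kl; case: eqVneq => [->|po]; first by rewrite lin_lz hZ_origin.
by rewrite lin_ly (hZ1 po) mulr1 subrr.
Qed.

Lemma cofin_kl p : cofin (fun Q : pt => lin (kl p) Q != 0).
Proof.
rewrite /kl; case: eqVneq => [_|po].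
  by apply: cofinS (cofin_neq o) => Q Qo; rewrite lin_lz hZ_neq0.
by apply: (@cofin_lin _ _ _ o); rewrite lin_ly hZ_origin mulr0 subr0 hY_o_neq0.
Qed.

Definition fdiv P : seq (bool * pt) := [seq (false, p) | p <- P].
Definition base a (a' : 'I_3 -> k) b := lin a b != 0 /\ lin a' b != 0.
Definition U01 (c : k) b := b != o /\ hY b != c.

Lemma mu_fdiv P (b b' d d' e e' : pt) :
  mu (fdiv P) (b, d) (b', d') = mu (fdiv P) (b, e) (b', e').
Proof. by rewrite /mu !big_map. Qed.

Lemma mu_fdiv1 P x y : \prod_(p <- P) lin (kl p) x.1 != 0 -> mu (fdiv P) x y = 1.
Proof.
elim: P => [|p P IH]; first by rewrite mu_nil.
rewrite big_cons mulf_eq0 negb_or => /andP[px /IH e].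
rewrite -[fdiv _]/((false, p) :: fdiv P) mu_cons e mulr1 /mu1 /=; case: eqVneq => // xp.
by rewrite xp lin_kl eqxx in px.
Qed.

Lemma cofin_base a (a' : 'I_3 -> k) b : base a a' b -> cofin (base a a').
Proof. by move=> [h h']; apply: cofinI (cofin_lin h) (cofin_lin h'). Qed.

Lemma cofin_U01 c : cofin (U01 c).
Proof.
apply: cofinI (cofin_neq o) _; apply: cofinS (@cofin_hY _ E [:: c]) => Q.
by rewrite inE.
Qed.

Lemma cofin_kls P : cofin (fun Q : pt => \prod_(p <- P) lin (kl p) Q != 0).
Proof.
elim: P => [|p P IH]; first by apply: cofin_true => Q; rewrite big_nil oner_neq0.
by apply: cofinS (cofinI (cofin_kl p) IH) => Q [h h']; rewrite big_cons mulf_neq0.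
Qed.

Lemma splits_sum c (I : Type) (r : seq I) (u : I -> k) (f : I -> pt -> k) :
  (forall i, splits c (f i)) -> splits c (fun Q => \sum_(i <- r) u i * f i Q).
Proof.
move=> hf; elim: r => [|i r IH].
  apply: splits_req (splits_left c (f := fun=> 0) _) _ => [b _|]; first exact: Rg_cst.
  by apply: cofin_true => Q; rewrite big_nil.
apply: splits_req (splitsD (u i) 1 (hf i) IH) _.
by apply: cofin_true => Q; rewrite big_cons mul1r.
Qed.

(** On the chart, F is a polynomial over a power of g, and expanding the numerator gives F = sum_j
    R_j(a) M_j(b). The M_j are monomials in x and y over powers of y - c, so they split. The R_j may
    have too many poles, but [dual_points] replaces them by restrictions of F to finitely many b,
    which inherit the pole bounds of F. *)
Lemma kunneth a (a' : 'I_3 -> k) c P F : (exists b : pt, base a a' b) ->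
  (forall x, base a a' x.1 -> U01 c x.2 -> Rg x (fun y => mu (fdiv P) x y * F y)) ->
  exists t (r n : 'I_t -> pt -> k),
    [/\ forall s b (d : pt), base a a' b -> RgE b (fun Q => mu (fdiv P) (b, d) (Q, d) * r s Q),
     forall s, splits c (n s) & req F (fun y => \sum_s r s y.1 * n s y.2)].
Proof.
move=> [b0 hb0] hF.
pose L (s : bool) := if s then lz k true else a.
pose g : {mpoly k[3 + 3]} := lform false a' * \prod_(p <- P) lform false (kl p) * lform true (ly c).
pose ga b := lin a' b / lin a b * \prod_(p <- P) (lin (kl p) b / lin a b).
pose gb b := lin (ly c) b / lin (lz k true) b.
have gE y : pol L g y = ga y.1 * gb y.2.
  rewrite /g !polM !pol_lform /=; congr (_ * _ * _).
  elim: (P) => [|p P' IH]; first by rewrite !big_nil pol1.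
  by rewrite !big_cons polM pol_lform IH.
have gaN b : lin a b != 0 -> ga b != 0 -> base a a' b /\ \prod_(p <- P) lin (kl p) b != 0.
  move=> ab; rewrite /ga !mulf_eq0 !negb_or => /andP[/andP[h _] h']; split=> //.
  apply: contraNN h'; elim: (P) => [|p P' IH]; first by rewrite big_nil oner_eq0.
  by rewrite !big_cons !mulf_eq0 => /orP[->//|/IH ->]; rewrite orbT.
have gaP b : base a a' b -> \prod_(p <- P) lin (kl p) b != 0 -> ga b != 0.
  move=> [h h'] e; apply: mulf_neq0; first by rewrite mulf_neq0 ?invr_eq0.
  move: e; elim: (P) => [|p P' IH]; first by rewrite !big_nil.
  by rewrite !big_cons mulf_eq0 negb_or => /andP[e /IH e']; rewrite !mulf_neq0 ?invr_eq0.
have gbP b : U01 c b -> gb b != 0.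
  by move=> [bo bc]; rewrite /gb lin_ly lin_lz (hZ1 bo) mulr1 divr1 subr_eq0.
have gbN b : hZ b != 0 -> gb b != 0 -> U01 c b.
  rewrite hZ_neq0 => bo; rewrite /gb lin_ly lin_lz (hZ1 bo) mulr1 divr1 subr_eq0; by split.
have [a1 [ba1 ka1]] := cofin_ex (cofinI (cofin_base hb0) (cofin_kls P)).
have [b1 ub1] := cofin_ex (cofin_U01 c).
have [|x cx|n [q hq]] := @pol_of_Rg _ E L g F.
- exists (a1, b1); split; first by case; rewrite /= ?lin_lz ?hZ_neq0; [case: ub1|case: ba1].
  by rewrite gE mulf_neq0 ?gaP ?gbP.
- rewrite gE mulf_eq0 negb_or => /andP[g1 g2].
  have [bx kx] := gaN _ (cx false) g1.
  have ux : U01 c x.2 by apply: gbN => //; move: (cx true); rewrite /= lin_lz.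
  by apply: Rg_eq (hF _ bx ux) _ => y; rewrite mu_fdiv1 // mul1r.
pose N := size (msupp q).
pose mm (j : 'I_N) : 'X_{1..3 + 3} := nth 0%MM (msupp q) j.
pose R j b := q@_(mm j) * \prod_(i < 3) (hcoord b i / lin a b) ^+ mm j (lshift 3 i) / ga b ^+ n.
pose M j b := \prod_(i < 3) (hcoord b i / lin (lz k true) b) ^+ mm j (rshift 3 i) / gb b ^+ n.
have qE y : pol L q y = \sum_j (q@_(mm j) *
    \prod_(i < 3) (hcoord y.1 i / lin a y.1) ^+ mm j (lshift 3 i)) *
    \prod_(i < 3) (hcoord y.2 i / lin (lz k true) y.2) ^+ mm j (rshift 3 i).
  rewrite /pol mevalE (big_nth 0%MM) big_mkord; apply: eq_bigr => j _.
  rewrite big_split_ord /= mulrA; congr (_ * _ * _); apply: eq_bigr => i _.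
    by rewrite (affc_var L false i y).
  by rewrite (affc_var L true i y).
have FE : req F (fun y => \sum_j R j y.1 * M j y.2).
  have h : gen2 (fun y : X => ga y.1 != 0 /\ gb y.2 != 0).
    apply: cofinS (cofinI (cofin_base hb0) (cofin_kls P)) => b [h h'].
    by apply: cofinS (cofin_U01 c) => b' /gbP; split=> //; apply: gaP.
  apply: gen2S (gen2I hq h) => y [e [ay by_]].
  apply: (mulfI (x := pol L g y ^+ n)); first by rewrite gE expf_neq0 // mulf_neq0.
  rewrite e qE mulr_sumr; apply: eq_bigr => j _; rewrite gE /R /M exprMn.
  have h1 := expf_neq0 n ay; have h2 := expf_neq0 n by_.
  by move: (\prod_i _) (\prod_i _) => u v; field; rewrite h1 h2.
have hzU b : U01 c b -> lin (lz k true) b != 0 by move=> [bo _]; rewrite lin_lz hZ_neq0.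
have MV j b : U01 c b -> RVE b (M j) (M j b).
  move=> ub; apply: (RVf (S := curve E)); last by rewrite expf_neq0 ?gbP.
    by apply: (RV_prod (S := curve E)) => i; apply: RVX; apply: RV_lin_coord; apply: hzU.
  by apply: RVX; apply: RV_lin; apply: hzU.
have RRV j b : base a a' b -> \prod_(p <- P) lin (kl p) b != 0 -> RVE b (R j) (R j b).
  move=> bb kb; have [ab _] := bb; apply: (RVf (S := curve E)); last by rewrite expf_neq0 ?gaP.
    apply: (RVM (S := curve E)); first exact: RV_cst.
    by apply: (RV_prod (S := curve E)) => i; apply: RVX; apply: RV_lin_coord.
  apply: RVX; apply: (RVM (S := curve E)); first exact: RV_lin.
  by apply: (RV_prod (S := curve E)) => p; apply: RV_lin.
have [t [bs [cs [hbs dual]]]] := dual_points (U01 c) R M.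
exists t, (fun s b => \sum_j R j b * M j (bs s)), (fun s b => \sum_j cs s j * M j b); split.
- move=> s b d bb; pose h e := mu (fdiv P) (b, d) (e, d).
  have hE y : mu (fdiv P) (b, d) y = h y.1 by case: y => *; apply: mu_fdiv.
  have Rh : RgE b h.
    rewrite /h; elim: (P) => [|p P' IH]; first by apply: Rg_eq (Rg_cst (S := curve E) b 1) _ => Q; rewrite mu_nil.
    have R1 : RgE b (fun Q => mu1 (false, p) (b, d) (Q, d)).
      rewrite /mu1 /=; case: eqVneq => [->|_]; last exact: (Rg_cst (S := curve E)).
      by exists 0; apply: RV_tauV.
    by apply: Rg_eq (RgM (S := curve E) R1 IH) _ => Q; rewrite -[fdiv (p :: P')]/((false, p) :: fdiv P') mu_cons.
  pose G y := h y.1 * \sum_j R j y.1 * M j y.2.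
  have [v hv] : Rg (b, bs s) G.
    apply: Rg_req (hF (b, bs s) bb (hbs s)) _; apply: gen2S FE => -[b' d'] /= ->.
    by rewrite /G /h (mu_fdiv _ _ _ _ _ d d).
  have {}hv : RVE b (fun e => G (e, bs s)) v.
    apply: RV_line1 hv _.
    apply: cofinS (cofinI (honest Rh) (cofinI (cofin_base hb0) (cofin_kls P))) => e [he [be ke]].
    apply: RVM; first exact: (RV_fst (x := (e, bs s))).
    apply: RV_sum => j; apply: RVM; first by apply: (RV_fst (x := (e, bs s))); apply: RRV.
    exact: (RV_snd (x := (e, bs s)) (MV j _ (hbs s))).
  by exists v.
- move=> s; apply: splits_sum => j.
  apply: splits_req (splits_monomial E c (mm j (rshift 3 i0)) (mm j (rshift 3 i1)) n) _.
  apply: cofinS (cofin_neq o) => Q Qo; rewrite /M /gb lin_ly lin_lz (hZ1 Qo) !big_ord_recl big_ord0.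
  have e0 : ord0 = i0 by apply: val_inj.
  have e1 : lift ord0 ord0 = i1 by apply: val_inj.
  have e2 : lift ord0 (lift ord0 ord0) = i2 by apply: val_inj.
  rewrite e2 e1 e0 -[hcoord Q i2]/(hZ Q) (hZ1 Qo) !divr1 !mulr1 expr1n mulr1.
  by rewrite -/(hX Q) -/(hY Q).
apply: gen2S (gen2I FE (_ : gen2 (fun y => U01 c y.2))) => [y [-> uy]|]; first exact: dual.
by apply: cofin_true => e; apply: cofin_U01.
Qed.
End Kunneth.

(** * Splitting sections along each factor *)

Section Splitting.
Context (k : closedFieldType) (E : elliptic_curve k).
Local Notation pt := (Defs.point E).
Local Notation X := (surface E).
Local Notation RVE := (@RV k (curve E)).
Local Notation RgE := (@Rg k (curve E)).
Local Notation RV := (@RV k (surf E)).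
Local Notation Rg := (@Rg k (surf E)).
Local Notation req := (@req k (surf E)).
Local Notation o := (origin E).
Local Notation Cv := (curve E).
Implicit Types (a l : 'I_3 -> k) (b p q : pt) (f g : pt -> k) (F G : X -> k) (P : seq pt) (x y : X).

Definition pole_le q b f := RgE b (fun Q => (if b == q then (tau q Q)^-1 else 1) * f Q).

Lemma Rg_pole_le q b f : RgE b f -> pole_le q b f.
Proof.
move=> hf; apply: RgM => //; case: eqVneq => [->|_]; last exact: Rg_cst.
by exists 0; apply: RV_tauV.
Qed.

Lemma pole_le_Rg q b f : b != q -> pole_le q b f -> RgE b f.
Proof. by rewrite /pole_le => /negbTE -> h; apply: Rg_eq h _ => Q; rewrite mul1r. Qed.

Lemma pole_leD q b f g u : pole_le q b f -> pole_le q b g ->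
  pole_le q b (fun Q => f Q + u * g Q).
Proof.
move=> hf hg; apply: Rg_eq (RgD hf (RgM (Rg_cst (S := Cv) b u) hg)) _ => Q.
by rewrite mulrDr mulrCA.
Qed.

Lemma phi_split q c : (q != o -> hY q = c) -> exists al be : pt -> k,
  [/\ forall b, b != o -> pole_le q b al,
      forall b, b = o \/ hY b != c -> pole_le q b be &
      forall Q, phi_ c Q = al Q - be Q].
Proof.
move=> hq; have [->|qo] := eqVneq q o.
  exists (fun=> 0), (fun Q => - phi_ c Q); split=> [b _|b hb|Q]; last by rewrite opprK add0r.
    by apply: Rg_pole_le; apply: (Rg_cst (S := Cv)).
  have [bo|bo] := eqVneq b o; last first.
    apply: Rg_pole_le; apply: Rg_eq (RgM (Rg_cst (S := Cv) b (-1)) (Rg_phi_ (c := c) bo _)) _.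
      by case: hb => // e; rewrite e eqxx in bo.
    by move=> Q; rewrite mulN1r.
  rewrite /pole_le bo eqxx tau_o.
  apply: Rg_eq (RgM (Rg_cst (S := Cv) o (-1)) (ex_intro _ _ (RV_phi_ratio E c))) _ => Q.
  by rewrite mulN1r mulrN mulrC.
exists (sg q), (fun Q => sg q Q - phi_ c Q); split=> [b bo|b hb|Q]; last by rewrite subKr.
  have [->|bq] := eqVneq b q; last by apply: Rg_pole_le; apply: Rg_sg.
  rewrite /pole_le eqxx; apply: Rg_req (Rg_cst (S := Cv) q 1) _.
  by apply: cofinS (gen_tau q) => Q tQ; rewrite -(tau_sg qo) mulVf.
apply: Rg_pole_le; have [->|bo] := eqVneq b o; first exact: Rg_sg_phi_.
have hb' : hY b != c by case: hb => // e; rewrite e eqxx in bo.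
apply: RgB; last exact: Rg_phi_.
by apply: Rg_sg => //; apply: contraNneq hb' => ->; rewrite hq.
Qed.

Lemma splits_pole q c f : (q != o -> hY q = c) -> splits c f -> exists al be : pt -> k,
  [/\ forall b, b != o -> pole_le q b al,
      forall b, b = o \/ hY b != c -> pole_le q b be &
      cofin (fun Q => f Q = al Q - be Q)].
Proof.
move=> /phi_split [a1 [b1 [ha1 hb1 e1]]] [a0 [b0 [e [ha0 hb0 e0]]]].
exists (fun Q => a0 Q + e * a1 Q), (fun Q => b0 Q + e * b1 Q); split=> [b bo|b hb|].
- by apply: pole_leD (ha1 _ bo); apply/Rg_pole_le/ha0.
- by apply: pole_leD (hb1 _ hb); apply/Rg_pole_le/hb0.
- by apply: cofinS e0 => Q ->; rewrite e1; ring.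
Qed.

(** Apply [kunneth] to f as a function of the second point alone, then fix a general first point: f
    becomes a combination of functions that split. *)
Lemma regular_splits c f : (forall b, U01 c b -> RgE b f) -> splits c f.
Proof.
move=> hf; have [b0 hb0] := exists_affine E.
have [|x _ ux|t [r [n [_ hn e]]]] := @kunneth _ E (lz k false) (lz k false) c [::] (fun y => f y.2).
- by exists b0; rewrite /base lin_lz hZ_neq0.
- by apply: Rg_eq (Rg_snd (hf _ ux)) _ => y; rewrite mu_nil mul1r.
have [a ha] := cofin_ex e.
apply: splits_req (splits_sum (index_enum 'I_t) (fun s => r s a) hn) _.
by apply: cofinS ha.
Qed.

Definition tdiv P : seq (bool * pt) := [seq (true, p) | p <- P].

Lemma mu_tdiv1 P x y : x.2 \notin P -> mu (tdiv P) x y = 1.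
Proof.
elim: P => [|p P IH]; first by rewrite mu_nil.
rewrite inE negb_or => /andP[/negbTE xp /IH e].
by rewrite -[tdiv _]/((true, p) :: tdiv P) mu_cons e mulr1 /mu1 /= xp.
Qed.

Lemma mu_pole P q Qs x y : mu (fdiv P ++ tdiv (q :: Qs)) x y =
  mu (fdiv P) x y * ((if x.2 == q then (tau q y.2)^-1 else 1) * mu (tdiv Qs) x y).
Proof. by rewrite mu_cat -[tdiv (q :: Qs)]/((true, q) :: tdiv Qs) mu_cons. Qed.

Section Divisor.
Context (P : seq pt) (q : pt) (Qs : seq pt) (c : k).
Local Notation D := (fdiv P ++ tdiv (q :: Qs)).
Context (hQ : forall b, b \in q :: Qs -> b = o \/ hY b = c).

Lemma Rg_product x (r f : pt -> k) :
  RgE x.1 (fun Q => mu (fdiv P) x (Q, x.2) * r Q) -> pole_le q x.2 f ->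
  Rg x (fun y => mu D x y * (r y.1 * f y.2)).
Proof.
move=> hr hf; apply: Rg_eq (RgM (RgM (Rg_fst hr) (Rg_snd hf)) (Rg_mu (tdiv Qs) x)) _ => y.
case: x y {hr hf} => a b [a' b']; rewrite mu_pole (mu_fdiv _ _ _ _ b' b b) /=; ring.
Qed.

Lemma U01_notin b : U01 c b -> b \notin q :: Qs.
Proof.
move=> [bo bc]; apply/negP => /hQ [e|e]; first by rewrite e eqxx in bo.
by rewrite e eqxx in bc.
Qed.

Lemma pole_ordinate : q != o -> hY q = c.
Proof. by move=> qo; case: (hQ (mem_head q Qs)) => // e; rewrite e eqxx in qo. Qed.

Lemma surj0 a (a' : 'I_3 -> k) F : (exists b : pt, base a a' b) ->
  (forall x, base a a' x.1 -> U01 c x.2 -> Rg x (fun y => mu D x y * F y)) ->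
  exists t (r al be : 'I_t -> pt -> k),
    [/\ forall s b (d : pt), base a a' b -> RgE b (fun Q => mu (fdiv P) (b, d) (Q, d) * r s Q),
     forall s b, b != o -> pole_le q b (al s),
     forall s b, b = o \/ hY b != c -> pole_le q b (be s) &
     req F (fun y => \sum_s r s y.1 * (al s y.2 - be s y.2))].
Proof.
move=> hb0 hF; have [|t [r [n [hr hn e]]]] := @kunneth _ E a a' c P F hb0.
  move=> x bx ux; apply: Rg_eq (hF x bx ux) _ => y; congr (_ * _).
  by rewrite mu_cat (mu_tdiv1 _ (U01_notin ux)) mulr1.
have /choice [al /choice [be h]] : forall s, exists al be : pt -> k,
  [/\ forall b, b != o -> pole_le q b al,
      forall b, b = o \/ hY b != c -> pole_le q b be &
      cofin (fun Q => n s Q = al Q - be Q)] by move=> s; apply: splits_pole pole_ordinate _.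
exists t, r, al, be; split=> // [s b|s b|]; [by case: (h s) => h1 _ _; apply: h1|by case: (h s) => _ h1 _; apply: h1|].
have e' : gen2 (fun y : X => forall s, n s y.2 = al s y.2 - be s y.2).
  by apply: gen2_all => s; apply: cofin_true => a1; case: (h s).
by apply: gen2S (gen2I e e') => y [-> e2]; apply: eq_bigr => s _; rewrite e2.
Qed.

(** At a diagonal point each f_s is regular with the same value in both variables, so the
    differences vanish. No pole in the second variable interferes, since x.1 lies in [U01 c]. *)
Lemma St_diagonal t (r f : 'I_t -> pt -> k) x : U01 c x.1 ->
  (forall s, RgE x.1 (fun Q => mu (fdiv P) x (Q, x.2) * r s Q)) ->
  (forall s, RgE x.1 (f s)) -> (forall s, pole_le q x.2 (f s)) ->
  St true D x (fun y => \sum_s r s y.1 * (f s y.2 - f s y.1)).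
Proof.
move=> ux hr hf hf2.
have sumE y : mu D x y * (\sum_s r s y.1 * (f s y.2 - f s y.1)) =
    \sum_s mu D x y * (r s y.1 * (f s y.2 - f s y.1)) by rewrite mulr_sumr.
split=> [|_ x12].
  apply: Rg_eq (Rg_sum (S := surf E) (x := x) (index_enum 'I_t) (F := fun s y =>
    mu D x y * (r s y.1 * (f s y.2 - f s y.1))) _) _ => [s|y]; last by rewrite sumE.
  have h1 : pole_le q x.2 (fun=> 1) by apply: Rg_pole_le; apply: (Rg_cst (S := Cv)).
  apply: Rg_eq (RgB (Rg_product (hr s) (hf2 s)) (RgM (Rg_product (hr s) h1) (Rg_fst (hf s)))) _ => y.
  ring.
apply: RV_eq (RV_sum (S := surf E) (x := x) (index_enum 'I_t) (F := fun s y =>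
  mu D x y * (r s y.1 * (f s y.2 - f s y.1))) (v := fun=> 0) _) _ _ => [s|y|].
- have [w hw] := Rg_fst (hr s); have [v hv] := hf s.
  have hv2 : RVE x.2 (f s) v by rewrite -x12.
  apply: RV_eq (RVM hw (RVB (RV_snd hv2) (RV_fst hv))) _ _ => [y|]; last by rewrite subrr mulr0.
  rewrite mu_cat (mu_tdiv1 _ (x := x)); last by rewrite -x12; apply: U01_notin.
  case: x y {ux hr hf hf2 sumE hw hv x12 hv2} => b d [b' d'] /=.
  by rewrite (mu_fdiv _ _ _ _ d' d d); ring.
- by rewrite sumE.
- by rewrite big1.
Qed.

(** The pieces of [surj0] need not vanish on the diagonal. Subtracting sum_s r_s(a) al_s(a) from
    both cures this: it equals sum_s r_s(a) be_s(a), because their difference is F on the diagonal,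
    which is 0. The base lies in U01 so that al_s and be_s are regular at the first point. *)
Lemma surj1 a (a' : 'I_3 -> k) F : (exists b : pt, base a a' b) ->
  (forall b, base a a' b -> U01 c b) ->
  (forall x, base a a' x.1 -> U01 c x.2 -> St true D x F) ->
  exists al be : X -> k, [/\ forall x, base a a' x.1 -> x.2 != o -> St true D x al,
    forall x, base a a' x.1 -> x.2 = o \/ hY x.2 != c -> St true D x be &
    req F (fun y => al y - be y)].
Proof.
move=> hb0 hU hF; have [x bx ux|t [r [al [be [hr hal hbe e]]]]] := surj0 (F := F) hb0.
  by have [] := hF x bx ux.
have U_al s b : U01 c b -> RgE b (al s).
  move=> ub; apply: (@pole_le_Rg q); last by apply: hal; case: ub.
  by have := U01_notin ub; rewrite inE negb_or => /andP[].
have U_be s b : U01 c b -> RgE b (be s).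
  move=> ub; apply: (@pole_le_Rg q); last by apply: hbe; case: ub => _; right.
  by have := U01_notin ub; rewrite inE negb_or => /andP[].
have diag : cofin (fun b => \sum_s r s b * al s b = \sum_s r s b * be s b).
  have [b0 bb0] := hb0.
  have hon : cofin (fun b => forall s, [/\ RVE b (r s) (r s b), RVE b (al s) (al s b) & RVE b (be s) (be s b)]).
    have hon1 s : cofin (fun b => [/\ RVE b (r s) (r s b), RVE b (al s) (al s b) & RVE b (be s) (be s b)]).
      have [b1 [bb1 kb1]] := cofin_ex (cofinI (cofin_base bb0) (cofin_kls P)).
      have rb1 : RgE b1 (r s).
        by apply: Rg_eq (hr s b1 b1 bb1) _ => Q; rewrite mu_fdiv1 ?mul1r.
      apply: cofinS (cofinI (honest rb1) (cofinI (honest (U_al s _ (hU _ bb1)))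
        (honest (U_be s _ (hU _ bb1))))) => b [h1 [h2 h3]]; by split.
    have : gen2 (fun y : X => forall s, [/\ RVE y.1 (r s) (r s y.1), RVE y.1 (al s) (al s y.1) & RVE y.1 (be s) (be s y.1)]).
      by apply: gen2_all => s; apply: cofinS (hon1 s) => b h; apply: cofin_true.
    by apply: cofinS => b /cofin_ex[].
  apply: cofinS (cofinI hon (cofinI (cofin_base bb0) (cofin_kls P))) => b [hb [bb kb]].
  have ub := hU _ bb; have [_ /(_ isT erefl) h0] := hF (b, b) bb ub.
  have {}h0 : RV (b, b) (fun y => \sum_s r s y.1 * (al s y.2 - be s y.2)) 0.
    apply: RV_req (RV_eq h0 _ erefl) e => y.
    by rewrite mu_cat mu_fdiv1 // mu_tdiv1 ?mulr1 ?mul1r //; apply: U01_notin.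
  have h1 : RV (b, b) (fun y => \sum_s r s y.1 * (al s y.2 - be s y.2))
      (\sum_s r s b * (al s b - be s b)).
    apply: RV_sum => s; have [h1 h2 h3] := hb s.
    apply: RVM; first exact: (RV_fst (x := (b, b))).
    by apply: RVB; apply: (RV_snd (x := (b, b))).
  apply/eqP; rewrite -subr_eq0 -sumrB; apply/eqP; rewrite -[RHS](RV_uniq h1 h0).
  by apply: eq_bigr => s _; rewrite mulrBr.
exists (fun y => \sum_s r s y.1 * (al s y.2 - al s y.1)),
  (fun y => \sum_s r s y.1 * (be s y.2 - al s y.1)); split.
- move=> x bx xo; apply: St_diagonal => [|s|s|s]; first exact: hU.
  + by case: x bx xo => b d bx _; apply: hr.
  + by apply: U_al; apply: hU.
  + exact: hal.
- move=> x bx xo; apply: (@St_req _ _ _ _ _ (fun y => \sum_s r s y.1 * (be s y.2 - be s y.1))).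
    apply: St_diagonal => [|s|s|s]; first exact: hU.
    + by case: x bx xo => b d bx _; apply: hr.
    + by apply: U_be; apply: hU.
    + exact: hbe.
  apply: cofinS diag => b eb; apply: cofin_true => d /=.
  transitivity (\sum_s r s b * be s d - \sum_s r s b * be s b).
    by rewrite -sumrB; apply: eq_bigr => s _; rewrite mulrBr.
  by rewrite -eb -sumrB; apply: eq_bigr => s _; rewrite mulrBr.
- by apply: gen2S e => y ->; rewrite -sumrB; apply: eq_bigr => s _; ring.
Qed.
End Divisor.

Lemma nv_mul (f g : {mpoly k[3 + 3]}) y : nv (f * g) y = nv f y && nv g y.
Proof. by rewrite /nv mevalM mulf_eq0 negb_or. Qed.

Lemma nv_lform s l y : nv (lform s l) y = (lin l (proj s y) != 0).
Proof. by rewrite /nv coords_lform. Qed.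

Lemma lin_lz_neq0 s b : (lin (lz k s) b != 0) = (b != o).
Proof. by rewrite lin_lz hZ_neq0. Qed.

Lemma lin_ly_neq0 c b : (lin (ly c) b != 0) <-> b = o \/ hY b != c.
Proof.
rewrite lin_ly; have [->|bo] := eqVneq b o.
  by rewrite hZ_origin mulr0 subr0 hY_o_neq0; split=> // _; left.
by rewrite (hZ1 bo) mulr1 subr_eq0; split=> [|[e|//]]; [right|rewrite e eqxx in bo].
Qed.

Lemma lz_ly c b : lin (lz k true) b != 0 \/ lin (ly c) b != 0.
Proof.
have [->|bo] := eqVneq b o; last by left; rewrite lin_lz_neq0.
by right; apply/lin_ly_neq0; left.
Qed.

Section Base.
Context (p q : pt) (c : k) (hp : p != o -> hY p = c).
Local Notation D := ([:: (false, p); (true, q)]).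

(** On almost every line {a} x E the function F has at most one simple pole, at q, so it is constant
    there and depends on a alone. *)
Lemma strip_sections F : (forall x, U01 c x.1 -> St false D x F) ->
  exists f : pt -> k, (forall b, U01 c b -> RgE b f) /\ req F (fun y => f y.1).
Proof.
move=> hF.
have muE x y : U01 c x.1 -> mu D x y = if x.2 == q then (tau q y.2)^-1 else 1.
  move=> [xo xc]; rewrite !mu_cons mu_nil mulr1 /mu1 /=; case: eqVneq => [xp|_]; last by rewrite mul1r.
  by move: xc; rewrite xp hp ?eqxx // -xp.
have hF0 x : U01 c x.1 -> x.2 != q -> Rg x F.
  move=> ux /negbTE xq; have [h _] := hF x ux.
  by apply: Rg_eq h _ => y; rewrite muE // xq mul1r.
have [a1 ua1] := cofin_ex (@cofin_U01 _ E c); have [b1 b1q] := cofin_ex (cofin_neq q).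
have [v [g [hg _ Fg]]] := hF0 (a1, b1) ua1 b1q.
have gg := ratfun_gen (S := surf E) hg.
have [[a0 b0] [/= r0 b0q]] := gen2_ex (gen2I gg (cofin_true (fun _ => cofin_neq q)) : gen2 (fun y => _ /\ y.2 != q)).
have rb0 := cofin_ratX_line1 r0.
have Fc : req F (fun y => g (y.1, b0)).
  apply: cofinS (cofinI Fg (cofinI gg (cofinI rb0 (@cofin_U01 _ E c)))) => a [Fa [ga [ra ua]]].
  have hon : cofin (fun b => RV (a, b) g (g (a, b))).
    by apply: cofinS ga => b rb; exists g; split=> //; apply: cofin_true => *; apply: cofin_true.
  have hL b : b != q -> RgE b (fun b' => g (a, b')).
    move=> bq; have [w hw] : Rg (a, b) g by apply: Rg_req (hF0 (a, b) ua bq) Fg.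
    by exists w; apply: (RV_line2 hw).
  have hq' : RgE q (fun b' => g (a, b') / tau q b').
    have [h _] := hF (a, q) ua.
    have [w hw] : Rg (a, q) (fun y => (tau q y.2)^-1 * g y).
      by apply: Rg_req h _; apply: gen2S Fg => y ->; rewrite muE //= eqxx.
    have ht : RgE q (fun Q => (tau q Q)^-1) by exists 0; apply: RV_tauV.
    exists w; apply: RV_eq (RV_line2 hw _) _ erefl => [|b]; last by rewrite mulrC.
    apply: cofinS (cofinI hon (honest ht)) => b [h1 h2].
    by apply: RVM => //; apply: (RV_snd (x := (a, b)) h2).
  have [e he] := no_simple_pole hL hq'.
  have e0 : g (a, b0) = e.
    apply: (RV_uniq (S := Cv) (x := b0) (F := fun b' => g (a, b'))).
      by apply: (rat_RV (S := Cv)); apply: ratX_line2.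
    by apply: RV_req (RV_cst (S := Cv) b0 e) _; apply: cofinS he => b ->.
  by apply: cofinS (cofinI Fa he) => b [-> ->]; rewrite e0.
exists (fun Q => g (Q, b0)); split=> // b ub.
have [w hw] : Rg (b, b0) g by apply: Rg_req (hF0 (b, b0) ub b0q) Fg.
exists w; apply: (RV_line1 hw); apply: cofinS rb0 => a' ra.
by exists g; split=> //; apply: cofin_true => *; apply: cofin_true.
Qed.

Lemma surj_base F : (forall x, U01 c x.1 -> St false D x F) ->
  exists al be : X -> k, [/\ forall x, x.1 != o -> St false D x al,
    forall x, x.1 = o \/ hY x.1 != c -> St false D x be & req F (fun y => al y - be y)].
Proof.
move=> hF; have [f [hf Fc]] := strip_sections hF.
have [al [be [hal hbe e]]] := splits_pole hp (regular_splits hf).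
have lift x g : pole_le p x.1 g -> St false D x (fun y => g y.1).
  move=> hg; split=> //; apply: Rg_eq (RgM (Rg_fst hg) (Rg_mu [:: (true, q)] x)) _ => y.
  by rewrite [in RHS]mu_cons /mu1 /=; ring.
exists (fun y => al y.1), (fun y => be y.1); split.
- by move=> x xo; apply: lift; apply: hal.
- by move=> x xo; apply: lift; apply: hbe.
- have e2 : gen2 (fun y : X => f y.1 = al y.1 - be y.1).
    by apply: cofinS e => Q eQ; apply: cofin_true.
  by apply: gen2S (gen2I Fc e2) => y [-> ->].
Qed.
End Base.

(** * Vanishing of higher cohomology *)

Section Exact.
Context (I : finType) (V : I -> {mpoly k[3 + 3]}) (hV : is_affine_cover E V).
Local Notation nv := (@nv k E).
Local Notation lf := (lform (k := k) false).
Local Notation lt := (lform (k := k) true).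
Local Notation lz := (lz k false).

Lemma bihomog_mul2 s t l l' : exists d e, bihomog d e (lform s l * lform t l' : {mpoly k[3 + 3]}).
Proof. by do 2 eexists; apply: bihomogM; apply: bihomog_lform. Qed.

Lemma exact_strip m D n a (a' : 'I_3 -> k) c : (exists b : pt, base a a' b) ->
  (n = 0%N -> splits_over m D V 0 (nv (lf a * lf a' * lt lz)) (nv (lf a * lf a' * lt (ly c)))) ->
  exact m D V n.+1 (nv (lf a * lf a')).
Proof.
move=> [b [hb hb']] hs.
have oy : lin (ly c) o != 0 by apply/lin_ly_neq0; left.
have [a1 oa1] := exists_affine E.
apply: (exact_iff (T := fun y : X => nv (lf a * lf a' * lt lz) y \/ nv (lf a * lf a' * lt (ly c)) y)).
  move=> y; split=> [[]|h]; [by rewrite nv_mul => /andP[]|by rewrite nv_mul => /andP[]|].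
  by case: (lz_ly c y.2) => h'; [left|right]; rewrite nv_mul h nv_lform.
apply: exact_mv.
- rewrite mulrAC; apply: exact_nv => //; [|by exists b|by exists a1; rewrite (lin_lz_neq0 false)].
  by exists 1%N, 0%N; apply: bihomog_lform.
- rewrite mulrAC; apply: exact_nv => //; [|by exists b|by exists o].
  by exists 1%N, 0%N; apply: bihomog_lform.
- apply: (exact_iff (T := nv (lf a * lt lz * (lf a' * lt (ly c))))).
    move=> y; rewrite !nv_mul; split; first by case/andP=> /andP[-> ->] /andP[-> ->].
    by case=> /andP[/andP[-> ->] ->] /andP[_ ->].
  apply: exact_nv => //; [exact: bihomog_mul2|by exists b|by exists a1; rewrite (lin_lz_neq0 false)].
- case: n hs => [hs|n _]; first exact: hs.
  apply: splits_over_forms => //; first exact: bihomog_mul2.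
  exact: lz_ly.
Qed.

Lemma base_ly c b : U01 c b -> base lz (ly c) b.
Proof. by move=> [bo bc]; split; [rewrite (lin_lz_neq0 false)|apply/lin_ly_neq0; right]. Qed.

Lemma base_U01 c b : base lz (ly c) b -> U01 c b.
Proof.
move=> [h /lin_ly_neq0 h']; move: h; rewrite (lin_lz_neq0 false) => bo; split=> //.
by case: h' => // e; rewrite e eqxx in bo.
Qed.

(** On the two strips the degree n + 2 involves only nonempty simplices. Their intersection is taken
    in degree n + 1, so a splitting on the empty list is called for only when n = 0, and only
    there. *)
Lemma exact_top m D n c : 
  (n = 0%N -> splits_over m D V 0 (nv (lf lz * lf (ly c) * lt lz)) (nv (lf lz * lf (ly c) * lt (ly c)))) ->
  exact m D V n.+2 (fun=> True).
Proof.
move=> hs; have [a1 oa1] := exists_affine E.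
have oy : lin (ly c) o != 0 by apply/lin_ly_neq0; left.
apply: (exact_iff (T := fun y : X => nv (lf lz) y \/ nv (lf (ly c)) y)).
  by move=> y; split=> // _; rewrite !nv_lform; apply: lz_ly.
apply: exact_mv.
- apply: (exact_iff (T := nv (lf lz * lf lz))); first by move=> y; rewrite nv_mul andbb.
  by apply: (@exact_strip _ _ _ _ _ c) => //; exists a1; split; rewrite (lin_lz_neq0 false).
- apply: (exact_iff (T := nv (lf (ly c) * lf (ly c)))); first by move=> y; rewrite nv_mul andbb.
  by apply: (@exact_strip _ _ _ _ _ c) => //; exists o.
- apply: (exact_iff (T := nv (lf lz * lf (ly c)))); first by move=> y; rewrite nv_mul; split=> /andP.
  apply: (@exact_strip _ _ _ _ _ c) => //.
  by have [b ub] := cofin_ex (@cofin_U01 _ E c); exists b; apply: base_ly.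
- have := @splits_over_forms _ E m D I V hV n false lz (ly c) 1.
  rewrite !mul1r; apply; last exact: lz_ly.
  by exists 0%N, 0%N; rewrite -mpolyC1; apply: bihomogC.
Qed.

Lemma nv3 s t u l (l' l'' : 'I_3 -> k) y : nv (lform s l * lform t l' * lform u l'') y <->
  [/\ lin l (proj s y) != 0, lin l' (proj t y) != 0 & lin l'' (proj u y) != 0].
Proof.
by rewrite !nv_mul !nv_lform; split; [case/andP=> /andP[-> ->] ->|case=> -> -> ->].
Qed.

Lemma splits0 P q Qs c a (a' : 'I_3 -> k) : (forall b, b \in q :: Qs -> b = o \/ hY b = c) ->
  (exists b : pt, base a a' b) -> splits_over false (fdiv P ++ tdiv (q :: Qs)) V 0
    (nv (lf a * lf a' * lt lz)) (nv (lf a * lf a' * lt (ly c))).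
Proof.
move=> hQ hb [|//] _ F hF.
have [x bx ux|t [r [al [be [hr hal hbe e]]]]] := @surj0 P q Qs c hQ a a' F hb.
  have [] := hF x _ => //; have [h1 h2] := bx; have [h3 h4] := base_ly ux.
  split=> //; apply/nv3; by split.
have St_s (f : 'I_t -> pt -> k) x : base a a' x.1 -> (forall s, pole_le q x.2 (f s)) ->
    St false (fdiv P ++ tdiv (q :: Qs)) x (fun y => \sum_s r s y.1 * f s y.2).
  move=> bx hf; apply: St_sum => s; split=> //.
  by apply: Rg_product (hf s); case: x bx {hf} => b d bx; apply: hr.
exists (fun y => \sum_s r s y.1 * al s y.2), (fun y => \sum_s r s y.1 * be s y.2); split.
- move=> x [/nv3[h1 h2 h3] _]; apply: St_s => [|s]; first by split.
  by apply: hal; move: h3; rewrite lin_lz_neq0.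
- move=> x [/nv3[h1 h2 h3] _]; apply: St_s => [|s]; first by split.
  by apply: hbe; apply/lin_ly_neq0.
- apply: gen2S e => y ->; rewrite -sumrB; apply: eq_bigr => s _; exact: mulrBr.
Qed.

Lemma splits1 P q Qs c a (a' : 'I_3 -> k) : (forall b, b \in q :: Qs -> b = o \/ hY b = c) ->
  (exists b : pt, base a a' b) -> (forall b : pt, base a a' b -> U01 c b) ->
  splits_over true (fdiv P ++ tdiv (q :: Qs)) V 0
    (nv (lf a * lf a' * lt lz)) (nv (lf a * lf a' * lt (ly c))).
Proof.
move=> hQ hb hU [|//] _ F hF.
have [x bx ux|al [be [hal hbe e]]] := @surj1 P q Qs c hQ a a' F hb hU.
  have [h1 h2] := bx; have [h3 h4] := base_ly ux.
  by apply: hF; split=> //; apply/nv3; split.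
exists al, be; split=> //.
- move=> x [/nv3[h1 h2 h3] _]; apply: hal => //.
  by move: h3; rewrite lin_lz_neq0.
- by move=> x [/nv3[h1 h2 h3] _]; apply: hbe => //; apply/lin_ly_neq0.
Qed.

Lemma exists_base_ly c : exists b : pt, base lz (ly c) b.
Proof. by have [b ub] := cofin_ex (@cofin_U01 _ E c); exists b; apply: base_ly. Qed.

Lemma exact_above1 m P q Qs c n : (forall b, b \in q :: Qs -> b = o \/ hY b = c) ->
  exact m (fdiv P ++ tdiv (q :: Qs)) V n.+2 (fun=> True).
Proof.
move=> hQ; apply: (@exact_top _ _ _ c) => _; case: m.
  by apply: splits1 => //; [exact: exists_base_ly|exact: base_U01].
by apply: splits0 => //; exact: exists_base_ly.
Qed.

(** Two different lines are used: y = y(q) to split along the second factor, and y = y(p) along the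
    first, where sections over the intersection depend on the first point alone. *)
Lemma exact1 p q : exact false [:: (false, p); (true, q)] V 1 (fun=> True).
Proof.
have hq b : b \in [:: q] -> b = o \/ hY b = hY q by rewrite inE => /eqP ->; right.
have [a1 oa1] := exists_affine E; pose c := hY p.
have oy : lin (ly c) o != 0 by apply/lin_ly_neq0; left.
apply: (exact_iff (T := fun y : X => nv (lf lz) y \/ nv (lf (ly c)) y)).
  by move=> y; split=> // _; rewrite !nv_lform; apply: lz_ly.
apply: exact_mv.
- apply: (exact_iff (T := nv (lf lz * lf lz))); first by move=> y; rewrite nv_mul andbb.
  have hb : exists b : pt, base lz lz b by exists a1; split; rewrite (lin_lz_neq0 false).
  by apply: (@exact_strip _ _ _ _ _ (hY q)) => // _; exact: (@splits0 [:: p] q [::] (hY q) lz lz hq hb).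
- apply: (exact_iff (T := nv (lf (ly c) * lf (ly c)))); first by move=> y; rewrite nv_mul andbb.
  have hb : exists b : pt, base (ly c) (ly c) b by exists o.
  by apply: (@exact_strip _ _ _ _ _ (hY q)) => // _;
    exact: (@splits0 [:: p] q [::] (hY q) (ly c) (ly c) hq hb).
- exact: exact0.
move=> [|//] _ F hF.
have [//|x ux|al [be [hal hbe e]]] := @surj_base p q c _ F.
  have [h1 h2] := base_ly ux; apply: hF; by split=> //; rewrite nv_lform.
exists al, be; split=> //.
- move=> x [h _]; apply: hal; by move: h; rewrite nv_lform (lin_lz_neq0 false).
- move=> x [h _]; apply: hbe; by move: h; rewrite nv_lform => /lin_ly_neq0.
Qed.

End Exact.
End Splitting.

(** * Translations *)

Section Translation.
Context (k : closedFieldType) (E : elliptic_curve k).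
Local Notation pt := (Defs.point E).
Local Notation RV := (@RV k (curve E)).
Local Notation Rg := (@Rg k (curve E)).
Local Notation C := (curve E).
Local Notation a1 := (ec1 E).
Local Notation a2 := (ec2 E).
Local Notation a3 := (ec3 E).
Local Notation a4 := (ec4 E).
Local Notation o := (origin E).
Implicit Types (P Q a : pt).

Lemma nY_on_curve P : on_curve E (if P == o then None else Some (hX P, - nY P)).
Proof.
case: eqVneq => [//|Po] /=; apply/eqP; rewrite -[RHS](_ : weierstrass a1 a2 a3 a4 (ec6 E) (hX P) (hY P) = 0).
  by rewrite /weierstrass /nY; ring.
by rewrite /weierstrass (weierstrass_affine Po) subrr.
Qed.

Definition negp P : pt := Point (nY_on_curve P).

Lemma negp_o : negp o = o.
Proof. by apply: val_inj => /=; rewrite ?eqxx. Qed.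

Lemma negp_affine P : P != o -> [/\ negp P != o, hX (negp P) = hX P & hY (negp P) = - nY P].
Proof.
move=> /negbTE Po; split; [|by rewrite /hX /hcoord /= Po|by rewrite /hY /hcoord /= Po].
by apply/eqP => /(congr1 val); rewrite /= Po.
Qed.

Lemma nY_negp P : P != o -> nY (negp P) = - hY P.
Proof. by move=> /negp_affine[_ x y]; rewrite {1}/nY x y /nY; ring. Qed.

Lemma negpK P : negp (negp P) = P.
Proof.
have [->|Po] := eqVneq P o; first by rewrite !negp_o.
have [o1 x1 y1] := negp_affine Po; have [o2 x2 y2] := negp_affine o1.
by apply: affine_eq => //; [rewrite x2 | rewrite y2 (nY_negp Po) opprK].
Qed.

Lemma addp0 a : addp a o = a.
Proof. by apply: val_inj; rewrite /=; case: a => -[[]|]. Qed.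

Lemma add0p P : addp o P = P.
Proof. by apply: val_inj. Qed.

Definition slope P Q := if hX Q == hX P
  then (3%:R * hX Q ^+ 2 + 2%:R * a2 * hX Q + a4 - a1 * hY Q) / (2%:R * hY Q + a1 * hX Q + a3)
  else (hY P - hY Q) / (hX P - hX Q).

Lemma coord_val Q u v : val Q = Some (u, v) -> hX Q = u /\ hY Q = v.
Proof. by rewrite /hX /hY /hcoord /= => ->. Qed.

Lemma addp_affine P Q : P != o -> Q != o -> Q != negp P ->
  [/\ addp Q P != o,
      hX (addp Q P) = slope P Q ^+ 2 + a1 * slope P Q - a2 - hX Q - hX P &
      hY (addp Q P) = - (slope P Q + a1) * hX (addp Q P) - (hY Q - slope P Q * hX Q) - a3].
Proof.
move=> Po Qo QN.
have c : ((hX Q == hX P) && (hY Q + hY P + a1 * hX Q + a3 == 0)) = false.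
  apply: contraNF QN => /andP[/eqP x /eqP y]; have [No xN yN] := negp_affine Po.
  apply/eqP/affine_eq => //; first by rewrite xN.
  by rewrite yN /nY -x; apply: (eq_of_relation (c := 1) y); ring.
have v : val (addp Q P) = Some (slope P Q ^+ 2 + a1 * slope P Q - a2 - hX Q - hX P,
    - (slope P Q + a1) * (slope P Q ^+ 2 + a1 * slope P Q - a2 - hX Q - hX P)
      - (hY Q - slope P Q * hX Q) - a3).
  by rewrite /= (affineE Po) (affineE Qo) /= c.
have [ex ey] := coord_val v.
by split=> //; [apply/eqP => e; move: v; rewrite e|rewrite {1}ey ex].
Qed.

Lemma addp_eq_o P Q : (addp Q P == o) = (Q == negp P).
Proof.
have [->|Po] := eqVneq P o; first by rewrite addp0 negp_o.
have [No xN yN] := negp_affine Po.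
have [->|Qo] := eqVneq Q o; first by rewrite add0p (negbTE Po) eq_sym (negbTE No).
have [->|QN] := eqVneq Q (negp P); last by have [/negbTE] := addp_affine Po Qo QN.
have vN : val (negp P) = Some (hX P, - nY P) by rewrite (affineE No) xN yN.
have e : add_coord E (val (negp P)) (val P) = None.
  by rewrite vN (affineE Po) /= eqxx ifT //; apply/eqP; rewrite /nY; ring.
by apply/eqP/val_inj.
Qed.

(** The chord through Q and P is the line through Q and -(-P), whose slope is [sg (negp P)]. In the
    tangent case [chord] turns the quotient into GG / (y + nY), which has the right value. *)
Lemma RV_slope P Q : P != o -> Q != o -> Q != negp P -> RV Q (sg (negp P)) (slope P Q).
Proof.
move=> Po Qo QN; have [No xN yN] := negp_affine Po.
have [xQ|xQ] := eqVneq (hX Q) (hX P); last first.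
  have -> : slope P Q = (hY Q + nY (negp P)) / (hX Q - hX (negp P)).
    rewrite /slope (negbTE xQ) (nY_negp Po) xN -(opprB (hX Q)) -(opprB (hY Q)) invrN.
    by rewrite mulrNN.
  apply: RVf (RV_nY _ Qo) (RVB (RV_hX Qo) (RV_cst _ _)) _.
  by rewrite xN subr_neq0.
have [QP|nyQ] := same_x Po Qo xQ; last first.
  case/eqP: QN; apply: affine_eq => //; first by rewrite xN.
  by rewrite yN; apply/eqP; rewrite -subr_eq0 opprK nyQ.
subst Q; have dP : hY P + nY P != 0.
  apply: contraNneq QN => e; apply/eqP/affine_eq => //.
  by rewrite yN; apply/eqP; rewrite -subr_eq0 opprK e.
have -> : slope P P = GG P P / (hY P + nY P).
  by rewrite /slope eqxx /GG /nY; congr (_ / _); ring.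
apply: RV_req (RVf (RV_GG P Po) (RV_nY P Po) dP) _.
apply: (@req_affine _ _ _ [:: hX P] [:: - nY P]) => Q Qo'; rewrite !inE => xQP yQP.
have d1 : hX Q - hX P != 0 by rewrite subr_eq0.
have d2 : hY Q + nY P != 0 by rewrite -[nY P]opprK subr_eq0.
by apply/eqP; rewrite /sg (nY_negp Po) xN eqr_div // [X in X == _]mulrC -(chord Po Qo').
Qed.

Lemma cofin_translate P : P != o -> cofin (fun Q => [/\ Q != o, Q != negp P, hX Q != hX P,
  slope P Q = sg (negp P) Q & sg (negp P) Q != 0]).
Proof.
move=> Po; have [No xN yN] := negp_affine Po.
apply: cofinS (cofinI (cofinI (cofin_neq o) (cofin_neq (negp P)))
  (cofinI (@cofin_hX _ E [:: hX P]) (gen_tau (negp P)))) => Q [[Qo QN] [xQ tQ]].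
rewrite inE in xQ; rewrite (tau_sg No) in tQ; split=> //.
rewrite /slope (negbTE xQ) /sg (nY_negp Po) xN -(opprB (hX Q)) -(opprB (hY Q)) invrN.
by rewrite mulrNN.
Qed.

(** At the origin the formula for the abscissa x3 of the sum is a difference of poles. The second
    symmetric function of the three abscissas on the chord expresses x3 (x + x_P) instead; divided
    by the square of the slope, its terms are regular. The ordinate is treated in the same way. *)
Lemma translate_origin P : P != o ->
  RV o (fun Q => hX (addp Q P)) (hX P) /\ RV o (fun Q => hY (addp Q P)) (hY P).
Proof.
move=> Po; have [No xN yN] := negp_affine Po; pose la := sg (negp P).
have cof := cofin_translate Po.
have la1 : RV o (fun Q => la Q / phi Q) 1 by apply: RV_sg_phi.
have laV : RV o (fun Q => (la Q)^-1) 0.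
  apply: RV_req (RV_eq (RVf (RV_phiV_o E) la1 (oner_neq0 _)) (fun=> erefl) (mul0r _)) _.
  apply: cofinS (cofinI cof (gen_phi E)) => Q [[_ _ _ _ l0] p0]; rewrite /la; field; exact/andP.
have xla : RV o (fun Q => hX Q / la Q ^+ 2) 1.
  apply: RV_req (RV_eq (RVf (RV_x_phi E) (RVX 2 la1) _) (fun=> erefl) _) _.
  - by rewrite expr1n oner_neq0.
  - by rewrite expr1n divr1.
  apply: cofinS (cofinI cof (gen_phi E)) => Q [[_ _ _ _ l0] p0]; rewrite /la; field; exact/andP.
have den : RV o (fun Q => (hX Q + hX P) / la Q ^+ 2) 1.
  apply: RV_eq (RVD xla (RVM (RV_cst (S := C) o (hX P)) (RVX 2 laV))) _ _ => [Q|].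
    by rewrite exprVn mulrDl.
  by rewrite expr0n mulr0 addr0.
have dgen := RV_gen_neq0 den (oner_neq0 _).
pose x3 Q := la Q ^+ 2 + a1 * la Q - a2 - hX Q - hX P.
have rel : cofin (fun Q => [/\ la Q != 0, hX Q + hX P != 0, hX (addp Q P) = x3 Q,
    hY (addp Q P) = - la Q * (x3 Q - hX P) - hY P - a1 * x3 Q - a3 &
    x3 Q * (hX Q + hX P) = a4 - 2%:R * la Q * (hY P - la Q * hX P) - a1 * (hY P - la Q * hX P)
      - a3 * la Q - hX Q * hX P]).
  apply: cofinS (cofinI cof dgen) => Q [[Qo QN xQ sl l0] d0].
  have [_ x3E y3E] := addp_affine Po Qo QN.
  have lE : la Q * (hX Q - hX P) = hY Q - hY P.
    rewrite /la /sg (nY_negp Po) xN divfK //; exact: subr_neq0.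
  split=> //.
  - by apply: contraNneq d0 => ->; rewrite mul0r.
  - by rewrite x3E sl.
  - rewrite y3E x3E sl -/(la Q) -/(x3 Q).
    by apply: (eq_of_relation (c := 1) lE); ring.
  - have yQ : hY Q = hY P + la Q * (hX Q - hX P) by rewrite lE addrC subrK.
    have w : (hY Q ^+ 2 + a1 * hX Q * hY Q + a3 * hY Q) - (hY P ^+ 2 + a1 * hX P * hY P + a3 * hY P) =
      (hX Q ^+ 3 + a2 * hX Q ^+ 2 + a4 * hX Q + ec6 E) - (hX P ^+ 3 + a2 * hX P ^+ 2 + a4 * hX P + ec6 E).
      by rewrite !weierstrass_affine.
    rewrite yQ in w; apply: (mulIf (subr_neq0 xQ)).
    by apply: (eq_of_relation (c := 1) w); rewrite /x3; ring.
have RV0M f g : RV o f 0 -> Rg o g -> RV o (fun Q => f Q * g Q) 0.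
  by move=> hf [v hg]; apply: RV_eq (RVM hf hg) _ _ => //; rewrite mul0r.
have RgC c : Rg o (fun=> c : k) := Rg_cst (S := C) o c.
have RlaV : Rg o (fun Q => (la Q)^-1) by exists 0.
pose G Q := (a4 - a1 * hY P) * (la Q)^-1 + (a1 * hX P - 2%:R * hY P - a3).
have RG : Rg o G by apply: RgD (RgM (RgC _) RlaV) (RgC _).
have X0 : RV o (fun Q => hX (addp Q P)) (hX P).
  apply: RV_req (RV_eq (RVf (RVD (RV0M _ _ laV RG)
    (RVB (RV_cst (S := C) o (2%:R * hX P)) (RVM (RV_cst (S := C) o (hX P)) xla))) den (oner_neq0 _))
    (fun=> erefl) (_ : _ = hX P)) _.
    by rewrite add0r mulr1 divr1 mulr2n mulrDl mul1r addrK.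
  apply: cofinS rel => Q [l0 d0 -> _ e]; rewrite -[x3 Q](mulfK d0) e /G; field; exact/andP.
split=> //; pose R Q := 2%:R * hX P * (hX (addp Q P) + (a2 + hX P)) + (a4 - a1 * hY P - hX P ^+ 2).
have RR : Rg o R.
  by apply: RgD (RgM (RgC _) (RgD _ (RgC _))) (RgC _); exists (hX P).
pose s := 2%:R * hY P + a1 * hX P + a3.
apply: RV_req (RV_eq (RVB (RVf (RVB (RV_cst (S := C) o s) (RV0M _ _ laV RR)) den (oner_neq0 _))
  (RVD (RVM (RV_cst (S := C) o a1) X0) (RV_cst (S := C) o (hY P + a3)))) (fun=> erefl) (_ : _ = hY P)) _.
  by rewrite subr0 divr1 /s; ring.
apply: cofinS rel => Q [l0 d0 xE -> e]; rewrite xE.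
suff -> : - la Q * (x3 Q - hX P) = (s - (la Q)^-1 * R Q) / ((hX Q + hX P) / la Q ^+ 2) by ring.
have d1 : (hX Q + hX P) / la Q ^+ 2 != 0 by rewrite mulf_neq0 ?invr_eq0 ?expf_neq0.
apply: (mulIf d1); rewrite divfK // /R xE.
apply: (mulIf (expf_neq0 2 l0)).
have -> : - la Q * (x3 Q - hX P) * ((hX Q + hX P) / la Q ^+ 2) * la Q ^+ 2 =
  - la Q * (x3 Q * (hX Q + hX P) - hX P * (hX Q + hX P)) by field.
rewrite e /s /x3; field.
exact: l0.
Qed.

Lemma translate_regular P a : a != negp P ->
  RV a (fun Q => hX (addp Q P)) (hX (addp a P)) /\ RV a (fun Q => hY (addp Q P)) (hY (addp a P)).
Proof.
have [-> aN|Po aN] := eqVneq P o.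
  rewrite negp_o in aN; have e Q : addp Q o = Q := addp0 Q.
  by split; rewrite e; [apply: RV_eq (RV_hX aN) _ _|apply: RV_eq (RV_hY aN) _ _] => // Q; rewrite e.
have [->|ao] := eqVneq a o; first by rewrite add0p; apply: translate_origin.
have [_ xE yE] := addp_affine Po ao aN.
have cof := cofin_translate Po; have hs := RV_slope Po ao aN.
have X0 : RV a (fun Q => hX (addp Q P)) (hX (addp a P)).
  apply: RV_req (RV_eq (RVB (RVB (RVB (RVD (RVX 2 hs) (RVM (RV_cst (S := C) a a1) hs))
    (RV_cst (S := C) a a2)) (RV_hX ao)) (RV_cst (S := C) a (hX P))) (fun=> erefl) (esym xE)) _.
  apply: cofinS cof => Q [Qo QN _ sl _]; have [_ -> _] := addp_affine Po Qo QN.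
  by rewrite sl.
split=> //; apply: RV_req (RV_eq (RVB (RVB (RVM (RVN (RVD hs (RV_cst (S := C) a a1))) X0)
  (RVB (RV_hY ao) (RVM hs (RV_hX ao)))) (RV_cst (S := C) a a3)) (fun=> erefl) (esym yE)) _.
apply: cofinS cof => Q [Qo QN _ sl _]; have [_ _ ->] := addp_affine Po Qo QN.
by rewrite sl.
Qed.

Lemma translate_pole P : exists2 w, w != 0 &
  RV (negp P) (fun Q => hX (addp Q P) / tau (negp P) Q ^+ 2) 1 /\
  RV (negp P) (fun Q => hY (addp Q P) / tau (negp P) Q ^+ 3) w.
Proof.
have [->|Po] := eqVneq P o.
  exists 1; first exact: oner_neq0.
  rewrite negp_o tau_o; split; [apply: RV_eq (RV_x_phi E) _ _|apply: RV_eq (RV_y_phi E) _ _] => // Q;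
  by rewrite addp0.
(* The ordinate of the sum has leading term - slope^3. *)
exists (-1); first by rewrite oppr_eq0 oner_neq0.
have [No xN yN] := negp_affine Po; have cof := cofin_translate Po.
pose la := tau (negp P); have laE : la = sg (negp P) by apply: tau_sg.
have V := RV_tauV (negp P); rewrite -/la in V.
have cst c := RV_cst (S := C) (negp P) (c : k).
have X0 : RV (negp P) (fun Q => hX (addp Q P) / la Q ^+ 2) 1.
  apply: RV_req (RV_eq (RVD (cst 1) (RVM V (RVB (cst a1)
    (RVM V (RVD (cst (a2 + hX P)) (RV_hX No)))))) (fun=> erefl) (_ : _ = 1)) _.
    by rewrite mul0r addr0.
  apply: cofinS cof => Q [Qo QN _ sl l0]; have [_ -> _] := addp_affine Po Qo QN.
  by rewrite sl -laE in l0 *; field.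
split=> //.
apply: RV_req (RV_eq (RVB (RVM (RVN (RVD (cst 1) (RVM (cst a1) V))) X0)
  (RVM (RVM V V) (RVD (RVM V (RVD (RV_hY No) (cst a3))) (RVN (RV_hX No))))) (fun=> erefl) (_ : _ = -1)) _.
  by rewrite mulr0 addr0 mulr1 !mul0r subr0.
apply: cofinS cof => Q [Qo QN _ sl l0]; have [_ _ ->] := addp_affine Po Qo QN.
by rewrite -?/la sl -laE in l0 *; field.
Qed.

Lemma RV_phi_translate P a : a != negp P -> hY (addp a P) != 0 ->
  RV a (fun Q => phi (addp Q P)) (phi (addp a P)).
Proof.
move=> aN ya; have [hx hy] := translate_regular aN.
by apply: RV_eq (RVf (RVX 2 hx) hy ya) _ _ => [Q|]; rewrite phiE.
Qed.

(** The local equation 1 / phi of the origin pulls back to a local equation of -P: numerator and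
    denominator of phi have orders 4 and 3 there. *)
Lemma RV_phi_translate_pole P : exists2 w, w != 0 &
  RV (negp P) (fun Q => (phi (addp Q P))^-1 * tau (negp P) Q) w.
Proof.
have [w w0 [hx hy]] := translate_pole P; exists w => //.
apply: RV_req (RV_eq (RVf hy (RVX 2 hx) _) (fun=> erefl) (_ : _ = w)) _.
- by rewrite expr1n oner_neq0.
- by rewrite expr1n divr1.
apply: cofinS (cofinI (RV_gen_neq0 hx (oner_neq0 _)) (gen_tau (negp P))) => Q [x0 t0].
have {}x0 : hX (addp Q P) != 0 by apply: contraNneq x0 => ->; rewrite mul0r.
by rewrite phiE invf_div; field; apply/andP.
Qed.

Lemma cofin_xy_translate P : cofin (fun a => hX (addp a P) != 0 /\ hY (addp a P) != 0).
Proof.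
have [w w0 [hx hy]] := translate_pole P.
apply: cofinS (cofinI (RV_gen_neq0 hx (oner_neq0 _)) (RV_gen_neq0 hy w0)) => Q [x0 y0].
by split; [apply: contraNneq x0|apply: contraNneq y0] => ->; rewrite mul0r.
Qed.
End Translation.

(** * The line bundles *)

Section OpenSets.
Context (k : closedFieldType) (E : elliptic_curve k).
Local Notation pt := (Defs.point E).
Local Notation X := (surface E).
Local Notation o := (origin E).
Implicit Types (P Q a b : pt) (x y : X).

Lemma minors a b : a != b -> exists i j, hcoord a i * hcoord b j - hcoord a j * hcoord b i != 0.
Proof.
move=> ab; have [ao|ao] := eqVneq a o.
  have bo : b != o by rewrite -ao eq_sym.
  exists i1, i2; rewrite ao -/(hY o) -/(hZ o) -/(hZ b) -/(hY b) hZ_origin hY_origin (hZ1 bo).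
  by rewrite mul0r subr0 mulr1 oner_neq0.
have [bo|bo] := eqVneq b o.
  exists i1, i2; rewrite bo -/(hY o) -/(hZ o) -/(hZ a) -/(hY a) hZ_origin hY_origin (hZ1 ao).
  by rewrite mulr0 sub0r mulr1 oppr_eq0 oner_neq0.
have [xab|xab] := eqVneq (hX a) (hX b).
  exists i1, i2; rewrite -/(hY b) -/(hZ b) -/(hZ a) -/(hY a) (hZ1 ao) (hZ1 bo) mulr1 mul1r subr_eq0.
  by apply: contraNneq ab => yab; apply/eqP/affine_eq.
by exists i0, i2; rewrite -/(hX b) -/(hZ b) -/(hZ a) -/(hX a) (hZ1 ao) (hZ1 bo) mulr1 mul1r subr_eq0.
Qed.

Lemma near_off_diagonal x : x.1 != x.2 -> \forall y \near x, y.1 != y.2.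
Proof.
move=> /minors[i [j h]].
pose p : {mpoly k[3 + 3]} := 'X_(var false i) * 'X_(var true j) - 'X_(var false j) * 'X_(var true i).
have pE y : p.@[coords y] = hcoord y.1 i * hcoord y.2 j - hcoord y.1 j * hcoord y.2 i.
  by rewrite /p mevalB !mevalM !mevalXU !coords_var.
have hp : bihomog 1 1 p.
  rewrite /p -scaleN1r; apply: bihomogD; last apply: bihomogZ.
    by apply: (bihomogM (d := 1) (e := 0) (d' := 0) (e' := 1)); apply: bihomog_var.
  by apply: (bihomogM (d := 1) (e := 0) (d' := 0) (e' := 1)); apply: bihomog_var.
rewrite -pE in h; have h1 := near_nonvanishing hp h.
apply: filterS h1 => y; rewrite pE; apply: contraNneq => ->.
by rewrite mulrC subrr.
Qed.

Lemma near_neq s x b : proj s x != b -> \forall y \near x, proj s y != b.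
Proof.
move=> /minors[i [j h]].
pose l (t : 'I_3) := (t == i)%:R * hcoord b j - (t == j)%:R * hcoord b i.
have lE Q : lin l Q = hcoord Q i * hcoord b j - hcoord Q j * hcoord b i.
  rewrite /lin /l -[hcoord Q i](lin_coord i Q) -[hcoord Q j](lin_coord j Q) /lin !mulr_suml -sumrB.
  by apply: eq_bigr => t _; ring.
rewrite -lE -coords_lform in h; have h1 := near_nonvanishing (@bihomog_lform k s l) h.
apply: filterS h1 => y; rewrite coords_lform lE; apply: contraNneq => ->.
by rewrite mulrC subrr.
Qed.

(** Finitely many points can be avoided near x, except x itself, where the condition is known. *)
Lemma near_cofin s x (A : pt -> Prop) : cofin A -> A (proj s x) -> \forall y \near x, A (proj s y).
Proof.
move=> [t ht] Ax; suff h : \forall y \near x, forall b, b \in t -> proj s y = b -> A b.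
  apply: filterS h => y hy; have [yt|/ht//] := boolP (proj s y \in t).
  exact: hy yt erefl.
elim: t {ht} => [|b t IH]; first by near=> y.
have [xb|xb] := eqVneq (proj s x) b.
  apply: filterS IH => y hy c; rewrite inE => /orP[/eqP -> _|]; last exact: hy.
  by rewrite -xb.
apply: filterS2 IH (near_neq xb) => y hy yb c; rewrite inE => /orP[/eqP -> e|]; last exact: hy.
by rewrite e eqxx in yb.
Unshelve. all: by end_near.
Qed.

Lemma open_of_near (A : set X) : (forall x, A x -> \forall y \near x, A y) -> open A.
Proof. by move=> h; rewrite openE => x /h. Qed.

End OpenSets.

(** * Local equations of the diagonal *)

Section Diagonal.
Context (k : closedFieldType) (E : elliptic_curve k).
Local Notation pt := (Defs.point E).
Local Notation X := (surface E).
Local Notation RVE := (@RV k (curve E)).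
Local Notation RgE := (@Rg k (curve E)).
Local Notation RV := (@RV k (surf E)).
Local Notation Rg := (@Rg k (surf E)).
Local Notation o := (origin E).
Local Notation C := (curve E).
Local Notation ratX := (ratfun (@hcoord2 k E)).
Local Notation a1 := (ec1 E).
Local Notation a2 := (ec2 E).
Local Notation a3 := (ec3 E).
Local Notation a4 := (ec4 E).
Local Notation a6 := (ec6 E).
Implicit Types (P Q a b : pt) (x y : X) (f g : pt -> k) (th : X -> k).

(* The differences f(Q) - f(a) divisible by th. *)
Definition divides_diff th x f := Rg x (fun y => (f y.2 - f y.1) / th y).

Lemma divides_diff_cst th x c : divides_diff th x (fun=> c).
Proof. by apply: Rg_eq (Rg_cst (S := surf E) x 0) _ => y; rewrite subrr mul0r. Qed.

Lemma divides_diffM th x f g : RgE x.1 f -> RgE x.2 g -> divides_diff th x f ->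
  divides_diff th x g -> divides_diff th x (fun Q => f Q * g Q).
Proof.
move=> rf rg hf hg.
by apply: Rg_eq (RgD (RgM (Rg_snd rg) hf) (RgM (Rg_fst rf) hg)) _ => y; ring.
Qed.

Lemma divides_diffV th x f v w : RVE x.1 f v -> RVE x.2 f w -> v != 0 -> w != 0 ->
  divides_diff th x f -> divides_diff th x (fun Q => (f Q)^-1).
Proof.
move=> hv hw v0 w0 hf.
have h1 := RV_fst (RVV hv v0); have h2 := RV_snd (RVV hw w0).
apply: Rg_req (RgM (Rg_cst (S := surf E) x (-1)) (RgM hf (RgM (ex_intro _ _ h1) (ex_intro _ _ h2)))) _.
have g1 := RV_gen_neq0 (RV_fst hv) v0; have g2 := RV_gen_neq0 (RV_snd hw) w0.
apply: gen2S (gen2I g1 g2) => y [f1 f2].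
have [->|t0] := eqVneq (th y) 0; first by rewrite invr0 !mulr0 mul0r mulr0.
by field; rewrite f1 f2 t0.
Qed.

Lemma divides_diff_eq th x f g : divides_diff th x f -> cofin (fun Q => f Q = g Q) ->
  divides_diff th x g.
Proof.
move=> hf e; have e2 := e; apply: Rg_req hf _; apply: cofinS e => a ea; apply: cofinS e2 => b eb.
by rewrite /= ea eb.
Qed.

(* The ideal of the diagonal at (a, a) is generated by the differences of the
   coordinates, hence by th as soon as th divides these. *)
Lemma divides_diagonal th a F : (forall i j, hcoord a j != 0 ->
    divides_diff th (a, a) (fun Q => hcoord Q i / hcoord Q j)) ->
  gen2 (fun y : X => th y != 0) ->
  Rg (a, a) F -> cofin (fun b => forall v, RV (b, b) F v -> v = 0) ->
  Rg (a, a) (fun y => F y / th y).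
Proof.
move=> hth gth [v [f [hf _ Ff]]] h0.
have {}h0 : cofin (fun b => f (b, b) = 0).
  apply: cofinS (cofinI h0 (cofin_ratX_diag hf)) => b [h rb]; apply: h.
  exact: RV_req (rat_RV (S := surf E) rb) (req_sym Ff).
suff h : Rg (a, a) (fun y => (f y - f (y.1, y.1)) / th y).
  apply: Rg_req h _; apply: gen2S (gen2I Ff (_ : gen2 (fun y : X => f (y.1, y.1) = 0))).
    by move=> y [-> ->]; rewrite subr0.
  by apply: cofinS h0 => b e; apply: cofin_true.
have diag (g : X -> k) : ratX (a, a) g -> Rg (a, a) g /\ RV (a, a) (fun y => g (y.1, y.1)) (g (a, a)).
  move=> rg; split; first by exists (g (a, a)); apply: rat_RV.
  exact: (RV_fst (x := (a, a)) (rat_RV (S := C) (ratX_diag rg))).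
have {Ff h0} : forall g : X -> k, ratX (a, a) g -> Rg (a, a) (fun y => (g y - g (y.1, y.1)) / th y).
  move=> g; elim=> [s i j hj|c|g1 g2 r1 h1 r2 h2|g1 g2 r1 h1 r2 h2|g1 r1 h1 g0] /=.
  - case: s hj => hj; first exact: hth.
    by apply: Rg_eq (Rg_cst (S := surf E) (a, a) 0) _ => y; rewrite /hcoord2 /= subrr mul0r.
  - by apply: Rg_eq (Rg_cst (S := surf E) (a, a) 0) _ => y; rewrite subrr mul0r.
  - by apply: Rg_eq (RgD h1 h2) _ => y; ring.
  - have [_ d1] := diag _ r1; have [d2 _] := diag _ r2.
    by apply: Rg_eq (RgD (RgM d2 h1) (RgM (ex_intro _ _ d1) h2)) _ => y; ring.
  - have [_ d1] := diag _ r1; have d2 := rat_RV (S := surf E) r1.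
    have e1 := RVV d1 g0; have e2 := RVV d2 g0.
    apply: Rg_req (RgM (Rg_cst (S := surf E) (a, a) (-1)) (RgM h1 (RgM (ex_intro _ _ e1) (ex_intro _ _ e2)))) _.
    apply: gen2S (gen2I gth (gen2I (RV_gen_neq0 d1 g0) (RV_gen_neq0 d2 g0))) => y [t0 [f1 f2]].
    by field; rewrite f1 f2 t0.
by move=> h; apply: h.
Qed.

(** Cofactors in the factorisations dy den1 = dx den2 and dw den3 = dz num3, where d denotes the
    difference of a coordinate at the two points. Where the appropriate one is nonzero, a single
    difference generates the ideal of the diagonal. *)
Definition den1 y := hY y.2 + nY y.1.
Definition den2 y := GG y.1 y.2.
Definition den3 y := let: (z, w, z', w') := (zc y.2, wc y.2, zc y.1, wc y.1) in
  1 + a1 * z + a3 * (w + w') - a2 * z ^+ 2 - a4 * z * (w + w') - a6 * (w ^+ 2 + w * w' + w' ^+ 2).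
Definition num3 y := let: (z, w, z', w') := (zc y.2, wc y.2, zc y.1, wc y.1) in
  z ^+ 2 + z * z' + z' ^+ 2 + a2 * (z + z') * w' + a4 * w' ^+ 2 - a1 * w'.

Lemma chord3 y : hY y.1 != 0 -> hY y.2 != 0 ->
  (wc y.2 - wc y.1) * den3 y = (zc y.2 - zc y.1) * num3 y.
Proof.
move=> h1 h2; have e1 := weierstrass_zw h1; have e2 := weierstrass_zw h2.
have w : zc y.1 ^+ 3 - zc y.2 ^+ 3 = 
  (- a2 * wc y.1 * zc y.1 ^+ 2 + (a1 * wc y.1 - a4 * wc y.1 ^+ 2) * zc y.1 +
    (wc y.1 + a3 * wc y.1 ^+ 2 - a6 * wc y.1 ^+ 3)) -
  (- a2 * wc y.2 * zc y.2 ^+ 2 + (a1 * wc y.2 - a4 * wc y.2 ^+ 2) * zc y.2 +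
    (wc y.2 + a3 * wc y.2 ^+ 2 - a6 * wc y.2 ^+ 3)) by rewrite e1 e2.
by rewrite /den3 /num3; apply: (eq_of_relation (c := 1) w); ring.
Qed.

Definition theta (t : bool * bool) y : k := match t with
  | (false, false) => 1
  | (false, true) => hX y.2 - hX y.1
  | (true, false) => hY y.2 - hY y.1
  | (true, true) => zc y.2 - zc y.1 end.

(* Away from the zeros of theta t outside the diagonal. *)
Definition off_residual (t : bool * bool) y : Prop := match t with
  | (false, false) => y.1 != y.2
  | (false, true) => [/\ y.1 != o, y.2 != o & den1 y != 0]
  | (true, false) => [/\ y.1 != o, y.2 != o & den2 y != 0]
  | (true, true) => [/\ hY y.1 != 0, hY y.2 != 0 & den3 y != 0] end.

(** On the diagonal, [den1] and [den2] are up to sign the two partial derivatives at an affine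
    point, and [den3] is 1 at the origin. *)
Lemma off_residual_cover y : exists t, off_residual t y.
Proof.
have [e|ne] := eqVneq y.1 y.2; last by exists (false, false).
have [yo|yo] := eqVneq y.1 o.
  exists (true, true); rewrite /= /den3 -e yo zc_o wc_o hY_o_neq0; split=> //.
  by rewrite !mul0r !mulr0 !expr0n /= !(addr0, subr0, mulr0) oner_neq0.
have [d0|d0] := eqVneq (den1 y) 0; last by exists (false, true); rewrite /= -e.
exists (true, false); rewrite /= -e; split=> //; rewrite /den2 -e; apply: GG_nonsingular => //.
by move: d0; rewrite /den1 -e.
Qed.

Lemma gen_theta t : gen2 (fun y : X => theta t y != 0).
Proof.
case: t => -[] [] /=.
- apply: cofinS (cofinI (@cofin_hX _ E [:: 0]) (@cofin_hY _ E [:: 0])) => a; rewrite !inE => -[xa ya].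
  have h := RV_gen_neq0 (RVB (RV_z_o E) (RV_cst (S := C) o (zc a))) _.
  by apply: h; rewrite sub0r oppr_eq0 /zc mulf_neq0 ?invr_eq0.
- by apply: cofin_true => a; apply: cofinS (@cofin_hY _ E [:: hY a]) => Q; rewrite inE subr_eq0.
- by apply: cofin_true => a; apply: cofinS (@cofin_hX _ E [:: hX a]) => Q; rewrite inE subr_eq0.
- by apply: cofin_true => a; apply: cofin_true => Q; apply: oner_neq0.
Qed.

Lemma RV_theta t y : off_residual t y -> RV y (theta t) (theta t y).
Proof.
case: t => -[] [] /=.
- by move=> [h1 h2 _]; apply: RVB; [apply: RV_snd (RV_z h2)|apply: RV_fst (RV_z h1)].
- by move=> [h1 h2 _]; apply: RVB; [apply: RV_snd (RV_hY h2)|apply: RV_fst (RV_hY h1)].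
- by move=> [h1 h2 _]; apply: RVB; [apply: RV_snd (RV_hX h2)|apply: RV_fst (RV_hX h1)].
- by move=> _; apply: RV_cst.
Qed.

Lemma theta_diagonal t y : off_residual t y -> y.1 = y.2 -> theta t y = 0.
Proof. by case: t => -[] [] /= h e; rewrite ?e ?subrr // in h *; rewrite eqxx in h. Qed.

Lemma theta_neq0 t y : off_residual t y -> y.1 != y.2 -> theta t y != 0.
Proof.
case: t => -[] [] /=; last by move=> _ _; apply: oner_neq0.
- move=> [h1 h2 d] ne; apply: contraNneq ne => /eqP; rewrite subr_eq0 => /eqP z.
  have /eqP := chord3 h1 h2; rewrite z subrr mul0r mulf_eq0 (negbTE d) orbF subr_eq0 => /eqP w.
  have oE P : hY P != 0 -> (P == o) = (wc P == 0).
    move=> hP; have [->|Po] := eqVneq P o; first by rewrite wc_o eqxx.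
    by rewrite (wE Po) invr_eq0 (negbTE hP).
  have [y1o|y1o] := eqVneq y.1 o.
    by rewrite y1o eq_sym oE // w -oE // y1o eqxx.
  have y2o : y.2 != o by rewrite oE // w -oE.
  have yE : hY y.2 = hY y.1 by apply: invr_inj; rewrite -!wE.
  apply/eqP/affine_eq => //; apply: (mulIf (_ : (hY y.1)^-1 != 0)); first by rewrite invr_eq0.
  by rewrite -{2}yE; apply/esym.
- move=> [h1 h2 d] ne; apply: contraNneq ne => /eqP; rewrite subr_eq0 => /eqP yE.
  have /eqP := chord h1 h2; rewrite yE subrr mul0r eq_sym mulf_eq0 (negbTE d) orbF subr_eq0 => /eqP xE.
  by apply/eqP/affine_eq.
- move=> [h1 h2 d] ne; apply: contraNneq ne => /eqP; rewrite subr_eq0 => /eqP xE.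
  by have [->|/eqP] := same_x h1 h2 xE; rewrite // (negbTE d).
Qed.

Lemma RV_GG2 y : y.1 != o -> y.2 != o -> RV y den2 (den2 y).
Proof.
move=> h1 h2; have x1 := RV_fst (RV_hX h1); have x2 := RV_snd (RV_hX h2); have y2 := RV_snd (RV_hY h2).
have c e := RV_cst (S := surf E) y (e : k).
exact: (RVB (RVD (RVD (RVD (RVD (RVX 2 x2) (RVM x2 x1)) (RVX 2 x1)) (RVM (c a2) (RVD x2 x1))) (c a4))
  (RVM (c a1) y2)).
Qed.

Lemma RV_den1 y : y.1 != o -> y.2 != o -> RV y den1 (den1 y).
Proof.
move=> h1 h2; have c e := RV_cst (S := surf E) y (e : k).
exact: (RVD (RV_snd (RV_hY h2)) (RVD (RVD (RV_fst (RV_hY h1)) (RVM (c a1) (RV_fst (RV_hX h1)))) (c a3))).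
Qed.

Lemma RV_den3 y : hY y.1 != 0 -> hY y.2 != 0 -> RV y den3 (den3 y) /\ RV y num3 (num3 y).
Proof.
move=> h1 h2; have c e := RV_cst (S := surf E) y (e : k).
have z' := RV_fst (RV_z h1); have w' := RV_fst (RV_w h1).
have z := RV_snd (RV_z h2); have w := RV_snd (RV_w h2); split.
  exact: (RVB (RVB (RVB (RVD (RVD (c 1) (RVM (c a1) z)) (RVM (c a3) (RVD w w'))) (RVM (c a2) (RVX 2 z)))
    (RVM (RVM (c a4) z) (RVD w w'))) (RVM (c a6) (RVD (RVD (RVX 2 w) (RVM w w')) (RVX 2 w')))).
exact: (RVB (RVD (RVD (RVD (RVD (RVX 2 z) (RVM z z')) (RVX 2 z')) (RVM (RVM (c a2) (RVD z z')) w'))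
  (RVM (c a4) (RVX 2 w'))) (RVM (c a1) w')).
Qed.

Lemma divides_coordinates t a : off_residual t (a, a) -> forall i j, hcoord a j != 0 ->
  divides_diff (theta t) (a, a) (fun Q => hcoord Q i / hcoord Q j).
Proof.
move=> ha i j hj.
(* It suffices to treat the coordinates divided by hcoord m. *)
have reduce m : hcoord a m != 0 ->
    (forall i, divides_diff (theta t) (a, a) (fun Q => hcoord Q i / hcoord Q m)) ->
    divides_diff (theta t) (a, a) (fun Q => hcoord Q i / hcoord Q j).
  move=> hm hd; apply: (@divides_diff_eq _ _ (fun Q => hcoord Q i / hcoord Q m * (hcoord Q j / hcoord Q m)^-1)).
    have r n := RV_coord (P := a) n hm.
    have vj : hcoord a j / hcoord a m != 0 by rewrite mulf_neq0 ?invr_eq0.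
    apply: divides_diffM (hd i) _; [by exists (hcoord a i / hcoord a m)| |].
      by exists (hcoord a j / hcoord a m)^-1; apply: RVV.
    exact: (@divides_diffV (theta t) (a, a) _ _ _ (r j) (r j) vj vj (hd j)).
  by apply: cofinS (cofinI (cofin_hcoord E j) (cofin_hcoord E m)) => Q [qj qm]; field; apply/andP.
have gt := gen_theta t.
have affine_case : a != o -> divides_diff (theta t) (a, a) (@hX _ E) ->
    divides_diff (theta t) (a, a) (@hY _ E) ->
    divides_diff (theta t) (a, a) (fun Q => hcoord Q i / hcoord Q j).
  move=> ao hx hy; apply: (reduce i2); first by rewrite -[hcoord a i2]/(hZ a) hZ_neq0.
  move=> n; have e Q : Q != o -> hcoord Q i2 = 1 := @hZ1 _ _ Q.
  case: (ord3P n) => ->; [apply: divides_diff_eq hx _|apply: divides_diff_eq hy _|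
    apply: divides_diff_eq (divides_diff_cst _ _ 1) _]; apply: cofinS (cofin_neq o) => Q Qo;
  by rewrite (e Q Qo) divr1.
have self f : (forall y, theta t y = f y.2 - f y.1) -> divides_diff (theta t) (a, a) f.
  move=> ef; apply: Rg_req (Rg_cst (S := surf E) (a, a) 1) _; apply: gen2S gt => y ty.
  by rewrite -ef divff.
case: t ha gt self reduce affine_case => -[] [] /= ha gt self reduce affine_case.
- have [h1 h2 d] := ha; have [rd rn] := RV_den3 (y := (a, a)) h1 h2.
  have hz : divides_diff (theta (true, true)) (a, a) (@zc _ E) by apply: self.
  have hw : divides_diff (theta (true, true)) (a, a) (@wc _ E).
    apply: Rg_req (ex_intro _ _ (RVf rn rd d)) _.
    have gy : gen2 (fun y : X => hY y.1 != 0 /\ hY y.2 != 0).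
      by apply: cofinS (cofin_hcoord E i1) => b hb; apply: cofinS (cofin_hcoord E i1).
    apply: gen2S (gen2I gt (gen2I (RV_gen_neq0 rd d) gy)) => y [t0 [d0 [y1 y2]]].
    by apply/eqP; rewrite eqr_div // mulrC -chord3.
  apply: (reduce i1) => // n; case: (ord3P n) => ->; [exact: hz| |exact: hw].
  apply: divides_diff_eq (divides_diff_cst _ _ 1) _.
  by apply: cofinS (cofin_hcoord E i1) => Q hQ; rewrite divff.
- have [h1 h2 d] := ha; apply: affine_case => //; last exact: self.
  apply: Rg_req (ex_intro _ _ (RVf (RV_den1 (y := (a, a)) h1 h2) (RV_GG2 (y := (a, a)) h1 h2) d)) _.
  have go : gen2 (fun y : X => y.1 != o /\ y.2 != o).
    by apply: cofinS (cofin_neq o) => b bo; apply: cofinS (cofin_neq o).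
  apply: gen2S (gen2I gt (gen2I (RV_gen_neq0 (RV_GG2 (y := (a, a)) h1 h2) d) go)) => y [t0 [d0 [y1 y2]]].
  by apply/eqP; rewrite eqr_div // mulrC /den1 (chord y1 y2).
- have [h1 h2 d] := ha; apply: affine_case => //; first exact: self.
  apply: Rg_req (ex_intro _ _ (RVf (RV_GG2 (y := (a, a)) h1 h2) (RV_den1 (y := (a, a)) h1 h2) d)) _.
  have go : gen2 (fun y : X => y.1 != o /\ y.2 != o).
    by apply: cofinS (cofin_neq o) => b bo; apply: cofinS (cofin_neq o).
  apply: gen2S (gen2I gt (gen2I (RV_gen_neq0 (RV_den1 (y := (a, a)) h1 h2) d) go)) => y [t0 [d0 [y1 y2]]].
  by apply/eqP; rewrite eqr_div // /den1 mulrC -(chord y1 y2).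
- by rewrite eqxx in ha.
Qed.

End Diagonal.

Section Bundles.
Context (k : closedFieldType) (E : elliptic_curve k).
Local Notation pt := (Defs.point E).
Local Notation X := (surface E).
Local Notation RVE := (@RV k (curve E)).
Local Notation RV := (@RV k (surf E)).
Local Notation Rg := (@Rg k (surf E)).
Local Notation req := (@req k (surf E)).
Local Notation val_at := (@val_at k (surf E)).
Local Notation o := (origin E).
Local Notation C := (curve E).
Local Notation ratX := (ratfun (@hcoord2 k E)).
Implicit Types (P Q a b p q : pt) (x y z : X) (F G : X -> k) (W : set X).

Lemma open_diagonal W a : open W -> W (a, a) -> cofin (fun b => W (b, b)).
Proof.
move=> oW Wa; have [d [e [f [hf fa sub]]]] := nbhs_nonvanishing (open_nbhs_nbhs (conj oW Wa)).
have [j hj] := hcoord_neq0 a.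
have rf : ratX (a, a) (fun y => f.@[fun i => aff j j i y]).
  by apply: ratX_mpoly => i; apply: ratX_aff.
have fE b : hcoord b j != 0 -> f.@[coords (b, b)] != 0 <-> f.@[fun i => aff j j i (b, b)] != 0.
  move=> hb; rewrite (meval_aff hf (j1 := j) (j2 := j)) // !mulf_eq0 !negb_or !expf_neq0 //.
have h := cofin_rat (ratX_diag rf) ((fE a hj).1 fa).
apply: cofinS (cofinI h (cofin_hcoord E j)) => b [fb hb].
by apply: sub; apply/(fE b hb).
Qed.

(** Off the diagonal theta is a unit. At a diagonal point, openness of W spreads the vanishing of F
    to almost all of the diagonal, as [divides_diagonal] requires. *)
Lemma theta_ideal t W F x : open W -> W x -> off_residual t x -> (forall y, W y -> Rg y F) ->
  (forall y, W y -> y.1 = y.2 -> RV y F 0) -> Rg x (fun y => F y / theta t y).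
Proof.
move=> oW Wx hx hF h0; have [e|ne] := eqVneq x.1 x.2; last first.
  have h := RVV (RV_theta hx) (theta_neq0 hx ne).
  by apply: RgM (hF x Wx) (ex_intro _ _ h).
case: x e Wx hx => a b /= <- Wa ha.
apply: (@divides_diagonal _ _ (theta t) a F (divides_coordinates ha) (gen_theta E t) (hF _ Wa)).
apply: cofinS (open_diagonal oW Wa) => c Wc v hv; exact: RV_uniq hv (h0 (c, c) Wc erefl).
Qed.

Lemma near_value (A : X -> Prop) F x : (forall y, A y -> RV y F (F y)) -> A x ->
  (\forall y \near x, A y) -> F x != 0 -> \forall y \near x, A y /\ F y != 0.
Proof.
move=> hF Ax nA Fx; apply: filterS2 nA (RV_near_neq0 (hF x Ax) Fx) => y Ay [w hw w0].
by split=> //; rewrite (RV_uniq (hF y Ay) hw).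
Qed.

Lemma open_off_residual t : open (fun y : X => off_residual t y).
Proof.
have affine (F : X -> k) x : (forall y, y.1 != o -> y.2 != o -> RV y F (F y)) -> x.1 != o -> x.2 != o ->
    F x != 0 -> \forall y \near x, [/\ y.1 != o, y.2 != o & F y != 0].
  move=> hF h1 h2 d; have n1 := @near_neq _ E false x o h1; have n2 := @near_neq _ E true x o h2.
  have := @near_value (fun y => y.1 != o /\ y.2 != o) F x _ (conj h1 h2) _ d.
  move/(_ (fun y hy => hF y hy.1 hy.2) (filterI n1 n2)); apply: filterS => y [[a1 a2] a3]; by split.
apply: open_of_near => x; case: t => -[] [] /=; last exact: near_off_diagonal.
- move=> [h1 h2 d].
  have n1 := @near_cofin _ E false x _ (cofin_hcoord E i1) h1.
  have n2 := @near_cofin _ E true x _ (cofin_hcoord E i1) h2.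
  have h : \forall y \near x, (hY y.1 != 0 /\ hY y.2 != 0) /\ den3 y != 0.
    apply: (@near_value (fun y => hY y.1 != 0 /\ hY y.2 != 0)) => // [y [a1 a2]|].
      by have [] := RV_den3 a1 a2.
    exact: filterI n1 n2.
  by apply: filterS h => y [[a1 a2] a3].
- by move=> [h1 h2 d]; exact: (affine _ x (@RV_GG2 _ E) h1 h2 d).
- by move=> [h1 h2 d]; exact: (affine _ x (@RV_den1 _ E) h1 h2 d).
Qed.

(** ** Local equations of the origin *)

(* 1 / phi vanishes to first order at o. *)
Definition ps (s : bool) a : k := if s then (phi a)^-1 else 1.
Definition Ud (s : bool) a : Prop := if s then a = o \/ hX a != 0 /\ hY a != 0 else a != o.
(** The case s = s' is separate because [ps true] evaluates to 0 at the origin, where the quotient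
    would be 0 instead of 1. *)
Definition tr (s s' : bool) a : k := if s == s' then 1 else ps s a / ps s' a.

Lemma cofin_Ud s P : cofin (fun a => Ud s (addp a P)).
Proof.
case: s => /=; first by apply: cofinS (cofin_xy_translate P) => a h; right.
by apply: (cofinS _ (cofin_neq (negp P))) => a h; rewrite addp_eq_o.
Qed.

Lemma Ud_cover a : exists s, Ud s a.
Proof. by have [->|ao] := eqVneq a o; [exists true; left|exists false]. Qed.

Lemma gen_ps s P : cofin (fun a => ps s (addp a P) != 0).
Proof.
case: s => /=; last by apply: cofin_true => a; apply: oner_neq0.
apply: cofinS (cofin_xy_translate P) => a [xa ya].
by rewrite invr_eq0 phiE mulf_neq0 ?invr_eq0 ?expf_neq0.
Qed.

Lemma phi_neq0 a : hX a != 0 -> hY a != 0 -> phi a != 0.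
Proof. by move=> xa ya; rewrite phiE mulf_neq0 ?invr_eq0 ?expf_neq0. Qed.

Lemma RV_ps s P a : Ud s (addp a P) -> addp a P != o ->
  RVE a (fun Q => ps s (addp Q P)) (ps s (addp a P)) /\ ps s (addp a P) != 0.
Proof.
case: s => /= [h ao|h _]; last by split; [exact: RV_cst|exact: oner_neq0].
have [xa ya] : hX (addp a P) != 0 /\ hY (addp a P) != 0 by case: h => // e; rewrite e eqxx in ao.
have p0 := phi_neq0 xa ya; split; last by rewrite invr_eq0.
by apply: RVV p0; apply: RV_phi_translate => //; rewrite -addp_eq_o.
Qed.

Lemma RV_tr s s' P a : Ud s (addp a P) -> Ud s' (addp a P) ->
  RVE a (fun Q => ps s (addp Q P) / ps s' (addp Q P)) (tr s s' (addp a P)).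
Proof.
rewrite /tr; case: eqVneq => [<- h _|ne h h'].
  by apply: RV_req (RV_cst (S := C) a 1) _; apply: cofinS (gen_ps s P) => Q hQ; rewrite divff.
have ao : addp a P != o by move: ne h h'; case: s; case: s'.
have [r1 n1] := RV_ps h ao; have [r2 n2] := RV_ps h' ao.
exact: RVf r1 r2 n2.
Qed.

Lemma tr_cocycle s1 s2 s3 a : Ud s1 a -> Ud s2 a -> Ud s3 a -> tr s1 s2 a * tr s2 s3 a = tr s1 s3 a.
Proof.
have n s s' : Ud s a -> Ud s' a -> s != s' -> phi a != 0.
  have h : Ud false a -> Ud true a -> phi a != 0.
    by move=> /= ao [e|[xa ya]]; [rewrite e eqxx in ao|apply: phi_neq0].
  by case: s; case: s' => // *; apply: h.
rewrite /tr /ps; case: s1; case: s2; case: s3 => //= h1 h2 h3; rewrite ?mulr1 ?mul1r //.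
- by have p0 := n true false h1 h2 isT; rewrite divr1 mulfV ?invr_eq0.
- by have p0 := n false true h1 h2 isT; rewrite divr1 mulVf ?invr_eq0.
Qed.

Lemma ps_unit s P a : Ud s (addp a P) -> exists2 w, w != 0 &
  RVE a (fun Q => ps s (addp Q P) / (if a == negp P then (tau (negp P) Q)^-1 else 1)) w.
Proof.
move=> h; case: eqVneq => [e|ne]; last first.
  have [|r n] := RV_ps h; first by rewrite addp_eq_o.
  by exists (ps s (addp a P)) => //; apply: RV_eq r _ _ => // Q; rewrite divr1.
have s1 : s = true by case: s h => //=; rewrite addp_eq_o e eqxx.
have [w w0 hw] := RV_phi_translate_pole P; exists w => //.
by rewrite e s1; apply: RV_eq hw _ _ => // Q; rewrite invrK.
Qed.

(** ** L = O({o} x E + E x {o}) and M = O(E x {o} - diagonal) *)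

Definition psL (P Q : pt) (i : bool * bool) y := ps i.1 (addp y.1 P) * ps i.2 (addp y.2 Q).

Definition bundle_L : line_data E := @LineData k E (bool * bool)%type
  (fun i y => Ud i.1 y.1 /\ Ud i.2 y.2)
  (fun i j y => tr i.1 j.1 y.1 * tr i.2 j.2 y.2).

Definition psM (i : bool * (bool * bool)) y := ps i.1 y.2 / theta i.2 y.

(** The transition functions are true values of rational functions, since on the diagonal a literal
    quotient of two local equations would be 0 / 0. *)
Definition bundle_M : line_data E := @LineData k E (bool * (bool * bool))%type
  (fun i y => Ud i.1 y.2 /\ off_residual i.2 y)
  (fun i j y => val_at y (fun z => psM i z / psM j z)).

Lemma open_Ud2 s s' P Q : open (fun y : X => Ud s (addp y.1 P) /\ Ud s' (addp y.2 Q)).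
Proof.
apply: open_of_near => x [h1 h2].
by apply: filterI; [exact: (near_cofin (s := false) (cofin_Ud s P) h1)|
  exact: (near_cofin (s := true) (cofin_Ud s' Q) h2)].
Qed.

Lemma presented_L x : presented (N := pullback_translate x bundle_L) (psL x.1 x.2).
Proof.
split=> [i|y|i|i j y [h1 h2] [h3 h4]].
- exact: open_Ud2.
- have [s hs] := Ud_cover (addp y.1 x.1); have [s' hs'] := Ud_cover (addp y.2 x.2).
  by exists (s, s').
- apply: cofinS (gen_ps i.1 x.1) => a ha; apply: cofinS (gen_ps i.2 x.2) => b hb.
  by rewrite mulf_neq0.
- apply: RV_eq (RVM (RV_fst (RV_tr h1 h3)) (RV_snd (RV_tr h2 h4))) _ _ => // z.
  by rewrite /psL mulf_div.
Qed.

Lemma trans_presented N (psi : lb_index N -> X -> k) : presented psi ->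
  (forall i x, lb_open i x -> lb_trans (l := N) i i x = 1) ->
  (forall h i j x, lb_open h x -> lb_open i x -> lb_open j x ->
    lb_trans (l := N) h i x * lb_trans i j x = lb_trans h j x) -> is_line_bundle N.
Proof.
move=> hP h1 hM; split=> //; first exact: pr_open hP.
  by apply/seteqP; split=> // x _; have [i hi] := pr_cover hP x; exists i.
move=> i j; apply: (@RV_regular_on _ _ _ (fun y => psi i y / psi j y)).
  by apply: openI; apply: pr_open hP _.
by move=> y [hi hj]; apply: pr_trans hP _ _ _ hi hj.
Qed.

Lemma line_bundle_L : is_line_bundle bundle_L.
Proof.
have h := presented_L (o, o).
have hP : presented (N := bundle_L) (psL o o).
  split=> [i|y|i|i j y [h1 h2] [h3 h4]].
  - have <- : (fun y : X => Ud i.1 (addp y.1 o) /\ Ud i.2 (addp y.2 o)) = lb_open (l := bundle_L) i.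
      by apply/funext => y; rewrite !addp0.
    exact: open_Ud2.
  - by have [i] := pr_cover h y; rewrite /= !addp0; exists i.
  - exact: (pr_gen h).
  - have := pr_trans h (i := i) (j := j) (x := y); rewrite /= !addp0; apply; by split.
apply: (trans_presented hP) => [i x _|l i j x [a1 a2] [b1 b2] [c1 c2]] /=.
  by rewrite /tr !eqxx mulr1.
by rewrite mulrACA (tr_cocycle a1 b1 c1) (tr_cocycle a2 b2 c2).
Qed.

Definition theta_ratio t t' y : off_residual t y -> off_residual t' y ->
  Rg y (fun z => theta t z / theta t' z).
Proof.
move=> h h'; apply: (@theta_ideal t' (fun z => off_residual t z)) => //.
- exact: open_off_residual.
- by move=> z hz; exists (theta t z); apply: RV_theta.
- by move=> z hz e; rewrite -(theta_diagonal hz e); apply: RV_theta.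
Qed.

Lemma gen_psM i : gen2 (fun y : X => psM i y != 0).
Proof.
have h : gen2 (fun y : X => ps i.1 y.2 != 0).
  by apply: cofin_true => a; apply: cofinS (gen_ps i.1 o) => b; rewrite addp0.
by apply: gen2S (gen2I h (gen_theta E i.2)) => y [h1 h2]; rewrite /psM mulf_neq0 ?invr_eq0.
Qed.

Lemma RV_tr0 s s' a : Ud s a -> Ud s' a -> RVE a (fun Q => ps s Q / ps s' Q) (tr s s' a).
Proof.
move=> h h'; have := @RV_tr s s' o a; rewrite addp0 => /(_ h h') r.
by apply: RV_eq r _ _ => // Q; rewrite addp0.
Qed.

Lemma presented_M : presented (N := bundle_M) psM.
Proof.
split=> [i|y|i|i j y [h1 h2] [h3 h4]].
- apply: openI; last exact: open_off_residual.
  apply: open_of_near => x h; apply: (near_cofin (s := true) _ h).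
  by apply: cofinS (cofin_Ud i.1 o) => a; rewrite addp0.
- have [s hs] := Ud_cover y.2; have [t ht] := off_residual_cover y.
  by exists (s, t).
- exact: gen_psM.
- apply: val_atP; apply: Rg_eq (RgM (Rg_snd (ex_intro _ _ (RV_tr0 h1 h3))) (theta_ratio h4 h2)) _ => z.
  by rewrite /psM !invfM !invrK; ring.
Qed.

Lemma line_bundle_M : is_line_bundle bundle_M.
Proof.
have hP := presented_M; apply: (trans_presented hP) => [i x hi|h i j x hh hi hj].
  apply: val_atE; apply: RV_req (RV_cst (S := surf E) x 1) _.
  by apply: gen2S (gen_psM i) => z hz; rewrite divff.
have r1 := pr_trans hP hh hi; have r2 := pr_trans hP hi hj; have r3 := pr_trans hP hh hj.
apply: RV_uniq r3; apply: RV_req (RVM r1 r2) _.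
by apply: gen2S (gen_psM i) => z hz; rewrite mulrA divfK.
Qed.

Definition DL (p q : pt) : seq (bool * pt) := [:: (false, p); (true, q)].
Definition DM : seq (bool * pt) := [:: (true, o)].

Lemma unit_L x i y : lb_open (l := pullback_translate x bundle_L) i y -> exists2 w, w != 0 &
  RV y (fun z => psL x.1 x.2 i z / mu (DL (negp x.1) (negp x.2)) y z) w.
Proof.
move=> [h1 h2]; have [w1 n1 r1] := ps_unit h1; have [w2 n2 r2] := ps_unit h2.
exists (w1 * w2); first by rewrite mulf_neq0.
apply: RV_eq (RVM (RV_fst r1) (RV_snd r2)) _ _ => // z.
by rewrite mulf_div /DL !mu_cons mu_nil mulr1.
Qed.

Lemma unit_M s y : Ud s y.2 -> exists2 w, w != 0 & RV y (fun z => ps s z.2 / mu DM y z) w.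
Proof.
move=> h; have [] := @ps_unit s o y.2; first by rewrite addp0.
move=> w n r; exists w => //; apply: RV_eq (RV_snd r) _ _ => // z.
by rewrite addp0 negp_o /DM mu_cons mu_nil mulr1.
Qed.

(** At x, f and mu D' differ by a unit, so multiplication by f absorbs exactly the poles along
    D'. *)
Lemma St_unit m D D' x f w F : RV x (fun y => f y / mu D' x y) w -> w != 0 ->
  St m D x (fun y => f y * F y) <-> St m (D' ++ D) x F.
Proof.
move=> r w0; have r' := RVV r w0.
have g := gen2I (gen_mu D' x) (RV_gen_neq0 r w0).
have e1 : req (fun y => f y / mu D' x y * (mu (D' ++ D) x y * F y)) (fun y => mu D x y * (f y * F y)).
  by apply: gen2S g => y [m0 _]; rewrite mu_cat; field.
have e2 : req (fun y => (f y / mu D' x y)^-1 * (mu D x y * (f y * F y))) (fun y => mu (D' ++ D) x y * F y).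
  apply: gen2S g => y [m0 f0]; rewrite mu_cat.
  have {}f0 : f y != 0 by apply: contraNneq f0 => ->; rewrite mul0r.
  by field; rewrite m0 f0.
split=> -[h h0]; split=> [|mt e].
- exact: Rg_req (RgM (ex_intro _ _ r') h) e2.
- by apply: RV_req e2; apply: RV_eq (RVM r' (h0 mt e)) _ _ => //; rewrite mulr0.
- exact: Rg_req (RgM (ex_intro _ _ r) h) e1.
- by apply: RV_req e1; apply: RV_eq (RVM r (h0 mt e)) _ _ => //; rewrite mulr0.
Qed.

Lemma matches_L x : matches (N := pullback_translate x bundle_L) (psL x.1 x.2) false
  (DL (negp x.1) (negp x.2)).
Proof.
move=> W F oW.
have St_nil y G : St false [::] y G <-> Rg y G.
  split=> [[h _]|h]; first by apply: Rg_eq h _ => z; rewrite mu_nil mul1r.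
  by split=> //; apply: Rg_eq h _ => z; rewrite mu_nil mul1r.
split=> h y Wy => [|i hi].
  have [i hi] := pr_cover (presented_L x) y; have [w w0 r] := unit_L hi.
  by rewrite -[DL _ _]cats0; apply/(St_unit _ _ _ r w0)/St_nil; apply: h.
have [w w0 r] := unit_L hi.
by apply/St_nil/(St_unit _ _ _ r w0); rewrite cats0; apply: h.
Qed.

Lemma theta_matches W F : open W ->
  (forall x, W x -> forall t, off_residual t x -> Rg x (fun y => F y / theta t y)) <->
  (forall x, W x -> St true [::] x F).
Proof.
move=> oW; split=> h x Wx => [|t ht].
  have R t : off_residual t x -> Rg x (fun y => theta t y * (F y / theta t y)).
    by move=> ht; apply: RgM (ex_intro _ _ (RV_theta ht)) (h x Wx t ht).
  have e t : req (fun y => theta t y * (F y / theta t y)) (fun y => mu [::] x y * F y).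
    by apply: gen2S (gen_theta E t) => y ty; rewrite mu_nil mul1r mulrC divfK.
  have [t ht] := off_residual_cover x; split=> [|_ x12]; first exact: Rg_req (R t ht) (e t).
  apply: RV_req (e t); have [v hv] := h x Wx t ht.
  by apply: RV_eq (RVM (RV_theta ht) hv) _ _ => //; rewrite (theta_diagonal ht x12) mul0r.
apply: (theta_ideal oW Wx ht) => y Wy => [|y12]; have [h1 h2] := h y Wy.
  by apply: Rg_eq h1 _ => z; rewrite mu_nil mul1r.
by apply: RV_eq (h2 isT y12) _ _ => // z; rewrite mu_nil mul1r.
Qed.

Lemma open_Ud s : open (fun y : X => Ud s y.2).
Proof.
apply: open_of_near => x h; apply: (near_cofin (s := true) _ h).
by apply: cofinS (cofin_Ud s o) => a; rewrite addp0.
Qed.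

Lemma matches_M : matches (N := bundle_M) psM true DM.
Proof.
move=> W F oW.
have key s : (forall x, W x /\ Ud s x.2 -> forall t, off_residual t x ->
    Rg x (fun y => ps s y.2 * F y / theta t y)) <->
    (forall x, W x /\ Ud s x.2 -> St true DM x F).
  apply: (iff_trans (theta_matches _ (openI oW (open_Ud s)))).
  split=> h x [Wx sx]; have [w w0 r] := unit_M sx.
    by rewrite -[DM]cats0; apply/(St_unit _ _ _ r w0); apply: h.
  by apply/(St_unit _ _ _ r w0); rewrite cats0; apply: h.
split=> h x Wx => [|[s t] [hs ht]].
  have [s hs] := Ud_cover x.2; apply: (key s).1 => // y [Wy sy] t ht.
  by apply: Rg_eq (h y Wy (s, t) (conj sy ht)) _ => z; rewrite /psM mulrAC.
have := (key s).2 (fun y hy => h y hy.1) x (conj Wx hs) t ht.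
by move=> r; apply: Rg_eq r _ => z; rewrite /psM mulrAC.
Qed.

Definition psN (x : X) (i : (bool * bool) * (bool * (bool * bool))) y := psL x.1 x.2 i.1 y * psM i.2 y.

Lemma presented_N x : presented (N := tensor (pullback_translate x bundle_L) bundle_M) (psN x).
Proof.
have hL := presented_L x; have hM := presented_M.
split=> [i|y|i|i j y [h1 h2] [h3 h4]].
- by apply: openI; [apply: pr_open hL _|apply: pr_open hM _].
- have [i hi] := pr_cover hL y; have [j hj] := pr_cover hM y; by exists (i, j).
- by apply: gen2S (gen2I (pr_gen hL i.1) (pr_gen hM i.2)) => y [a b]; rewrite mulf_neq0.
- apply: RV_eq (RVM (pr_trans hL h1 h3) (pr_trans hM h2 h4)) _ _ => // z.
  by rewrite mulf_div.
Qed.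

Lemma matches_N x : matches (N := tensor (pullback_translate x bundle_L) bundle_M) (psN x) true
  (DL (negp x.1) (negp x.2) ++ DM).
Proof.
move=> W F oW.
have key i : (forall y, W y /\ lb_open (l := pullback_translate x bundle_L) i y -> forall j, lb_open (l := bundle_M) j y ->
    Rg y (fun z => psM j z * (psL x.1 x.2 i z * F z))) <->
    (forall y, W y /\ lb_open (l := pullback_translate x bundle_L) i y ->
      St true (DL (negp x.1) (negp x.2) ++ DM) y F).
  apply: (iff_trans (matches_M _ (openI oW (pr_open (presented_L x) i)))).
  split=> h y [Wy iy]; have [w w0 r] := unit_L iy.
    by apply/(St_unit _ _ _ r w0); apply: h.
  by apply/(St_unit _ _ _ r w0); apply: h.
split=> h y Wy => [|[i j] [hi hj]].
  have [i hi] := pr_cover (presented_L x) y; apply: (key i).1 => // z [Wz iz] j hj.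
  by apply: Rg_eq (h z Wz (i, j) (conj iz hj)) _ => u; rewrite /psN /=; ring.
have := (key i).2 (fun z hz => h z hz.1) y (conj Wy hi) j hj.
by move=> r; apply: Rg_eq r _ => z; rewrite /psN /=; ring.
Qed.

End Bundles.

(** * Cohomology of the three bundles *)

Section Final.
Context (k : closedFieldType) (E : elliptic_curve k).
Local Notation pt := (Defs.point E).
Local Notation X := (surface E).
Local Notation RVE := (@RV k (curve E)).
Local Notation RgE := (@Rg k (curve E)).
Local Notation RV := (@RV k (surf E)).
Local Notation Rg := (@Rg k (surf E)).
Local Notation req := (@req k (surf E)).
Local Notation o := (origin E).
Local Notation C := (curve E).
Local Notation ratX := (ratfun (@hcoord2 k E)).
Implicit Types (P Q a b p q : pt) (x y z : X) (F G : X -> k) (W : set X).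

Definition tm (Qs : seq pt) b Q : k := mu (tdiv Qs) (b, b) (Q, Q).

Lemma mu_tm Qs x y : mu (tdiv Qs) x y = tm Qs x.2 y.2.
Proof. by rewrite /tm /mu !big_map. Qed.

Lemma tm_cons c Qs b Q : tm (c :: Qs) b Q = (if b == c then (tau c Q)^-1 else 1) * tm Qs b Q.
Proof. by rewrite /tm -[tdiv _]/((true, c) :: tdiv Qs) mu_cons. Qed.

Lemma Rg_tm Qs b : RgE b (tm Qs b).
Proof.
elim: Qs => [|c Qs IH].
  by apply: Rg_eq (Rg_cst (S := C) b 1) _ => Q; rewrite /tm mu_nil.
have h : RgE b (fun Q => if b == c then (tau c Q)^-1 else 1).
  by case: eqVneq => [->|_]; [exists 0; apply: RV_tauV|exact: Rg_cst].
by apply: Rg_eq (RgM h IH) _ => Q; rewrite tm_cons.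
Qed.

Lemma tm1 Qs b Q : b \notin Qs -> tm Qs b Q = 1.
Proof. by move=> h; apply: mu_tdiv1. Qed.

Lemma cofin_notin (s : seq pt) : cofin (fun b => b \notin s).
Proof. by exists s. Qed.

Lemma honest2 (g : X -> k) y : ratX y g -> RV y g (g y).
Proof. exact: (rat_RV (S := surf E)). Qed.

(** For almost every Q, the only possible pole of F on the line E x {Q} is a simple one at p; hence
    F is constant there and depends on the second point alone. *)
Lemma global_sections p Qs F : (forall x, St false ((false, p) :: tdiv Qs) x F) ->
  exists f : pt -> k, (forall b, RgE b (fun Q => tm Qs b Q * f Q)) /\ req F (fun y => f y.2).
Proof.
move=> hF.
have muE x y : mu ((false, p) :: tdiv Qs) x y =
    (if x.1 == p then (tau p y.1)^-1 else 1) * tm Qs x.2 y.2.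
  by rewrite mu_cons mu_tm /mu1.
have hF0 x : x.1 != p -> x.2 \notin Qs -> Rg x F.
  move=> /negbTE xp xQ; have [h _] := hF x.
  by apply: Rg_eq h _ => y; rewrite muE xp tm1 // !mul1r.
have [a1 a1p] := cofin_ex (cofin_neq p); have [b1 b1Q] := cofin_ex (cofin_notin Qs).
have [v [g [hg _ Fg]]] := hF0 (a1, b1) a1p b1Q.
have gg : gen2 (fun y : X => ratX y g) := ratfun_gen (S := surf E) hg.
have gp : gen2 (fun y : X => y.1 != p /\ y.2 \notin Qs).
  by apply: cofinS (cofin_neq p) => a ap; apply: cofinS (cofin_notin Qs).
have [[a0 b0] [r0 [/= a0p b0Q]]] := gen2_ex (gen2I gg gp).
have r2 := cofin_ratX_line2 r0.
exists (fun Q => g (a0, Q)); split=> [b|].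
  have [w hw] : Rg (a0, b) (fun y => tm Qs b y.2 * g y).
    have [h _] := hF (a0, b); apply: Rg_req h _; apply: gen2S Fg => y ->.
    by rewrite muE /= (negbTE a0p) mul1r.
  exists w; apply: (RV_line2 hw).
  apply: cofinS (cofinI (honest (Rg_tm Qs b)) r2) => b' [h1 h2].
  by apply: RVM (RV_snd (x := (a0, b')) h1) (honest2 h2).
apply: cofinS (cofinI Fg gg) => a [Fa ga].
apply: cofinS (cofinI Fa (cofinI ga (cofinI r2 (cofin_notin Qs)))) => Q [-> [rQ [rQ0 QQ]]] /=.
have hon := cofin_ratX_line1 rQ.
have line a' : a' != p -> RgE a' (fun b => g (b, Q)).
  move=> ap; have [w hw] : Rg (a', Q) g by apply: Rg_req (hF0 (a', Q) ap QQ) Fg.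
  by exists w; apply: (RV_line1 hw); apply: cofinS hon => b; apply: honest2.
have linep : RgE p (fun b => g (b, Q) / tau p b).
  have [h _] := hF (p, Q).
  have [w hw] : Rg (p, Q) (fun y => (tau p y.1)^-1 * g y).
    by apply: Rg_req h _; apply: gen2S Fg => y ->; rewrite muE /= eqxx tm1 // mulr1.
  have ht : RgE p (fun Q => (tau p Q)^-1) by exists 0; apply: RV_tauV.
  exists w; apply: RV_eq (RV_line1 hw _) _ erefl => [|b]; last by rewrite mulrC.
  apply: cofinS (cofinI hon (honest ht)) => b [h1 h2].
  by apply: RVM (honest2 h1); apply: (RV_fst (x := (b, Q)) h2).
have [e he] := no_simple_pole line linep.
have val c : ratX (c, Q) g -> g (c, Q) = e.
  move=> rc; apply: (RV_uniq (S := C) (x := c) (F := fun b => g (b, Q))).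
    exact: (rat_RV (S := C) (ratX_line1 rc)).
  by apply: RV_req (RV_cst (S := C) c e) _; apply: cofinS he => b ->.
by rewrite !val.
Qed.

Lemma diag_zero b F : Rg (b, b) F -> cofin (fun b' => RV (b', b') F 0) -> RV (b, b) F 0.
Proof.
move=> [v [f [hf _ Ff]]] h0; exists f; split=> //.
apply: (RV_uniq (S := C) (rat_RV (S := C) (ratX_diag hf))).
apply: RV_req (RV_cst (S := C) b 0) _; apply: (@req_sym _ C).
apply: cofinS (cofinI h0 (cofin_ratX_diag hf)) => b' [h r].
exact: RV_uniq (honest2 r) (RV_req h Ff).
Qed.

Lemma cofin_mu_diag D x : cofin (fun b => Rg (b, b) (mu D x)).
Proof.
have h s c : cofin (fun b => Rg (b, b) (mu1 (s, c) x)).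
  rewrite /mu1 /=; case: eqVneq => [_|_]; last by apply: cofin_true => b; apply: Rg_cst.
  have ht : RgE c (fun Q => (tau c Q)^-1) by exists 0; apply: RV_tauV.
  apply: cofinS (honest ht) => b hb; 
  apply: (@Rg_proj _ _ s (b, b) (fun Q => (tau c Q)^-1)).
  by exists (tau c b)^-1; case: (s).
elim: D => [|[s c] D IH].
  by apply: cofin_true => b; apply: Rg_eq (Rg_cst (S := surf E) _ 1) _ => y; rewrite mu_nil.
apply: cofinS (cofinI (h s c) IH) => b [h1 h2].
by apply: Rg_eq (RgM h1 h2) _ => y; rewrite mu_cons.
Qed.

(** A regular function on E is determined at a point by its values at almost all others, so
    vanishing along the diagonal may be checked away from the poles in D. *)
Lemma St_vanish D x F : St false D x F -> (x.1 = x.2 -> cofin (fun b => RV (b, b) F 0)) -> St true D x F.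
Proof.
case: x => a b /= [h _] h0; split=> // _ /= ab; move: h; rewrite -ab => h; apply: diag_zero h _.
apply: cofinS (cofinI (h0 ab) (cofin_mu_diag D (a, a))) => c [h1 [v h2]].
by apply: RV_eq (RVM h2 h1) _ _ => //; rewrite mulr0.
Qed.

Lemma St_weaken m D x F : St m D x F -> St false D x F.
Proof. by case. Qed.

Lemma St_prod p Qs x (r f : pt -> k) :
  RgE x.1 (fun Q => (if x.1 == p then (tau p Q)^-1 else 1) * r Q) ->
  RgE x.2 (fun Q => tm Qs x.2 Q * f Q) -> St false ((false, p) :: tdiv Qs) x (fun y => r y.1 * f y.2).
Proof.
move=> hr hf; split=> //; apply: Rg_eq (RgM (Rg_fst hr) (Rg_snd hf)) _ => y.
by rewrite mu_cons mu_tm /mu1 /=; ring.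
Qed.

Lemma tm_count Qs b Q : tm Qs b Q = (tau b Q)^-1 ^+ count_mem b Qs.
Proof.
elim: Qs => [|c Qs IH]; first by rewrite /tm mu_nil.
by rewrite tm_cons IH /= exprD eq_sym; case: eqVneq => [->|_]; rewrite ?expr1 ?expr0.
Qed.

Lemma not_extendable p Qs (f g : pt -> k) w : w != 0 ->
  RVE p (fun Q => g Q / tau p Q ^+ (count_mem p Qs).+1) w ->
  RgE p (fun Q => tm Qs p Q * f Q) -> ~ cofin (fun Q => f Q = g Q).
Proof.
move=> w0 hw [v hv] e; case/eqP: w0; apply: RV_uniq hw _.
apply: RV_req (RV_eq (RVM hv (RV_tauV p)) (fun=> erefl) (mulr0 _)) _.
by apply: cofinS e => Q ->; rewrite tm_count exprS invfM exprVn; ring.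
Qed.

(** The pole order wanted at p is one more than the multiplicity of p in q + o. For p = o it is 3 or
    2, given by y or x. For p different from o it is 2 if p = q, given by x translated to p, and
    otherwise 1, given by [sg p], whose second pole at o is allowed. *)
Lemma exists_pole p q : exists g w, [/\ w != 0,
  RVE p (fun Q => g Q / tau p Q ^+ (count_mem p [:: q; o]).+1) w &
  forall b, b != p -> RgE b (fun Q => tm [:: q; o] b Q * g Q)].
Proof.
have reg g b : RgE b g -> RgE b (fun Q => tm [:: q; o] b Q * g Q).
  exact: RgM (Rg_tm _ _).
have one : (1 : k) != 0 := oner_neq0 _.
have [po|po] := eqVneq p o.
  rewrite po /= ?eqxx ?addn0; case: (q == o).
    exists (@hY _ E), 1; split=> // [|b bo]; first by rewrite tau_o; apply: RV_y_phi.
    by apply: reg; exists (hY b); apply: RV_hY.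
  exists (@hX _ E), 1; split=> // [|b bo]; first by rewrite tau_o; apply: RV_x_phi.
  by apply: reg; exists (hX b); apply: RV_hX.
rewrite /= [o == p]eq_sym (negbTE po) !addn0; case: eqVneq => [qp|qp] /=.
  exists (fun Q => hX (addp Q (negp p))), 1; have [w w0 [h _]] := translate_pole (negp p).
  rewrite negpK in h; split=> // b bp; apply: reg.
  by exists (hX (addp b (negp p))); have [] := @translate_regular _ E (negp p) b; rewrite ?negpK.
exists (sg p), 1; split=> // [|b bp].
  apply: RV_req (RV_cst (S := C) p 1) _; apply: cofinS (gen_tau p) => Q tQ.
  by rewrite expr1 -(tau_sg po) divff.
have [->|bo] := eqVneq b o; last by apply: reg; apply: Rg_sg.
apply: Rg_eq (RgM (Rg_tm [:: q] o) (ex_intro _ _ (RV_sg_phi po))) _ => Q.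
by rewrite !tm_cons eqxx tau_o; ring.
Qed.

(** A section depends on the second point alone and vanishes on the diagonal, where that point is
    arbitrary. *)
Lemma no_sections p Qs F : (forall x, St true ((false, p) :: tdiv Qs) x F) -> req F (fun=> 0).
Proof.
move=> hF.
have [f [hf Ff]] := global_sections (fun x => St_weaken (hF x)).
have f0 : cofin (fun b => f b = 0).
  have [b0 b0Q] := cofin_ex (cofin_notin Qs).
  have rf : RgE b0 f by apply: Rg_eq (hf b0) _ => Q; rewrite tm1 // mul1r.
  apply: cofinS (cofinI (honest rf) (cofin_notin (p :: Qs))) => b [h]; rewrite inE negb_or => /andP[bp bQ].
  have [_ /(_ isT erefl) h0] := hF (b, b).
  apply: (RV_uniq (RV_snd (x := (b, b)) h)); apply: RV_req (RV_eq h0 (fun=> erefl) erefl) _.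
  apply: gen2S Ff => y ->.
  by rewrite mu_cons /mu1 /= (negbTE bp) mul1r mu_tdiv1 // mul1r.
apply: gen2S (gen2I Ff (_ : gen2 (fun y : X => f y.2 = 0))) => [y [-> ->]//|].
by apply: cofin_true.
Qed.

Section FirstCohomology.
Context (N : line_data E) (psi : lb_index N -> X -> k) (p : pt) (Qs : seq pt).
Local Notation D := ((false, p) :: tdiv Qs).
Context (hP : presented psi) (hM : matches psi true D).

(** The class is the connecting image of g, seen as a section on the diagonal. If it were zero, g
    would be the restriction of a global section, that is of a function f(Q) of the second point
    alone, whose pole at p is too small. *)
Lemma nonvanishing1_pole (g : pt -> k) w : w != 0 ->
  RVE p (fun Q => g Q / tau p Q ^+ (count_mem p Qs).+1) w ->
  (forall b, b != p -> RgE b (fun Q => tm Qs b Q * g Q)) -> cohomology_nonzero N 1.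
Proof.
move=> w0 hw hg.
(* Points away from all poles, where [tau p] and g take their true values. *)
pose good b := [/\ b \notin p :: Qs, RVE b (tau p) (tau p b), tau p b != 0 & RVE b g (g b)].
have hgood : cofin good.
  have [b0] := cofin_ex (cofin_notin (p :: Qs)); rewrite inE negb_or => /andP[b0p b0Q].
  have rg : RgE b0 g by apply: Rg_eq (hg b0 b0p) _ => Q; rewrite tm1 // mul1r.
  have ht : RgE p (fun Q => (tau p Q)^-1) by exists 0; apply: RV_tauV.
  apply: cofinS (cofinI (cofinI (cofin_notin (p :: Qs)) (honest rg)) (cofinI (honest ht) (gen_tau p))).
  move=> b [[h1 h2] [h3 h4]]; split=> //.
  by apply: RV_eq (RVV h3 _) _ _ => [|Q|]; rewrite ?invrK ?invr_eq0.
pose A1 b := b = p \/ good b.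
have cA1 : cofin A1 by apply: cofinS hgood => b; right.
pose U (i : option bool) : set X := match i with
  | Some true => [set y | A1 y.1 /\ A1 y.2] | Some false => [set y | y.2 != p]
  | None => [set y | y.1 != y.2] end.
have oU i : open (U i).
  apply: open_of_near => x; case: i => [[]|] /=.
  - by move=> [h1 h2]; apply: filterI; [exact: (near_cofin (s := false) cA1 h1)|exact: (near_cofin (s := true) cA1 h2)].
  - exact: (@near_neq _ E true).
  - exact: near_off_diagonal.
have cU : \bigcup_i U i = setT.
  apply/seteqP; split=> // -[a b] _; have [ab|ab] := eqVneq a b; last by exists None.
  have [bp|bp] := eqVneq b p; last by exists (Some false).
  by exists (Some true) => //; split; left; rewrite //= ab.
(* Local extensions of g from the diagonal. Near (p, p) the excess of the pole of g is moved to the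
   first variable, where a simple pole at p is allowed; off the diagonal 0 will do. *)
pose rho (i : option bool) y : k := match i with
  | Some true => tau p y.1 * (g y.2 / tau p y.2) | Some false => g y.2 | None => 0 end.
have rho_St i x : U i x -> St false D x (rho i).
  case: i => [[]|] /=; last by move=> _; apply: St0.
    move=> [h1 h2]; apply: (@St_prod p Qs x (tau p) (fun Q => g Q / tau p Q)).
      case: h1 => [->|[h r1 _ _]].
        by rewrite eqxx; apply: Rg_req (Rg_cst (S := C) p 1) _; apply: cofinS (gen_tau p) => Q t0; rewrite mulVf.
      move: h; case: eqVneq => [->|_ _]; first by rewrite inE eqxx.
      by apply: Rg_eq (ex_intro _ _ r1) _ => Q; rewrite mul1r.
    case: h2 => [->|[h r1 n1 r2]].
      exists w; apply: RV_req hw _; apply: cofinS (gen_tau p) => Q t0.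
      by rewrite tm_count exprS invfM exprVn; ring.
    by apply: RgM (Rg_tm _ _) (ex_intro _ _ (RVf r2 r1 n1)).
  move=> xp; apply: St_eq (@St_prod p Qs x (fun=> 1) g _ (hg _ xp)) _ => [|y]; last by rewrite mul1r.
  by case: eqVneq => [->|_]; [exists 0; apply: RV_eq (RV_tauV p) _ _ => // Q; rewrite mulr1|
    apply: RgM; apply: Rg_cst].
have rho_val i b : good b -> i != None -> RV (b, b) (rho i) (g b).
  move=> [_ r1 n1 r2]; case: i => [[]|//] _ /=; last exact: (RV_snd (x := (b, b)) r2).
  have h1 := RV_fst (x := (b, b)) r1; have h2 := RV_snd (x := (b, b)) (RVf r2 r1 n1).
  by apply: RV_eq (RVM h1 h2) _ _ => //; rewrite mulrC divfK.
apply: (nonvanishing1 hP hM (U := OpenCover oU cU) (rho := rho)) => [u v x hu hv|[F hF]].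
  apply: St_vanish => [|e]; first by apply: StB; apply: rho_St.
  have nu : u != None by apply: contraPneq hu => -> /=; rewrite e eqxx.
  have nv : v != None by apply: contraPneq hv => -> /=; rewrite e eqxx.
  apply: cofinS hgood => b gb.
  by apply: RV_eq (RVB (rho_val v b gb nv) (rho_val u b gb nu)) _ _ => //; rewrite subrr.
have gF x : St false D x F.
  have [i _ hi] : (\bigcup_i U i) x by rewrite cU.
  by apply: St_eq (StB (rho_St i x hi) (St_weaken (hF i x hi))) _ => y; rewrite subKr.
have [f [hf Ff]] := global_sections gF.
apply: (not_extendable w0 hw (hf p)).
have [b0 b0Q] := cofin_ex (cofin_notin Qs).
have rf : RgE b0 f by apply: Rg_eq (hf b0) _ => Q; rewrite tm1 // mul1r.
apply: cofinS (cofinI (honest rf) hgood) => b [rb gb].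
have [bn _ _ _] := gb; move: bn; rewrite inE negb_or => /andP[bp bQ].
have Ub : U (Some true) (b, b) by split; right.
have [_ /(_ isT erefl) h0] := hF (Some true) (b, b) Ub.
have h1 := RVB (rho_val (Some true) b gb isT) (RV_snd (x := (b, b)) rb).
apply/esym/eqP; rewrite -subr_eq0; apply/eqP; apply: RV_uniq h1 _.
apply: RV_req h0 _; apply: gen2S Ff => y ->.
by rewrite mu_cons /mu1 /= (negbTE bp) mul1r mu_tdiv1 // mul1r.
Qed.

End FirstCohomology.
End Final.

(** * A nonzero class of M, the three indices, and the cup product off the curve *)

Section Cup.
Context (k : closedFieldType) (E : elliptic_curve k).
Local Notation pt := (Defs.point E).
Local Notation X := (surface E).
Local Notation RgE := (@Rg k (curve E)).
Local Notation RV := (@RV k (surf E)).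
Local Notation o := (origin E).
Local Notation C := (curve E).
Local Notation DM := (DM E).
Implicit Types (P Q a b p q : pt) (x y z : X) (F G : X -> k) (W : set X).

Lemma St_mono m D D' x F : St m D x F -> St m (D' ++ D) x F.
Proof.
move=> [h h0]; have e y : mu (D' ++ D) x y * F y = mu D' x y * (mu D x y * F y).
  by rewrite mu_cat mulrA.
split=> [|mt x12]; first by apply: Rg_eq (RgM (Rg_mu D' x) h) _ => y; rewrite e.
have [v hv] := Rg_mu D' x.
by apply: RV_eq (RVM hv (h0 mt x12)) _ _ => [y|]; rewrite ?e ?mulr0.
Qed.

(** Keeps away from the poles of [phi] other than the origin. *)
Definition V1 b := b = o \/ hY b != 0.

Lemma cofin_V1 : cofin V1.
Proof. by apply: cofinS (@cofin_hY _ E [:: 0]) => b; rewrite inE; right. Qed.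

Lemma Rg_phi b : b != o -> V1 b -> RgE b (@phi _ E).
Proof. by move=> bo [e|hb]; [rewrite e eqxx in bo|apply: Rg_phi_]. Qed.

Lemma Rg_tm_phi b Qs : V1 b -> o \in Qs -> RgE b (fun Q => tm Qs b Q * phi Q).
Proof.
move=> hb; have [->|bo] := eqVneq b o; last by move=> _; apply: RgM (Rg_tm _ _) (Rg_phi bo hb).
elim: Qs => // c Qs IH; rewrite inE => /orP[/eqP <-|/IH h].
  apply: Rg_req (Rg_tm Qs o) _; apply: cofinS (gen_phi E) => Q p0.
  by rewrite tm_cons eqxx tau_o; field.
have h1 : RgE o (fun Q => if o == c then (tau c Q)^-1 else 1).
  by case: eqVneq => [->|_]; [exists 0; apply: RV_tauV|apply: Rg_cst].
by apply: Rg_eq (RgM h1 h) _ => Q; rewrite tm_cons mulrA.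
Qed.

(* The nonzero class of H^1(M): it comes from the class of phi in H^1(E, O). *)
Definition UM (i : option bool) : set X := match i with
  | Some false => [set y | y.1 != o] | Some true => [set y | V1 y.1 /\ V1 y.2]
  | None => [set y | V1 y.1 /\ y.1 != y.2] end.

(** The term - phi(a) carries the class of a simple pole along {o} x E. Near (o, o), adding phi(Q),
    whose pole along E x {o} is allowed in M, makes it vanish on the diagonal; the third open set
    misses the diagonal. *)
Definition rhoM (i : option bool) y : k := match i with
  | Some false => 0 | Some true => phi y.2 - phi y.1 | None => - phi y.1 end.

Lemma UM_open i : open (UM i).
Proof.
apply: open_of_near => x; case: i => [[]|] /=.
- by move=> [h1 h2]; apply: filterI; [exact: (near_cofin (s := false) cofin_V1 h1)|exact: (near_cofin (s := true) cofin_V1 h2)].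
- exact: (@near_neq _ E false).
- by move=> [h1 h2]; apply: filterI; [exact: (near_cofin (s := false) cofin_V1 h1)|exact: near_off_diagonal].
Qed.

Lemma UM_cover : \bigcup_i UM i = setT.
Proof.
apply/seteqP; split=> // -[a b] _; have [ao|ao] := eqVneq a o; last by exists (Some false).
have [bo|bo] := eqVneq b o; first by exists (Some true) => //; split; left.
by exists None => //; split; [left|rewrite /= ao eq_sym].
Qed.

Definition coverM : open_cover E := OpenCover UM_open UM_cover.

Lemma rhoM_diff u w x : UM u x -> UM w x -> St true DM x (fun y => rhoM w y - rhoM u y).
Proof.
have A : V1 x.2 -> St false DM x (fun y => phi y.2).
  move=> h; split=> //; apply: Rg_eq (Rg_snd (Rg_tm_phi (Qs := [:: o]) h (mem_head _ _))) _ => y.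
  by rewrite -mu_tm.
have B : V1 x.1 -> x.1 != o -> St false DM x (fun y => phi y.1).
  by move=> h ho; split=> //; apply: RgM (Rg_mu _ _) (Rg_fst (Rg_phi ho h)).
have St0' := @St0 _ E false DM x.
move=> hu hw; apply: St_vanish => [|e].
  move: hu hw; case: u => [[]|]; case: w => [[]|] /=.
  - by move=> _ _; apply: St_eq St0' _ => y; rewrite subrr.
  - by move=> [h1 h2] h3; apply: St_eq (StB (B h1 h3) (A h2)) _ => y; ring.
  - by move=> [h1 h2] _; apply: St_eq (StN (A h2)) _ => y; ring.
  - by move=> h3 [h1 h2]; apply: St_eq (StB (A h2) (B h1 h3)) _ => y; ring.
  - by move=> _ _; apply: St_eq St0' _ => y; rewrite subrr.
  - by move=> h3 [h1 _]; apply: St_eq (StN (B h1 h3)) _ => y; ring.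
  - by move=> _ [h1 h2]; apply: St_eq (A h2) _ => y; ring.
  - by move=> [h1 _] h3; apply: St_eq (B h1 h3) _ => y; ring.
  - by move=> _ _; apply: St_eq St0' _ => y; rewrite subrr.
have nu : u != None by apply: contraPneq hu => -> /=; rewrite e eqxx => -[].
have nw : w != None by apply: contraPneq hw => -> /=; rewrite e eqxx => -[].
apply: cofinS (cofinI (cofin_neq o) cofin_V1) => b [bo hb].
have z i : i != None -> RV (b, b) (rhoM i) 0.
  case: i => [[]|//] _; last exact: RV_cst.
  have [v hv] := Rg_phi bo hb.
  by apply: RV_eq (RVB (RV_snd (x := (b, b)) hv) (RV_fst (x := (b, b)) hv)) _ _; rewrite ?subrr.
by apply: RV_eq (RVB (z w nw) (z u nu)) _ _ => //; rewrite subrr.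
Qed.

(** If F existed, F + tau_p(a) would have only the allowed poles, as tau_p - phi is regular at o; so
    it would be a function f(Q). Since F vanishes on the diagonal, f = tau_p. But f is regular at p,
    which is neither q nor o, and tau_p is not. *)
Lemma no_glue p q : p != o -> p != q ->
  ~ exists F, forall u x, UM u x -> St true (DL p q ++ DM) x (fun y => rhoM u y - F y).
Proof.
move=> po pq [F hF]; pose Qs := [:: q; o].
have tauP b : b != o -> RgE b (fun Q => (if b == p then (tau p Q)^-1 else 1) * tau p Q).
  move=> bo; case: eqVneq => [->|bp].
    by apply: Rg_req (Rg_cst (S := C) p 1) _; apply: cofinS (gen_tau p) => Q t0; rewrite mulVf.
  by apply: RgM (Rg_cst (S := C) b 1) _; rewrite tau_sg //; apply: Rg_sg.
have one b : RgE b (fun Q => tm Qs b Q * 1) by apply: RgM (Rg_tm _ _) (Rg_cst _ _).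
have one1 b : RgE b (fun Q => (if b == p then (tau p Q)^-1 else 1) * 1).
  apply: RgM; last exact: Rg_cst.
  by case: eqVneq => [->|_]; [exists 0; apply: RV_tauV|apply: Rg_cst].
have gF x : St false ((false, p) :: tdiv Qs) x (fun y => F y + tau p y.1).
  have [xo|xo] := eqVneq x.1 o; last first.
    have h1 := St_weaken (hF (Some false) x xo).
    have h2 := St_prod (tauP _ xo) (one x.2).
    by apply: St_eq (StB h2 h1) _ => y /=; ring.
  have td : RgE o (fun Q => tau p Q - phi Q) by rewrite tau_sg //; apply: (Rg_sg_phi_ 0 po).
  have h2 : St false ((false, p) :: tdiv Qs) x (fun y => (tau p y.1 - phi y.1) * 1).
    apply: (@St_prod _ _ p Qs x (fun Q => tau p Q - phi Q) (fun=> 1)) (one x.2).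
    have op : (o == p) = false by rewrite eq_sym (negbTE po).
    rewrite xo op.
    by apply: RgM (Rg_cst (S := C) o 1) td.
  have [xo2|xo2] := eqVneq x.2 o.
    have Vo : V1 o by left.
    have h1 : UM (Some true) x by split; rewrite ?xo ?xo2.
    have h3 : St false ((false, p) :: tdiv Qs) x (fun y => 1 * phi y.2).
      apply: (@St_prod _ _ p Qs x (fun=> 1) (@phi _ E)) (one1 x.1) _.
      by rewrite xo2; apply: Rg_tm_phi => //; rewrite !inE eqxx orbT.
    by apply: St_eq (StB (StD h2 h3) (St_weaken (hF _ x h1))) _ => y /=; ring.
  have h1 : UM None x by split; [rewrite xo; left|rewrite xo eq_sym].
  by apply: St_eq (StB h2 (St_weaken (hF _ x h1))) _ => y /=; ring.
have [f [hf Ff]] := global_sections gF.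
have cnt : count_mem p Qs = 0%N by rewrite /= eq_sym (negbTE pq) eq_sym (negbTE po).
apply: (@not_extendable _ E p Qs f (tau p) 1 (oner_neq0 _) _ (hf p)).
  rewrite cnt; apply: RV_req (RV_cst (S := C) p 1) _.
  by apply: cofinS (gen_tau p) => Q t0; rewrite expr1 divff.
have [b0] := cofin_ex (cofin_notin (p :: o :: Qs)).
rewrite inE negb_or => /andP[b0p]; rewrite inE negb_or => /andP[b0o b0Q].
have rf : RgE b0 f by apply: Rg_eq (hf b0) _ => Q; rewrite tm1 // mul1r.
have rt : RgE b0 (tau p) by rewrite tau_sg //; apply: Rg_sg.
apply: cofinS (cofinI (cofinI (honest rf) (honest rt)) (cofin_notin (p :: o :: Qs))) => b [[r1 r2]].
rewrite inE negb_or => /andP[bp]; rewrite inE negb_or => /andP[bo bQ].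
have [_ /(_ isT erefl) h0] := hF (Some false) (b, b) bo.
have h1 := RVB (RV_cst (S := surf E) (b, b) 0) (RVB (RV_snd (x := (b, b)) r1) (RV_fst (x := (b, b)) r2)).
apply/eqP; rewrite -subr_eq0 -oppr_eq0 -sub0r; apply/eqP; apply: RV_uniq h1 _.
apply: RV_req h0 _; apply: gen2S Ff => y <-.
rewrite addrK mu_cat mu_cons mu_cons mu_nil /mu1 /= (negbTE bp).
move: bQ; rewrite !inE negb_or => /andP[/negbTE -> /negbTE bo'].
by rewrite mu_cons mu_nil /mu1 /= bo' !mul1r.
Qed.

Lemma cup_represents L M (psi : lb_index L -> X -> k) (psi' : lb_index M -> X -> k)
    (U : open_cover E) m n (s : cochain L U m) (t : cochain M U n) SS TT :
  represents psi s SS -> represents psi' t TT ->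
  represents (N := tensor L M) (fun i y => psi i.1 y * psi' i.2 y) (cup s t)
    (fun c y => SS (fun h => c (inord h)) y * TT (fun h => c (inord (m + h)%N)) y).
Proof.
move=> hs ht c x cx [i j] [hi hj].
have h1 := hs (fun h => c (inord h)) x (fun h _ => cx (inord h) I) i hi.
have h2 := ht (fun h => c (inord (m + h)%N)) x (fun h _ => cx (inord (m + h)%N) I) j hj.
by apply: RV_eq (RVM h1 h2) _ _ => // y /=; ring.
Qed.

Lemma index_unique (L : line_data E) n : cohomology_nonzero L n ->
  (forall m, m != n -> ~ cohomology_nonzero L m) -> index_condition L /\ bundle_index L = n.
Proof.
move=> hn hm; have u m : cohomology_nonzero L m -> m = n.
  by move=> h; apply/eqP/negPn/negP => /hm.
split; first by exists n; split=> // m /u.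
by rewrite /bundle_index; case: xgetP => [m _ /u //|/(_ n)].
Qed.

Lemma pole_o q Qs : (forall c, c \in Qs -> c = o) ->
  forall b, b \in q :: Qs -> b = o \/ hY b = hY q.
Proof. by move=> h b; rewrite inE => /orP[/eqP ->|/h]; [right|left]. Qed.

Lemma pole_nil : forall c : pt, c \in [::] -> c = o.
Proof. by []. Qed.

Lemma pole_one : forall c : pt, c \in [:: o] -> c = o.
Proof. by move=> c; rewrite inE => /eqP. Qed.

Lemma index_L x : index_condition (pullback_translate x (bundle_L E)) /\
  bundle_index (pullback_translate x (bundle_L E)) = 0%N.
Proof.
have hP := presented_L x; have hM := @matches_L _ E x.
apply: index_unique => [|[|[|n]] // _].
- apply: (nonvanishing0 hP hM (F := fun=> 1)) => [y|h].
    by split=> //; apply: Rg_eq (Rg_mu _ _) _ => z; rewrite mulr1.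
  by have [y /eqP] := gen2_ex h; rewrite oner_eq0.
- by apply: (vanishing hP hM) => J V hV; apply: exact1.
- apply: (vanishing hP hM) => J V hV.
  exact: (@exact_above1 _ E J V hV false [:: negp x.1] (negp x.2) [::] _ n (pole_o pole_nil)).
Qed.

Lemma index_M : index_condition (bundle_M E) /\ bundle_index (bundle_M E) = 1%N.
Proof.
have hP := presented_M E; have hM := @matches_M _ E.
apply: index_unique => [|[|[|n]] // _].
- apply: (nonvanishing1 hP hM (U := coverM) (rho := rhoM)); first exact: rhoM_diff.
  (* The class survives even after enlarging the sheaf by poles at p and o, for any p other than o;
     this is [no_glue] with q = o. *)
  have [p po] := cofin_ex (cofin_neq o) => -[F hF].
  by apply: (no_glue po po); exists F => u x hx; apply: St_mono; apply: hF.
- apply: (vanishing0 hP hM) => F hF; apply: (@no_sections _ E o [:: o]) => y.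
  exact: (@St_mono true DM [:: (false, o)]).
- apply: (vanishing hP hM) => J V hV.
  exact: (@exact_above1 _ E J V hV true [::] o [::] _ n (pole_o pole_nil)).
Qed.

Lemma index_N x : index_condition (tensor (pullback_translate x (bundle_L E)) (bundle_M E)) /\
  bundle_index (tensor (pullback_translate x (bundle_L E)) (bundle_M E)) = 1%N.
Proof.
have hP := presented_N x; have hM := @matches_N _ E x.
have hM' : matches (N := tensor (pullback_translate x (bundle_L E)) (bundle_M E)) (psN x) true ((false, negp x.1) :: tdiv [:: negp x.2; o]) := hM.
apply: index_unique => [|[|[|n]] // _].
- have [g [w [w0 hw hg]]] := exists_pole (negp x.1) (negp x.2).
  exact: (nonvanishing1_pole hP hM' w0 hw hg).
- by apply: (vanishing0 hP hM) => F hF; apply: (@no_sections _ E (negp x.1) [:: negp x.2; o]).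
- apply: (vanishing hP hM) => J V hV.
  exact: (@exact_above1 _ E J V hV true [:: negp x.1] (negp x.2) [:: o] _ n (pole_o pole_one)).
Qed.

(** With s the constant section 1, the cup product is the image of the class of [rhoM] under the
    inclusion of sheaves, to which [no_glue] applies. *)
Lemma cup_nonzero x : negp x.1 != o -> negp x.1 != negp x.2 ->
  ~ cup_product_zero (pullback_translate x (bundle_L E)) (bundle_M E).
Proof.
move=> po pq; rewrite /cup_product_zero.
have [_ eL] := index_L x; have [_ eM] := index_M; rewrite eL eM => h.
have [s [cs rs]] := global_cochain (presented_L x) (@matches_L _ E x) (F := fun=> 1)
  (fun y => conj (Rg_eq (Rg_mu _ _) (fun z => esym (mulr1 _))) (fun h => False_ind _ (Bool.diff_false_true h))) coverM.
have [t [ct rt]] := difference_cochain (presented_M E) (@matches_M _ E) (U := coverM) rhoM_diff.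
apply: (no_glue po pq).
apply: (zero_class_glue (presented_N x) (@matches_N _ E x) (U := coverM) _ _ (h coverM s t cs ct)).
  by move=> u w y hu hw; apply: St_mono; apply: rhoM_diff.
have e (h' : 'I_2) : inord (0 + h')%N = h' :> 'I_2 by exact: inord_val.
move=> c y cy i hi; apply: RV_eq (cup_represents rs rt cy hi) _ erefl => z.
by rewrite mul1r !e.
Qed.
End Cup.

(** * Vanishing of the cup product on the curve *)

Section CupZero.
Context (k : closedFieldType) (E : elliptic_curve k).
Local Notation pt := (Defs.point E).
Local Notation X := (surface E).
Local Notation RVE := (@RV k (curve E)).
Local Notation RgE := (@Rg k (curve E)).
Local Notation RV := (@RV k (surf E)).
Local Notation Rg := (@Rg k (surf E)).
Local Notation req := (@req k (surf E)).
Local Notation o := (origin E).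
Local Notation C := (curve E).
Local Notation DM := (DM E).
Local Notation ratX := (ratfun (@hcoord2 k E)).
Implicit Types (P Q b p q : pt) (x y z : X) (F G : X -> k) (W : set X).

Section Gap.
Context (J : finType) (V : J -> {mpoly k[3 + 3]}) (hV : is_affine_cover E V).

(* Mayer-Vietoris when the sections over A /\ B split up to multiples of h. *)
Lemma exact_mv_gap D (A B : X -> Prop) h (CC : seq J -> X -> k) :
  exact false D V 1 A -> exact false D V 1 B ->
  (forall F, sections false D (fun y => A y /\ B y) F -> exists al be e,
     [/\ sections false D A al, sections false D B be & req F (fun y => al y - be y + e * h y)]) ->
  (forall l, size l = 2%N -> sections false D (fun y => (A y \/ B y) /\ inV V l y) (CC l)) ->
  (forall l, size l = 3%N -> gen2 (fun y : X => delta (CC^~ y) l = 0)) ->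
  exists (B0 : J -> X -> k) e,
    [/\ forall v, sections false D (fun y => A y /\ inV V [:: v] y) (B0 v),
        forall v, sections false D (fun y => B y /\ inV V [:: v] y) (fun y => B0 v y - e * h y) &
        forall v w, gen2 (fun y : X => CC [:: v; w] y = B0 w y - B0 v y)].
Proof.
move=> exA exB hsplit hC dC.
have [l sl x [Ax xl]|//|bA [hA eA]] := exA CC; first by apply: hC => //; split=> //; left.
have [l sl x [Bx xl]|//|bB [hB eB]] := exB CC; first by apply: hC => //; split=> //; right.
have [v0 _] := inhabitedV hV; pose f y := bA [:: v0] y - bB [:: v0] y.
have fv v : req (fun y => bA [:: v] y - bB [:: v] y) f.
  apply: gen2S (gen2I (eA [:: v0; v] erefl) (eB [:: v0; v] erefl)) => y [h1 h2]; rewrite /f.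
  move: h1 h2; rewrite /= !subr0 => h1 h2.
  have e : bA [:: v] y - bA [:: v0] y = bB [:: v] y - bB [:: v0] y by rewrite -h1 -h2.
  by apply: (eq_of_relation (c := 1) e); ring.
have in1 v y : inV V [:: v] y <-> (V v).@[coords y] != 0.
  by split=> [hy|hy w]; [apply: hy; rewrite mem_head|rewrite inE => /eqP ->].
have hf : sections false D (fun y => A y /\ B y) f.
  move=> x [Ax Bx]; have [v hv] := cover_all hV x; apply: St_req (fv v).
  by apply: StB; [apply: hA|apply: hB] => //; split=> //; apply/in1.
have [al [be [e [hal hbe fE]]]] := hsplit f hf.
exists (fun v y => bA [:: v] y - al y), e; split=> [v x [Ax xv]|v x [Bx xv]|v w].
- by apply: StB; [apply: hA|apply: hal].
- apply: (@St_req _ _ _ _ x (fun y => bB [:: v] y - be y)); first by apply: StB; [apply: hB|apply: hbe].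
  apply: gen2S (gen2I (fv v) fE) => y [h1 h2]; rewrite h2 in h1.
  by apply: (eq_of_relation (c := -1) h1); ring.
- by apply: gen2S (eA [:: v; w] erefl) => y ->; rewrite /= subr0; ring.
Qed.

(** Forgetting the vanishing on the diagonal, the only obstruction to a cocycle being a coboundary
    is a multiple of phi(a): sections over the intersection of the strips are functions of the first
    point, split by [regular_splits] up to e phi. The primitive B0 is allowed this pole along {o} x
    E. *)
Lemma first_cohomology_M (CC : seq J -> X -> k) :
  (forall l, size l = 2%N -> sections false DM (inV V l) (CC l)) ->
  (forall l, size l = 3%N -> gen2 (fun y : X => delta (CC^~ y) l = 0)) ->
  exists (B0 : J -> X -> k) e,
    [/\ forall v x, inV V [:: v] x -> x.1 != o -> St false DM x (B0 v),
        forall v x, inV V [:: v] x -> V1 x.1 -> St false DM x (fun y => B0 v y - e * phi y.1) &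
        forall v w, gen2 (fun y : X => CC [:: v; w] y = B0 w y - B0 v y)].
Proof.
move=> hC dC; pose lf := lform (k := k) false; pose l0 := lz k false; pose l1 := ly (0 : k).
have hq := @pole_o _ E o [::] (@pole_nil _ E).
have [a1 oa1] := exists_affine E.
have ex l : (exists b : pt, lin l b != 0) -> exact false DM V 1 (nv (lf l)).
  move=> [b hb]; apply: (exact_iff (T := nv (lf l * lf l))); first by move=> y; rewrite nv_mul andbb.
  have hb' : exists b : pt, base l l b by exists b.
  by apply: (@exact_strip _ _ _ _ hV _ _ _ _ _ (hY o)) => // _;
    exact: (@splits0 _ _ _ _ [::] o [::] (hY o) l l hq hb').
have [||F hF|l sl x [_ xl]|//|B0 [e [h1 h2 h3]]] :=
  @exact_mv_gap DM (nv (lf l0)) (nv (lf l1)) (fun y => phi y.1) CC.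
- by apply: ex; exists a1; rewrite (lin_lz_neq0 false).
- by apply: ex; exists o; apply/lin_ly_neq0; left.
- have [//|x ux|f [hf Ff]] := @strip_sections _ E o o 0 _ F.
    apply: (@St_mono _ _ false DM [:: (false, o)]); apply: hF.
    by have [b1 b2] := base_ly ux; rewrite !nv_lform.
  have [al [be [e [hal hbe fE]]]] := regular_splits hf.
  have lift x g : RgE x.1 g -> St false DM x (fun y => g y.1).
    by move=> hg; split=> //; apply: RgM (Rg_mu _ _) (Rg_fst hg).
  exists (fun y => al y.1), (fun y => be y.1), e; split.
  + by move=> x; rewrite nv_lform (lin_lz_neq0 false) => xo; apply: lift; apply: hal.
  + by move=> x; rewrite nv_lform => /lin_ly_neq0 xo; apply: lift; apply: hbe.
  + have fE2 : gen2 (fun y : X => f y.1 = al y.1 - be y.1 + e * phi y.1).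
      by apply: cofinS fE => Q eQ; apply: cofin_true.
    by apply: gen2S (gen2I Ff fE2) => y [-> ->].
- exact: hC.
exists B0, e; split=> // v x xv hx; [apply: h1|apply: h2]; split=> //; rewrite nv_lform.
  by rewrite (lin_lz_neq0 false).
by apply/lin_ly_neq0.
Qed.
End Gap.

Lemma Rg_tm_tau p b : p != o -> RgE b (fun Q => tm [:: p; o] b Q * tau p Q).
Proof.
move=> po; have [->|bp] := eqVneq b p.
  apply: Rg_req (Rg_tm [:: o] p) _; apply: cofinS (gen_tau p) => Q t0.
  by rewrite [in RHS]tm_cons eqxx; field.
have [bo|bo] := eqVneq b o; last by apply: RgM (Rg_tm _ _) _; rewrite tau_sg //; apply: Rg_sg.
apply: Rg_eq (RgM (Rg_tm [:: p] b) (_ : RgE b (fun Q => tau p Q / phi Q))) _ => [|Q].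
  by rewrite bo; exists 1; apply: RV_tau_phi.
by rewrite !tm_cons bo eqxx tau_o /tm mu_nil; ring.
Qed.

Lemma St_one p Qs x (f : pt -> k) : RgE x.2 (fun Q => tm Qs x.2 Q * f Q) ->
  St false ((false, p) :: tdiv Qs) x (fun y => f y.2).
Proof.
move=> hf; apply: St_eq (@St_prod _ _ p Qs x (fun=> 1) f _ hf) _ => [|y]; last by rewrite mul1r.
apply: RgM; last exact: Rg_cst.
by case: eqVneq => [->|_]; [exists 0; apply: RV_tauV|apply: Rg_cst].
Qed.

Lemma St_two p Qs x (f : pt -> k) : RgE x.1 (fun Q => (if x.1 == p then (tau p Q)^-1 else 1) * f Q) ->
  St false ((false, p) :: tdiv Qs) x (fun y => f y.1).
Proof.
move=> hf; apply: St_eq (@St_prod _ _ p Qs x f (fun=> 1) hf _) _ => [|y]; last by rewrite mulr1.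
by apply: RgM; [exact: Rg_tm|exact: Rg_cst].
Qed.

Lemma global_L p q F : (forall x, St false (DL p q) x F) -> exists c, req F (fun=> c).
Proof.
move=> hF; have [f [hf Ff]] := @global_sections _ E p [:: q] F hF.
have [b bq||c hc] := @no_simple_pole _ E q f.
- by apply: Rg_eq (hf b) _ => Q; rewrite tm1 ?mul1r // inE.
- by apply: Rg_eq (hf q) _ => Q; rewrite tm_cons eqxx /tm mu_nil mulr1 mulrC.
exists c; have h : gen2 (fun y : X => f y.2 = c) by apply: cofin_true.
by apply: gen2S (gen2I Ff h) => y [-> ->].
Qed.

Section Diagonal.
Context (J : finType) (V : J -> {mpoly k[3 + 3]}) (hV : is_affine_cover E V).

Lemma inV_open l : open (fun y : X => inV V l y).
Proof.
elim: l => [|v l IH].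
  by apply: open_of_near => x _; near=> y => w.
have -> : (fun y : X => inV V (v :: l) y) = (nonvanishing (V v) `&` (fun y : X => inV V l y)).
  apply/seteqP; split=> y h; first by split=> [|w wl]; apply: h; rewrite inE ?eqxx ?wl ?orbT.
  by move=> w; rewrite inE => /orP[/eqP ->|]; [case: h|case: h => _; apply].
by apply: openI IH; have [d [e hb]] := cover_bihomog hV v; apply: open_nonvanishing hb.
Unshelve. all: by end_near.
Qed.

(* The restrictions of the B0 v to the diagonal glue to a function with at most
   one simple pole, which is constant. *)
Lemma diagonal_constant (CC : seq J -> X -> k) (B0 : J -> X -> k) e :
  (forall l x, size l = 2%N -> inV V l x -> St true DM x (CC l)) ->
  (forall v x, inV V [:: v] x -> x.1 != o -> St false DM x (B0 v)) ->
  (forall v x, inV V [:: v] x -> V1 x.1 -> St false DM x (fun y => B0 v y - e * phi y.1)) ->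
  (forall v w, gen2 (fun y : X => CC [:: v; w] y = B0 w y - B0 v y)) ->
  exists c, forall v b, inV V [:: v] (b, b) -> cofin (fun b' => RV (b', b') (B0 v) c).
Proof.
move=> hC h1 h2 h3.
have muM x F : x.2 != o -> St false DM x F -> Rg x F.
  move=> /negbTE xo [h _]; apply: Rg_eq h _ => y.
  by rewrite mu_cons mu_nil /mu1 /= xo !mul1r.
have in1 v y : (V v).@[coords y] != 0 -> inV V [:: v] y by move=> h w; rewrite inE => /eqP ->.
have affine v b : inV V [:: v] (b, b) -> exists b', inV V [:: v] (b', b') /\ b' != o.
  move=> hb; exact: cofin_ex (cofinI (open_diagonal (inV_open [:: v]) hb) (cofin_neq o)).
have reg v b : inV V [:: v] (b, b) -> b != o -> exists2 f, ratX (b, b) f & req (B0 v) f.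
  move=> hb bo; have [w [f [rf _ ef]]] := muM (b, b) _ bo (h1 v (b, b) hb bo).
  by exists f.
have [v1 /in1 vo] := cover_all hV (o, o).
have [b1 [hb1 b1o]] := affine v1 o vo.
have [f rf ef] := reg v1 b1 hb1 b1o; pose g b := f (b, b).
have glue v b : inV V [:: v] (b, b) -> cofin (fun b' => RV (b', b') (B0 v) (g b')).
  move=> hb; have [b2 [hb2 b2o]] := affine v b hb.
  have [f' rf' ef'] := reg v b2 hb2 b2o.
  have c1 := open_diagonal (inV_open [:: v]) hb2; have c2 := open_diagonal (inV_open [:: v1]) hb1.
  apply: cofinS (cofinI (cofinI c1 c2) (cofinI (cofin_neq o) (cofinI (cofin_ratX_diag rf) (cofin_ratX_diag rf')))).
  move=> b' [[i1' i2'] [bo [r r']]].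
  have i3 : inV V [:: v1; v] (b', b').
    by move=> w; rewrite inE => /orP[/eqP ->|]; [apply: i2'; rewrite mem_head|apply: i1'].
  have [_ /(_ isT erefl) h0] := hC [:: v1; v] (b', b') erefl i3.
  have {}h0 : RV (b', b') (fun y => f' y - f y) 0.
    apply: RV_req h0 _; apply: gen2S (gen2I (h3 v1 v) (gen2I ef ef')) => y [-> [-> ->]].
    by rewrite mu_cons mu_nil /mu1 /= (negbTE bo) !mul1r.
  have e0 := RV_uniq (RVB (honest2 r') (honest2 r)) h0.
  have -> : g b' = f' (b', b') by move/eqP: e0; rewrite subr_eq0 => /eqP.
  exact: RV_req (honest2 r') (req_sym ef').
have greg b : b != o -> RgE b g.
  move=> bo; have [v /in1 hv] := cover_all hV (b, b); have [f' rf' ef'] := reg v b hv bo.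
  have gl := glue v b hv.
  apply: Rg_req (ex_intro _ _ (rat_RV (S := C) (ratX_diag rf'))) _.
  apply: cofinS (cofinI gl (cofin_ratX_diag rf')) => b' [r r'].
  exact: RV_uniq (honest2 r') (RV_req r ef').
(* Near (o, o), B0 is e phi(a) plus a function with at most a simple pole along E x {o}; on the
   diagonal both give at most a simple pole at o. *)
have go : RgE o (fun Q => g Q / tau o Q).
  have Vo : V1 (o, o).1 by left.
  have [[w [f2 [rf2 _ ef2]]] _] := h2 v1 (o, o) vo Vo.
  have R1 : RgE o (fun Q => f2 (Q, Q)) by exists (f2 (o, o)); apply: (rat_RV (S := C) (ratX_diag rf2)).
  have R2 := RgD R1 (Rg_cst (S := C) o e).
  apply: Rg_req R2 _; rewrite tau_o.
  have ht : RgE o (fun Q => (tau o Q)^-1) by exists 0; apply: RV_tauV.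
  apply: cofinS (cofinI (cofinI (glue v1 o vo) (cofin_ratX_diag rf2)) (cofinI (honest ht) (gen_phi E))).
  move=> b [[r r2] [ht' p0]]; rewrite tau_o in ht'.
  have rp : RVE b (@phi _ E) (phi b).
    by apply: RV_eq (RVV ht' _) _ _ => [|Q|]; rewrite ?invrK ?invr_eq0.
  have r3 : RV (b, b) (fun y => mu DM (o, o) y * (B0 v1 y - e * phi y.1)) ((phi b)^-1 * (g b - e * phi b)).
    have m1 : RV (b, b) (mu DM (o, o)) (phi b)^-1.
      apply: RV_eq (RV_snd (x := (b, b)) ht') _ erefl => y.
      by rewrite mu_cons mu_nil /mu1 /= ?eqxx ?tau_o mulr1.
    by apply: RVM m1 (RVB r (RVM (RV_cst (S := surf E) (b, b) e) (RV_fst (x := (b, b)) rp))).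
  have -> : f2 (b, b) = (phi b)^-1 * (g b - e * phi b) by exact: RV_uniq (honest2 r2) (RV_req r3 ef2).
  by field.
have [c hc] := no_simple_pole greg go.
exists c => v b hb; apply: cofinS (cofinI (glue v b hb) hc) => b' [r <-] //.
Qed.
End Diagonal.

(** The class s is a constant e0 and t is the coboundary of B0, so the product is that of e0 B0. But
    B0 equals a constant c on the diagonal and has the pole e phi(a) along {o} x E; subtracting c
    and e h repairs both. If p = o, the pole is allowed and h = 0. If p = q, h = tau_p(a) - tau_p(Q)
    has this pole, vanishes on the diagonal, and its other poles are allowed. *)
Lemma cup_zero x : negp x.1 = o \/ negp x.1 = negp x.2 ->
  cup_product_zero (pullback_translate x (bundle_L E)) (bundle_M E).
Proof.
set p := negp x.1; set q := negp x.2 => hpq; rewrite /cup_product_zero.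
have [_ eL] := index_L x; have [_ eM] := index_M E; rewrite eL eM => U s t cs ct.
have hPL := presented_L x; have hML := @matches_L _ E x.
have hPM := presented_M E; have hMM := @matches_M _ E.
have [SS rs] := cochain_represents hPL cs.1; have [TT rt] := cochain_represents hPM ct.1.
have [J [V [hV /choice[r hr]]]] := affine_refinement U.
have [v0 _] := inhabitedV hV.
pose SL := list_cochain r v0 SS; pose TL := list_cochain r v0 TT.
have in1 v y : (V v).@[coords y] != 0 -> inV V [:: v] y by move=> h w; rewrite inE => /eqP ->.
have SSt v y : inV V [:: v] y -> St false (DL p q) y (SL [:: v]).
  exact: (list_cochain_St hML v0 hr rs (l := [:: v])).
have Sdiff v w : req (SL [:: v]) (SL [:: w]).
  apply: gen2S (list_cochain_delta hPL v0 hV hr cs rs (l := [:: w; v]) erefl) => y /=.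
  by rewrite !subr0 => /eqP; rewrite subr_eq0 => /eqP.
have [e0 he0] : exists c, req (SL [:: v0]) (fun=> c).
  apply: (@global_L p q) => y; have [v hv] := cover_all hV y.
  exact: St_req (SSt v y (in1 v y hv)) (Sdiff v v0).
have hT l y : size l = 2%N -> inV V l y -> St true DM y (TL l).
  by move=> sl; apply: (list_cochain_St hMM v0 hr rt sl).
have [l sl y yl||B0 [e [h1 h2 h3]]] := @first_cohomology_M J V hV TL.
- exact: St_weaken (hT l y sl yl).
- by move=> l sl; apply: (list_cochain_delta hPM v0 hV hr ct rt sl).
have [c hc] := diagonal_constant hV hT h1 h2 h3.
pose h y := if p == o then 0 else tau p y.1 - tau p y.2.
pose Gl v y := B0 v y - c - e * h y.
pose DN := (false, p) :: tdiv [:: q; o].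
have cst a y : St false DN y (fun=> a : k).
  by apply: (@St_one p [:: q; o] y (fun=> a)); apply: RgM (Rg_tm _ _) (Rg_cst _ _).
have mono F y : St false DM y F -> St false DN y F by move=> hF; apply: (@St_mono _ _ false DM (DL p q)).
have Gl_St v y : inV V [:: v] y -> St false DN y (Gl v).
  move=> hv; have [po|po] := eqVneq p o.
    have hE z : Gl v z = B0 v z - c by rewrite /Gl /h po eqxx mulr0 subr0.
    have [yo|yo] := eqVneq y.1 o; last first.
      by apply: St_eq (StB (mono _ _ (h1 v y hv yo)) (cst c y)) _.
    have Vy : V1 y.1 by left.
    have hphi : St false DN y (fun z => phi z.1).
      apply: St_two; rewrite yo po eqxx tau_o.
      by apply: Rg_req (Rg_cst (S := C) o 1) _; apply: cofinS (gen_phi E) => Q t0; rewrite mulVf.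
    apply: St_eq (StB (StD (mono _ _ (h2 v y hv Vy)) (StM (Rg_cst (S := surf E) y e) hphi)) (cst c y)) _ => z.
    by rewrite hE; ring.
  have qp : p = q by case: hpq => // e1; rewrite e1 eqxx in po.
  have hE z : Gl v z = B0 v z - c - e * (tau p z.1 - tau p z.2) by rewrite /Gl /h (negbTE po).
  have tau2 : St false DN y (fun z => tau p z.2).
    by apply: St_one; rewrite -qp; apply: Rg_tm_tau.
  have eR := Rg_cst (S := surf E) y e.
  have [yo|yo] := eqVneq y.1 o; last first.
    have tau1 : St false DN y (fun z => tau p z.1).
      apply: St_two; case: eqVneq => [->|yp].
        by apply: Rg_req (Rg_cst (S := C) p 1) _; apply: cofinS (gen_tau p) => Q t0; rewrite mulVf.
      by apply: RgM (Rg_cst (S := C) _ 1) _; rewrite tau_sg //; apply: Rg_sg.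
    apply: St_eq (StB (StB (mono _ _ (h1 v y hv yo)) (cst c y)) (StM eR (StB tau1 tau2))) _ => z.
    by rewrite hE.
  have Vy : V1 y.1 by left.
  have td : RgE o (fun Q => tau p Q - phi Q) by rewrite tau_sg //; apply: (Rg_sg_phi_ 0 po).
  have td1 : St false DN y (fun z => tau p z.1 - phi z.1).
    apply: (@St_two p [:: q; o] y (fun Q => tau p Q - phi Q)).
    have op : (o == p) = false by rewrite eq_sym (negbTE po).
    by rewrite yo op; apply: RgM (Rg_cst (S := C) o 1) td.
  apply: St_eq (StB (StB (mono _ _ (h2 v y hv Vy)) (cst c y)) (StM eR (StB td1 tau2))) _ => z.
  by rewrite hE; ring.
have hdiag : cofin (fun b => RV (b, b) h 0).
  rewrite /h; case: eqP => [_|_]; first by apply: cofin_true => b; apply: RV_cst.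
  have ht : RgE p (fun Q => (tau p Q)^-1) by exists 0; apply: RV_tauV.
  apply: cofinS (cofinI (honest ht) (gen_tau p)) => b [r1 t0].
  have r2 : RVE b (tau p) (tau p b) by apply: RV_eq (RVV r1 _) _ _ => [|Q|]; rewrite ?invrK ?invr_eq0.
  by apply: RV_eq (RVB (RV_fst (x := (b, b)) r2) (RV_snd (x := (b, b)) r2)) _ _ => //; rewrite subrr.
have Gl_true v y : inV V [:: v] y -> St true DN y (Gl v).
  move=> hv; apply: St_vanish (Gl_St v y hv) _ => y12.
  have hvd : inV V [:: v] (y.1, y.1) by case: y y12 hv => b b' /= <-.
  apply: cofinS (cofinI (hc v y.1 hvd) hdiag) => b [r1 r2].
  apply: RV_eq (RVB (RVB r1 (RV_cst (S := surf E) (b, b) c)) (RVM (RV_cst (S := surf E) (b, b) e) r2)) _ _ => //.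
  by rewrite subrr mulr0 subrr.
have rN : represents (N := tensor (pullback_translate x (bundle_L E)) (bundle_M E)) (psN x) (p := 1) (cup s t)
  (fun c y => SS (fun h => c (inord h)) y * TT (fun h => c (inord (0 + h)%N)) y) := cup_represents rs rt.
apply: (zero_class_of_lists (p := 0) (presented_N x) (@matches_N _ E x) hV hr
  (B := fun l y => e0 * Gl (head v0 l) y) rN) => [[|v [|//]] // _ y yv|[|v [|w [|//]]] // _].
  exact: StM (Rg_cst (S := surf E) y e0) (Gl_true v y yv).
have e' (h' : 'I_2) : inord (0 + h')%N = h' :> 'I_2 by exact: inord_val.
have eS : (fun h : 'I_1 => r (nth v0 [:: v; w] (inord h : 'I_2))) = (fun i : 'I_1 => r (nth v0 [:: v] i)).
  by apply/funext => i; rewrite ord1 inordK.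
have eT : (fun h' : 'I_2 => r (nth v0 [:: v; w] (inord (0 + h')%N : 'I_2))) = (fun i : 'I_2 => r (nth v0 [:: v; w] i)).
  by apply/funext => i; rewrite e'.
apply: gen2S (gen2I (gen2I (Sdiff v v0) he0) (h3 v w)) => y [[s1 s2] t1].
transitivity (SL [:: v] y * TL [:: v; w] y).
  by rewrite /SL /TL /list_cochain -eS -eT.
by rewrite s1 s2 t1 /= !subr0 /Gl; ring.
Qed.

End CupZero.

(** * The curve *)

Section CurveC.
Context (k : closedFieldType) (E : elliptic_curve k).
Local Notation pt := (Defs.point E).
Local Notation X := (surface E).
Local Notation o := (origin E).
Local Notation ratX := (ratfun (@hcoord2 k E)).
Implicit Types (a b : pt) (x y z : X) (W A B Z : set X).

Lemma open_line W a : open W -> W (o, a) -> cofin (fun b => W (o, b)).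
Proof.
move=> oW Wa; have [d [e [f [hf fa sub]]]] := nbhs_nonvanishing (open_nbhs_nbhs (conj oW Wa)).
have [j hj] := hcoord_neq0 a; have ho : hcoord o i1 != 0 := hY_o_neq0 E.
have rf : ratX (o, a) (fun y => f.@[fun i => aff i1 j i y]).
  by apply: ratX_mpoly => i; apply: ratX_aff.
have fE b : hcoord b j != 0 -> f.@[coords (o, b)] != 0 <-> f.@[fun i => aff i1 j i (o, b)] != 0.
  move=> hb; rewrite (meval_aff hf (j1 := i1) (j2 := j)) // !mulf_eq0 !negb_or !expf_neq0 //.
have h := cofin_rat (ratX_line2 rf) ((fE a hj).1 fa).
apply: cofinS (cofinI h (cofin_hcoord E j)) => b [fb hb].
by apply: sub; apply/(fE b hb).
Qed.

Lemma closed_of_near A : (forall x, ~ A x -> \forall y \near x, ~ A y) -> closed A.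
Proof. by move=> h; rewrite -[A]setCK; apply: open_closedC; apply: open_of_near. Qed.

Lemma near_point x z : x != z -> \forall y \near x, y != z.
Proof.
move=> xz; have : (x.1 != z.1) || (x.2 != z.2).
  by rewrite -negb_and; apply: contraNN xz => /andP[/eqP h1 /eqP h2]; case: x z h1 h2 => ? ? [? ?] /= -> ->.
case/orP=> h.
  by have := @near_neq _ E false x z.1 h; apply: filterS => y; apply: contraNneq => ->.
by have := @near_neq _ E true x z.2 h; apply: filterS => y; apply: contraNneq => ->.
Qed.

Lemma closed_finite (t : seq X) : closed [set y | y \in t].
Proof.
apply: closed_of_near => x /= /negP; elim: t => [_|z t IH]; first by near=> y.
rewrite inE negb_or => /andP[xz /IH h].
by apply: filterS2 (near_point xz) h => y yz yt; apply/negP; rewrite inE negb_or yz; apply/negP.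
Unshelve. all: by end_near.
Qed.

Lemma irreducible_finite Z (t : seq X) : irreducible_closed Z -> Z `<=` [set y | y \in t] ->
  exists z, Z z /\ Z `<=` [set y | y = z].
Proof.
move=> [cZ [z0 Zz0] irr]; elim: t => [/(_ z0 Zz0)//|z t IH] sub.
have [|||h|/IH //] := irr [set y | y \in [:: z]] [set y | y \in t].
- exact: closed_finite.
- exact: closed_finite.
- by move=> y /sub /=; rewrite !inE => /orP[->|->]; [left|right].
- have e y : Z y -> y = z by move=> /h /=; rewrite inE => /eqP.
  by exists z; rewrite -{1}(e z0 Zz0); split=> // y /e.
Qed.

Section Image.
Context (phi : pt -> X) (phi_inj : injective phi).
Context (phi_open : forall W a, open W -> W (phi a) -> cofin (fun b => W (phi b))).
Context (phi_closed : closed (range phi)).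

Lemma closed_cofinite A : closed A -> ~ (range phi `<=` A) -> cofin (fun b => ~ A (phi b)).
Proof.
move=> /closed_openC oA nA; apply: contrapT => h; apply: nA => _ [b _ <-].
by apply: contrapT => nb; apply: h; apply: (phi_open oA nb).
Qed.

Lemma image_irreducible : irreducible_closed (range phi).
Proof.
split=> // [|A B cA cB sub]; first by exists (phi o); exists o.
have [h|/(closed_cofinite cA) h] := pselect (range phi `<=` A); first by left.
right; apply: contrapT => /(closed_cofinite cB) h'.
have [b [nA nB]] := cofin_ex (cofinI h h').
by case: (sub (phi b)) => //; exists b.
Qed.

(** Open sets pull back to cofinite subsets of E, so a proper closed subset of the image is finite;
    if irreducible, it is a point. *)
Lemma image_proper Z : irreducible_closed Z -> Z `<` range phi -> exists z, Z z /\ Z `<=` [set y | y = z].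
Proof.
move=> iZ [sub nsub]; have [cZ _ _] := iZ.
have [s hs] := closed_cofinite cZ nsub.
apply: (@irreducible_finite Z (map phi s)) => // y Zy /=.
have [b _ e] := sub y Zy; apply/mapP; exists b; rewrite ?e //.
by apply: contrapT => /negP /hs; rewrite e.
Qed.

Lemma image_dim : has_dim (range phi) 1.
Proof.
split.
  exists (fun i => if i is 0%N then [set y | y \in [:: phi o]] else range phi); split.
    move=> [|i] _; last by split=> //; exact: image_irreducible.
    split; last by move=> y /=; rewrite inE => /eqP ->; exists o.
    split; [exact: closed_finite|by exists (phi o) => /=; rewrite mem_head|].
    move=> A B _ _ sub; have [h|h] := sub (phi o) (mem_head _ _).
      by left=> y /=; rewrite inE => /eqP ->.
    by right=> y /=; rewrite inE => /eqP ->.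
  move=> [|//] _; split; first by move=> y /=; rewrite inE => /eqP ->; exists o.
  move=> h; have [b bo] := cofin_ex (cofin_neq o).
  have /= := h (phi b) (ex_intro2 _ _ b I erefl).
  by rewrite inE => /eqP /phi_inj e; rewrite e eqxx in bo.
move=> [F [hF sF]]; have [s1 n1] := sF 0%N isT; have [s2 n2] := sF 1%N isT.
have [i1' sub1] := hF 1%N isT; have [_ sub2] := hF 2%N isT; have [[_ [w Fw] _] _] := hF 0%N isT.
have [|z [_ hz]] := image_proper i1'.
  by split=> // h; apply: n2 => y /sub2 /h.
apply: n1 => y /hz /= ->; by rewrite -(hz w (s1 w Fw)).
Qed.
End Image.

Definition axis_or_diagonal : set X := [set x | x.1 = o \/ x.1 = x.2].

Lemma closed_axis : closed (range (fun b : pt => (o, b) : X)).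
Proof.
apply: closed_of_near => -[a b] h.
have ao : a != o by apply/eqP => e; apply: h; exists b => //; rewrite e.
have := @near_neq _ E false (a, b) o ao; apply: filterS => y yo [c _ e].
by move: yo; rewrite -e /= ?eqxx.
Qed.

Lemma closed_diagonal : closed (range (fun b : pt => (b, b) : X)).
Proof.
apply: closed_of_near => -[a b] h.
have ab : a != b by apply/eqP => e; apply: h; exists b => //; rewrite e.
have := @near_off_diagonal _ E (a, b) ab; apply: filterS => y yo [c _ e].
by move: yo; rewrite -e /= ?eqxx.
Qed.

Lemma is_curve_axis_or_diagonal : is_curve axis_or_diagonal.
Proof.
have i1 : injective (fun b : pt => (o, b) : X) by move=> b b' [].
have i2 : injective (fun b : pt => (b, b) : X) by move=> b b' [].
have o1 W a := @open_line W a; have o2 W a := @open_diagonal _ E W a.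
have irr1 := image_irreducible o1 closed_axis; have irr2 := image_irreducible o2 closed_diagonal.
have unionE : axis_or_diagonal = range (fun b : pt => (o, b) : X) `|` range (fun b : pt => (b, b) : X).
  apply/seteqP; split=> [[a b]|y [] [b _ <-]]; [|by left|by right].
  by case=> /= e; [left|right]; exists b; rewrite // -e.
split.
- by rewrite unionE; apply: closedU; [exact: closed_axis|exact: closed_diagonal].
- by exists (o, o); left.
move=> Z [[cZ nZ irr] sub max].
have key A : irreducible_closed A -> A `<=` axis_or_diagonal -> Z `<=` A -> Z = A.
  by move=> iA sA ZA; apply/seteqP; split=> //; apply: max.
(* A component lies in one of the two irreducible pieces and equals it by maximality. *)
have [|h|h] := irr _ _ closed_axis closed_diagonal; first by rewrite -unionE.
- by rewrite (key _ irr1 _ h); [apply: image_dim closed_axis|rewrite unionE => y; left].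
- by rewrite (key _ irr2 _ h); [apply: image_dim closed_diagonal|rewrite unionE => y; right].
Qed.

End CurveC.

Theorem mainTheorem8 (k : closedFieldType) (E : elliptic_curve k) :
  exists L M : line_data E,
    [/\ is_line_bundle L, is_line_bundle M, pair_index_condition L M &
        exists C : set (surface E),
          is_curve C /\
          forall x : surface E,
            (C x -> cup_product_zero (pullback_translate x L) M) /\
            (~ C x -> ~ cup_product_zero (pullback_translate x L) M)].
Proof.
exists (bundle_L E), (bundle_M E); split; [exact: line_bundle_L|exact: line_bundle_M| |].
  move=> x; have [iL eL] := index_L x; have [iM eM] := index_M E; have [iN eN] := index_N x.
  by split; rewrite // eL eM eN.
exists (@axis_or_diagonal k E); split=> [|x]; first exact: is_curve_axis_or_diagonal.
split=> hx; first by apply: cup_zero; case: hx => ->; [left; apply: negp_o|right].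
by apply: cup_nonzero; apply/eqP => e; apply: hx; [left; rewrite -[x.1]negpK e negp_o|
  right; rewrite -[x.1]negpK e negpK].
Qed.
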